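(* Let $\lambda>0$, let $B^{\lambda,br}$ be a Brownian bridge of length $1$ from $0$ to $\lambda$, and let $V(B^{\lambda,br})$ be its Vervaat transform. Let $\widehat{Z}^{\lambda}:=\sup\{t<1: V(B^{\lambda,br})_t=\lambda\}$ be the time of the last hit of $\lambda$ by $V(B^{\lambda,br})$ strictly before time $1$. Then $\widehat{Z}^{\lambda}$ has density $$f_{\widehat{Z}^{\lambda}}(t)=\frac{\lambda}{\sqrt{2 \pi (1-t)t^3}} \exp\left(-\frac{\lambda^2 (1-t)}{2t}\right),\qquad 0<t<1,$$ and, given $\widehat{Z}^{\lambda}$, the path of $V(B^{\lambda,br})$ is decomposed into two conditionally independent pieces: (i) $(V(B^{\lambda,br})_{u};\ 0 \leq u \leq \widehat{Z}^{\lambda})$ is a three-dimensional Bessel bridge of length $\widehat{Z}^{\lambda}$ starting from $0$ and ending at $\lambda$; (ii) $(V(B^{\lambda,br})_{u};\ \widehat{Z}^{\lambda} \leq u \leq 1)$ is a Brownian excursion above level $\lambda$ of length $1-\widehat{Z}^{\lambda}$.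
   Context: Vervaat transform: for continuous $f:[0,1]\to\mathbb{R}$ with $f(0)=0$, let $\tau(f)$ be the first time at which $f$ attains its minimum on $[0,1]$. Define $V(f)(t)=f(\tau(f)+t)-f(\tau(f))$ for $0\le t\le 1-\tau(f)$ and $V(f)(t)=f(\tau(f)+t-1)+f(1)-f(\tau(f))$ for $1-\tau(f)\le t\le 1$. A Brownian excursion of length $\ell>0$ is a three-dimensional Bessel bridge from $0$ to $0$ of length $\ell$; a Brownian excursion above level $\lambda$ of length $\ell$ is $\lambda$ plus a Brownian excursion of length $\ell$. The piece on $[\widehat Z^\lambda,1]$ is re-indexed by $u-\widehat Z^\lambda$. *)

(* Defs.v *)
From HB Require Import structures.
From mathcomp Require Import all_boot all_order all_algebra.
From mathcomp Require Import all_classical all_reals all_analysis measurable_realfun.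
Set Implicit Arguments.
Unset Strict Implicit.
Unset Printing Implicit Defensive.
Import Order.TTheory GRing.Theory Num.Theory.
Import numFieldNormedType.Exports.
Local Open Scope classical_set_scope.
Local Open Scope ring_scope.

(* Processes are functions X : R -> T -> R, time first. *)

Section vervaat.
Context {R : realType}.
Implicit Types f : R -> R.

Definition argmin_time f : R :=
  inf [set t | 0 <= t <= 1 /\ forall s, 0 <= s <= 1 -> f t <= f s].

Definition vervaat f (t : R) : R :=
  let tau := argmin_time f in
  if t <= 1 - tau then f (tau + t) - f tau
  else f (tau + t - 1) + f 1 - f tau.

(* The library's sup is 0 when f never takes the value lam on [0, 1[. *)
Definition last_hit (lam : R) f : R :=
  sup [set t | 0 <= t < 1 /\ f t = lam].

End vervaat.

(* Markovian bridges.  A transition function is described by its density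
   k t x y with respect to a reference measure, itself of density h with
   respect to Lebesgue measure.  The bridge of length l from x to y is the
   process with continuous paths such that, for 0 < t_1 < ... < t_n < l, the law
   of (X_{t_1}, ..., X_{t_n}) has density
     k t_1 x z_1 * k (t_2 - t_1) z_1 z_2 * ... * k (l - t_n) z_n y / k l x y
   with respect to the n-fold power of the reference measure.
   Finite-dimensional laws are specified on rectangles, encoded by lists
   c = [:: (t_1, A_1); ...; (t_n, A_n)]. *)
Section bridge_fdd.
Context {R : realType}.
Implicit Types (k : R -> R -> R -> R) (h : R -> R) (c : seq (R * set R)).

Definition rectangle c : Prop :=
  path <%R 0 (unzip1 c) /\ forall i, measurable (nth setT (unzip2 c) i).

Definition last_time c : R := last 0 (unzip1 c).

Fixpoint bridge_mass k h (l y s x : R) c : \bar R :=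
  if c is (t, A) :: c' then
    (\int[lebesgue_measure]_(z in A)
       ((k (t - s) x z * h z)%:E * bridge_mass k h l y t z c'))%E
  else (k (l - s) x y)%:E.

Definition bridge_prob k h (l x y : R) c : \bar R :=
  (bridge_mass k h l y 0 x c * ((k l x y)^-1)%:E)%E.

Definition brownian_density (t x y : R) : R := normal_pdf x (Num.sqrt t) y.

Definition brownian_ref (_ : R) : R := 1.

(* Three-dimensional Bessel process: reference measure z^2 dz on ]0, +oo[.
   With respect to dy the transition densities are
     (y / x) (p_t (y - x) - p_t (y + x))          from x > 0,
     sqrt (2 / (pi t^3)) y^2 exp (- y^2 / (2 t))  from x = 0,
   where p_t is the centred Gaussian density of variance t.  Dividing by y^2
   makes the density symmetric and continuous up to the boundary of the
   quadrant, which gives a meaning to bridges ending at 0. *)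
Definition bessel3_density (t x y : R) : R :=
  if x * y == 0 then
    Num.sqrt (2 / (pi * t ^+ 3)) * expR (- (x ^+ 2 + y ^+ 2) / (2 * t))
  else (brownian_density t x y - brownian_density t (- x) y) / (x * y).

Definition bessel3_ref (z : R) : R := if 0 < z then z ^+ 2 else 0.

End bridge_fdd.

Section processes.
Context {R : realType} {d : measure_display} {T : measurableType d}.
Variable P : probability T R.
Implicit Types (k : R -> R -> R -> R) (h : R -> R) (c : seq (R * set R)).
Implicit Types (X : R -> T -> R) (Z : T -> R) (E : set T).

Definition cylinder X c : set T := \big[setI/setT]_(p <- c) (X p.1 @^-1` p.2).

(* Paths start at x surely, as the Vervaat transform is a functional of
   continuous paths with a given initial value. *)
Definition markov_bridge k h (l x y : R) X : Prop :=
  [/\ forall t, 0 <= t <= l -> measurable_fun setT (X t),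
      forall w, {within `[0, l], continuous (X ^~ w)},
      forall w, X 0 w = x,
      (\forall w \ae P, X l w = y) &
      forall c, rectangle c -> last_time c < l ->
        P (cylinder X c) = bridge_prob k h l x y c].

Definition brownian_bridge (l x y : R) X : Prop :=
  markov_bridge brownian_density brownian_ref l x y X.

(* z |-> g z is a version of P (E | Z = z). *)
Definition cond_prob Z E (g : R -> \bar R) : Prop :=
  [/\ measurable E, measurable_fun setT g &
      forall A : set R, measurable A ->
        P (E `&` Z @^-1` A) = (\int[P]_(w in Z @^-1` A) g (Z w))%E].

Definition cond_independent Z (F G : set (set T)) : Prop :=
  forall E1 E2 g1 g2, F E1 -> G E2 ->
    cond_prob Z E1 g1 -> cond_prob Z E2 g2 ->
    cond_prob Z (E1 `&` E2) (fun z => g1 z * g2 z)%E.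

Definition path_sigma X : set (set T) :=
  <<s [set E | exists t, exists A : set R,
         [/\ 0 <= t, measurable A & E = X t @^-1` A] ] >>.

(* Given Z, the process (X_u; 0 <= u <= len Z) is a bridge of length len Z
   from x to y.  As the length is random, the law given Z = z only concerns the
   times smaller than len z. *)
Definition cond_markov_bridge k h Z (len : R -> R) (x y : R) X : Prop :=
  [/\ forall t, 0 <= t -> measurable_fun setT (X t),
      forall w, {within `[0, len (Z w)], continuous (X ^~ w)},
      (\forall w \ae P, X 0 w = x),
      (\forall w \ae P, X (len (Z w)) w = y) &
      forall c, rectangle c ->
        cond_prob Z (cylinder X c `&` [set w | last_time c < len (Z w)])
          (fun z => if last_time c < len z then bridge_prob k h (len z) x y c
                    else 0%E)].

Definition cond_bessel3_bridge Z (len : R -> R) (x y : R) X : Prop :=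
  cond_markov_bridge bessel3_density bessel3_ref Z len x y X.

Definition cond_excursion_above (lam : R) Z (len : R -> R) X : Prop :=
  cond_bessel3_bridge Z len 0 0 (fun u w => X u w - lam).

(* The pieces of X on [0, Z] and on [Z, 1], the latter re-indexed by u - Z;
   both are stopped at the end of their lifetime. *)
Definition piece_before Z X : R -> T -> R :=
  fun u w => X (Num.min u (Z w)) w.

Definition piece_after Z X : R -> T -> R :=
  fun u w => X (Num.min (Z w + u) 1) w.

End processes.

Definition last_hit_density {R : realType} (lam t : R) : R :=
  lam / Num.sqrt (2 * pi * (1 - t) * t ^+ 3)
  * expR (- (lam ^+ 2 * (1 - t) / (2 * t))).

(* Main.v *)
Require Import Defs.
From HB Require Import structures.
From mathcomp Require Import all_boot all_order all_algebra.
From mathcomp Require Import all_classical all_reals all_analysis measurable_realfun.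
From mathcomp Require Import ring lra zify.
Set Implicit Arguments.
Unset Strict Implicit.
Unset Printing Implicit Defensive.
Import Order.TTheory GRing.Theory Num.Theory.
Import numFieldNormedType.Exports.
Local Open Scope classical_set_scope.
Local Open Scope ring_scope.

(** Split the Vervaat path at its last hit [Z] of the end level. In terms of the bridge [B], this
    cuts the time circle at the first minimum [tau] and at [tau + Z]. Fix a small mesh. The event that
    the minimum is reached in [[u, u + e]] and left through the end level in [[v, v + e]], with the path
    in prescribed boxes elsewhere, is squeezed from below by events "stay above a floor", whose
    probabilities are compositions of reflected Gaussian kernels. Letting the depth of the dip at the
    minimum tend to 0, the kernel across the dip becomes a hitting density; since the kernel killed at 0
    is [x y] times the Bessel kernel, everything recombines into masses of Bessel bridges from 0 to
    [lam] and from 0 to 0. Summing over the position of the minimum and letting the mesh tend to 0,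
    Fatou's lemma bounds the joint law of [Z] and of the two pieces from below, on boxes, by the law of
    the statement. That law has total mass 1, because the density of [Z] is a convolution of a hitting
    density with a Gaussian density; hence the lower bound is an equality. *)

(** * Integration on the line *)

(** Only finite-dimensional laws of the bridge are given; neither the level nor the time of its
    minimum has a law at hand, so nothing is conditioned on them. They are averaged instead. The
    path is shifted up by [a]: for a given path, the shifts compatible with a dip of depth at most
    [b] fill an interval of length at most [b]. Likewise the pairs [(u, z)] whose cell is compatible
    with a path fill an area of at most the squared mesh. Tonelli then turns integrals of cell
    probabilities into a bound on a single probability. Limits of cell masses use pointwise
    convergence of kernels without domination; this is why only one inequality comes out. The
    constant comes from one cell of mesh [d]: the dip at the minimum gives [d / 2], the last visit
    of the end level gives [d * l / 2], and the end point of the bridge gives [1 / gauss 1 l]. The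
    factor [1 - z] is the length of the interval of possible times of the minimum. The shift is
    integrated against [a ^+ 2], one factor [a] from each end of the path; this is the Bessel
    reference measure, so the end of the bridge is glued to its start. *)

Section real_measure.
Context {R : realType}.
Implicit Types (x y z b c : R) (f : R -> \bar R).
Notation mu := (@lebesgue_measure R).

Lemma measurable_invr : measurable_fun setT (@GRing.inv R).
Proof.
have -> : @GRing.inv R = fun x => if x == 0 then 0 else x^-1.
  by apply/funext => x; case: eqP => // ->; rewrite invr0.
apply: measurable_fun_if => //.
- by apply: measurable_fun_eqr.
- rewrite setTI; apply: open_continuous_measurable_fun.
    rewrite (_ : _ @^-1` _ = ~` [set 0]).
      by apply: closed_openC; exact: closed_eq.
    by apply/seteqP; split=> x /=; [move/negbT/eqP|move/eqP/negbTE].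
  by move=> x; rewrite inE/= => /negbT x0; exact: inv_continuous.
Qed.

Lemma measurable_funV d (T : measurableType d) (f : T -> R) :
  measurable_fun setT f -> measurable_fun setT (fun w => (f w)^-1).
Proof. by move=> mf; exact: (measurableT_comp measurable_invr). Qed.

Lemma measurable_sqrtr : measurable_fun setT (@Num.sqrt R).
Proof. by apply: continuous_measurable_fun; exact: sqrt_continuous. Qed.

Lemma emeasurable_funZl d (T : measurableType d) (D : set T) (k : \bar R) (g : T -> \bar R) :
  measurable_fun setT g -> measurable_fun D (fun w => k * g w)%E.
Proof.
move=> mg; apply: (measurable_funS measurableT (@subsetT _ D)).
by apply: emeasurable_funM => //; exact: measurable_cst.
Qed.

Lemma lebesgue_measureD c (A : set R) : measurable A ->
  pushforward mu ((fun x => x + c) : _ -> measurableTypeR R) A = mu A.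
Proof.
move=> mA.
have mphi : measurable_fun setT ((fun x => x + c) : measurableTypeR R -> measurableTypeR R).
  by apply: measurable_funD.
apply/esym/lebesgue_measure_unique => //=.
move=> _ [[a b]] _ <-.
rewrite /pushforward (_ : _ @^-1` _ = `](a - c), (b - c)]%classic).
  rewrite !lebesgue_measure_itv/= !lte_fin ltrD2r.
  by case: ifP => // _; rewrite -!EFinD; congr (_%:E); ring.
by apply/seteqP; split=> x /=; rewrite !in_itv/= ltrBlDr lerBrDr.
Qed.

Lemma ge0_integralD_shift c f : measurable_fun setT f -> (forall x, 0 <= f x)%E ->
  (\int[mu]_x f x = \int[mu]_x f (x + c)%R)%E.
Proof.
move=> mf f0.
have mphi : measurable_fun setT ((fun x => x + c) : measurableTypeR R -> measurableTypeR R).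
  by apply: measurable_funD.
rewrite -(@ge0_integral_pushforward _ _ _ _ _ _ mphi mu setT f) //.
by apply: eq_measure_integral => A mA _; exact/esym/lebesgue_measureD.
Qed.

Lemma ge0_integralN f : measurable_fun setT f -> (forall x, 0 <= f x)%E ->
  (\int[mu]_x f x = \int[mu]_x f (- x)%R)%E.
Proof.
move=> mf f0.
have mphi : measurable_fun setT ((fun x => - x) : measurableTypeR R -> measurableTypeR R).
  exact: measurableT_comp.
rewrite -(@ge0_integral_pushforward _ _ _ _ _ _ mphi mu setT f) //.
by apply: eq_measure_integral => A mA _; exact/esym/lebesgue_measureN.
Qed.

Lemma ge0_integral_preimageD c f (A : set R) : measurable A ->
  measurable_fun setT f -> (forall x, 0 <= f x)%E ->
  (\int[mu]_(x in A) f x = \int[mu]_(x in [set y | A (y + c)%R]) f (x + c)%R)%E.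
Proof.
move=> mA mf f0.
rewrite [LHS]integral_mkcond (ge0_integralD_shift c).
- rewrite [RHS]integral_mkcond; apply: eq_integral => x _.
  by rewrite /patch; case: ifPn.
- exact/(measurable_restrictT _ mA)/measurable_funTS.
- exact: erestrict_ge0.
Qed.

(** Folding the line at [b] brings the image term of a reflected kernel back to the half-line above
    [b]. *)
Lemma ge0_integral_fold b f : measurable_fun setT f -> (forall x, 0 <= f x)%E ->
  (\int[mu]_x f x = \int[mu]_(x in `]b, +oo[) (f x + f (2 * b - x)%R))%E.
Proof.
move=> mf f0.
have mf' : measurable_fun setT (fun x : R => f (2 * b - x)).
  by apply: measurableT_comp => //; apply: measurable_funB.
rewrite ge0_integralD//; [|by apply: measurable_funTS..].
rewrite -(setUv `]b, +oo[%classic) ge0_integral_setU//; last 2 first.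
- exact: measurable_funS mf.
- by apply/disj_setPS => x [].
congr (_ + _)%E.
rewrite setCitvr.
(* The point [b] is dropped so that the two open half-lines are mirror images of each other. *)
rewrite -(@integral_setD1 _ _ b _ ) //; last exact: measurable_funTS.
rewrite (_ : _ `\ b = `]-oo, b[%classic); last first.
  apply/seteqP; split=> x /=; rewrite !in_itv/=.
    by move=> [xb] /eqP xnb; rewrite lt_neqAle xnb.
  by move=> xb; split; [exact: ltW|apply/eqP; rewrite lt_eqF].
have mr : measurable_fun setT (f \_ `]-oo, b[).
  by apply/(measurable_restrictT _ (measurable_itv _))/measurable_funTS.
rewrite [LHS]integral_mkcond ge0_integralN; last 2 first.
- exact: mr.
- exact: erestrict_ge0.
rewrite (ge0_integralD_shift (- (2 * b))); last 2 first.
- by apply: (measurableT_comp mr).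
- by move=> x; exact: erestrict_ge0.
rewrite [RHS]integral_mkcond; apply: eq_integral => x _.
rewrite /patch; have -> : - (x - 2 * b) = 2 * b - x by ring.
have -> : (2 * b - x \in `]-oo, b[%classic) = (x \in `]b, +oo[%classic).
  by apply/idP/idP; rewrite !inE/= !in_itv/= andbT => ?; lra.
by [].
by apply: measurableD.
exact: measurableC.
Qed.

End real_measure.

(** * Gaussian and killed kernels *)

Section gauss.
Context {R : realType}.
Implicit Types s t x y z b : R.
Notation mu := (@lebesgue_measure R).

(** Locking keeps conversion and simplification away from the body; [gaussE] gives access to it. *)
Fact gauss_key : unit. Proof. by []. Qed.
Definition gauss : R -> R -> R := locked_with gauss_key (fun t x =>
  (Num.sqrt (2 * pi * t))^-1 * expR (- (x ^+ 2 / (2 * t)))).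

Lemma gaussE t x : gauss t x = (Num.sqrt (2 * pi * t))^-1 * expR (- (x ^+ 2 / (2 * t))).
Proof. by rewrite /gauss unlock. Qed.

Lemma gauss_gt0 t x : 0 < t -> 0 < gauss t x.
Proof.
by move=> t0; rewrite gaussE mulr_gt0 ?expR_gt0// invr_gt0 sqrtr_gt0 !mulr_gt0// pi_gt0.
Qed.

Lemma gauss_ge0 t x : 0 <= gauss t x.
Proof. by rewrite gaussE mulr_ge0 ?expR_ge0// invr_ge0. Qed.

Lemma gaussN t x : gauss t (- x) = gauss t x.
Proof. by rewrite !gaussE sqrrN. Qed.

Lemma brownian_densityE t x y : 0 < t -> brownian_density t x y = gauss t (y - x).
Proof.
move=> t0; rewrite /brownian_density normal_pdfE ?gt_eqF ?sqrtr_gt0//.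
rewrite /normal_peak /normal_fun gaussE sqr_sqrtr ?ltW//.
congr (_^-1 * expR _).
  by congr Num.sqrt; rewrite -mulr_natl; ring.
by rewrite mulNr mulr_natl.
Qed.

Lemma integral_gauss t y : 0 < t -> (\int[mu]_x (gauss t (x - y))%:E = 1)%E.
Proof.
move=> t0; rewrite -(@integral_normal_pdf R y (Num.sqrt t)) ?gt_eqF ?sqrtr_gt0//.
by apply: eq_integral => x _; rewrite -brownian_densityE.
Qed.

Lemma measurable_gauss d (T : measurableType d) (f g : T -> R) :
  measurable_fun setT f -> measurable_fun setT g ->
  measurable_fun setT (fun w => gauss (f w) (g w)).
Proof.
move=> mf mg; under eq_fun do rewrite gaussE.
apply: measurable_funM.
  apply: measurable_funV; apply: (measurableT_comp measurable_sqrtr).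
  by apply: measurable_funM.
apply: measurableT_comp => //; apply: measurableT_comp => //.
apply: measurable_funM; first exact: measurable_funX.
by apply: measurable_funV; apply: measurable_funM.
Qed.

Lemma measurable_EFin_gauss d (T : measurableType d) (f g : T -> R) :
  measurable_fun setT f -> measurable_fun setT g ->
  measurable_fun setT (fun w => (gauss (f w) (g w))%:E).
Proof. by move=> mf mg; apply/measurable_EFinP/measurable_gauss. Qed.

(** Completing the square in [z]: the last factor is the law at time [s] of the Brownian bridge of
    length [s + t] from [x] to [y]. *)
Lemma gauss_mul s t x y z : 0 < s -> 0 < t ->
  gauss s (z - x) * gauss t (y - z) =
  gauss (s + t) (y - x) * gauss (s * t / (s + t)) (z - (t * x + s * y) / (s + t)).
Proof.
move=> s0 t0; have st0 : 0 < s + t by rewrite addr_gt0.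
rewrite !gaussE mulrACA -expRD -invfM -sqrtrM ?mulr_ge0 ?pi_ge0 ?ltW//.
rewrite [RHS]mulrACA -expRD -invfM -sqrtrM ?mulr_ge0 ?pi_ge0 ?ltW//.
congr (_^-1 * expR _).
  by congr Num.sqrt; field; rewrite gt_eqF.
by field; rewrite ?gt_eqF.
Qed.

Lemma gauss_conv s t x y : 0 < s -> 0 < t ->
  (\int[mu]_z (gauss s (z - x) * gauss t (y - z))%:E = (gauss (s + t) (y - x))%:E)%E.
Proof.
move=> s0 t0; have st0 : 0 < s + t by rewrite addr_gt0.
under eq_integral do rewrite gauss_mul// EFinM.
rewrite ge0_integralZl//=.
- by rewrite integral_gauss ?mule1// divr_gt0 ?mulr_gt0.
- apply: measurable_EFin_gauss => //; exact: measurable_funB.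
- by move=> z _; rewrite lee_fin gauss_ge0.
- by rewrite lee_fin gauss_ge0.
Qed.

(** Transition density of Brownian motion killed at the level [b], by the method of images:
    [2 * b - x] is the mirror image of the start. *)
Definition killed b t x y : R :=
  if (b < x) && (b < y) then gauss t (y - x) - gauss t (y + x - 2 * b) else 0.

Lemma gauss_le t x y : 0 < t -> `|x| <= `|y| -> gauss t y <= gauss t x.
Proof.
move=> t0 xy; rewrite !gaussE ler_wpM2l ?invr_ge0// ler_expR lerN2 ler_pM2r ?invr_gt0 ?mulr_gt0//.
by rewrite -[x ^+ 2]real_normK ?num_real// -[y ^+ 2]real_normK ?num_real// lerXn2r// nnegrE.
Qed.

Lemma killed_ge0 b t x y : 0 < t -> 0 <= killed b t x y.
Proof.
move=> t0; rewrite /killed; case: ifPn => // /andP[bx b_y].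
by rewrite subr_ge0 gauss_le// ler_norml; have := ler_norm (y + x - 2 * b) => ?; lra.
Qed.

Lemma measurable_killed d (T : measurableType d) (fb f g h : T -> R) :
  measurable_fun setT fb ->
  measurable_fun setT f -> measurable_fun setT g -> measurable_fun setT h ->
  measurable_fun setT (fun w => killed (fb w) (f w) (g w) (h w)).
Proof.
move=> mb mf mg mh; apply: measurable_fun_ifT => //.
  by apply: measurable_and; apply: measurable_fun_ltr.
apply: measurable_funB; apply: measurable_gauss => //; first exact: measurable_funB.
apply: measurable_funB; first exact: measurable_funD.
exact: measurable_funM.
Qed.

(** Both full-line convolutions, from [x] and from its image, are folded at [b]; in their difference
    the four products that remain are exactly those of two killed kernels. *)
Lemma killed_conv b s t x y : 0 < s -> 0 < t ->
  (\int[mu]_(z in `]b, +oo[) (killed b s x z * killed b t z y)%:E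
   = (killed b (s + t) x y)%:E)%E.
Proof.
move=> s0 t0; have st0 : 0 < s + t by rewrite addr_gt0.
have [/andP[bx b_y]|nb] := boolP ((b < x) && (b < y)); last first.
  rewrite [in RHS]/killed (negbTE nb); apply: integral0_eq => z _.
  rewrite /killed; move: nb; case: (b < x) => //=; last by rewrite mul0r.
  by case: (b < y) => // _; rewrite andbF mulr0.
pose h (z : R) : \bar R := (gauss s (z + x - 2 * b) * gauss t (y - z))%:E.
pose g (z : R) : \bar R := (gauss s (z - x) * gauss t (y - z))%:E.
have mg : measurable_fun setT g.
  apply/measurable_EFinP; apply: measurable_funM; apply: measurable_gauss => //;
  exact: measurable_funB.
have mh : measurable_fun setT h.
  apply/measurable_EFinP; apply: measurable_funM; apply: measurable_gauss => //.
    by apply: measurable_funB => //; exact: measurable_funD.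
  exact: measurable_funB.
have g0 z : (0 <= g z)%E by rewrite lee_fin mulr_ge0 ?gauss_ge0.
have h0 z : (0 <= h z)%E by rewrite lee_fin mulr_ge0 ?gauss_ge0.
have Ig := gauss_conv x y s0 t0; rewrite -/g in Ig.
have Ih : (\int[mu]_z h z = (gauss (s + t) (y + x - 2 * b))%:E)%E.
  rewrite (_ : y + x - 2 * b = y - (2 * b - x)); last by ring.
  rewrite -(gauss_conv _ _ s0 t0); apply: eq_integral => z _.
  by rewrite /h; congr ((gauss _ _ * _)%:E); ring.
move: Ig Ih; rewrite (ge0_integral_fold b mg g0) (ge0_integral_fold b mh h0).
set I1 := integral _ _ _ => I1E; set I2 := integral _ _ _ => I2E.
rewrite /killed bx b_y/= EFinB -I1E -I2E.
have m1 (k : R -> \bar R) : measurable_fun setT k ->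
    measurable_fun `]b, +oo[ (fun z : R => k z + k (2 * b - z)%R)%E.
  move=> mk; apply: measurable_funTS; apply: emeasurable_funD => //.
  by apply: (measurableT_comp mk); exact: measurable_funB.
(* The difference of the two convolutions is stated as a sum, so that additivity of nonnegative
   integrals applies. *)
suff -> : I1 = (\int[mu]_(z in `]b, +oo[) (killed b s x z * killed b t z y)%:E + I2)%E.
  rewrite addeK//; first by rewrite /killed bx b_y.
  by rewrite I2E.
rewrite -ge0_integralD//; last 4 first.
- by move=> z _; rewrite lee_fin mulr_ge0 ?killed_ge0.
- by apply/measurable_funTS/measurable_EFinP/measurable_funM; exact: measurable_killed.
- by move=> z _; rewrite adde_ge0.
- exact: m1.
apply: eq_integral => z; rewrite inE/= in_itv/= andbT => bz.
rewrite /g /h /killed bx b_y bz/= -!EFinD; congr (_%:E).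
have -> : gauss s (2 * b - z - x) = gauss s (z + x - 2 * b).
  by rewrite -gaussN; congr gauss; ring.
have -> : gauss t (y - (2 * b - z)) = gauss t (y + z - 2 * b).
  by congr gauss; ring.
have -> : 2 * b - z + x - 2 * b = - (z - x) by ring.
by rewrite gaussN; ring.
Qed.

End gauss.

(** * The kernel of the three-dimensional Bessel process *)

Section bessel.
Context {R : realType}.
Implicit Types s t x y z b w : R.
Notation mu := (@lebesgue_measure R).

(* [sinh w / w], extended by continuity: it makes [bes] a formula for [bessel3_density] without
   case distinction. *)
Definition sinhc w : R := if w == 0 then 1 else (expR w - expR (- w)) / (2 * w).

Lemma sinhc0 : sinhc 0 = 1. Proof. by rewrite /sinhc eqxx. Qed.

Lemma sinhc_le w : 0 <= w -> sinhc w <= expR w.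
Proof.
move=> w0; rewrite /sinhc; case: eqVneq => [->|wn0]; first by rewrite expR0.
have {wn0}w0' : 0 < w by rewrite lt_neqAle eq_sym wn0.
rewrite ler_pdivrMr ?mulr_gt0//.
have := expR_ge1Dx (- (2 * w)).
have -> : expR (- (2 * w)) = expR (- w) * expR (- w) by rewrite -expRD; congr expR; ring.
have e1 : expR w * expR (- w) = 1 by rewrite expRN divff// gt_eqF ?expR_gt0.
move=> /(ler_wpM2l (expR_ge0 w)); rewrite mulrA e1 mul1r; lra.
Qed.

Lemma sinhc_ge w : 0 <= w -> expR (- w) <= sinhc w.
Proof.
move=> w0; rewrite /sinhc; case: eqVneq => [->|wn0]; first by rewrite oppr0 expR0.
have {wn0}w0' : 0 < w by rewrite lt_neqAle eq_sym wn0.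
rewrite ler_pdivlMr ?mulr_gt0//.
have := expR_ge1Dx (2 * w).
have -> : expR (2 * w) = expR w * expR w by rewrite -expRD; congr expR; ring.
have e1 : expR w * expR (- w) = 1 by rewrite expRN divff// gt_eqF ?expR_gt0.
move=> /(ler_wpM2l (expR_ge0 (- w))); rewrite mulrA [expR (- w) * expR w]mulrC e1 mul1r; lra.
Qed.

Lemma sinhc_gt0 w : 0 <= w -> 0 < sinhc w.
Proof. by move=> /sinhc_ge; apply: lt_le_trans; rewrite expR_gt0. Qed.

(** Duplication formula: [sinhc (2 * v)] is [sinhc v] times [cosh v], and [cosh v] is at least 1. *)
Lemma sinhc_half w : 0 <= w -> sinhc (w / 2) <= sinhc w.
Proof.
move=> w0; have [->|wn0] := eqVneq w 0; first by rewrite mul0r.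
have {wn0}w0' : 0 < w by rewrite lt_neqAle eq_sym wn0.
set v := w / 2; have v0 : 0 < v by rewrite divr_gt0.
have -> : w = 2 * v by rewrite /v; field.
rewrite /sinhc !gt_eqF ?mulr_gt0//.
have e1 : expR v * expR (- v) = 1 by rewrite expRN divff// gt_eqF ?expR_gt0.
have -> : expR (2 * v) = expR v * expR v by rewrite -expRD; congr expR; ring.
have -> : expR (- (2 * v)) = expR (- v) * expR (- v) by rewrite -expRD; congr expR; ring.
have v1 := expR_ge1Dx v.
set a := expR v in e1 v1 *; set c := expR (- v) in e1 *.
have c0 : 0 < c by rewrite expR_gt0.
have ca : c <= 1 by rewrite -expR0 ler_expR; lra.
have a1 : 1 <= a by lra.
have -> : (a * a - c * c) / (2 * (2 * v)) = (a - c) / (2 * v) * ((a + c) / 2) by field; rewrite gt_eqF.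
(* Since [a * c = 1], the product [(a - 1) * (1 - c)] equals [a + c - 2]. *)
rewrite ler_peMr//; last by have : 0 <= (a - 1) * (1 - c); [rewrite mulr_ge0 ?subr_ge0|nra].
by rewrite divr_ge0 ?subr_ge0 ?mulr_ge0 ?(ltW v0)// (le_trans ca).
Qed.

(** Monotonicity along halvings is the form used to dominate kernels started at [2^-1 ^+ n]. *)
Lemma sinhc_pow n w : 0 <= w -> sinhc (w / 2 ^+ n) <= sinhc w.
Proof.
elim: n w => [|n ih] w w0; first by rewrite expr0 divr1.
rewrite exprS invfM mulrA; apply: le_trans (ih _ _) (sinhc_half w0).
by rewrite divr_ge0.
Qed.

Lemma measurable_sinhc : measurable_fun setT sinhc.
Proof.
apply: measurable_fun_ifT => //; first exact: measurable_fun_eqr.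
apply: measurable_funM; last by apply: measurable_funV; exact: measurable_funM.
by apply: measurable_funB => //; apply: measurableT_comp.
Qed.

Fact bes_key : unit. Proof. by []. Qed.
Definition bes : R -> R -> R -> R := locked_with bes_key (fun t x y =>
  Num.sqrt (2 / (pi * t ^+ 3)) * expR (- (x ^+ 2 + y ^+ 2) / (2 * t)) * sinhc (x * y / t)).

Lemma bes_sinhc t x y : bes t x y =
  Num.sqrt (2 / (pi * t ^+ 3)) * expR (- (x ^+ 2 + y ^+ 2) / (2 * t)) * sinhc (x * y / t).
Proof. by rewrite /bes unlock. Qed.

Lemma besC t x y : bes t x y = bes t y x.
Proof. by rewrite !bes_sinhc [x ^+ 2 + _]addrC [x * y]mulrC. Qed.

Lemma bes_gt0 t x y : 0 < t -> 0 <= x -> 0 <= y -> 0 < bes t x y.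
Proof.
move=> t0 x0 y0; rewrite bes_sinhc !mulr_gt0 ?expR_gt0// ?sinhc_gt0//.
  by rewrite sqrtr_gt0 divr_gt0// mulr_gt0 ?pi_gt0 ?exprn_gt0.
by rewrite divr_ge0 ?mulr_ge0 ?(ltW t0).
Qed.

Lemma bes_ge0 t x y : 0 < t -> 0 <= x -> 0 <= y -> 0 <= bes t x y.
Proof. by move=> *; rewrite ltW// bes_gt0. Qed.

Lemma besE t x y : 0 < t -> bessel3_density t x y = bes t x y.
Proof.
move=> t0; rewrite /bessel3_density bes_sinhc.
case: eqVneq => [->|xy0]; first by rewrite mul0r sinhc0 mulr1.
rewrite !brownian_densityE// opprK /sinhc mulf_eq0 (negbTE xy0)/= gt_eqF ?invr_gt0//.
(* Expanding the squares isolates the cross terms [exp (x y / t)] and [exp (- x y / t)], whose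
   difference is a hyperbolic sine. *)
have -> : gauss t (y - x) = gauss t 0 * (expR (- (x ^+ 2 + y ^+ 2) / (2 * t)) * expR (x * y / t)).
  rewrite !gaussE -expRD expr0n/= mul0r oppr0 expR0 mulr1; congr (_ * expR _).
  by field; rewrite gt_eqF.
have -> : gauss t (y + x) = gauss t 0 * (expR (- (x ^+ 2 + y ^+ 2) / (2 * t)) * expR (- (x * y / t))).
  rewrite !gaussE -expRD expr0n/= mul0r oppr0 expR0 mulr1; congr (_ * expR _).
  by field; rewrite gt_eqF.
have -> : Num.sqrt (2 / (pi * t ^+ 3)) = gauss t 0 * (2 / t).
  rewrite !gaussE expr0n/= mul0r oppr0 expR0 mulr1.
  rewrite -[2 / t]ger0_norm ?divr_ge0 ?ltW// -sqrtr_sqr -sqrtrV ?mulr_ge0 ?pi_ge0 ?ltW//.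
  rewrite -sqrtrM ?invr_ge0 ?mulr_ge0 ?pi_ge0 ?ltW//; congr Num.sqrt.
  have p0 : pi != 0 :> R by rewrite gt_eqF ?pi_gt0.
  have tn0 : t != 0 by rewrite gt_eqF.
  by move: (pi) p0 => p p0; field; rewrite p0 tn0.
have /andP[x0 y0] : (x != 0) && (y != 0) by move: xy0; rewrite mulf_eq0 negb_or.
by field; rewrite x0 y0 gt_eqF.
Qed.

(** Doob transform by the harmonic function [x]. Along a chain of killed kernels each intermediate
    position contributes [z * z], which is the Bessel reference density, so that only the factors of
    the two ends survive. *)
Lemma killed_bes t x y : 0 < t -> 0 < x -> 0 < y -> killed 0 t x y = x * y * bes t x y.
Proof.
move=> t0 x0 y0; rewrite -besE// /bessel3_density mulf_eq0 !gt_eqF//=.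
rewrite !brownian_densityE// opprK /killed x0 y0/= mulr0 subr0.
by rewrite mulrCA divff ?mulr1// gt_eqF ?mulr_gt0.
Qed.

Lemma measurable_bes d (T : measurableType d) (f g h : T -> R) :
  measurable_fun setT f -> measurable_fun setT g -> measurable_fun setT h ->
  measurable_fun setT (fun u => bes (f u) (g u) (h u)).
Proof.
move=> mf mg mh; under eq_fun do rewrite bes_sinhc.
apply: measurable_funM; last first.
  apply: (measurableT_comp measurable_sinhc); apply: measurable_funM.
    exact: measurable_funM.
  exact: measurable_funV.
apply: measurable_funM.
  apply: (measurableT_comp measurable_sqrtr); apply: measurable_funM => //.
  by apply: measurable_funV; apply: measurable_funM => //; exact: measurable_funX.
apply: measurableT_comp => //; apply: measurable_funM.
  by apply: measurableT_comp => //; apply: measurable_funD; exact: measurable_funX.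
by apply: measurable_funV; exact: measurable_funM.
Qed.

Lemma cvg_sinhc0 (u : nat -> R) : (forall n, 0 <= u n) -> u n @[n --> \oo] --> (0 : R) ->
  sinhc (u n) @[n --> \oo] --> (1 : R).
Proof.
move=> u0 uc; apply: (@squeeze_cvgr _ _ _ _ (fun n => expR (- u n)) (fun n => expR (u n))).
- by apply: nearW => n; rewrite sinhc_ge// sinhc_le.
- rewrite -expR0 -[0]oppr0; apply: (@cvg_comp _ _ _ (fun n => - u n) expR).
    by apply: cvgN uc.
  exact: continuous_expR.
- by rewrite -expR0; apply: (@cvg_comp _ _ _ u expR _ _ _ uc); exact: continuous_expR.
Qed.

(** A bound uniform in [n] by the kernel started at 1; the constant compensates the factor
    [exp (- 1 / (2 s))] of that start. *)
Lemma bes_pow_le s n z : 0 < s -> 0 <= z ->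
  bes s (2^-1 ^+ n) z <= expR (1 / (2 * s)) * bes s 1 z.
Proof.
move=> s0 z0; rewrite !bes_sinhc [leRHS]mulrA [X in _ <= X * _]mulrCA -expRD.
have e0 : 0 <= 2^-1 ^+ n :> R by rewrite exprn_ge0.
have S0 : 0 <= sinhc (2^-1 ^+ n * z / s).
  by rewrite (ltW (sinhc_gt0 _))// divr_ge0 ?(ltW s0)// mulr_ge0.
apply: ler_pM => //.
- rewrite ler_wpM2l ?sqrtr_ge0// ler_expR -mulrDl ler_pM2r ?invr_gt0 ?mulr_gt0//.
  by rewrite expr1n; have := sqr_ge0 (2^-1 ^+ n : R); lra.
- rewrite mul1r exprVn (_ : _ * z / s = z / s / 2 ^+ n); last by rewrite -mulrA mulrC.
  by apply: sinhc_pow; rewrite divr_ge0 ?(ltW s0).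
Qed.

Lemma cvg_bes0 s z : 0 < s -> 0 <= z -> bes s (2^-1 ^+ n) z @[n --> \oo] --> bes s 0 z.
Proof.
move=> s0 z0; under eq_fun do rewrite bes_sinhc; rewrite bes_sinhc mul0r mul0r sinhc0.
have h : (2^-1 ^+ n : R) @[n --> \oo] --> (0 : R).
  by apply: cvg_expr; rewrite ger0_norm ?invr_ge0// invf_lt1// ltr1n.
apply: cvgM; last first.
  apply: cvg_sinhc0.
    by move=> n; rewrite divr_ge0 ?mulr_ge0 ?exprn_ge0 ?invr_ge0 ?(ltW s0).
  rewrite -[X in _ --> X](mul0r (z / s)); under eq_fun do rewrite -mulrA.
  by apply: cvgM => //; exact: cvg_cst.
apply: cvgM; first exact: cvg_cst.
apply: (@cvg_comp _ _ _ _ expR); last exact: continuous_expR.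
apply: cvgM; last exact: cvg_cst.
apply: cvgN; apply: cvgD; last exact: cvg_cst.
by rewrite expr2; under eq_fun do rewrite expr2; exact: cvgM.
Qed.

End bessel.

(** * Chapman-Kolmogorov equation of the Bessel kernel up to the boundary *)

Section bessel_conv.
Context {R : realType}.
Implicit Types s t x y z b w : R.
Notation mu := (@lebesgue_measure R).

Lemma bessel3_ref_ge0 z : 0 <= bessel3_ref z.
Proof. by rewrite /bessel3_ref; case: ifP => // _; rewrite sqr_ge0. Qed.

Lemma measurable_bessel3_ref : measurable_fun setT (@bessel3_ref R).
Proof.
by apply: measurable_fun_ifT => //; exact: measurable_fun_ltr.
Qed.

Definition bessel_conv_at s t x y : Prop :=
  (\int[mu]_z (bes s x z * bessel3_ref z * bes t z y)%:E = (bes (s + t) x y)%:E)%E.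

Let integrand_ge0 s t x y z : 0 < s -> 0 < t -> 0 <= x -> 0 <= y ->
  0 <= bes s x z * bessel3_ref z * bes t z y.
Proof.
move=> s0 t0 x0 y0; rewrite /bessel3_ref; case: ifPn => z0; last by rewrite mulr0 mul0r.
by rewrite !mulr_ge0 ?sqr_ge0 ?bes_ge0// ltW.
Qed.

Let measurable_integrand s t x y :
  measurable_fun setT (fun z => (bes s x z * bessel3_ref z * bes t z y)%:E).
Proof.
apply/measurable_EFinP/measurable_funM; last exact: measurable_bes.
by apply: measurable_funM; [exact: measurable_bes|exact: measurable_bessel3_ref].
Qed.

Let conv_gt0 s t x y : 0 < s -> 0 < t -> 0 < x -> 0 < y -> bessel_conv_at s t x y.
Proof.
move=> s0 t0 x0 y0; rewrite /bessel_conv_at.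
have xy : (x * y)^-1 != 0 by rewrite invr_neq0// gt_eqF ?mulr_gt0.
have -> : bes (s + t) x y = (x * y)^-1 * killed 0 (s + t) x y.
  by rewrite killed_bes ?addr_gt0// mulrA mulVf ?mul1r// gt_eqF ?mulr_gt0.
rewrite EFinM -killed_conv// -ge0_integralZl//; last 3 first.
- by apply/measurable_funTS/measurable_EFinP/measurable_funM; exact: measurable_killed.
- by move=> z _; rewrite lee_fin mulr_ge0 ?killed_ge0.
- by rewrite lee_fin invr_ge0 mulr_ge0 ?ltW.
rewrite [RHS]integral_mkcond; apply: eq_integral => z _.
rewrite /patch /bessel3_ref mem_setE in_itv/= andbT; case: ifPn => z0.
  rewrite -EFinM !killed_bes//; congr (_%:E); field.
  by rewrite !gt_eqF.
by rewrite mulr0 mul0r.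
Qed.

(** The start 0 is reached along [2^-1 ^+ n] by dominated convergence; the dominating function is
    integrable by the identity already known for the start 1. *)
Let conv_0 s t y : 0 < s -> 0 < t -> 0 <= y ->
  (forall x, 0 < x -> bessel_conv_at s t x y) -> bessel_conv_at s t 0 y.
Proof.
move=> s0 t0 y0 H; rewrite /bessel_conv_at.
pose f n z : \bar R := (bes s (2^-1 ^+ n) z * bessel3_ref z * bes t z y)%:E.
pose g z : \bar R := ((expR (1 / (2 * s)))%:E * (bes s 1 z * bessel3_ref z * bes t z y)%:E)%E.
have p n : 0 < 2^-1 ^+ n :> R by rewrite exprn_gt0.
have [] := @dominated_convergence _ _ R mu setT measurableT f
  (fun z => (bes s 0 z * bessel3_ref z * bes t z y)%:E) g.
- by move=> n; exact: measurable_integrand.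
- exact: measurable_integrand.
- apply: aeW => z _; apply: cvg_EFin; first exact: nearW.
  apply: cvgM; last exact: cvg_cst.
  rewrite /bessel3_ref; case: ifPn => z0; last first.
    by rewrite mulr0; under eq_fun do rewrite mulr0; exact: cvg_cst.
  by apply: cvgM; [apply: cvg_bes0 => //; exact: ltW|exact: cvg_cst].
- apply: integrableZl => //; apply/integrableP; split; first exact: measurable_integrand.
  under eq_integral => z _.
    rewrite gee0_abs ?lee_fin ?integrand_ge0//; over.
  by rewrite H// ltry.
- apply: aeW => z n _; rewrite /f /g gee0_abs lee_fin; last by rewrite integrand_ge0// ltW.
  rewrite /bessel3_ref; case: ifPn => z0; last by rewrite !mulr0 !mul0r.
  rewrite !mulrA ler_wpM2r ?bes_ge0 ?(ltW z0)// ler_pM2r//.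
  by rewrite ler_wpM2r ?(ltW z0)// bes_pow_le// ltW.
move=> _ _; rewrite (_ : (fun n => _) = fun n => (bes (s + t) (2^-1 ^+ n) y)%:E); last first.
  by apply/funext => n; exact: H.
move=> /cvg_lim <- //; apply/cvg_lim => //; apply: cvg_EFin; first exact: nearW.
by apply: cvg_bes0 => //; exact: addr_gt0.
Qed.

Let conv_sym s t x y : bessel_conv_at s t x y -> bessel_conv_at t s y x.
Proof.
rewrite /bessel_conv_at addrC besC => <-; apply: eq_integral => z _.
by congr (_%:E); rewrite besC [bes s _ _]besC; ring.
Qed.

Lemma bes_conv s t x y : 0 < s -> 0 < t -> 0 <= x -> 0 <= y ->
  (\int[mu]_z (bes s x z * bessel3_ref z * bes t z y)%:E = (bes (s + t) x y)%:E)%E.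
Proof.
move=> s0 t0 x0 y0.
have h u v y' : 0 < u -> 0 < v -> 0 < y' -> bessel_conv_at u v 0 y'.
  move=> u0 v0 y0'; apply: conv_0 => //; first exact: ltW.
  by move=> x' x0'; exact: conv_gt0.
have := x0; rewrite le_eqVlt => /predU1P[<-|x0'].
  have := y0; rewrite le_eqVlt => /predU1P[<-|y0']; last exact: h.
  apply: conv_0 => // x' x0'; apply: conv_sym; exact: h.
have := y0; rewrite le_eqVlt => /predU1P[<-|y0']; last exact: conv_gt0.
by apply: conv_sym; exact: h.
Qed.

Lemma cvgn_comp (f : R -> R) (u : nat -> R) l : {for l, continuous f} ->
  u n @[n --> \oo] --> l -> f (u n) @[n --> \oo] --> f l.
Proof. by move=> fl ul; exact: (@cvg_comp _ _ _ u f _ _ _ ul). Qed.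

Lemma cvg_bes_time (u : nat -> R) t x y : 0 < t -> u n @[n --> \oo] --> t ->
  bes (u n) x y @[n --> \oo] --> bes t x y.
Proof.
move=> t0 ut; under eq_fun do rewrite bes_sinhc; rewrite bes_sinhc.
have tn0 : t != 0 by rewrite gt_eqF.
have uV : (u n)^-1 @[n --> \oo] --> t^-1 by exact: cvgV.
apply: cvgM; last first.
  have [xy0|xy0] := eqVneq (x * y) 0.
    by rewrite xy0; under eq_fun do rewrite mul0r; rewrite mul0r; exact: cvg_cst.
  (* Away from 0 the case distinction of [sinhc] takes the same branch along the sequence, so the
     limit is taken in that branch. *)
  have : (fun w : R => (expR w - expR (- w)) / (2 * w)) (x * y / u n) @[n --> \oo] --> sinhc (x * y / t).
    rewrite /sinhc mulf_eq0 (negbTE xy0) invr_eq0 (negbTE tn0)/=.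
    have c1 : x * y / u n @[n --> \oo] --> x * y / t by apply: cvgM => //; exact: cvg_cst.
    apply: cvgM.
      apply: cvgB; first by apply: (cvgn_comp (@continuous_expR _ _) c1).
      exact: (cvgn_comp (@continuous_expR _ _) (cvgN c1)).
    by apply: cvgV; [rewrite mulf_neq0 ?pnatr_eq0// mulf_neq0 ?invr_eq0|apply: cvgM => //; exact: cvg_cst].
  apply: cvg_trans; apply: near_eq_cvg.
  have : \forall n \near \oo, 0 < u n by exact: (cvgr_gt _ ut).
  by apply: filterS => n u0; rewrite /sinhc mulf_eq0 (negbTE xy0) invr_eq0 gt_eqF.
apply: cvgM.
  apply: (cvgn_comp (@sqrt_continuous _ _)).
  apply: cvgM; first exact: cvg_cst.
  apply: cvgV; first by rewrite mulf_neq0 ?expf_neq0// gt_eqF ?pi_gt0.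
  apply: cvgM; first exact: cvg_cst.
  exact: (cvgn_comp (@exprn_continuous _ 3 t)).
apply: (cvgn_comp (@continuous_expR _ _)).
apply: cvgM; first exact: cvg_cst.
by apply: cvgV; [rewrite mulf_neq0 ?pnatr_eq0|apply: cvgM => //; exact: cvg_cst].
Qed.

End bessel_conv.

(** * Hitting densities *)

Lemma is_derive1V (R : realType) (f : R -> R) (x df : R) : f x != 0 ->
  is_derive x 1 f df -> is_derive x 1 (fun y => (f y)^-1) (- (f x) ^- 2 * df).
Proof.
move=> fx [f1 f2]; apply: DeriveDef; first exact: derivableV.
by rewrite deriveV// f2.
Qed.

Section derive1.
Context {R : realType}.
Implicit Types (f g : R -> R) (x a b : R).

Lemma is_derive1_cst a x : is_derive x (1 : R) (fun _ : R => a) (0 : R).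
Proof. exact: is_derive_cst. Qed.

Lemma is_derive1B f g x a b : is_derive x (1 : R) f a -> is_derive x (1 : R) g b ->
  is_derive x (1 : R) (fun y => f y - g y) (a - b).
Proof. by move=> ? ?; exact: is_deriveB. Qed.

Lemma is_derive1M f g x a b : is_derive x (1 : R) f a -> is_derive x (1 : R) g b ->
  is_derive x (1 : R) (fun y => f y * g y) (f x * b + g x * a).
Proof. by move=> ? ?; exact: is_deriveM. Qed.

End derive1.

(** * Distribution function of the standard normal law *)

Section normal_cdf.
Context {R : realType}.
Notation mu := (@lebesgue_measure R).

Definition ncdf (x : R) : R := \int[mu]_(t in [set` `]-oo, x]]) normal_pdf 0 1 t.

Lemma is_derive_ncdf (x : R) : is_derive x 1 ncdf (gauss 1 x).
Proof.
have xx1 : x < x + 1 by rewrite ltrDl.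
have [|||df f'] := @continuous_FTC1 R (normal_pdf 0 1) -oo%O x (x + 1) xx1.
- by apply: integrableS (integrable_normal_pdf 0 1).
- by rewrite ltNyr.
- by apply: continuous_normal_pdf; rewrite oner_eq0.
apply: DeriveDef => //; rewrite -derive1E f' -(subr0 x) -brownian_densityE//.
by rewrite /brownian_density subr0 sqrtr1.
Qed.

(** The identity as a random variable under the normal law: [ncdf] is its distribution function and
    inherits the limits at infinity. *)
Let idTR : measurableTypeR R -> R := idfun.

#[local] HB.instance Definition _ :=
  @isMeasurableFun.Build _ _ _ _ idTR (@measurable_id _ _ setT).

Lemma cvgy_ncdf (u : nat -> R) : u n @[n --> \oo] --> +oo ->
  ncdf (u n) @[n --> \oo] --> (1 : R).
Proof.
move=> uy; apply: fine_cvg; have := @cvg_cdfy1 _ _ _ _ (idTR : {RV (normal_prob 0 1) >-> R}).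
exact: (@cvg_comp _ _ _ u _ _ _ _ uy).
Qed.

Lemma cvgNy_ncdf (u : nat -> R) : u n @[n --> \oo] --> -oo ->
  ncdf (u n) @[n --> \oo] --> (0 : R).
Proof.
move=> uy; apply: fine_cvg; have := @cvg_cdfNy0 _ _ _ _ (idTR : {RV (normal_prob 0 1) >-> R}).
exact: (@cvg_comp _ _ _ u _ _ _ _ uy).
Qed.

End normal_cdf.

(** * Convolutions with hitting densities *)

Section hitting.
Context {R : realType}.
Implicit Types s t x y z b w : R.
Notation mu := (@lebesgue_measure R).

(* Density at [t] of the first hitting time of level [x] by Brownian motion. *)
Definition hit t x : R := x / t * gauss t x.

(** With [rho ^+ 2 = w / (1 - w)] one has [x^2 / w + y^2 / (1 - w) = (x + y)^2 + (x / rho - y *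
    rho)^2]. As a function of [w], a product of two Gaussian densities becomes Gaussian in the
    variable [rr], hence explicitly integrable. *)
Let rho w := Num.sqrt (w / (1 - w)).
Let rr t x y w := (x / rho w - y * rho w) / Num.sqrt t.

Let gauss_rr t x y w : 0 < t -> 0 < w < 1 ->
  gauss t (x + y) * gauss 1 (rr t x y w) =
  Num.sqrt t * gauss (t * w) x * gauss (t * (1 - w)) y * Num.sqrt (w * (1 - w)).
Proof.
move=> t0 /andP[w0 w1]; have w1' : 0 < 1 - w by rewrite subr_gt0.
have p0 : 0 < pi :> R by exact: pi_gt0.
have sqd a : 0 < a -> Num.sqrt a ^+ 2 = a by move=> a0; rewrite sqr_sqrtr// ltW.
have rhoE : rho w ^+ 2 = w / (1 - w) by rewrite sqd// divr_gt0.
rewrite !gaussE mulrACA -expRD.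
rewrite [RHS](_ : _ = (Num.sqrt t * Num.sqrt (w * (1 - w)) * (Num.sqrt (2 * pi * (t * w)))^-1
  * (Num.sqrt (2 * pi * (t * (1 - w))))^-1) * (expR (- (x ^+ 2 / (2 * (t * w)))) * expR (- (y ^+ 2 / (2 * (t * (1 - w))))))); last by ring.
rewrite -expRD; congr (_ * expR _).
  rewrite -!sqrtrV ?mulr_ge0 ?pi_ge0 ?ltW//.
  rewrite -!sqrtrM ?mulr_ge0 ?invr_ge0 ?mulr_ge0 ?pi_ge0 ?ltW//.
  congr Num.sqrt; move: (pi) p0 => p p0; field.
  by rewrite !gt_eqF.
have r0 : 0 < rho w by rewrite sqrtr_gt0 divr_gt0.
rewrite /rr expr_div_n sqd//.
have -> : (x / rho w - y * rho w) ^+ 2 = x ^+ 2 / rho w ^+ 2 + y ^+ 2 * rho w ^+ 2 - 2 * x * y.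
  by field; rewrite gt_eqF.
by rewrite rhoE; field; rewrite !gt_eqF.
Qed.

Let is_derive_rho w : 0 < w < 1 ->
  is_derive w 1 rho (((1 - w) ^+ 2 * (2 * rho w))^-1).
Proof.
move=> /andP[w0 w1]; have w1' : 0 < 1 - w by rewrite subr_gt0.
have d1 : is_derive w 1 (fun v : R => v / (1 - v)) (((1 - w) ^+ 2)^-1).
  have d2 : is_derive w 1 (fun v : R => (1 - v)^-1) (((1 - w) ^+ 2)^-1).
    have : is_derive w 1 (fun v : R => 1 - v) (- 1).
      by apply: (is_derive_eq (is_derive1B (is_derive1_cst 1 w) (is_derive_id w 1))); rewrite sub0r.
    move=> h; apply: (is_derive_eq (is_derive1V _ h)); first by rewrite gt_eqF.
    by rewrite mulrN1 opprK.
  by apply: (is_derive_eq (is_derive1M (is_derive_id w 1) d2)); rewrite /GRing.scale/=; field; rewrite gt_eqF.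
have d2 := @is_derive1_comp _ Num.sqrt (fun v : R => v / (1 - v)) w _ _ (is_derive1_sqrt (divr_gt0 w0 w1')) d1.
by apply: (is_derive_eq d2); rewrite -/(rho w) [RHS]invfM mulrC.
Qed.

Let is_derive_rr t x y w : 0 < t -> 0 < w < 1 ->
  is_derive w 1 (rr t x y)
   (- (x / rho w ^+ 2 + y) / Num.sqrt t * ((1 - w) ^+ 2 * (2 * rho w))^-1).
Proof.
move=> t0 w01; have /andP[w0 w1] := w01; have w1' : 0 < 1 - w by rewrite subr_gt0.
have r0 : 0 < rho w by rewrite sqrtr_gt0 divr_gt0.
have d1 := is_derive_rho w01.
have d2 : is_derive w 1 (fun v : R => (rho v)^-1) (- (rho w)^-2 * ((1 - w) ^+ 2 * (2 * rho w))^-1).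
  by apply: is_derive1V => //; rewrite gt_eqF.
have d3 := is_derive1M (is_derive1B (is_derive1M (is_derive1_cst x w) d2) (is_derive1M (is_derive1_cst y w) d1)) (is_derive1_cst (Num.sqrt t)^-1 w).
apply: (is_derive_eq d3); rewrite /GRing.scale/=; field.
by rewrite (gt_eqF r0) (gt_eqF w1') gt_eqF ?sqrtr_gt0.
Qed.

(** In the derivative both products of Gaussians are equal; the contributions of [x] cancel between
    the two terms and those of [y], which make [hit], add up. *)
Let prim t x y w : R := gauss t (x - y) * ncdf (rr t x (- y) w) - gauss t (x + y) * ncdf (rr t x y w).

Let is_derive_prim t x y w : 0 < t -> 0 < w < 1 ->
  is_derive w 1 (prim t x y) (t * (gauss (t * w) x * hit (t * (1 - w)) y)).
Proof.
move=> t0 w01; have /andP[w0 w1] := w01; have w1' : 0 < 1 - w by rewrite subr_gt0.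
have r0 : 0 < rho w by rewrite sqrtr_gt0 divr_gt0.
have d1 := is_derive1_comp (is_derive_ncdf (rr t x (- y) w)) (is_derive_rr x (- y) t0 w01).
have d2 := is_derive1_comp (is_derive_ncdf (rr t x y w)) (is_derive_rr x y t0 w01).
have d3 := is_derive1B (is_derive1M (is_derive1_cst (gauss t (x - y)) w) d1) (is_derive1M (is_derive1_cst (gauss t (x + y)) w) d2).
apply: (is_derive_eq d3); rewrite !mulr0 !addr0 !mulrA.
rewrite (gauss_rr x (- y) t0 w01) (gauss_rr x y t0 w01) gaussN.
have -> : Num.sqrt (w * (1 - w)) = (1 - w) * rho w.
  have E : 1 - w = Num.sqrt ((1 - w) ^+ 2) by rewrite sqrtr_sqr ger0_norm// ltW.
  rewrite /rho [X in _ = X * _]E -sqrtrM ?sqr_ge0//.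
  by congr Num.sqrt; field; rewrite gt_eqF.
rewrite /hit; field.
by rewrite (gt_eqF r0) (gt_eqF w1') (gt_eqF t0) gt_eqF ?sqrtr_gt0.
Qed.

Let continuous_integrand t x y w : 0 < t -> 0 < w < 1 ->
  {for w, continuous (fun w => t * (gauss (t * w) x * hit (t * (1 - w)) y))}.
Proof.
move=> t0 /andP[w0 w1]; have w1' : 0 < 1 - w by rewrite subr_gt0.
have cg (u : R -> R) z : 0 < u w -> {for w, continuous u} -> {for w, continuous (fun v => gauss (u v) z)}.
  move=> u0 cu; rewrite /prop_for /continuous_at gaussE; under eq_fun do rewrite gaussE.
  apply: cvgM.
    apply: cvgV; first by rewrite gt_eqF// sqrtr_gt0 !mulr_gt0 ?pi_gt0.
    apply: (@cvg_comp _ _ _ _ Num.sqrt); last exact: sqrt_continuous.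
    by apply: cvgM => //; exact: cvg_cst.
  apply: (@cvg_comp _ _ _ _ expR); last exact: continuous_expR.
  apply: cvgN; apply: cvgM; first exact: cvg_cst.
  apply: cvgV; first by rewrite gt_eqF// mulr_gt0.
  by apply: cvgM => //; exact: cvg_cst.
have c1 : {for w, continuous (fun v : R => t * v)} by apply: cvgM; [exact: cvg_cst|exact: cvg_id].
have c2 : {for w, continuous (fun v : R => t * (1 - v))}.
  apply: cvgM; first exact: cvg_cst.
  by apply: cvgB; [exact: cvg_cst|exact: cvg_id].
apply: cvgM; first exact: cvg_cst.
apply: cvgM; first by apply: cg => //; exact: mulr_gt0.
apply: cvgM; last by apply: cg => //; exact: mulr_gt0.
apply: cvgM; first exact: cvg_cst.
by apply: cvgV => //; rewrite gt_eqF// mulr_gt0.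
Qed.

Let integral_cc t x y a b : 0 < t -> 0 < a -> a < b -> b < 1 ->
  (\int[mu]_(w in `[a, b]) (t * (gauss (t * w) x * hit (t * (1 - w)) y))%:E
   = (prim t x y b)%:E - (prim t x y a)%:E)%E.
Proof.
move=> t0 a0 ab b1.
have ab01 z : z \in `[a, b] -> 0 < z < 1.
  by rewrite in_itv/= => /andP[az zb]; rewrite (lt_le_trans a0)// (le_lt_trans zb).
have dF z : z \in `[a, b] -> derivable (prim t x y) z 1.
  by move=> /ab01 z01; have [] := is_derive_prim x y t0 z01.
apply: continuous_FTC2 => //.
- apply: continuous_in_subspaceT => z; rewrite inE => /ab01 z01.
  exact: continuous_integrand.
- split.
  + by move=> z zab; apply: dF; exact: subset_itv_oo_cc zab.
  + apply: cvg_at_right_filter; apply: differentiable_continuous; apply/derivable1_diffP.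
    by apply: dF; rewrite in_itv/= lexx ltW.
  + apply: cvg_at_left_filter; apply: differentiable_continuous; apply/derivable1_diffP.
    by apply: dF; rewrite in_itv/= lexx ltW.
- move=> z zab; rewrite derive1E.
  by have [_ ->] := is_derive_prim x y t0 (ab01 _ (subset_itv_oo_cc zab)).
Qed.

(** At the end points [1 / (n + 3)] and [1 - 1 / (n + 3)] the variable [rho] takes the values
    [1 / q n] and [q n]. *)
Let q n : R := Num.sqrt n.+2%:R.

Let q_gt0 n : 0 < q n. Proof. by rewrite sqrtr_gt0 ltr0n. Qed.

Let cvg_q : q n @[n --> \oo] --> +oo.
Proof.
apply/cvgryPge => A; near=> n; rewrite /q.
have [A0|A0] := ltP A 0; first by rewrite (le_trans (ltW A0))// sqrtr_ge0.
rewrite -(ger0_norm A0) -sqrtr_sqr ler_sqrt ?ler0n//.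
near: n; have h := @cvgr_idn R; move: h => /cvgryPge/(_ (A ^+ 2)).
by apply: filterS => n /le_trans; apply; rewrite ler_nat -addn2 leq_addr.
Unshelve. all: by end_near. Qed.

Let rho_a n : rho (n.+3%:R^-1) = (q n)^-1.
Proof.
rewrite /rho /q -sqrtrV ?ler0n//; congr Num.sqrt.
rewrite -(natr1 n.+2).
have : 0 < n.+2%:R :> R by rewrite ltr0n.
by move: (n.+2%:R) => m m0; field; rewrite !gt_eqF//; lra.
Qed.

Let rho_b n : rho (1 - n.+3%:R^-1) = q n.
Proof.
rewrite /rho /q; congr Num.sqrt.
rewrite -(natr1 n.+2).
have : 0 < n.+2%:R :> R by rewrite ltr0n.
by move: (n.+2%:R) => m m0; field; rewrite gt_eqF//; lra.
Qed.

(** Strong Markov property at the first hit of [y] on the way to [x + y], obtained from the explicit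
    primitive, which runs from [gauss t (x - y) - gauss t (x + y)] to [gauss t (x - y)]. Times are
    written [t * w], whence the division by [t]. *)
Lemma gauss_hit_integral t x y : 0 < t -> 0 <= x -> 0 < y ->
  (\int[mu]_(w in `]0%R, 1%R[) (gauss (t * w) x * hit (t * (1 - w)) y)%:E
   = (gauss t (x + y) / t)%:E)%E.
Proof.
move=> t0 x0 y0.
pose a n : R := n.+3%:R^-1; pose F n := `[a n, 1 - a n]%classic.
pose f w : \bar R := (t * (gauss (t * w) x * hit (t * (1 - w)) y))%:E.
have a0 n : 0 < a n by rewrite invr_gt0.
have a12 n : a n < 2^-1 by rewrite ltf_pV2 ?posrE// ltr_nat.
have mf : measurable_fun setT f.
  apply/measurable_EFinP; apply: measurable_funM => //.
  apply: measurable_funM; first by apply: measurable_gauss => //; exact: measurable_funM.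
  apply: measurable_funM; last first.
    by apply: measurable_gauss => //; apply: measurable_funM => //; exact: measurable_funB.
  apply: measurable_funM => //; apply: measurable_funV; apply: measurable_funM => //; exact: measurable_funB.
have f0 w : 0 < w < 1 -> (0 <= f w)%E.
  move=> /andP[w0 w1]; rewrite lee_fin mulr_ge0 ?(ltW t0)// mulr_ge0 ?gauss_ge0//.
  by rewrite mulr_ge0 ?gauss_ge0// divr_ge0 ?(ltW y0)// mulr_ge0 ?(ltW t0)// subr_ge0 ltW.
have UF : \bigcup_n F n = `]0%R, 1%R[%classic.
  apply/seteqP; split=> w /=.
    move=> [n _]; rewrite /F/= !in_itv/= => /andP[aw wa].
    by rewrite (lt_le_trans (a0 n))//= (le_lt_trans wa)// ltrBlDl ltrDr.
  rewrite in_itv/= => /andP[w0 w1].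
  have m0 : 0 < Num.min w (1 - w) by rewrite lt_min w0 subr_gt0.
  have [n _ h] : \forall n \near \oo, a n < Num.min w (1 - w).
    have /cvgr_lt/(_ _ m0) := @cvg_harmonic R.
    apply: filterS => n; apply: le_lt_trans.
    by rewrite lef_pV2 ?posrE// ler_nat -addn2 leq_addr.
  exists n => //; rewrite /F/= in_itv/=.
  by have /= := h n (leqnn n); rewrite lt_min => /andP[? ?]; apply/andP; split; lra.
have ndF : nondecreasing_seq F.
  move=> m n mn; apply/subsetPset => w; rewrite /F/= !in_itv/= => /andP[h1 h2].
  have : a n <= a m by rewrite lef_pV2 ?posrE// ler_nat.
  by move=> h; apply/andP; split; lra.
have F01 n w : F n w -> 0 < w < 1.
  by rewrite /F/= in_itv/= => /andP[h1 h2]; rewrite (lt_le_trans (a0 n))//=; have := a0 n; lra.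
have H : (fun n => \int[mu]_(w in F n) f w)%E @ \oo --> (\int[mu]_(w in \bigcup_n F n) f w)%E.
  apply: ge0_nondecreasing_set_cvg_integral => //.
  - by move=> n; exact: measurable_itv.
  - by move=> n; exact: measurable_funTS.
  - by move=> n w /F01/f0.
rewrite UF in H.
have H2 : (fun n => \int[mu]_(w in F n) f w)%E @ \oo --> (gauss t (x + y))%:E.
  rewrite (_ : (fun n => _) = fun n => (prim t x y (1 - a n) - prim t x y (a n))%:E); last first.
    apply/funext => n; rewrite integral_cc//.
    + by have := a12 n; lra.
    + by rewrite ltrBlDl ltrDr.
  apply: cvg_EFin; first exact: nearW.
  have st : 0 < Num.sqrt t by rewrite sqrtr_gt0.
  have cvgq0 (c : R) : c / q n @[n --> \oo] --> (0 : R).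
    rewrite -(mulr0 c); apply: cvgM; first exact: cvg_cst.
    by apply: (gtr0_cvgV0 _).2 cvg_q; exact: nearW.
  have cvgqy (c d : R) : 0 < c -> (c * q n + d / q n) / Num.sqrt t @[n --> \oo] --> +oo.
    move=> c0; apply/cvgryPge => A; near=> n; rewrite ler_pdivlMr//.
    have : (A * Num.sqrt t + 1) / c <= q n by near: n; move/cvgryPge : cvg_q; exact.
    rewrite ler_pdivrMr// [q n * c]mulrC.
    suff : -1 < d / q n by lra.
    by near: n; apply: (cvgr_gt _ (cvgq0 d)); rewrite ltrN10.
  have rb : prim t x y (1 - a n) @[n --> \oo] --> gauss t (x - y).
    rewrite -[X in _ --> X]subr0 -[X in _ --> X - _]mulr1 -(mulr0 (gauss t (x + y))).
    apply: cvgB; apply: cvgM; try exact: cvg_cst.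
      apply: cvgy_ncdf; under eq_fun do rewrite /rr rho_b mulNr opprK addrC.
      exact: cvgqy.
    apply: cvgNy_ncdf; apply/cvgNry.
    rewrite (_ : - _ = fun n => (y * q n + (- x) / q n) / Num.sqrt t); first exact: cvgqy.
    apply/funext => n; transitivity (- rr t x y (1 - a n)); first by [].
    rewrite /rr rho_b; move: (q n) (Num.sqrt t) => u v.
    ring.
  have ra : prim t x y (a n) @[n --> \oo] --> gauss t (x - y) - gauss t (x + y).
    have [x0'|x0'] := ltP 0 x.
      rewrite -[X in _ --> X - _]mulr1 -[X in _ --> _ - X]mulr1.
      apply: cvgB; apply: cvgM; try exact: cvg_cst.
        apply: cvgy_ncdf; under eq_fun do rewrite /rr rho_a invrK -mulNr opprK.
        exact: cvgqy.
      apply: cvgy_ncdf; under eq_fun do rewrite /rr rho_a invrK -mulNr.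
      exact: cvgqy.
    (* For [x = 0] the arguments of [ncdf] tend to 0 instead of infinity, and the two terms
       cancel. *)
    have xE : x = 0 by apply/eqP; rewrite eq_le x0 x0'.
    rewrite xE sub0r add0r gaussN subrr.
    have c0 : {for 0, continuous (@ncdf R)}.
      by apply: differentiable_continuous; apply/derivable1_diffP; have [] := is_derive_ncdf (0 : R).
    have cz (c : R) : rr t 0 c (a n) @[n --> \oo] --> (0 : R).
      under eq_fun do rewrite /rr rho_a mul0r sub0r -mulNr.
      by rewrite -(mul0r (Num.sqrt t)^-1); apply: cvgM; [exact: cvgq0|exact: cvg_cst].
    rewrite /prim sub0r add0r gaussN -[X in _ --> X](subrr (gauss t y * ncdf 0)).
    by apply: cvgB; apply: cvgM; try exact: cvg_cst; exact: (cvgn_comp c0 (cz _)).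
  rewrite (_ : gauss t (x + y) = gauss t (x - y) - (gauss t (x - y) - gauss t (x + y))); last by ring.
  exact: cvgB rb ra.
have E : (\int[mu]_(w in `]0%R, 1%R[) f w = (gauss t (x + y))%:E)%E.
  by apply: cvg_unique H H2.
rewrite mulrC EFinM -E -ge0_integralZl//.
- apply: eq_integral => w _; rewrite /f -EFinM; congr (_%:E).
  by move: (gauss _ _ * _) => c; rewrite mulrA mulVf ?mul1r// gt_eqF.
- exact: measurable_funTS.
- by rewrite lee_fin invr_ge0 ltW.
Unshelve. all: by end_near. Qed.

Lemma hit_ge0 t x : 0 < t -> 0 <= x -> 0 <= hit t x.
Proof. by move=> t0 x0; rewrite mulr_ge0 ?gauss_ge0// divr_ge0// ltW. Qed.

Lemma measurable_hit d (T : measurableType d) (f g : T -> R) :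
  measurable_fun setT f -> measurable_fun setT g ->
  measurable_fun setT (fun u => hit (f u) (g u)).
Proof.
move=> mf mg; apply: measurable_funM; last exact: measurable_gauss.
by apply: measurable_funM => //; exact: measurable_funV.
Qed.

Lemma ge0_integral01_onem (f : R -> \bar R) : measurable_fun setT f -> (forall w, 0 <= f w)%E ->
  (\int[mu]_(w in `]0%R, 1%R[) f w = \int[mu]_(w in `]0%R, 1%R[) f (1 - w)%R)%E.
Proof.
move=> mf f0; rewrite [LHS]integral_mkcond ge0_integralN; last 2 first.
- by apply/(measurable_restrictT _ (measurable_itv _))/measurable_funTS.
- exact: erestrict_ge0.
rewrite (ge0_integralD_shift (- 1)); last 2 first.
- apply: measurableT_comp; last by [].
  by apply/(measurable_restrictT _ (measurable_itv _))/measurable_funTS.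
- by move=> w; exact: erestrict_ge0.
rewrite [RHS]integral_mkcond; apply: eq_integral => w _.
rewrite /patch; have -> : - (w - 1) = 1 - w by ring.
have -> // : (1 - w \in `]0, 1[%classic) = (w \in `]0, 1[%classic).
by apply/idP/idP; rewrite !inE/= !in_itv/= => /andP[? ?]; apply/andP; split; lra.
Qed.

(** Semigroup property of hitting times. By the partial fractions
    [1 / (w * (1 - w)) = 1 / w + 1 / (1 - w)] it is a combination of two convolutions of a Gaussian
    density with a hitting density. *)
Lemma hit_integral t x y : 0 < t -> 0 < x -> 0 < y ->
  (\int[mu]_(w in `]0%R, 1%R[) (hit (t * w) x * hit (t * (1 - w)) y)%:E
   = (hit t (x + y) / t)%:E)%E.
Proof.
move=> t0 x0 y0.
(* The maximum with 0 makes the integrand nonnegative on the whole line; it changes nothing on []0,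
   1[]. *)
pose f x y w : \bar R := (Num.max 0 (gauss (t * w) x * hit (t * (1 - w)) y))%:E.
have mf x' y' : measurable_fun setT (f x' y').
  apply/measurable_EFinP; apply: measurable_maxr => //; apply: measurable_funM.
    by apply: measurable_gauss => //; exact: measurable_funM.
  by apply: measurable_hit => //; apply: measurable_funM => //; exact: measurable_funB.
have f0 x' y' w : (0 <= f x' y' w)%E by rewrite lee_fin le_max lexx.
have fE x' y' w : 0 < y' -> w \in `]0, 1[ -> f x' y' w = (gauss (t * w) x' * hit (t * (1 - w)) y')%:E.
  move=> y0' ; rewrite in_itv/= => /andP[w0 w1]; congr (_%:E); apply/max_idPr.
  by rewrite mulr_ge0 ?gauss_ge0// hit_ge0 ?(ltW y0')// mulr_gt0// subr_gt0.
have fi x' y' : 0 < x' -> 0 < y' -> (\int[mu]_(w in `]0%R, 1%R[) f x' y' w = (gauss t (x' + y') / t)%:E)%E.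
  move=> x0' y0'; rewrite -gauss_hit_integral ?(ltW x0')//.
  by apply: eq_integral => w; rewrite inE/= => w01; rewrite fE.
transitivity (\int[mu]_(w in `]0%R, 1%R[) ((x / t)%:E * f x y w + (y / t)%:E * f y x (1 - w)%R))%E.
  apply: eq_integral => w; rewrite inE/= => w01.
  rewrite !fE//; last by move: w01; rewrite !in_itv/= => /andP[? ?]; apply/andP; split; lra.
  move: w01; rewrite in_itv/= => /andP[w0 w1].
  rewrite /hit -!EFinM -EFinD; congr (_%:E); rewrite (_ : 1 - (1 - w) = w); last by ring.
  field.
  by rewrite !gt_eqF// subr_gt0.
have xt : (0 <= (x / t)%:E)%E by rewrite lee_fin divr_ge0 ?(ltW x0) ?(ltW t0).
have yt : (0 <= (y / t)%:E)%E by rewrite lee_fin divr_ge0 ?(ltW y0) ?(ltW t0).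
have mf' x' y' : measurable_fun setT (fun w : R => f x' y' (1 - w)).
  by apply: measurableT_comp => //; exact: measurable_funB.
rewrite ge0_integralD//; last 4 first.
- by move=> w _; rewrite mule_ge0.
- exact: (emeasurable_funZl _ (mf _ _)).
- by move=> w _; rewrite mule_ge0.
- exact: (emeasurable_funZl _ (mf' _ _)).
rewrite !ge0_integralZl//; last 2 first.
- exact: (measurable_funTS (mf' _ _)).
- exact: (measurable_funTS (mf _ _)).
rewrite -(ge0_integral01_onem (mf y x))// !fi// -!EFinM -EFinD [y + x]addrC /hit.
by congr (_%:E); field; rewrite gt_eqF.
Qed.

Lemma hit_bes t x : 0 < t -> 0 < x -> hit t x = x / 2 * bes t 0 x.
Proof.
move=> t0 x0; rewrite bes_sinhc !mul0r sinhc0 mulr1 /hit gaussE.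
have -> : Num.sqrt (2 / (pi * t ^+ 3)) = (Num.sqrt (2 * pi * t))^-1 * (2 / t).
  rewrite -[2 / t]ger0_norm ?divr_ge0 ?(ltW t0)// -sqrtr_sqr -sqrtrV ?mulr_ge0 ?pi_ge0 ?(ltW t0)//.
  rewrite -sqrtrM ?invr_ge0 ?mulr_ge0 ?pi_ge0 ?(ltW t0)//; congr Num.sqrt.
  have p0 : pi != 0 :> R by rewrite gt_eqF ?pi_gt0.
  by move: (pi) p0 => p p0; field; rewrite p0 gt_eqF.
rewrite expr0n/= add0r mulNr; move: (expR _) (Num.sqrt (2 * pi * t))^-1 => e c; field.
by rewrite gt_eqF.
Qed.

End hitting.

(** * Chains of kernels *)

Section liminf_bound.
Context {R : realType}.
Local Open Scope ereal_scope.
Implicit Types (u v : nat -> \bar R) (a b r : \bar R).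

Lemma lte_dense_EFin a b : a < b -> exists r : R, a < r%:E < b.
Proof.
move: a b => [a| |] [b| |]//=; rewrite ?lte_fin.
- by move=> ab; exists ((a + b) / 2)%R; rewrite !lte_fin midf_lt//= midf_lt.
- by move=> _; exists (a + 1)%R; rewrite lte_fin ltrDl ltr01 ltry.
- by move=> _; exists (b - 1)%R; rewrite ltNyr lte_fin ltrBlDr ltrDl ltr01.
- by move=> _; exists 0%R; rewrite ltNyr ltry.
Qed.

(** A lower bound for [limn_einf], phrased with real thresholds so that it combines with filters;
    [liminf_geP] relates the two. *)
Definition liminf_ge b u := forall r : R, r%:E < b -> \forall n \near \oo, r%:E < u n.

Lemma liminf_geP b u : liminf_ge b u <-> b <= limn_einf u.
Proof.
have H : limn_einf u = ereal_sup (range (einfs u)).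
  by rewrite limn_einf_lim; apply/cvg_lim => //; exact: cvg_einfs_sup.
split=> [h|h r rb].
  rewrite leNgt; apply/negP => /lte_dense_EFin[r /andP[ur rb]].
  have [n _ nu] := h _ rb.
  suff : r%:E <= limn_einf u by rewrite leNgt ur.
  rewrite H; apply: (@le_trans _ _ (einfs u n)); last by apply: ereal_sup_ubound; exists n.
  by apply/ereal_infP => _ [k /= nk <-]; rewrite ltW// nu.
have /ereal_sup_gtP[_ [n _ <-] rn] : r%:E < ereal_sup (range (einfs u)).
  by rewrite -H (lt_le_trans rb).
exists n => // k /= nk; apply: lt_le_trans rn _.
by apply: ereal_inf_lbound; exists k.
Qed.

Lemma liminf_ge_cvg b u : u @ \oo --> b -> liminf_ge b u.
Proof. by move=> /cvg_limn_einf_sup[ub _]; apply/liminf_geP; rewrite ub. Qed.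

Lemma liminf_ge_near b u v : liminf_ge b u -> (\forall n \near \oo, u n <= v n) -> liminf_ge b v.
Proof.
move=> bu uv r /bu; move: uv; apply: filterS2 => n uv ru; exact: lt_le_trans ru uv.
Qed.

Lemma liminf_ge_le b u c : liminf_ge b u -> (\forall n \near \oo, u n <= c) -> b <= c.
Proof.
move=> bu uc; rewrite leNgt; apply/negP => /lte_dense_EFin[r /andP[cr rb]].
have [n [ru nc]] : exists n, r%:E < u n /\ u n <= c.
  have := filterI (bu _ rb) uc; move=> /(_ _)/filter_ex [n [? ?]]; by exists n.
by have := lt_le_trans ru nc; rewrite ltNge ltW.
Qed.

(** The values 0 of [a] and [+oo] of [b] are allowed; a threshold [r] is split as [(r / s) * s] with
    [s] below [b] and [r / s] below [a]. *)
Lemma liminf_geM (a : R) (x : nat -> R) b u : (0 <= a)%R -> 0 <= b ->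
  x @ \oo --> a -> (forall n, 0 <= u n) -> (forall n, (0 <= x n)%R) ->
  liminf_ge b u -> liminf_ge (a%:E * b) (fun n => (x n)%:E * u n).
Proof.
move=> a0 b0 xa u0 x0 bu r rab.
have [rlt0|r0] := ltP r 0%R.
  by apply: nearW => n; apply: (@lt_le_trans _ _ 0); rewrite ?lte_fin// mule_ge0// lee_fin.
have a0' : (0 < a)%R.
  rewrite lt_neqAle a0 andbT; apply/eqP => aE; move: rab.
  by rewrite -aE mul0e lte_fin ltNge r0.
have [s /andP[rs sb]] : exists s : R, (r / a)%:E < s%:E < b.
  apply: lte_dense_EFin; move: rab b0; case: b {bu} => [b| |]//.
  - by rewrite -EFinM !lte_fin mulrC -ltr_pdivrMr// mulrC.
  - by move=> *; rewrite ltry.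
have s0 : (0 < s)%R by move: rs; rewrite lte_fin; apply: le_lt_trans; rewrite divr_ge0// ltW.
have h1 : \forall n \near \oo, (r / s < x n)%R.
  by apply: (cvgr_gt _ xa); move: rs; rewrite lte_fin !ltr_pdivrMr// mulrC.
move: h1 (bu _ sb); apply: filterS2 => n h1 h2.
apply: (@le_lt_trans _ _ ((r / s)%:E * s%:E)); first by rewrite -EFinM divfK// gt_eqF.
apply: (@lt_le_trans _ _ ((x n)%:E * s%:E)); first by rewrite -!EFinM lte_fin ltr_pM2r.
by apply: lee_wpmul2l; [rewrite lee_fin|exact: ltW].
Qed.

(** Fatou's lemma for a pointwise lower bound: no domination of the integrands is asked for. *)
Lemma fatou_liminf_ge d (T : measurableType d) (mu : {measure set T -> \bar R}) (D : set T)
    (f : nat -> T -> \bar R) (g : T -> \bar R) :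
  measurable D -> (forall n, measurable_fun D (f n)) -> measurable_fun D g ->
  (forall n x, D x -> 0 <= f n x) -> (forall x, D x -> 0 <= g x) ->
  (forall x, D x -> liminf_ge (g x) (f ^~ x)) ->
  liminf_ge (\int[mu]_(x in D) g x) (fun n => \int[mu]_(x in D) f n x).
Proof.
move=> mD mf mg f0 g0 fg; apply/liminf_geP.
apply: le_trans (fatou mu mD mf f0).
apply: ge0_le_integral => //.
- rewrite (_ : (fun x => _) = fun x => limn (einfs (f ^~ x))); last first.
    by apply/funext => x; rewrite limn_einf_lim.
  apply: (emeasurable_fun_cvg (fun n x => einfs (f ^~ x) n)) => //.
    by move=> n; exact: measurable_fun_einfs.
  by move=> x _; exact: is_cvg_einfs.
- by move=> x Dx; apply/liminf_geP; exact: fg.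
Qed.

End liminf_bound.

(** * Iterated integrals along a list of kernels *)

Section chain.
Context {R : realType}.
Notation mu := (@lebesgue_measure R).
Implicit Types (f g : R -> \bar R) (x y z b : R).
Local Open Scope ereal_scope.

Definition chain_step : Type := ((R -> R -> R) * set R)%type.

(** Unnormalised finite-dimensional law of a Markov process. The terminal function is left abstract
    so that chains can be cut and concatenated. *)
Fixpoint chain (c : seq chain_step) f x : \bar R :=
  if c is (k, A) :: c' then \int[mu]_(z in A) ((k x z)%:E * chain c' f z) else f x.

Lemma chain_cat c1 c2 f x : chain (c1 ++ c2) f x = chain c1 (chain c2 f) x.
Proof.
elim: c1 x => [//|[k A] c1 ih] x /=.
by apply: eq_integral => z _; rewrite ih.
Qed.

Fixpoint good_chain (c : seq chain_step) : Prop :=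
  if c is (k, A) :: c' then
    [/\ measurable A, measurable_fun setT (fun u : R * R => k u.1 u.2),
        forall x z, (0 <= k x z)%R & good_chain c']
  else True.

Lemma good_chain_cat c1 c2 : good_chain c1 -> good_chain c2 -> good_chain (c1 ++ c2).
Proof. by elim: c1 => [//|[k A] c1 ih] /= [? ? ? /ih h] /h. Qed.

Lemma chain_ge0 c f x : good_chain c -> (forall z, 0 <= f z) -> 0 <= chain c f x.
Proof.
move=> + f0; elim: c x => [//|[k A] c ih] x /= [mA mk k0 gc].
by apply: integral_ge0 => z _; rewrite mule_ge0 ?lee_fin ?ih.
Qed.

Lemma eq_chain c f g x : f =1 g -> chain c f x = chain c g x.
Proof.
move=> fg; elim: c x => [//|[k A] c ih] x /=.
by apply: eq_integral => z _; rewrite ih.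
Qed.

(** The parameter is a point of a measurable space for joint measurability, and a natural number for
    limits of chains. *)
Definition pchain_step (P : Type) : Type := ((P -> R -> R -> R) * set R)%type.

Definition inst (P : Type) (p : P) (c : seq (pchain_step P)) : seq chain_step :=
  [seq (e.1 p, e.2) | e <- c].

Fixpoint good_pchain d (P : measurableType d) (c : seq (pchain_step P)) : Prop :=
  if c is (k, A) :: c' then
    [/\ measurable A, measurable_fun setT (fun u : (P * R) * R => k u.1.1 u.1.2 u.2),
        forall p x z, (0 <= k p x z)%R & good_pchain c']
  else True.

Lemma good_inst d (P : measurableType d) (p : P) c : good_pchain c -> good_chain (inst p c).
Proof.
elim: c => [//|[k A] c ih] /= [mA mk k0 gc]; split => //; last exact: ih.
have h : measurable_fun setT (fun u : R * R => ((p, u.1), u.2)).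
  by apply: measurable_fun_pair => //; exact: measurable_fun_pair.
exact: (measurableT_comp mk h).
Qed.

Lemma measurable_setI_integral d (P : measurableType d) (A : set R) (h : P * R -> \bar R) :
  measurable A -> measurable_fun setT h -> (forall u, 0 <= h u) ->
  measurable_fun setT (fun p => \int[mu]_(z in A) h (p, z)).
Proof.
move=> mA mh h0.
pose h' (u : P * R) := (\1_A u.2)%:E * h u.
have -> : (fun p => \int[mu]_(z in A) h (p, z)) = fubini_F mu h'.
  apply/funext => p; rewrite /fubini_F [LHS]integral_mkcond; apply: eq_integral => z _.
  by rewrite epatch_indic muleC.
apply: measurable_fun_fubini_tonelli_F => //.
- apply: emeasurable_funM => //; apply/measurable_EFinP.
  exact: (measurableT_comp (measurable_indic mA)).
- by move=> u; rewrite mule_ge0.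
Qed.

Lemma measurable_pchain d (P : measurableType d) (c : seq (pchain_step P)) (f : P -> R -> \bar R) :
  good_pchain c -> measurable_fun setT (fun u : P * R => f u.1 u.2) -> (forall p z, 0 <= f p z) ->
  measurable_fun setT (fun u : P * R => chain (inst u.1 c) (f u.1) u.2).
Proof.
move=> + mf f0; elim: c => [//|[k A] c ih] /= [mA mk k0 gc].
apply: (measurable_setI_integral (h := fun v : (P * R) * R =>
   (k v.1.1 v.1.2 v.2)%:E * chain (inst v.1.1 c) (f v.1.1) v.2)) => //.
- apply: emeasurable_funM; first exact/measurable_EFinP.
  have h : measurable_fun setT (fun v : (P * R) * R => (v.1.1, v.2)).
    by apply: measurable_fun_pair => //; exact: measurableT_comp.
  exact: (measurableT_comp (ih gc) h).
- by move=> u; rewrite mule_ge0 ?lee_fin// chain_ge0//; exact: good_inst.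
Qed.

Lemma measurable_chain c f : good_chain c -> measurable_fun setT f -> (forall z, 0 <= f z) ->
  measurable_fun setT (chain c f).
Proof.
move=> gc mf f0.
pose pc : seq (pchain_step unit) := [seq ((fun=> e.1), e.2) | e <- c].
have cE p : inst p pc = c.
  by rewrite /inst /pc -map_comp -[RHS]map_id; apply: eq_map => -[].
have gpc : good_pchain pc.
  rewrite /pc; elim: (c) gc => [//|[k A] c' ih] /= [mA mk k0 /ih gc']; split => //.
  have h : measurable_fun setT (fun u : (unit * R) * R => (u.1.2, u.2)).
    by apply: measurable_fun_pair => //; exact: measurableT_comp.
  exact: (measurableT_comp mk h).
have mf' : measurable_fun setT (fun u : unit * R => f u.2) by exact: (measurableT_comp mf).
have := measurable_pchain gpc mf' (fun _ => f0) => h.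
have h2 : measurable_fun setT (fun z : R => (tt, z)) by exact: measurable_fun_pair.
apply: eq_measurable_fun (measurableT_comp h h2) => z _ /=.
by rewrite cE.
Qed.

Let mkf (k : R -> R -> R) f x : measurable_fun setT (fun u : R * R => k u.1 u.2) ->
  measurable_fun setT f -> measurable_fun setT (fun z => (k x z)%:E * f z).
Proof.
move=> mk mf; apply: emeasurable_funM => //; apply/measurable_EFinP.
have h : measurable_fun setT (fun z : R => (x, z)) by exact: measurable_fun_pair.
exact: (measurableT_comp mk h).
Qed.

Let mkc (k : R -> R -> R) (A : set R) c f x : measurable_fun setT (fun u : R * R => k u.1 u.2) -> good_chain c ->
  measurable_fun setT f -> (forall z, 0 <= f z) -> measurable_fun A (fun z => (k x z)%:E * chain c f z).
Proof. by move=> mk gc mf f0; apply: measurable_funTS; apply: mkf => //; exact: measurable_chain. Qed.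

Lemma chainD c f g x : good_chain c -> measurable_fun setT f -> measurable_fun setT g ->
  (forall z, 0 <= f z) -> (forall z, 0 <= g z) ->
  chain c (fun z => f z + g z) x = chain c f x + chain c g x.
Proof.
move=> + mf mg f0 g0; elim: c x => [//|[k A] c ih] x /= [mA mk k0 gc].
rewrite -ge0_integralD//.
- by apply: eq_integral => z _; rewrite ih// ge0_muleDr ?chain_ge0.
- by move=> z _; rewrite mule_ge0 ?lee_fin ?chain_ge0.
- exact: mkc.
- by move=> z _; rewrite mule_ge0 ?lee_fin ?chain_ge0.
- exact: mkc.
Qed.

Lemma chainZ c (a : \bar R) f x : 0 <= a -> good_chain c -> measurable_fun setT f ->
  (forall z, 0 <= f z) -> chain c (fun z => a * f z) x = a * chain c f x.
Proof.
move=> a0 + mf f0; elim: c x => [//|[k A] c ih] x /= [mA mk k0 gc].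
rewrite -ge0_integralZl//.
- by apply: eq_integral => z _; rewrite ih// muleCA.
- exact: mkc.
- by move=> z _; rewrite mule_ge0 ?lee_fin ?chain_ge0.
Qed.

Lemma chain_kernelD (k1 k2 : R -> R -> R) A c f x : measurable A ->
  measurable_fun setT (fun u : R * R => k1 u.1 u.2) -> measurable_fun setT (fun u : R * R => k2 u.1 u.2) ->
  (forall x z, (0 <= k1 x z)%R) -> (forall x z, (0 <= k2 x z)%R) ->
  good_chain c -> measurable_fun setT f -> (forall z, 0 <= f z) ->
  chain (((fun x z => k1 x z + k2 x z)%R, A) :: c) f x = chain ((k1, A) :: c) f x + chain ((k2, A) :: c) f x.
Proof.
move=> mA mk1 mk2 k10 k20 gc mf f0 /=; rewrite -ge0_integralD//.
- by apply: eq_integral => z _; rewrite EFinD ge0_muleDl ?lee_fin.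
- by move=> z _; rewrite mule_ge0 ?lee_fin ?chain_ge0.
- exact: mkc.
- by move=> z _; rewrite mule_ge0 ?lee_fin ?chain_ge0.
- exact: mkc.
Qed.

Lemma ge0_integral_exchange (A D : set R) (h : R * R -> \bar R) : measurable A -> measurable D ->
  measurable_fun setT h -> (forall u, 0 <= h u) ->
  \int[mu]_(x in A) \int[mu]_(y in D) h (x, y) = \int[mu]_(y in D) \int[mu]_(x in A) h (x, y).
Proof.
move=> mA mD mh h0.
pose h' (u : R * R) := (\1_A u.1)%:E * ((\1_D u.2)%:E * h u).
have mh' : measurable_fun setT h'.
  apply: emeasurable_funM; first by apply/measurable_EFinP; exact: (measurableT_comp (measurable_indic mA)).
  apply: emeasurable_funM => //; apply/measurable_EFinP; exact: (measurableT_comp (measurable_indic mD)).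
have h'0 u : 0 <= h' u by rewrite !mule_ge0.
have mhx x : measurable_fun setT (fun y => h (x, y)).
  by apply: (measurableT_comp mh); exact: measurable_fun_pair.
have mhy y : measurable_fun setT (fun x => h (x, y)).
  by apply: (measurableT_comp mh); exact: measurable_fun_pair.
transitivity (\int[mu]_x \int[mu]_y h' (x, y)).
  rewrite [LHS]integral_mkcond; apply: eq_integral => x _.
  rewrite epatch_indic muleC /h'/= ge0_integralZl//.
  - congr (_ * _); rewrite [LHS]integral_mkcond; apply: eq_integral => y _.
    by rewrite epatch_indic muleC.
  - apply: emeasurable_funM; [by apply/measurable_EFinP; exact: measurable_indic|exact: mhx].
  - by move=> y _; rewrite mule_ge0.
transitivity (\int[mu]_y \int[mu]_x h' (x, y)); first exact: (@fubini_tonelli _ _ _ _ R mu mu h' mh' h'0).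
rewrite [RHS]integral_mkcond; apply: eq_integral => y _.
rewrite epatch_indic muleC /h'/=.
under eq_integral do rewrite muleCA.
rewrite ge0_integralZl//.
- congr (_ * _); rewrite [RHS]integral_mkcond; apply: eq_integral => x _.
  by rewrite epatch_indic muleC.
- apply: emeasurable_funM; [by apply/measurable_EFinP; exact: measurable_indic|exact: mhy].
- by move=> x _; rewrite mule_ge0.
Qed.

(** Tonelli at every step of the chain; it extracts the integrals over the random times of the
    minimum and of the last hit. *)
Lemma chain_integral c (D : set R) (F : R -> R -> \bar R) x : measurable D -> good_chain c ->
  measurable_fun setT (fun u : R * R => F u.1 u.2) -> (forall w z, 0 <= F w z) ->
  chain c (fun z => \int[mu]_(w in D) F w z) x = \int[mu]_(w in D) chain c (F w) x.
Proof.
move=> mD + mF F0; elim: c x => [//|[k A] c ih] x /= [mA mk k0 gc].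
have mcF : measurable_fun setT (fun u : R * R => chain c (F u.1) u.2).
  pose pc : seq (pchain_step R) := [seq ((fun=> e.1), e.2) | e <- c].
  have cE p : inst p pc = c.
    by rewrite /inst /pc -map_comp -[RHS]map_id; apply: eq_map => -[].
  have gpc : good_pchain pc.
    rewrite /pc; elim: (c) gc => [//|[k' A'] c' ih'] /= [mA' mk' k0' /ih' gc']; split => //.
    have h : measurable_fun setT (fun u : (R * R) * R => (u.1.2, u.2)).
      by apply: measurable_fun_pair => //; exact: measurableT_comp.
    exact: (measurableT_comp mk' h).
  apply: eq_measurable_fun (measurable_pchain gpc mF F0) => u _ /=.
  by rewrite cE.
have mkx : measurable_fun setT (fun u : R * R => (k x u.1)%:E * chain c (F u.2) u.1).
  apply: emeasurable_funM.
    apply/measurable_EFinP.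
    have h : measurable_fun setT (fun u : R * R => (x, u.1)) by exact: measurable_fun_pair.
    exact: (measurableT_comp mk h).
  have h : measurable_fun setT (fun u : R * R => (u.2, u.1)) by exact: measurable_fun_pair.
  exact: (measurableT_comp mcF h).
rewrite -(ge0_integral_exchange mA mD mkx); last first.
  by move=> u; rewrite mule_ge0 ?lee_fin ?chain_ge0.
apply: eq_integral => z _ /=; rewrite ih// -ge0_integralZl//.
- apply: measurable_funTS.
  have h : measurable_fun setT (fun w : R => (w, z)) by exact: measurable_fun_pair.
  exact: (measurableT_comp mcF h).
- by move=> w _; rewrite chain_ge0.
- by rewrite lee_fin.
Qed.

Fixpoint kernels_cvg (c : seq (pchain_step nat)) (c' : seq chain_step) : Prop :=
  match c, c' with
  | (k, A) :: c, (k', A') :: c' =>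
      [/\ A = A', forall x z, k n x z @[n --> \oo] --> k' x z & kernels_cvg c c']
  | [::], [::] => True
  | _, _ => False
  end.

(** Fatou's lemma at every step: pointwise convergence of the kernels is enough for a lower bound on
    the whole chain. *)
Lemma chain_liminf c c' (f : nat -> R -> \bar R) f' x :
  (forall n, good_chain (inst n c)) -> good_chain c' -> kernels_cvg c c' ->
  (forall n, measurable_fun setT (f n)) -> (forall n z, 0 <= f n z) ->
  measurable_fun setT f' -> (forall z, 0 <= f' z) ->
  (forall z, liminf_ge (f' z) (f ^~ z)) ->
  liminf_ge (chain c' f' x) (fun n => chain (inst n c) (f n) x).
Proof.
move=> + + + mf f0 mf' f'0 ff'.
elim: c c' x => [|[k A] c ih] [|[k' A'] c']//= x gc [mA' mk' k'0 gc'] [AA' kk' cc'].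
rewrite AA'; apply: fatou_liminf_ge => //.
- by move=> n; have [? ? ? ?] := gc n; exact: mkc.
- exact: mkc.
- by move=> n z _; have [? ? ? ?] := gc n; rewrite mule_ge0 ?lee_fin ?chain_ge0.
- by move=> z _; rewrite mule_ge0 ?lee_fin ?chain_ge0.
- move=> z _; apply: liminf_geM => //.
  + exact: chain_ge0.
  + by move=> n; have [? ? ? ?] := gc n; rewrite chain_ge0.
  + by move=> n; have [] := gc n.
  + by apply: ih => // n; have [] := gc n.
Qed.

End chain.

(** * Bessel bridge masses *)

Section bessel_chain.
Context {R : realType}.
Notation mu := (@lebesgue_measure R).
Implicit Types (f g : R -> \bar R) (s t l x y z b : R) (c : seq (R * set R)).

Lemma sinhc_even (w : R) : sinhc (- w) = sinhc w.
Proof.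
rewrite /sinhc oppr_eq0; case: eqVneq => // w0.
by rewrite opprK mulrN invrN mulrN -mulNr opprB.
Qed.

Lemma sinhc_ge0 (w : R) : 0 <= sinhc w.
Proof.
have [w0|w0] := leP 0 w; first exact: ltW (sinhc_gt0 w0).
by rewrite -sinhc_even ltW// sinhc_gt0// oppr_ge0 ltW.
Qed.

Lemma bes_nneg t x y : 0 <= bes t x y.
Proof. by rewrite bes_sinhc !mulr_ge0 ?sqrtr_ge0 ?expR_ge0 ?sinhc_ge0. Qed.

Fixpoint bstep s c : seq (@chain_step R) :=
  if c is (t, A) :: c' then
    ((fun x z => bes (t - s) x z * bessel3_ref z), A) :: bstep t c' else [::].

Definition end_time s c : R := last s (unzip1 c).

(** [bridge_mass] as a chain, with the kernel free of case distinctions; [bridge_massE] identifies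
    the two for increasing times. *)
Definition bmass l y s x c : \bar R :=
  chain (bstep s c) (fun z => (bes (l - end_time s c) z y)%:E) x.

Fixpoint msets c : Prop := if c is e :: c' then measurable e.2 /\ msets c' else True.

Lemma msets_cat c1 c2 : msets (c1 ++ c2) <-> msets c1 /\ msets c2.
Proof. by elim: c1 => [|e c1 ih] /=; [tauto|rewrite ih; tauto]. Qed.

Lemma measurable_bes_ref t : measurable_fun setT (fun u : R * R => bes t u.1 u.2 * bessel3_ref u.2).
Proof.
apply: measurable_funM; first exact: measurable_bes.
exact: (measurableT_comp measurable_bessel3_ref).
Qed.

Lemma good_bstep s c : msets c -> good_chain (bstep s c).
Proof.
elim: c s => [//|[t A] c ih] s /= [mA /ih gc]; split => //.
- exact: measurable_bes_ref.
- by move=> x z; rewrite mulr_ge0 ?bes_nneg ?bessel3_ref_ge0.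
Qed.

Lemma bstep_cat s c1 c2 : bstep s (c1 ++ c2) = bstep s c1 ++ bstep (end_time s c1) c2.
Proof. by elim: c1 s => [//|[t A] c1 ih] s /=; rewrite ih. Qed.

Lemma end_time_cat s c1 c2 : end_time s (c1 ++ c2) = end_time (end_time s c1) c2.
Proof. by rewrite /end_time /unzip1 map_cat last_cat. Qed.

Let mterm t y : measurable_fun setT (fun z : R => (bes t z y)%:E).
Proof. by apply/measurable_EFinP; exact: measurable_bes. Qed.

Let term_ge0 t y z : (0 <= (bes t z y)%:E)%E.
Proof. by rewrite lee_fin bes_nneg. Qed.

Lemma bmass_ge0 l y s x c : msets c -> (0 <= bmass l y s x c)%E.
Proof. by move=> mc; apply: chain_ge0 => //; exact: good_bstep. Qed.

Lemma bmass_cat l y s x c1 c2 :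
  bmass l y s x (c1 ++ c2) = chain (bstep s c1) (fun z => bmass l y (end_time s c1) z c2) x.
Proof. by rewrite /bmass bstep_cat chain_cat end_time_cat. Qed.

Lemma bridge_massE l y s x c : path <%R s (unzip1 c) -> end_time s c < l ->
  bridge_mass bessel3_density bessel3_ref l y s x c = bmass l y s x c.
Proof.
elim: c s x => [|[t A] c ih] s x /=.
  by move=> _ sl; rewrite /bmass/= /end_time/= besE// subr_gt0.
move=> /andP[st pc] el; apply: eq_integral => z _.
by rewrite ih// besE// subr_gt0.
Qed.

Lemma path_end_time s c : path <%R s (unzip1 c) -> s <= end_time s c.
Proof.
elim: c s => [//|[t A] c ih] s /= /andP[st /ih]; rewrite /end_time /=.
by apply: le_trans; exact: ltW.
Qed.

(** A free position at the first time [t] is integrated out by Chapman-Kolmogorov with the following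
    kernel, which is why [c] is non-empty. *)
Lemma chain_ref_conv s t x c f : s < t -> 0 <= x -> msets c ->
  path <%R t (unzip1 c) -> measurable_fun setT f -> (forall z, 0 <= f z)%E ->
  c <> [::] ->
  (\int[mu]_z ((bes (t - s) x z * bessel3_ref z)%:E * chain (bstep t c) f z)
   = chain (bstep s c) f x)%E.
Proof.
move=> st x0 + + mf f0; case: c => [//|[u A] c] /= [mA mc] /andP[tu pc] _.
have mg : measurable_fun setT (chain (bstep u c) f).
  by apply: measurable_chain => //; exact: good_bstep.
have g0 z : (0 <= chain (bstep u c) f z)%E by apply: chain_ge0 => //; exact: good_bstep.
set g := chain _ _ in mg g0 *.
pose h (v : R * R) : \bar R := ((bes (t - s) x v.1 * bessel3_ref v.1 * bes (u - t) v.1 v.2 * bessel3_ref v.2)%:E * g v.2)%E.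
have mh : measurable_fun setT h.
  apply: emeasurable_funM; last exact: (measurableT_comp mg).
  apply/measurable_EFinP; apply: measurable_funM; last exact: (measurableT_comp measurable_bessel3_ref).
  apply: measurable_funM; last exact: measurable_bes.
  apply: measurable_funM; first exact: measurable_bes.
  exact: (measurableT_comp measurable_bessel3_ref).
have h0 v : (0 <= h v)%E.
  by rewrite mule_ge0// lee_fin !mulr_ge0 ?bes_nneg ?bessel3_ref_ge0.
have r0 z : 0 <= bes (t - s) x z * bessel3_ref z by rewrite mulr_ge0 ?bes_nneg ?bessel3_ref_ge0.
transitivity (\int[mu]_z \int[mu]_(w in A) h (z, w))%E.
  apply: eq_integral => z _; rewrite -ge0_integralZl//.
  - by apply: eq_integral => w _; rewrite muleA -EFinM /h /= -!mulrA.
  - apply: emeasurable_funM; last exact: measurable_funTS.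
    apply/measurable_EFinP; apply: measurable_funTS; apply: measurable_funM; first exact: measurable_bes.
    exact: measurable_bessel3_ref.
  - by move=> w _; rewrite mule_ge0// lee_fin mulr_ge0 ?bes_nneg ?bessel3_ref_ge0.
  - by rewrite lee_fin.
rewrite (ge0_integral_exchange measurableT mA mh h0); apply: eq_integral => w _.
have [w0|w0] := leP w 0.
  rewrite /h/= /bessel3_ref [0 < w]ltNge w0/= mulr0 mul0e.
  by apply: integral0_eq => z _; rewrite mulr0 mul0e.
rewrite (_ : u - s = (t - s) + (u - t)); last by ring.
rewrite EFinM -bes_conv ?subr_gt0 ?(ltW w0)// -muleA muleC -ge0_integralZl//.
- by apply: eq_integral => z _; rewrite /h/= [RHS]muleC muleA -EFinM.
- apply/measurable_EFinP; apply: measurable_funM; last exact: measurable_bes.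
  by apply: measurable_funM; [exact: measurable_bes|exact: measurable_bessel3_ref].
- by move=> z _; rewrite lee_fin mulr_ge0 ?bes_nneg.
- by rewrite mule_ge0// lee_fin bessel3_ref_ge0.
Qed.

Lemma bmass_insert0 l y s x t c : path <%R s (t :: unzip1 c) -> end_time t c < l ->
  msets c -> 0 <= x -> 0 <= y -> bmass l y s x ((t, setT) :: c) = bmass l y s x c.
Proof.
move=> /= /andP[st pc] el mc x0 y0.
case: c pc el mc => [_|e c pc] el mc.
  rewrite /bmass /= /end_time/= in el *.
  rewrite (_ : l - s = (t - s) + (l - t)); last by ring.
  have st0 : 0 < t - s by rewrite subr_gt0.
  have tl0 : 0 < l - t by rewrite subr_gt0.
  by rewrite -(bes_conv st0 tl0 x0 y0); apply: eq_integral => z _; rewrite -EFinM.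
by rewrite /bmass /= -(@chain_ref_conv s t x (e :: c)).
Qed.

(** Consistency of the finite-dimensional laws: a time without constraint may be inserted
    anywhere. *)
Lemma bmass_insert l y s x t c1 c2 : path <%R s (unzip1 (c1 ++ (t, setT) :: c2)) ->
  end_time s (c1 ++ (t, setT) :: c2) < l -> msets (c1 ++ c2) -> 0 <= x -> 0 <= y ->
  bmass l y s x (c1 ++ (t, setT) :: c2) = bmass l y s x (c1 ++ c2).
Proof.
move=> + + + + y0; elim: c1 s x => [|[u A] c1 ih] s x /= p el mc x0.
  exact: bmass_insert0.
move/andP : p => [su p]; move: mc => [mA mc].
rewrite /bmass /=; apply: eq_integral => z _.
(* The induction hypothesis needs a nonnegative start; elsewhere the reference density vanishes. *)
have [z0|z0] := leP 0 z; last first.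
  by rewrite /bessel3_ref [0 < z]ltNge (ltW z0)/= mulr0 !mul0e.
by congr (_ * _)%E; exact: (ih u z).
Qed.

Definition shift_time b c := [seq (e.1 + b, e.2) | e <- c].

Lemma end_time_shift b s c : end_time (s + b) (shift_time b c) = end_time s c + b.
Proof. by elim: c s => [//|e c ih] s; exact: (ih e.1). Qed.

Lemma bmass_shift_time b l y s x c :
  bmass (l + b) y (s + b) x (shift_time b c) = bmass l y s x c.
Proof.
rewrite /bmass end_time_shift (_ : l + b - (_ + b) = l - end_time s c); last by ring.
move: (fun z => _) => f; elim: c s x => [//|[t A] c ih] s x /=.
apply: eq_integral => z _; rewrite ih.
by rewrite (_ : t + b - (s + b) = t - s); last by ring.
Qed.

Lemma measurable_bmass_all d (P : measurableType d) (l y s x : P -> R) c : msets c ->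
  measurable_fun setT l -> measurable_fun setT y -> measurable_fun setT s -> measurable_fun setT x ->
  measurable_fun setT (fun p => bmass (l p) (y p) (s p) (x p) c).
Proof.
move=> mc ml my ms mx; case: c mc => [_|[t A] c [mA mc]].
  rewrite /bmass/=; apply/measurable_EFinP; apply: measurable_bes => //.
  exact: measurable_funB.
(* Only the first kernel and the terminal function depend on the parameter. *)
pose pc : seq (@pchain_step R P) := ((fun p x z => bes (t - s p) x z * bessel3_ref z), A) ::
  [seq ((fun=> e.1), e.2) | e <- bstep t c].
have cE p : inst p pc = bstep (s p) ((t, A) :: c).
  rewrite /inst /pc /= -map_comp; congr cons.
  by rewrite -[RHS]map_id; apply: eq_map => -[].
have gpc : good_pchain pc.
  split => //.
  - apply: measurable_funM; last exact: (measurableT_comp measurable_bessel3_ref).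
    apply: measurable_bes => //; last exact: measurableT_comp.
    by apply: measurable_funB => //; apply: (measurableT_comp ms); exact: measurableT_comp.
  - by move=> p x' z; rewrite mulr_ge0 ?bes_nneg ?bessel3_ref_ge0.
  - have := good_bstep t mc; elim: (bstep t c) => [//|[k' A'] c' ih'] /= [mA' mk' k0' /ih' gc']; split => //.
    have h : measurable_fun setT (fun u : (P * R) * R => (u.1.2, u.2)).
      by apply: measurable_fun_pair => //; exact: measurableT_comp.
    exact: (measurableT_comp mk' h).
pose f (p : P) (z : R) : \bar R := (bes (l p - end_time t c) z (y p))%:E.
have mf : measurable_fun setT (fun u : P * R => f u.1 u.2).
  apply/measurable_EFinP; apply: measurable_bes => //; last exact: (measurableT_comp my).
  by apply: measurable_funB => //; exact: measurableT_comp.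
have h := measurable_pchain gpc mf (fun p z => term_ge0 _ _ _).
have h2 : measurable_fun setT (fun p : P => (p, x p)) by exact: measurable_fun_pair.
apply: eq_measurable_fun (measurableT_comp h h2) => p _.
by rewrite /= -[in RHS]/(bstep (s p) ((t, A) :: c)) /bmass -cE.
Qed.

Lemma measurable_bmass d (P : measurableType d) (l s : P -> R) y x c : msets c ->
  measurable_fun setT l -> measurable_fun setT s ->
  measurable_fun setT (fun p => bmass (l p) y (s p) x c).
Proof. by move=> *; exact: measurable_bmass_all. Qed.

(** Lower semicontinuity in the two end times, the form needed when the mesh tends to 0. *)
Lemma bmass_liminf (l s : nat -> R) l' s' y x c : msets c ->
  path <%R s' (unzip1 c) -> end_time s' c < l' ->
  l n @[n --> \oo] --> l' -> s n @[n --> \oo] --> s' ->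
  liminf_ge (bmass l' y s' x c) (fun n => bmass (l n) y (s n) x c).
Proof.
move=> mc pc el ll ss.
have subc (u v : nat -> R) u' v' : u n @[n --> \oo] --> u' -> v n @[n --> \oo] --> v' -> u n - v n @[n --> \oo] --> u' - v'.
  by move=> *; exact: cvgB.
case: c mc pc el => [_ _|[t A] c [mA mc] /= /andP[s't pc]] el.
  rewrite /bmass/= /end_time/= in el *; apply: liminf_ge_cvg; apply: cvg_EFin; first exact: nearW.
  by apply: cvg_bes_time; [rewrite subr_gt0|exact: subc].
pose pcn : seq (@pchain_step R nat) := ((fun n x z => bes (t - s n) x z * bessel3_ref z), A) ::
  [seq ((fun=> e.1), e.2) | e <- bstep t c].
have cE n : inst n pcn = bstep (s n) ((t, A) :: c).
  rewrite /inst /pcn /= -map_comp; congr cons.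
  by rewrite -[RHS]map_id; apply: eq_map => -[].
rewrite (_ : (fun n => _) = fun n => chain (inst n pcn) (fun z => (bes (l n - end_time t c) z y)%:E) x); last first.
  by apply/funext => n; rewrite cE.
apply: chain_liminf => //.
- by move=> n; rewrite cE; exact: good_bstep.
- exact: good_bstep.
- split => //.
    move=> x' z; apply: cvgM; last exact: cvg_cst.
    by apply: cvg_bes_time; [rewrite subr_gt0|apply: subc => //; exact: cvg_cst].
  elim: (bstep t c) => [//|[k B] cc ih] /=; split => // x' z; exact: cvg_cst.
- move=> z; apply: liminf_ge_cvg; apply: cvg_EFin; first exact: nearW.
  by apply: cvg_bes_time; [rewrite subr_gt0|apply: subc => //; exact: cvg_cst].
Qed.

End bessel_chain.

(** * Brownian motion above floors *)

Section floors.
Context {R : realType}.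
Notation mu := (@lebesgue_measure R).
Implicit Types (f g : R -> \bar R) (s t x y z b e : R).
(* [(t, b, A)]: stay above the floor [b] up to time [t], where the position is in [A]. *)
Implicit Types (c : seq (R * R * set R)) (k : R -> R -> R -> R -> R).

Fixpoint fstep k s c : seq (@chain_step R) :=
  if c is (t, b, A) :: c' then (k b (t - s), A) :: fstep k t c' else [::].

Definition ftimes c : seq R := [seq u.1.1 | u <- c].

Definition fend s c : R := last s (ftimes c).

Definition fmass k b y s x c : \bar R :=
  chain (fstep k s c) (fun z => (k b (1 - fend s c) z y)%:E) x.

Fixpoint fsets c : Prop := if c is u :: c' then measurable u.2 /\ fsets c' else True.

Definition good_kernel k := forall b t,
  measurable_fun setT (fun u : R * R => k b t u.1 u.2) /\ forall x y, 0 <= k b t x y.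

Lemma good_fstep k s c : good_kernel k -> fsets c -> good_chain (fstep k s c).
Proof.
move=> gk; elim: c s => [//|[[t b] A] c ih] s /= [mA /ih gc].
by have [mk k0] := gk b (t - s); split.
Qed.

Lemma measurable_kterm k b t y : good_kernel k -> measurable_fun setT (fun z => (k b t z y)%:E).
Proof.
move=> /(_ b t)[mk _]; apply/measurable_EFinP.
have h : measurable_fun setT (fun z : R => (z, y)) by exact: measurable_fun_pair.
exact: (measurableT_comp mk h).
Qed.

Lemma kterm_ge0 k b t y z : good_kernel k -> (0 <= (k b t z y)%:E)%E.
Proof. by move=> /(_ b t)[_ k0]; rewrite lee_fin. Qed.

Lemma gauss_le0 t x : t <= 0 -> gauss t x = 0.
Proof.
move=> t0; rewrite gaussE (_ : Num.sqrt _ = 0) ?invr0 ?mul0r//.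
by apply/eqP; rewrite sqrtr_eq0 mulr_ge0_le0// mulr_ge0 ?pi_ge0.
Qed.

Lemma killed_nneg b t x y : 0 <= killed b t x y.
Proof.
have [t0|t0] := ltP 0 t; first exact: killed_ge0.
by rewrite /killed !gauss_le0// subrr; case: ifP.
Qed.

(** The floor is only checked at the two ends of the step, which is what the finite-dimensional laws
    of the bridge express directly. *)
Definition grid_kernel b t x y : R := if (b < x) && (b < y) then gauss t (y - x) else 0.

Lemma good_killed : good_kernel (@killed R).
Proof. by move=> b t; split; [exact: measurable_killed|exact: killed_nneg]. Qed.

Lemma good_grid : good_kernel grid_kernel.
Proof.
move=> b t; split.
  apply: measurable_fun_ifT => //.
    by apply: measurable_and; apply: measurable_fun_ltr.
  by apply: measurable_gauss => //; exact: measurable_funB.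
by move=> x y; rewrite /grid_kernel; case: ifP => // _; exact: gauss_ge0.
Qed.

Lemma killed_le_grid b t x y : killed b t x y <= grid_kernel b t x y.
Proof. by rewrite /killed /grid_kernel; case: ifP => // _; rewrite gerBl gauss_ge0. Qed.

(** A Brownian bridge of length [t] from [x] to [y] reaches [b - e] with probability
    [exp (- 2 (x - b + e) (y - b + e) / t)]; both distances are at least [e] and [t] is at most
    [D]. *)
Lemma grid_le_killed b e D t x y : 0 < e -> 0 < t -> t <= D ->
  (1 - expR (- (2 * e ^+ 2 / D))) * grid_kernel b t x y <= killed (b - e) t x y.
Proof.
move=> e0 t0 tD; rewrite /grid_kernel; case: ifPn => [/andP[bx b_y]|_]; last by rewrite mulr0 killed_nneg.
have bex : b - e < x by rewrite (le_lt_trans _ bx)// gerBl ltW.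
have bey : b - e < y by rewrite (le_lt_trans _ b_y)// gerBl ltW.
rewrite /killed bex bey/= mulrBl mul1r lerD2l lerN2.
have -> : gauss t (y + x - 2 * (b - e)) = gauss t (y - x) * expR (- (2 * (x - b + e) * (y - b + e) / t)).
  by rewrite !gaussE -[RHS]mulrA -expRD; congr (_ * expR _); field; rewrite gt_eqF.
rewrite mulrC ler_wpM2r ?gauss_ge0// ler_expR lerN2.
have D0 : 0 < D by rewrite (lt_le_trans t0).
rewrite ler_pdivlMr// mulrAC ler_pdivrMr//.
have h : e ^+ 2 <= (x - b + e) * (y - b + e) by rewrite expr2 ler_pM ?(ltW e0)//; lra.
have : e ^+ 2 * t <= (x - b + e) * (y - b + e) * D.
  by rewrite ler_pM ?sqr_ge0 ?(ltW t0).
lra.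
Qed.

(** A free midpoint is put into every step, including the last one, which ends at time 1 and has
    floor [b]. *)
Fixpoint refine s b c : seq (R * R * set R) :=
  if c is (t, b1, A) :: c' then ((s + t) / 2, b1, setT) :: (t, b1, A) :: refine t b c'
  else [:: ((s + 1) / 2, b, setT)].

Fixpoint refn n s b c := if n is n'.+1 then refn n' s b (refine s b c) else c.

Definition ftimes_ok s c := path <%R s (ftimes c) && (fend s c < 1).

Lemma ftimes_ok_cons s t b A c : ftimes_ok s ((t, b, A) :: c) = (s < t) && ftimes_ok t c.
Proof. by rewrite /ftimes_ok /= -andbA. Qed.

Lemma ftimes_ok_nil s : ftimes_ok s [::] = (s < 1). Proof. by []. Qed.

Lemma ftimes_ok_lt1 s c : ftimes_ok s c -> s < 1.
Proof.
elim: c s => [//|[[t b] A] c ih] s; rewrite ftimes_ok_cons => /andP[st /ih]; exact: lt_trans.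
Qed.

Lemma ftimes_ok_refine s b c : ftimes_ok s c -> ftimes_ok s (refine s b c).
Proof.
elim: c s => [|[[t b1] A] c ih] s.
  by rewrite /= !ftimes_ok_cons !ftimes_ok_nil => s1; apply/andP; split; lra.
by rewrite /= !ftimes_ok_cons => /andP[st /ih ->]; rewrite andbT; apply/andP; split; lra.
Qed.

Lemma fsets_refine s b c : fsets c -> fsets (refine s b c).
Proof.
elim: c s => [|[[t b1] A] c ih] s /=; first by split.
by move=> [mA mc]; split => //; split => //; exact: ih.
Qed.

Lemma fend_refine s b c : fend s (refine s b c) = (fend s c + 1) / 2.
Proof. by elim: c s => [|[[t b1] A] c ih] s //; exact: (ih t). Qed.

Lemma killed_conv_chain b s t x (A : set R) g : 0 < s -> 0 < t -> measurable A ->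
  measurable_fun setT g -> (forall z, 0 <= g z)%E ->
  (\int[mu]_z ((killed b s x z)%:E * \int[mu]_(w in A) ((killed b t z w)%:E * g w))
   = \int[mu]_(w in A) ((killed b (s + t) x w)%:E * g w))%E.
Proof.
move=> s0 t0 mA mg g0.
pose h (v : R * R) : \bar R := ((killed b s x v.1 * killed b t v.1 v.2)%:E * g v.2)%E.
have mh : measurable_fun setT h.
  apply: emeasurable_funM; last exact: (measurableT_comp mg).
  by apply/measurable_EFinP; apply: measurable_funM; exact: measurable_killed.
have h0 v : (0 <= h v)%E by rewrite mule_ge0// lee_fin mulr_ge0 ?killed_nneg.
transitivity (\int[mu]_z \int[mu]_(w in A) h (z, w))%E.
  apply: eq_integral => z _; rewrite -ge0_integralZl//.
  - by apply: eq_integral => w _; rewrite muleA -EFinM.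
  - apply: emeasurable_funM; last exact: measurable_funTS.
    by apply/measurable_EFinP; apply: measurable_funTS; exact: measurable_killed.
  - by move=> w _; rewrite mule_ge0// lee_fin killed_nneg.
  - by rewrite lee_fin killed_nneg.
rewrite (ge0_integral_exchange measurableT mA mh h0); apply: eq_integral => w _.
rewrite -killed_conv// muleC -ge0_integralZl//.
- rewrite [RHS]integral_mkcond; apply: eq_integral => z _.
  rewrite /patch mem_setE in_itv/= andbT; case: ifPn => bz; first by rewrite /h muleC.
  by rewrite /h/= /killed (negbTE bz) andbF mul0r mul0e.
- by apply/measurable_EFinP; apply: measurable_funTS; apply: measurable_funM; exact: measurable_killed.
- by move=> z _; rewrite lee_fin mulr_ge0 ?killed_nneg.
Qed.

(** Chapman-Kolmogorov for the killed kernel: free midpoints leave the mass unchanged. The grid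
    masses are compared with this constant value. *)
Lemma killed_mass_refine b y s x c : ftimes_ok s c -> fsets c ->
  fmass (@killed R) b y s x (refine s b c) = fmass (@killed R) b y s x c.
Proof.
rewrite /fmass fend_refine; elim: c s x => [|[[t b1] A] c ih] s x.
  rewrite ftimes_ok_nil /= => s1 _.
  have h0 : 0 < (1 - s) / 2 by rewrite divr_gt0// subr_gt0.
  rewrite /fend/= (_ : (s + 1) / 2 - s = (1 - s) / 2); last by field.
  rewrite (_ : 1 - (s + 1) / 2 = (1 - s) / 2); last by field.
  rewrite [in RHS](_ : 1 - s = (1 - s) / 2 + (1 - s) / 2); last by field.
  rewrite -killed_conv// [RHS]integral_mkcond; apply: eq_integral => z _.
  rewrite /patch mem_setE in_itv/= andbT; case: ifPn => bz; first by [].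
  by rewrite /killed (negbTE bz) andbF mul0e.
rewrite ftimes_ok_cons /= => /andP[st oc] [mA mc].
have h0 : 0 < (t - s) / 2 by rewrite divr_gt0// subr_gt0.
rewrite (_ : (s + t) / 2 - s = (t - s) / 2); last by field.
rewrite (_ : t - (s + t) / 2 = (t - s) / 2); last by field.
rewrite killed_conv_chain//; last 2 first.
- apply: measurable_chain; first exact: (good_fstep _ good_killed (fsets_refine _ _ mc)).
    exact: measurable_kterm good_killed.
  by move=> z; exact: kterm_ge0 good_killed.
- move=> z; apply: chain_ge0; first exact: (good_fstep _ good_killed (fsets_refine _ _ mc)).
  by move=> z'; exact: kterm_ge0 good_killed.
rewrite (_ : (t - s) / 2 + (t - s) / 2 = t - s); last by field.
by apply: eq_integral => z _; congr (_ * _)%E; exact: ih.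
Qed.

Definition fshift e c : seq (R * R * set R) := [seq (u.1.1, u.1.2 + e, u.2) | u <- c].

Lemma ftimes_fshift e c : ftimes (fshift e c) = ftimes c.
Proof. by rewrite /ftimes -map_comp. Qed.

Lemma ftimes_ok_fshift e s c : ftimes_ok s (fshift e c) = ftimes_ok s c.
Proof. by rewrite /ftimes_ok /fend !ftimes_fshift. Qed.

Lemma fsets_fshift e c : fsets c -> fsets (fshift e c).
Proof. by elim: c => [//|u c ih] /= [? /ih]. Qed.

Lemma refine_fshift e s b c : refine s (b + e) (fshift e c) = fshift e (refine s b c).
Proof. by elim: c s => [//|[[t b1] A] c ih] s /=; rewrite ih. Qed.

Lemma killed_mass_refn n b y s x c : ftimes_ok s c -> fsets c ->
  fmass (@killed R) b y s x (refn n s b c) = fmass (@killed R) b y s x c.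
Proof.
elim: n c => [//|n ih] c oc mc /=.
by rewrite ih ?ftimes_ok_refine ?killed_mass_refine//; exact: fsets_refine.
Qed.

Lemma le_fmass k1 k2 b y s x c : good_kernel k1 -> good_kernel k2 ->
  (forall b t x y, k1 b t x y <= k2 b t x y) -> fsets c ->
  (fmass k1 b y s x c <= fmass k2 b y s x c)%E.
Proof.
move=> g1 g2 k12; rewrite /fmass; move: (1 - _) => v.
elim: c s x => [|[[t b1] A] c ih] s x /=; first by rewrite lee_fin.
move=> [mA mc].
have mch k : good_kernel k -> measurable_fun setT (chain (fstep k t c) (fun z => (k b v z y)%:E)).
  move=> gk; apply: measurable_chain; first exact: good_fstep.
    exact: measurable_kterm.
  by move=> z; exact: kterm_ge0.
have ch0 k z : good_kernel k -> (0 <= chain (fstep k t c) (fun z => (k b v z y)%:E) z)%E.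
  by move=> gk; apply: chain_ge0; [exact: good_fstep|move=> z'; exact: kterm_ge0].
have mk k z : good_kernel k -> measurable_fun setT (fun w => (k b1 (t - s) z w)%:E).
  move=> /(_ b1 (t - s))[mk _]; apply/measurable_EFinP.
  have h : measurable_fun setT (fun w : R => (z, w)) by exact: measurable_fun_pair.
  exact: (measurableT_comp mk h).
have k0 k z w : good_kernel k -> 0 <= k b1 (t - s) z w by move=> /(_ b1 (t - s))[].
apply: ge0_le_integral => //.
- by move=> z _; rewrite mule_ge0 ?lee_fin ?k0 ?ch0.
- by apply: measurable_funTS; apply: emeasurable_funM; [exact: mk|exact: mch].
- by apply: measurable_funTS; apply: emeasurable_funM; [exact: mk|exact: mch].
- move=> z _; apply: lee_pmul; rewrite ?lee_fin ?k0 ?ch0//; exact: ih.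
Qed.

Fixpoint fmesh s c (D : R) : Prop :=
  if c is (t, _, _) :: c' then t - s <= D /\ fmesh t c' D else 1 - s <= D.

Lemma fmesh_refine s b c D : fmesh s c D -> fmesh s (refine s b c) (D / 2).
Proof.
elim: c s => [|[[t b1] A] c ih] s /=; first by move=> h; split; lra.
by move=> [h /ih h']; repeat split => //; lra.
Qed.

Lemma fmesh_refn n s b c D : fmesh s c D -> fmesh s (refn n s b c) (D / 2 ^+ n).
Proof.
elim: n c D => [|n ih] c D h /=; first by rewrite expr0 divr1.
by rewrite exprS invfM mulrA; apply: ih; exact: fmesh_refine.
Qed.

Lemma size_refine s b c : size (refine s b c) = (size c).*2.+1.
Proof. by elim: c s => [//|[[t b1] A] c ih] s /=; rewrite ih doubleS. Qed.

Lemma size_refn n s b c : (size (refn n s b c)).+1 = ((size c).+1 * 2 ^ n)%N.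
Proof.
elim: n c => [|n ih] c /=; first by rewrite expn0 muln1.
by rewrite ih size_refine expnS mulnA -doubleS muln2.
Qed.

(** Each of the [(size c).+1] steps, the one ending at time 1 included, costs one factor, and the
    floors go down by [e]. *)
Lemma grid_mass_le b y s x c e D : 0 < e -> ftimes_ok s c -> fmesh s c D -> fsets c ->
  (((1 - expR (- (2 * e ^+ 2 / D))) ^+ (size c).+1)%:E * fmass grid_kernel b y s x c <=
   fmass (@killed R) (b - e) y s x (fshift (- e) c))%E.
Proof.
move=> e0; rewrite /fmass {2}/fend ftimes_fshift -/(fend s c).
have D1 s' c' : ftimes_ok s' c' -> fmesh s' c' D -> 0 <= 1 - expR (- (2 * e ^+ 2 / D)).
  move=> oc mc; have D0 : 0 < D.
    case: c' oc mc => [|[[t b1] A] c'].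
      by rewrite ftimes_ok_nil /=; lra.
    by rewrite ftimes_ok_cons => /andP[st _] /= [h _]; lra.
  by rewrite subr_ge0 -expR0 ler_expR oppr_le0 divr_ge0 ?(ltW D0)// mulr_ge0 ?sqr_ge0.
elim: c s x => [|[[t b1] A] c ih] s x oc /=.
  rewrite /fend/= => h _; rewrite -EFinM lee_fin expr1; apply: grid_le_killed => //.
  by rewrite ftimes_ok_nil in oc; rewrite subr_gt0.
move: (oc); rewrite ftimes_ok_cons => /andP[st oct] [h mc] [mA ms].
have u0 : 0 <= 1 - expR (- (2 * e ^+ 2 / D)) by exact: (D1 t c).
set u := 1 - _ in u0 ih *.
have mch k v cc : good_kernel k -> fsets cc -> measurable_fun setT (chain (fstep k t cc) (fun z => (k v (1 - fend t c) z y)%:E)).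
  move=> gk mcc; apply: measurable_chain; first exact: good_fstep.
    exact: measurable_kterm.
  by move=> z; exact: kterm_ge0.
have ch0 k v cc z : good_kernel k -> fsets cc -> (0 <= chain (fstep k t cc) (fun z => (k v (1 - fend t c) z y)%:E) z)%E.
  by move=> gk mcc; apply: chain_ge0; [exact: good_fstep|move=> z'; exact: kterm_ge0].
have mk k v z : good_kernel k -> measurable_fun setT (fun w => (k v (t - s) z w)%:E).
  move=> /(_ v (t - s))[mk _]; apply/measurable_EFinP.
  have h' : measurable_fun setT (fun w : R => (z, w)) by exact: measurable_fun_pair.
  exact: (measurableT_comp mk h').
have k0 k v z w : good_kernel k -> 0 <= k v (t - s) z w by move=> /(_ v (t - s))[].
have ms' := fsets_fshift (- e) ms.
rewrite -ge0_integralZl//; last 3 first.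
- by apply: measurable_funTS; apply: emeasurable_funM; [exact: mk good_grid|exact: mch good_grid _].
- by move=> z _; rewrite mule_ge0 ?lee_fin ?k0 ?ch0//; exact: good_grid.
- by rewrite lee_fin exprn_ge0.
apply: ge0_le_integral => //.
- by move=> z _; rewrite !mule_ge0 ?lee_fin ?exprn_ge0 ?k0 ?ch0//; exact: good_grid.
- apply: emeasurable_funZl; apply: emeasurable_funM; [exact: mk good_grid|exact: mch good_grid _].
- by apply: measurable_funTS; apply: emeasurable_funM; [exact: mk good_killed|exact: mch good_killed _].
- move=> z _; rewrite exprS EFinM muleACA -EFinM.
  apply: lee_pmul; rewrite ?lee_fin ?mulr_ge0 ?k0//; try exact: good_grid.
  + by rewrite mule_ge0 ?lee_fin ?exprn_ge0 ?ch0//; exact: good_grid.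
  + by apply: grid_le_killed => //; rewrite subr_gt0.
  + exact: ih.
Qed.

End floors.

(** * Paths above floors and their values at dyadic times *)

Section floor_paths.
Context {R : realType}.
Implicit Types (s t x y z b e : R) (c : seq (R * R * set R)) (f : R -> R).

Fixpoint on_grid f s b c : Prop :=
  if c is (t, b1, A) :: c' then [/\ b1 < f s, b1 < f t, A (f t) & on_grid f t b c']
  else b < f s /\ b < f 1.

Fixpoint stays f s b c : Prop :=
  if c is (t, b1, A) :: c' then
    [/\ forall u, s <= u <= t -> b1 < f u, A (f t) & stays f t b c']
  else forall u, s <= u <= 1 -> b < f u.

Lemma stays_on_grid f s b c : ftimes_ok s c -> stays f s b c -> on_grid f s b c.
Proof.
elim: c s => [|[[t b1] A] c ih] s.
  by rewrite ftimes_ok_nil /= => /ltW s1 h; split; apply: h; rewrite lexx s1.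
rewrite ftimes_ok_cons => /andP[/ltW st oc] /= [h At /(ih _ oc) hc].
by split => //; apply: h; rewrite ?lexx st.
Qed.

Lemma stays_refine f s b c : ftimes_ok s c -> stays f s b c -> stays f s b (refine s b c).
Proof.
elim: c s => [|[[t b1] A] c ih] s.
  rewrite ftimes_ok_nil /= => s1 h; split => //.
    by move=> u /andP[su us]; apply: h; apply/andP; split; lra.
  by move=> u /andP[su us]; apply: h; apply/andP; split; lra.
rewrite ftimes_ok_cons => /andP[st oc] /= [h At /(ih _ oc) hc]; split => //.
  by move=> u /andP[su us]; apply: h; apply/andP; split; lra.
by split => // u /andP[su us]; apply: h; apply/andP; split; lra.
Qed.

Lemma stays_refn f n s b c : ftimes_ok s c -> stays f s b c -> stays f s b (refn n s b c).
Proof.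
elim: n c => [//|n ih] c oc h /=; apply: ih; first exact: ftimes_ok_refine.
exact: stays_refine.
Qed.

Fixpoint on_dyadic n b s t f : Prop :=
  if n is n'.+1 then on_dyadic n' b s ((s + t) / 2) f /\ on_dyadic n' b ((s + t) / 2) t f
  else b < f s /\ b < f t.

Lemma on_grid_refn_nil f n s b : on_grid f s b (refn n s b [::]) -> on_dyadic n b s 1 f.
Proof.
suff H : (forall s, on_grid f s b (refn n s b [::]) -> on_dyadic n b s 1 f) /\
   (forall s t b1 A c, on_grid f s b (refn n s b ((t, b1, A) :: c)) ->
     [/\ on_dyadic n b1 s t f, A (f t) & on_grid f t b (refn n t b c)]).
  exact: H.1.
elim: n => [|n [ih1 ih2]]; first by split => [s'|s' t b1 A c] /=; [|case].
split=> [s' /= /ih2[h1 _ /ih1 h2]//|s' t b1 A c /= /ih2[h1 _ /ih2[h2 At hc]]].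
by split.
Qed.

Lemma on_grid_refn_cons f n s b t b1 A c : on_grid f s b (refn n s b ((t, b1, A) :: c)) ->
  [/\ on_dyadic n b1 s t f, A (f t) & on_grid f t b (refn n t b c)].
Proof.
elim: n s t b1 A c => [|n ih2] s t b1 A c /=; first by case.
by move=> /ih2[h1 _ /ih2[h2 At hc]]; split.
Qed.

Lemma on_dyadic_near f n b s t u : on_dyadic n b s t f -> s <= u <= t ->
  exists2 v, `|u - v| <= (t - s) / 2 ^+ n & b < f v.
Proof.
elim: n s t => [|n ih] s t /=.
  by move=> [h _] /andP[su ut]; exists s => //; rewrite expr0 divr1 ger0_norm ?subr_ge0// lerD2r.
move=> [h1 h2] /andP[su ut].
have E : (t - s) / 2 ^+ n.+1 = ((t - s) / 2) / 2 ^+ n by rewrite exprS invfM mulrA.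
have [um|um] := leP u ((s + t) / 2).
  have [v uv bv] := ih _ _ h1 (introT andP (conj su um)).
  by exists v => //; rewrite E (_ : (t - s) / 2 = (s + t) / 2 - s)//; field.
have [v uv bv] := ih _ _ h2 (introT andP (conj (ltW um) ut)).
by exists v => //; rewrite E (_ : (t - s) / 2 = t - (s + t) / 2)//; field.
Qed.

(** The margin [e] is what survives the limit: strict bounds at dense times alone would only give a
    large inequality. *)
Lemma on_dyadic_all f b e s t : continuous f -> 0 < e ->
  (forall n, on_dyadic n (b + e) s t f) -> forall u, s <= u <= t -> b < f u.
Proof.
move=> cf e0 H u sut; have st : s <= t by move/andP: sut => [/le_trans]; apply.
rewrite ltNge; apply/negP => fub.
have /cvgrPdist_lt /(_ _ e0) := cf u.
move=> /nbhs_ballP[dl /= dl0 hd].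
have [n hn] : exists n, (t - s) / 2 ^+ n < dl.
  have h : (2^-1 ^+ n : R) @[n --> \oo] --> (0 : R).
    by apply: cvg_expr; rewrite ger0_norm ?invr_ge0// invf_lt1// ltr1n.
  have h' : (t - s) * 2^-1 ^+ n @[n --> \oo] --> (0 : R).
    by rewrite -(mulr0 (t - s)); apply: cvgM => //; exact: cvg_cst.
  move: h' => /cvgr_lt/(_ _ dl0)[n _ /(_ n (leqnn n)) /= hn].
  by exists n; rewrite -exprVn.
have [v uv bv] := on_dyadic_near (H n) sut.
have := hd v (le_lt_trans uv hn); rewrite ltr_norml => /andP[h1 h2]; lra.
Qed.

Lemma on_grid_stays f b e s c : continuous f -> 0 < e ->
  (forall n, on_grid f s (b + e) (refn n s (b + e) (fshift e c))) -> stays f s b c.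
Proof.
move=> cf e0; elim: c s => [|[[t b1] A] c ih] s H /=.
  by apply: (on_dyadic_all cf e0) => n; exact: on_grid_refn_nil.
have h n := on_grid_refn_cons (H n).
split.
- by apply: (on_dyadic_all cf e0) => n; have [] := h n.
- by have [] := h 0%N.
- by apply: ih => n; have [] := h n.
Qed.

Lemma stays_le f b s c e e' : e' <= e -> stays f s (b + e) (fshift e c) ->
  stays f s (b + e') (fshift e' c).
Proof.
move=> ee; elim: c s => [|[[t b1] A] c ih] s /=.
  by move=> h u /h; apply: le_lt_trans; rewrite lerD2l.
move=> [h At /ih hc]; split => // u /h; apply: le_lt_trans; by rewrite lerD2l.
Qed.

Lemma continuous_floor f b s t : continuous f -> s <= t ->
  (forall u, s <= u <= t -> b < f u) ->
  exists2 e, 0 < e & forall u, s <= u <= t -> b + e < f u.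
Proof.
move=> cf st H; have [v] := EVT_min st (continuous_subspaceT cf).
rewrite in_itv/= => stv hv; exists ((f v - b) / 2).
  by rewrite divr_gt0// subr_gt0 H.
move=> u sut; have := hv u; rewrite in_itv/= => /(_ sut); have := H _ stv; lra.
Qed.

Lemma stays_margin f b s c : continuous f -> ftimes_ok s c -> stays f s b c ->
  exists2 e, 0 < e & stays f s (b + e) (fshift e c).
Proof.
move=> cf; elim: c s => [|[[t b1] A] c ih] s.
  by rewrite ftimes_ok_nil => /ltW s1 /= /(continuous_floor cf s1).
rewrite ftimes_ok_cons => /andP[/ltW st oc] /= [h At /(ih _ oc)[e1 e10 h1]].
have [e2 e20 h2] := continuous_floor cf st h.
exists (Num.min e1 e2); first by rewrite lt_min e10.
split => //; last by apply: stays_le h1; rewrite ge_min lexx.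
by move=> u /h2; apply: le_lt_trans; rewrite lerD2l ge_min lexx orbT.
Qed.

(** By compactness a path above its floors has a positive margin [1 / (k + 1)]; conversely dyadic
    values above the raised floors suffice by continuity. The event becomes a countable combination
    of conditions on coordinates. *)
Lemma staysE f b s c : continuous f -> ftimes_ok s c ->
  stays f s b c <-> exists k, forall n, on_grid f s (b + k.+1%:R^-1) (refn n s (b + k.+1%:R^-1) (fshift k.+1%:R^-1 c)).
Proof.
move=> cf oc; split=> [/(stays_margin cf oc)[e e0 h]|[k H]]; last first.
  by apply: (on_grid_stays (e := k.+1%:R^-1)) => //; rewrite invr_gt0.
have /cvgr_lt/(_ _ e0)[k _ /(_ k (leqnn k)) /= hk] := @cvg_harmonic R.
exists k => n; apply: stays_on_grid.
  elim: n (fshift _ c) (ftimes_ok_fshift k.+1%:R^-1 s c) => [|n ih] c' E /=; first by rewrite E.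
  by apply: ih; rewrite ftimes_ok_refine// E.
apply: stays_refn; first by rewrite ftimes_ok_fshift.
by apply: stays_le h; exact: ltW.
Qed.

Section measurability.
Context d (W : measurableType d) (X : R -> W -> R).
Hypothesis mX : forall t, measurable_fun setT (X t).

Lemma measurable_gt b t : measurable [set w | b < X t w].
Proof.
rewrite (_ : [set w | _] = X t @^-1` `]b, +oo[); last first.
  by apply/seteqP; split=> w /=; rewrite in_itv/= andbT.
by rewrite -[X in measurable X]setTI; apply: mX.
Qed.

Lemma measurable_on_grid s b c : fsets c -> measurable [set w | on_grid (X ^~ w) s b c].
Proof.
elim: c s => [|[[t b1] A] c ih] s /=.
  by move=> _; apply: measurableI; exact: measurable_gt.
move=> [mA mc].
rewrite (_ : [set w | _] = [set w | b1 < X s w] `&` [set w | b1 < X t w] `&` (X t @^-1` A)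
   `&` [set w | on_grid (X^~ w) t b c]); last first.
  by apply/seteqP; split=> w /=; [case|move=> [[[]]]].
apply: measurableI; last exact: ih.
apply: measurableI; first by apply: measurableI; exact: measurable_gt.
by rewrite -[X in measurable X]setTI; apply: mX.
Qed.

Lemma fsets_refn n s b c : fsets c -> fsets (refn n s b c).
Proof. by elim: n c => [//|n ih] c mc /=; apply: ih; exact: fsets_refine. Qed.

Lemma measurable_stays s b c : (forall w, continuous (X ^~ w)) -> ftimes_ok s c -> fsets c ->
  measurable [set w | stays (X ^~ w) s b c].
Proof.
move=> cX oc mc.
rewrite (_ : [set w | _] = \bigcup_k \bigcap_n [set w | on_grid (X^~ w) s (b + k.+1%:R^-1) (refn n s (b + k.+1%:R^-1) (fshift k.+1%:R^-1 c))]); last first.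
  apply/seteqP; split=> w /=.
    by move=> /(staysE _ (@cX w) oc)[k h]; exists k => // n _; exact: h.
  by move=> [k _ h]; apply/(staysE _ (@cX w) oc); exists k => n; exact: h.
apply: bigcup_measurable => k _; apply: bigcap_measurable => // n _.
by apply: measurable_on_grid; apply: fsets_refn; exact: fsets_fshift.
Qed.

End measurability.

End floor_paths.

(** * Probability that the bridge stays above floors *)

Section floor_law.
Context {R : realType} {d : measure_display} {T : measurableType d}.
Variable P : probability T R.
Implicit Types (s t b e : R) (c : seq (R * R * set R)).

Lemma ae_eq_measure (E F : set T) : measurable E -> measurable F ->
  (\forall w \ae P, E w <-> F w) -> P E = P F.
Proof.
move=> mE mF [N [mN N0 hN]].
have H E' F' : measurable E' -> measurable F' -> (forall w, ~ (E' w <-> F' w) -> N w) -> (P E' <= P F')%E.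
  move=> mE' mF' h; apply: (@le_trans _ _ (P (F' `|` N))).
    apply: le_measure; rewrite ?inE//; first exact: measurableU.
    move=> w Ew; have [Fw|nF] := pselect (F' w); [by left|right; apply: h]; tauto.
  by rewrite measureU0.
by apply/eqP; rewrite eq_le !H// => w h; apply: hN => /=; tauto.
Qed.

(** At a time shared by two steps both floors apply: that of the step which ends and, through
    [head_floor], that of the step which begins. *)
Definition head_floor b c : R := if c is (_, b1, _) :: _ then b1 else b.

Fixpoint grid_sets b c : seq (R * set R) :=
  if c is (t, b1, A) :: c' then
    (t, A `&` [set z | b1 < z /\ head_floor b c' < z]) :: grid_sets b c'
  else [::].

Lemma unzip1_grid_sets b c : unzip1 (grid_sets b c) = ftimes c.
Proof. by elim: c => [//|[[t b1] A] c ih] /=; rewrite ih. Qed.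

Lemma on_grid_cylinder (f : R -> R) s b c : on_grid f s b c <->
  [/\ head_floor b c < f s, b < f 1 & forall p, List.In p (grid_sets b c) -> p.2 (f p.1)].
Proof.
elim: c s => [|[[t b1] A] c ih] s /=; first by split=> [[]|[]].
split=> [[h1 h2 At /ih[h3 h4 h5]]|[h1 h2 h3]].
  by split => // p [<-/=|/h5//].
have /=[At [h4 h5]] := h3 _ (or_introl erefl).
by split => //; apply/ih; split => // p hp; apply: h3; right.
Qed.

Lemma cylinderP (X : R -> T -> R) (c : seq (R * set R)) w :
  cylinder X c w <-> forall p, List.In p c -> p.2 (X p.1 w).
Proof.
rewrite /cylinder; elim: c => [|p c ih]; first by rewrite big_nil.
rewrite big_cons; split=> [[h /ih hc] q [<-//|]|h]; first exact: hc.
by split; [apply: h; left|apply/ih => q hq; apply: h; right].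
Qed.

Lemma measurable_floor b b' (A : set R) : measurable A ->
  measurable (A `&` [set z : R | b < z /\ b' < z]).
Proof.
move=> mA; apply: measurableI => //.
rewrite (_ : [set z | _] = `]b, +oo[ `&` `]b', +oo[); last first.
  by apply/seteqP; split=> z /=; rewrite !in_itv/= !andbT.
exact: measurableI.
Qed.

(** The floor conditions spread over the kernels are collected in the sets of [grid_sets]; those at
    the two ends of the path remain as a test. *)
Lemma grid_mass_bridge b y s x c : ftimes_ok s c -> fsets c ->
  fmass grid_kernel b y s x c =
  if (head_floor b c < x) && (b < y)
  then bridge_mass brownian_density brownian_ref 1 y s x (grid_sets b c) else 0%E.
Proof.
rewrite /fmass; elim: c s x => [|[[t b1] A] c ih] s x.
  rewrite ftimes_ok_nil /= => s1 _; rewrite /fend/= /grid_kernel brownian_densityE ?subr_gt0//.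
  by case: ifP.
rewrite ftimes_ok_cons /= => /andP[st oc] [mA mc].
case: ifPn => [/andP[bx b_y]|]; last first.
  rewrite negb_and => h; apply: integral0_eq => z _; rewrite (ih t z oc mc).
  move: h => /orP[/negbTE bx|/negbTE ->]; last by rewrite andbF mule0.
  by rewrite /grid_kernel bx mul0e.
rewrite [LHS]integral_mkcond [RHS]integral_mkcond; apply: eq_integral => z _.
rewrite /patch in_setI; case: ifPn => //= Az.
rewrite (ih t z oc mc) b_y andbT /grid_kernel bx/= brownian_densityE ?subr_gt0//.
rewrite /brownian_ref mulr1; case: ifPn => [b1z|b1z]; last first.
  by rewrite mul0e memNset//= => -[]; rewrite (negbTE b1z).
case: ifPn => hz; first by rewrite mem_set.
by rewrite mule0 memNset//= => -[_]; rewrite (negbTE hz).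
Qed.

Variables (X : R -> T -> R) (x y : R).
Hypothesis BX : brownian_bridge P 1 x y X.
Hypothesis cX : forall w, continuous (X ^~ w).
Hypothesis mX : forall t, measurable_fun setT (X t).

Let p1 : R := gauss 1 (y - x).

Lemma grid_prob b c : ftimes_ok 0 c -> fsets c ->
  P [set w | on_grid (X ^~ w) 0 b c] = (fmass grid_kernel b y 0 x c * (p1^-1)%:E)%E.
Proof.
move=> oc mc; have [_ _ X0 X1 Xc] := BX.
rewrite grid_mass_bridge//.
have mg := measurable_on_grid mX 0 b mc.
have mcyl : measurable (cylinder X (grid_sets b c)).
  rewrite /cylinder; elim: (c) mc => [|[[t b1] A] c' ih] /=; first by rewrite big_nil.
  move=> [mA /ih h]; rewrite big_cons; apply: measurableI => //=.
  by rewrite -[X in measurable X]setTI; apply: mX => //; exact: measurable_floor.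
have rc : rectangle (grid_sets b c).
  rewrite /rectangle unzip1_grid_sets; split; first by move: oc => /andP[].
  elim: (c) mc => [|[[t b1] A] c' ih] /=; first by move=> _ i; rewrite nth_nil.
  by move=> [mA /ih h] [|i] /=; [exact: measurable_floor|exact: h].
have lc : last_time (grid_sets b c) < 1.
  by rewrite /last_time unzip1_grid_sets; move: oc => /andP[].
case: ifPn => [/andP[hx hy]|h]; last first.
  rewrite mul0e -(measure0 P); apply: ae_eq_measure => //.
  apply: filterS X1 => w X1w; split => // /on_grid_cylinder[]; rewrite X0 X1w => h1 h2 _.
  by move: h; rewrite h1 h2.
transitivity (P (cylinder X (grid_sets b c))).
  apply: ae_eq_measure => //; apply: filterS X1 => w X1w; split.
    by move=> /on_grid_cylinder[_ _ h]; exact/cylinderP.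
  by move=> /cylinderP h; apply/on_grid_cylinder; rewrite X0 X1w.
by rewrite (Xc _ rc lc) /bridge_prob brownian_densityE.
Qed.

Let p1_gt0 : 0 < p1. Proof. exact: gauss_gt0. Qed.

Let Pn e n b c := P [set w | on_grid (X ^~ w) 0 (b + e) (refn n 0 (b + e) (fshift e c))].
Let Pe e b c := P (\bigcap_n [set w | on_grid (X ^~ w) 0 (b + e) (refn n 0 (b + e) (fshift e c))]).

Lemma on_grid_refine f s b c : on_grid f s b (refine s b c) -> on_grid f s b c.
Proof.
elim: c s => [|[[t b1] A] c ih] s /=; first by move=> [h1 h2 _ []].
by move=> [h1 h2 _ [h3 h4 h5 /ih h]].
Qed.

Lemma refn_refine n s b c : refn n.+1 s b c = refine s b (refn n s b c).
Proof. by elim: n c => [//|n ih] c /=; rewrite -ih. Qed.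

Lemma on_grid_refnS f n s b c : on_grid f s b (refn n.+1 s b c) -> on_grid f s b (refn n s b c).
Proof. by rewrite refn_refine; exact: on_grid_refine. Qed.

(** Refining the grid adds conditions, so the events decrease. *)
Let cvg_Pn e b c : fsets c -> Pn e n b c @[n --> \oo] --> Pe e b c.
Proof.
move=> mc; apply: nonincreasing_cvg_mu.
- apply: (le_lt_trans (probability_le1 _ _)); last exact: ltry.
  by apply: measurable_on_grid => //; apply: fsets_refn; exact: fsets_fshift.
- by move=> n; apply: measurable_on_grid => //; apply: fsets_refn; exact: fsets_fshift.
- apply: bigcap_measurable => // n _.
  by apply: measurable_on_grid => //; apply: fsets_refn; exact: fsets_fshift.
- apply/nonincreasing_seqP => n; apply/subsetPset => w.
  exact: on_grid_refnS.
Qed.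

Lemma refn_fshift n e s b c : refn n s (b + e) (fshift e c) = fshift e (refn n s b c).
Proof. by elim: n c => [//|n ih] c /=; rewrite refine_fshift ih. Qed.

Lemma on_grid_le f e e' s b c : e' <= e ->
  on_grid f s (b + e) (fshift e c) -> on_grid f s (b + e') (fshift e' c).
Proof.
move=> ee; have h z b' : b' + e < z -> b' + e' < z by apply: le_lt_trans; rewrite lerD2l.
by elim: c s => [|[[t b1] A] c ih] s /=; [case=> /h ? /h|case=> /h ? /h ? ? /ih].
Qed.

Let meas_n e n b c : fsets c ->
  measurable [set w | on_grid (X ^~ w) 0 (b + e) (refn n 0 (b + e) (fshift e c))].
Proof. by move=> mc; apply: measurable_on_grid => //; apply: fsets_refn; exact: fsets_fshift. Qed.

(** Lowering the margin [1 / (k + 1)] relaxes the conditions, so the events increase. *)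
Let cvg_Pe b c : ftimes_ok 0 c -> fsets c ->
  Pe k.+1%:R^-1 b c @[k --> \oo] --> P [set w | stays (X ^~ w) 0 b c].
Proof.
move=> oc mc; rewrite (_ : [set w | _] = \bigcup_k \bigcap_n [set w | on_grid (X^~ w) 0 (b + k.+1%:R^-1) (refn n 0 (b + k.+1%:R^-1) (fshift k.+1%:R^-1 c))]); last first.
  apply/seteqP; split=> w /=.
    by move=> /(staysE _ (@cX w) oc)[k h]; exists k => // n _; exact: h.
  by move=> [k _ h]; apply/(staysE _ (@cX w) oc); exists k => n; exact: h.
apply: nondecreasing_cvg_mu.
- by move=> k; apply: bigcap_measurable => // n _; exact: meas_n.
- by apply: bigcup_measurable => k _; apply: bigcap_measurable => // n _; exact: meas_n.
- apply/nondecreasing_seqP => k; apply/subsetPset => w h n _.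
  have := h n I; rewrite /= !refn_fshift; apply: on_grid_le.
  by rewrite lef_pV2 ?posrE// ler_nat.
Qed.

Let step_weight (c0 D : R) n := 1 - expR (- (2 * c0 ^+ 2 / (D / 2 ^+ n))).

Let weight_ge0 (e : R) n : 0 <= step_weight e 1 n.
Proof.
rewrite subr_ge0 -expR0 ler_expR oppr_le0; apply: divr_ge0.
  by apply: mulr_ge0 => //; exact: sqr_ge0.
by apply: divr_ge0 => //; exact: exprn_ge0.
Qed.

(** There are [m * 2 ^ n] steps, and each loses [exp (- 2 e^2 2^n)]: Bernoulli's inequality shows
    that the loss per step beats the number of steps. *)
Let cvg_weight (e : R) m : 0 < e ->
  (step_weight e 1 n) ^+ (m * 2 ^ n)%N @[n --> \oo] --> (1 : R).
Proof.
move=> e0; pose u n : R := expR (- (2 * e ^+ 2 * 2 ^+ n)).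
have uE n : step_weight e 1 n = 1 - u n by rewrite /step_weight /u div1r invrK.
have u0 n : 0 <= u n by exact: expR_ge0.
have e2 : 0 < e ^+ 2 by rewrite exprn_gt0.
have p2 n : 0 < 2 ^+ n :> R by rewrite exprn_gt0.
have u1 n : u n <= 1.
  by rewrite -expR0 ler_expR oppr_le0 mulr_ge0 ?(ltW (p2 n))// mulr_ge0 ?sqr_ge0.
have bern (v : R) k : 0 <= v <= 1 -> 1 - k%:R * v <= (1 - v) ^+ k.
  move=> /andP[v0 v1]; elim: k => [|k ih]; first by rewrite mul0r subr0 expr0.
  rewrite exprS; apply: (@le_trans _ _ ((1 - v) * (1 - k%:R * v))).
    rewrite -natr1; have : 0 <= k%:R * v * v by rewrite !mulr_ge0.
    lra.
  by rewrite ler_wpM2l// subr_ge0.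
(* With [y = e^2 2^n] this is [exp (- 2 y) <= y^-2], from [exp y >= y]. *)
have ub n : u n <= (e ^+ 2)^-1 ^+ 2 * (2^-1 ^+ n) ^+ 2.
  rewrite !exprVn -invfM -exprMn /u expRN lef_pV2 ?posrE ?expR_gt0 ?exprn_gt0 ?mulr_gt0//.
  rewrite (_ : 2 * e ^+ 2 * 2 ^+ n = e ^+ 2 * 2 ^+ n + e ^+ 2 * 2 ^+ n); last by ring.
  have y0 : 0 <= e ^+ 2 * 2 ^+ n by rewrite mulr_ge0 ?sqr_ge0 ?(ltW (p2 n)).
  rewrite expRD -expr2 lerXn2r ?nnegrE ?expR_ge0//.
  by have := expR_ge1Dx (e ^+ 2 * 2 ^+ n); lra.
apply: (@squeeze_cvgr _ _ _ _ (fun n => 1 - m%:R * ((e ^+ 2)^-1 ^+ 2 * 2^-1 ^+ n)) (fun=> 1)).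
- apply: nearW => n; rewrite uE; apply/andP; split; last by rewrite exprn_ile1 ?subr_ge0// gerBl.
  apply: le_trans (bern (u n) (m * 2 ^ n)%N _); last by rewrite u0 u1.
  rewrite lerD2l lerN2 natrM -mulrA ler_wpM2l//.
  apply: le_trans (ler_wpM2l _ (ub n)) _; first by [].
  rewrite natrX mulrCA ler_wpM2l ?sqr_ge0// expr2 mulrA -exprMn divff// expr1n mul1r.
  by [].
- rewrite -[X in _ --> X]subr0; apply: cvgB; first exact: cvg_cst.
  rewrite -(mulr0 m%:R); apply: cvgM; first exact: cvg_cst.
  rewrite -(mulr0 ((e ^+ 2)^-1 ^+ 2)); apply: cvgM; first exact: cvg_cst.
  by apply: cvg_expr; rewrite ger0_norm ?invr_ge0// invf_lt1// ltr1n.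
- exact: cvg_cst.
Qed.

Let K b c : \bar R := (fmass (@killed R) b y 0 x c * (p1^-1)%:E)%E.

Lemma fmass_ge0 k b' y' s x' c : good_kernel k -> fsets c -> (0 <= fmass k b' y' s x' c)%E.
Proof.
by move=> gk mc; apply: chain_ge0; [exact: good_fstep|move=> z; exact: kterm_ge0].
Qed.

Let p1V_ge0 : (0 <= (p1^-1)%:E)%E. Proof. by rewrite lee_fin invr_ge0 ltW. Qed.

Let Pe_ge e b c : ftimes_ok 0 c -> fsets c -> (K (b + e) (fshift e c) <= Pe e b c)%E.
Proof.
move=> oc mc; have [<- _] := cvg_limn_einf_sup (@cvg_Pn e b c mc).
apply/liminf_geP => r rK; apply: nearW => n; apply: lt_le_trans rK _.
have oce : ftimes_ok 0 (fshift e c) by rewrite ftimes_ok_fshift.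
have mce := fsets_fshift e mc.
have ocn : ftimes_ok 0 (refn n 0 (b + e) (fshift e c)).
  by elim: n (fshift e c) oce => [//|n ih] c' h /=; apply: ih; exact: ftimes_ok_refine.
rewrite /Pn grid_prob//; last exact: fsets_refn.
rewrite /K lee_wpmul2r// -(killed_mass_refn n)//.
apply: le_fmass; [exact: good_killed|exact: good_grid|exact: killed_le_grid|exact: fsets_refn].
Qed.

(** The event lies in all its grid approximations; their floors, raised by [e], are paid back by
    comparing with the killed mass of the original floors. The weight lost in the comparison tends
    to 1. *)
Let Pe_le e b c : 0 < e -> ftimes_ok 0 c -> fsets c -> (Pe e b c <= K b c)%E.
Proof.
move=> e0 oc mc.
have oce : ftimes_ok 0 (fshift e c) by rewrite ftimes_ok_fshift.
have mce := fsets_fshift e mc.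
have mesh : fmesh 0 (fshift e c) 1.
  suff : forall s c', 0 <= s -> ftimes_ok s c' -> fmesh s c' 1 by exact.
  move=> s c'; elim: c' s => [|[[t b1] A] c' ih] s s0 /=; first by move=> _; lra.
  rewrite ftimes_ok_cons => /andP[st oc']; split; last by apply: ih oc'; lra.
  by have := ftimes_ok_lt1 oc'; lra.
have oc_refn n c' : ftimes_ok 0 c' -> ftimes_ok 0 (refn n 0 (b + e) c').
  by elim: n c' => [//|n ih] c' h /=; apply: ih; exact: ftimes_ok_refine.
rewrite -[leLHS]mul1e; apply: (@liminf_ge_le _ _ (fun n => ((step_weight e 1 n) ^+ ((size c).+1 * 2 ^ n)%N)%:E * Pe e b c)%E).
  apply: liminf_geM => //; first exact: cvg_weight.
  - by move=> n; rewrite exprn_ge0 ?weight_ge0.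
  - by move=> r rP; exact: nearW.
apply: nearW => n.
apply: (@le_trans _ _ (((step_weight e 1 n) ^+ ((size c).+1 * 2 ^ n)%N)%:E * Pn e n b c)%E).
  apply: lee_wpmul2l.
    by rewrite lee_fin exprn_ge0 ?weight_ge0.
  apply: le_measure; rewrite ?inE; [|exact: meas_n|by move=> w /(_ n I)].
  by apply: bigcap_measurable => // k _; exact: meas_n.
rewrite /Pn grid_prob ?oc_refn//; last exact: fsets_refn.
rewrite muleA /K lee_wpmul2r//.
have := @grid_mass_le _ (b + e) y 0 x (refn n 0 (b + e) (fshift e c)) e _ e0 (oc_refn n _ oce) (fmesh_refn n (b + e) mesh) (fsets_refn n 0 (b + e) mce).
rewrite size_refn size_map addrK => /le_trans; apply.
rewrite refn_fshift.
have -> : fshift (- e) (fshift e (refn n 0 b c)) = refn n 0 b c.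
  rewrite /fshift -map_comp -[RHS]map_id; apply: eq_map => -[[t b1] A] /=.
  by rewrite addrK.
by rewrite killed_mass_refn.
Qed.

Lemma cvg_killed (e : nat -> R) b t z z' : (forall n, 0 <= e n) -> e n @[n --> \oo] --> (0 : R) ->
  killed (b + e n) t z z' @[n --> \oo] --> killed b t z z'.
Proof.
move=> e0 ce; rewrite /killed.
case: ifPn => [/andP[bz bz']|h]; last first.
  rewrite (_ : (fun n => _) = fun=> 0); first exact: cvg_cst.
  apply/funext => n; rewrite ifF//; apply/negbTE; apply: contra h => /andP[h1 h2].
  by apply/andP; split; have := e0 n; lra.
have h : (gauss t (z' - z) - gauss t (z' + z - 2 * (b + e n))) @[n --> \oo] --> gauss t (z' - z) - gauss t (z' + z - 2 * b).
  apply: cvgB; first exact: cvg_cst.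
  rewrite gaussE; under eq_fun do rewrite gaussE.
  apply: cvgM; first exact: cvg_cst.
  apply: (cvgn_comp (@continuous_expR _ _)); apply: cvgN; apply: cvgM; last exact: cvg_cst.
  have h : z' + z - 2 * (b + e n) @[n --> \oo] --> z' + z - 2 * b.
    apply: cvgB; first exact: cvg_cst.
    apply: cvgM; first exact: cvg_cst.
    by rewrite -[X in _ --> X]addr0; apply: cvgD => //; exact: cvg_cst.
  exact: (cvgn_comp (@exprn_continuous _ 2 _) h).
apply: cvg_trans h; apply: near_eq_cvg.
have m0 : 0 < Num.min (z - b) (z' - b) by rewrite lt_min !subr_gt0 bz.
move: ce => /cvgr_lt/(_ _ m0); apply: filterS => n.
rewrite lt_min => /andP[h1 h2]; rewrite ifT//; apply/andP; split; lra.
Qed.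

Fixpoint pfstep (e : nat -> R) s c : seq (@pchain_step R nat) :=
  if c is (t, b, A) :: c' then ((fun n => killed (b + e n) (t - s)), A) :: pfstep e t c' else [::].

Lemma inst_pfstep (e : nat -> R) n s c : inst n (pfstep e s c) = fstep (@killed R) s (fshift (e n) c).
Proof. by elim: c s => [//|[[t b] A] c ih] s /=; rewrite -ih. Qed.

(** The killed kernel is continuous as the floor comes down, including at points on the floor, and
    Fatou carries this to the chain. *)
Let K_liminf b c : fsets c ->
  liminf_ge (K b c) (fun k => K (b + k.+1%:R^-1) (fshift k.+1%:R^-1 c)).
Proof.
move=> mc; rewrite /K muleC; under eq_fun do rewrite muleC.
have e0 n : 0 <= n.+1%:R^-1 :> R by rewrite invr_ge0.
apply: liminf_geM => //.
- exact: fmass_ge0 good_killed _.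
- exact: cvg_cst.
- by move=> n; apply: fmass_ge0; [exact: good_killed|exact: fsets_fshift].
rewrite /fmass (_ : (fun n => _) = fun n => chain (inst n (pfstep (fun n => n.+1%:R^-1) 0 c))
   (fun z => (killed (b + n.+1%:R^-1) (1 - fend 0 c) z y)%:E) x); last first.
  by apply/funext => n; rewrite inst_pfstep /fend ftimes_fshift.
have h := @cvg_harmonic R.
apply: chain_liminf.
- by move=> n; rewrite inst_pfstep; apply: good_fstep; [exact: good_killed|exact: fsets_fshift].
- exact: good_fstep good_killed _.
- elim: (c) (0 : R) => [//|[[t b1] A] c' ih] s /=; split => // z z'; exact: cvg_killed.
- by move=> n; exact: measurable_kterm good_killed.
- by move=> n z; rewrite lee_fin killed_nneg.
- exact: measurable_kterm good_killed.
- by move=> z; rewrite lee_fin killed_nneg.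
- move=> z; apply: liminf_ge_cvg; apply: cvg_EFin; first exact: nearW.
  exact: cvg_killed.
Qed.

(** Reflection principle for piecewise constant floors. The event with margin [1 / (k + 1)] has a
    probability between the killed masses of the raised and of the original floors, and the former
    is asymptotically at least the latter. *)
Theorem floor_prob b c : ftimes_ok 0 c -> fsets c ->
  P [set w | stays (X ^~ w) 0 b c] = (fmass (@killed R) b y 0 x c * (p1^-1)%:E)%E.
Proof.
move=> oc mc; have h := @cvg_Pe b c oc mc; apply/eqP; rewrite eq_le; apply/andP; split.
  apply: liminf_ge_le (liminf_ge_cvg h) _; apply: nearW => k.
  by apply: Pe_le => //; rewrite invr_gt0.
apply: (@le_trans _ _ (limn_einf (fun k => Pe k.+1%:R^-1 b c))); last first.
  by have [-> _] := cvg_limn_einf_sup h.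
apply/liminf_geP; apply: liminf_ge_near (@K_liminf b c mc) _; apply: nearW => k.
exact: Pe_ge.
Qed.

End floor_law.

(** * One cell of the decomposition at the minimum *)

Section cells.
Context {R : realType}.
Notation mu := (@lebesgue_measure R).
Implicit Types (f g F G : R -> \bar R) (s t x y z b l : R) (c : seq (R * set R)).

Lemma measurable_pair_fst d1 d2 d3 (T1 : measurableType d1) (T2 : measurableType d2)
    (T3 : measurableType d3) (f : T1 -> T3) :
  measurable_fun setT f -> measurable_fun setT (fun u : T1 * T2 => f u.1).
Proof. by move=> mf; exact: (measurableT_comp mf). Qed.

Lemma measurable_pair_snd d1 d2 d3 (T1 : measurableType d1) (T2 : measurableType d2)
    (T3 : measurableType d3) (f : T2 -> T3) :
  measurable_fun setT f -> measurable_fun setT (fun u : T1 * T2 => f u.2).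
Proof. by move=> mf; exact: (measurableT_comp mf). Qed.

Lemma measurable_section d1 d2 d3 (T1 : measurableType d1) (T2 : measurableType d2)
    (T3 : measurableType d3) (f : T1 * T2 -> T3) (a : T1) :
  measurable_fun setT f -> measurable_fun setT (fun q : T2 => f (a, q)).
Proof.
move=> mf.
have h : measurable_fun setT (fun y : T2 => (a, y)) by exact: measurable_fun_pair.
exact: (measurableT_comp mf h).
Qed.

Fixpoint kstep b s c : seq (@chain_step R) :=
  if c is (t, A) :: c' then (killed b (t - s), A) :: kstep b t c' else [::].

Lemma good_kstep b s c : msets c -> good_chain (kstep b s c).
Proof.
elim: c s => [//|[t A] c ih] s /= [mA /ih gc]; split => //.
  exact: measurable_killed.
exact: killed_nneg.
Qed.

(** The Doob transform along a chain: the inner factors become the reference measure, the factor [z]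
    of the terminal function is absorbed, and the factor [x] of the start comes out. *)
Lemma killed_chain s x c f g : path <%R s (unzip1 c) -> msets c -> 0 < x ->
  measurable_fun setT g -> (forall z, 0 <= g z)%E -> (forall z, (0 < z)%R -> f z = z%:E * g z)%E ->
  (chain (kstep 0 s c) f x = x%:E * chain (bstep s c) g x)%E.
Proof.
move=> + + + mg g0 fg; elim: c s x => [|[t A] c ih] s x /=; first by move=> _ _; exact: fg.
move=> /andP[st pc] [mA mc] x0.
have mb : measurable_fun setT (chain (bstep t c) g).
  by apply: measurable_chain => //; exact: good_bstep.
have b0 z : (0 <= chain (bstep t c) g z)%E by apply: chain_ge0 => //; exact: good_bstep.
rewrite -ge0_integralZl//.
- apply: eq_integral => z _; have [z0|z0] := ltP 0 z.
    rewrite ih// killed_bes ?subr_gt0// /bessel3_ref z0 !muleA -!EFinM.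
    by congr (_%:E * _)%E; ring.
  by rewrite /killed /bessel3_ref [0 < z]ltNge z0 /= andbF mulr0 !mul0e mule0.
- apply: emeasurable_funM; last exact: measurable_funTS.
  apply/measurable_EFinP; apply: measurable_funTS.
  exact: (measurable_section (f := fun u : R * R => bes (t - s) u.1 u.2 * bessel3_ref u.2) x (measurable_bes_ref _)).
- by move=> z _; rewrite mule_ge0// lee_fin mulr_ge0 ?bes_nneg ?bessel3_ref_ge0.
- by rewrite ?lee_fin ?(ltW x0).
Qed.

Lemma killed_chain_le0 b s x e c f : x <= b -> chain (kstep b s (e :: c)) f x = 0%E.
Proof.
case: e => t A xb /=; apply: integral0_eq => z _.
by rewrite /killed [b < x]ltNge xb /= mul0e.
Qed.

(** Boxes after the last hit are given relative to the end level; this translates them to absolute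
    heights. *)
Definition shift_set b c := [seq (e.1, [set y | e.2 (y - b)]) | e <- c].

Lemma msets_shift_set b c : msets c -> msets (shift_set b c).
Proof.
elim: c => [//|[t A] c ih] /= [mA /ih]; split => //.
have m : measurable_fun setT (fun y : R => y - b) by exact: measurable_funB.
by rewrite -[X in measurable X]setTI; exact: (m measurableT).
Qed.

Lemma msets_shift_time b c : msets c -> msets (shift_time b c).
Proof. by elim: c => [//|e c ih] /= [? /ih]. Qed.

Lemma killedD b t x y : killed b t (x + b) (y + b) = killed 0 t x y.
Proof.
rewrite /killed -!ltrBlDr subrr mulr0 subr0; congr (if _ then _ else _).
by congr (gauss _ _ - gauss _ _); ring.
Qed.

Lemma kstep_shift b s x c f : msets c -> measurable_fun setT f -> (forall z, 0 <= f z)%E ->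
  chain (kstep b s (shift_set b c)) f (x + b) = chain (kstep 0 s c) (fun z => f (z + b)%R) x.
Proof.
move=> + mf f0; elim: c s x => [//|[t A] c ih] s x /= [mA mc].
have mA' : measurable [set y | A (y - b)].
  by have [] : msets (shift_set b [:: (t, A)]) by exact: msets_shift_set.
have mc' := msets_shift_set b mc.
rewrite (ge0_integral_preimageD b)//.
- rewrite (_ : [set y | [set y | A (y - b)] (y + b)] = A); last first.
    by apply/seteqP; split=> y /=; rewrite addrK.
  by apply: eq_integral => z _; rewrite killedD ih.
- apply: emeasurable_funM; last by apply: measurable_chain => //; exact: good_kstep.
  by apply/measurable_EFinP; exact: measurable_killed.
- by move=> z; rewrite mule_ge0 ?lee_fin ?killed_nneg// chain_ge0//; exact: good_kstep.
Qed.

(* The limit of [(killed (- e) t x y - killed 0 t x y) / e] as [e] tends to 0. *)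
Definition hit_kernel t x y : R := if (0 <= x) && (0 <= y) then 2 * hit t (x + y) else 0.

Lemma hit_kernel_ge0 t x y : 0 < t -> 0 <= hit_kernel t x y.
Proof.
move=> t0; rewrite /hit_kernel; case: ifPn => // /andP[x0 y0].
by rewrite mulr_ge0// hit_ge0// addr_ge0.
Qed.

Lemma measurable_hit_kernel t : measurable_fun setT (fun u : R * R => hit_kernel t u.1 u.2).
Proof.
apply: measurable_fun_ifT => //; first by apply: measurable_and; exact: measurable_fun_ler.
by apply: measurable_funM => //; apply: measurable_hit => //; exact: measurable_funD.
Qed.

(* [G] enters through the entrance law of the three-dimensional Bessel process. *)
Definition entrance t G : \bar R := (\int[mu]_z ((bes t 0 z * bessel3_ref z)%:E * G z))%E.

Lemma entrance_ge0 t G : (forall z, 0 <= G z)%E -> (0 <= entrance t G)%E.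
Proof.
by move=> G0; apply: integral_ge0 => z _; rewrite mule_ge0// lee_fin mulr_ge0 ?bes_nneg ?bessel3_ref_ge0.
Qed.

Let measurable_entrance_integrand (k : R -> R) G : measurable_fun setT k -> measurable_fun setT G ->
  measurable_fun setT (fun u : R * R => (bes (k u.1) 0 u.2 * bessel3_ref u.2)%:E * G u.2)%E.
Proof.
move=> mk mG; apply: emeasurable_funM; last exact: (measurable_pair_snd mG).
apply/measurable_EFinP; apply: measurable_funM; last exact: (measurable_pair_snd measurable_bessel3_ref).
by apply: measurable_bes => //; exact: (measurable_pair_fst mk).
Qed.

Lemma measurable_entrance (k : R -> R) G : measurable_fun setT k -> measurable_fun setT G ->
  (forall z, 0 <= G z)%E -> measurable_fun setT (fun w => entrance (k w) G).
Proof.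
move=> mk mG G0.
apply: (measurable_setI_integral (h := fun u : R * R => ((bes (k u.1) 0 u.2 * bessel3_ref u.2)%:E * G u.2)%E)) => //.
  exact: measurable_entrance_integrand.
by move=> u; rewrite mule_ge0// lee_fin mulr_ge0 ?bes_nneg ?bessel3_ref_ge0.
Qed.

(** The dip to 0 is split at the relative time [w] of the minimum: hitting at distance [x + z] is
    hitting at distance [x], then at distance [z]. Each hitting density is half a position times a
    Bessel kernel at 0, and [2 * t] times the two halves gives [t / 2]. *)
Lemma hit_cell t x F G : 0 < t -> 0 < x -> measurable_fun setT G -> (forall z, 0 <= G z)%E ->
  (forall z, (0 < z)%R -> F z = z%:E * G z)%E ->
  (forall z, z <= 0 -> F z = 0%E) ->
  (\int[mu]_z ((hit_kernel t x z)%:E * F z) =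
   x%:E * \int[mu]_(w in `]0%R, 1%R[) ((t / 2 * bes (t * w) x 0)%:E * entrance (t * (1 - w)) G))%E.
Proof.
move=> t0 x0 mG G0 FG F0.
pose h (u : R * R) : \bar R := ((x * (t / 2) * bes (t * u.2) x 0)%:E * ((bes (t * (1 - u.2)) 0 u.1 * bessel3_ref u.1)%:E * G u.1))%E.
have mtw : measurable_fun setT (fun w : R => t * w) by exact: measurable_funM.
have mtw' : measurable_fun setT (fun w : R => t * (1 - w)).
  by apply: measurable_funM => //; exact: measurable_funB.
have mh : measurable_fun setT h.
  apply: emeasurable_funM.
    apply/measurable_EFinP; apply: measurable_funM => //; apply: measurable_bes => //.
    exact: (measurable_pair_snd mtw).
  apply: emeasurable_funM; last exact: (measurable_pair_fst mG).
  apply/measurable_EFinP; apply: measurable_funM; last exact: (measurable_pair_fst measurable_bessel3_ref).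
  by apply: measurable_bes => //; exact: (measurable_pair_snd mtw').
have h0 u : (0 <= h u)%E.
  by rewrite !mule_ge0// lee_fin ?mulr_ge0 ?bes_nneg ?bessel3_ref_ge0// ltW.
transitivity (\int[mu]_z \int[mu]_(w in `]0%R, 1%R[) h (z, w))%E.
  apply: eq_integral => z _; rewrite /h/=; have [z0|z0] := ltP 0 z; last first.
    rewrite F0// mule0 /bessel3_ref [0 < z]ltNge z0/=.
    by apply/esym/integral0_eq => w _; rewrite mulr0 mul0e mule0.
  rewrite FG// /hit_kernel (ltW x0) (ltW z0)/=.
  have -> : 2 * hit t (x + z) = 2 * t * (hit t (x + z) / t) by field; rewrite gt_eqF.
  rewrite EFinM -hit_integral// muleA [X in (X * _)%E]muleC muleA [RHS](_ : _ =
     \int[mu]_(w in `]0%R, 1%R[) ((z * (2 * t))%:E * G z * (hit (t * w) x * hit (t * (1 - w)) z)%:E))%E; last first.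
    apply: eq_integral => w; rewrite inE/= in_itv/= => /andP[w0 w1].
    rewrite !hit_bes ?mulr_gt0 ?subr_gt0// /bessel3_ref z0 muleA -EFinM muleAC -EFinM.
    by rewrite [bes _ x 0]besC; congr (_%:E * _)%E; field.
  rewrite ge0_integralZl//.
  - by rewrite -EFinM [LHS]muleAC.
  - apply/measurable_EFinP; apply: measurable_funTS; apply: measurable_funM; exact: measurable_hit.
  - move=> w; rewrite /= in_itv/= => /andP[w0 w1].
    by rewrite lee_fin mulr_ge0 ?hit_ge0 ?mulr_gt0 ?subr_gt0// ltW.
  - by rewrite mule_ge0// lee_fin mulr_ge0 ?mulr_ge0 ?ltW.
rewrite (ge0_integral_exchange measurableT (measurable_itv _) mh h0) -ge0_integralZl//.
- apply: eq_integral => w _; rewrite /h/= muleA -EFinM [(x * (t / 2 * _))%R]mulrA /entrance -ge0_integralZl//.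
  + exact: (measurable_section (f := fun u : R * R => ((bes (t * (1 - u.1)) 0 u.2 * bessel3_ref u.2)%:E * G u.2)%E) w (measurable_entrance_integrand mtw' mG)).
  + by move=> z _; rewrite mule_ge0// lee_fin mulr_ge0 ?bes_nneg ?bessel3_ref_ge0.
  + by rewrite lee_fin mulr_ge0 ?bes_nneg// mulr_ge0 ?divr_ge0 ?ltW.
- apply: measurable_funTS; apply: emeasurable_funM.
    by apply/measurable_EFinP; apply: measurable_funM => //; exact: measurable_bes.
  exact: (measurable_entrance mtw').
- by move=> w _; rewrite mule_ge0 ?entrance_ge0// lee_fin mulr_ge0 ?bes_nneg// divr_ge0// (ltW t0).
- by rewrite lee_fin (ltW x0).
Qed.

(** For [0 <= l], the density of the paths that stay above 0 but not above [l]. *)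
Definition exit_kernel l t x y : R := killed 0 t x y - killed l t x y.

(** Decomposition at the last visit of [l], at time [t * w]: a path above 0 from [x] to [l], then an
    excursion up to [y + l]. The kernel killed at 0 is the difference of two Gaussians, at distances
    [|x - l|] and [x + l], so two instances of [gauss_hit_integral] are subtracted. *)
Lemma exit_kernel_integral l t x y : 0 < l -> 0 < t -> 0 < x -> 0 < y ->
  ((exit_kernel l t x (y + l))%:E =
   (t * l * x * y / 2)%:E * \int[mu]_(w in `]0%R, 1%R[) (bes (t * w) x l * bes (t * (1 - w)) 0 y)%:E)%E.
Proof.
move=> l0 t0 x0 y0.
have xl : 0 < x + l by rewrite addr_gt0.
have yl : 0 < y + l by rewrite addr_gt0.
have -> : exit_kernel l t x (y + l) = gauss t (`|x - l| + y) - gauss t (x + l + y).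
  rewrite /exit_kernel /killed x0 yl/= ltrDr y0 andbT mulr0 subr0.
  rewrite (_ : y + l + x = x + l + y); last by ring.
  case: ltP => lx.
    rewrite ger0_norm ?subr_ge0 ?(ltW lx)//.
    rewrite (_ : x + l + y - 2 * l = x - l + y); last by ring.
    by rewrite opprB [LHS]addrC addrA addrNK.
  rewrite ler0_norm ?subr_le0// opprB subr0.
  by rewrite (_ : y + l - x = l - x + y)//; ring.
have ab : 0 <= `|x - l| by [].
have H : forall w, 0 < w < 1 -> gauss (t * w) `|x - l| * hit (t * (1 - w)) y =
  gauss (t * w) (x + l) * hit (t * (1 - w)) y + l * x * y / 2 * (bes (t * w) x l * bes (t * (1 - w)) 0 y).
  move=> w /andP[w0 w1]; have tw : 0 < t * w by rewrite mulr_gt0.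
  have tw' : 0 < t * (1 - w) by rewrite mulr_gt0// subr_gt0.
  have := killed_bes tw x0 l0; rewrite /killed x0 l0/= mulr0 subr0 => E.
  rewrite [hit _ y]hit_bes//.
  have -> : gauss (t * w) `|x - l| = gauss (t * w) (l - x).
    by have [h|h] := lerP 0 (x - l); [rewrite ger0_norm// -[LHS]gaussN opprB|rewrite ltr0_norm// opprB].
  have -> : gauss (t * w) (l - x) = gauss (t * w) (l + x) + x * l * bes (t * w) x l by rewrite -E; ring.
  by rewrite [l + x]addrC; ring.
have I1 := gauss_hit_integral t0 ab y0.
have I2 := gauss_hit_integral t0 (ltW xl) y0.
have mI : measurable_fun (`]0%R, 1%R[ : set R) (fun w : R => (bes (t * w) x l * bes (t * (1 - w)) 0 y)%:E).
  apply/measurable_EFinP; apply: measurable_funTS; apply: measurable_funM; apply: measurable_bes => //.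
  by apply: measurable_funM => //; exact: measurable_funB.
have I0 : (0 <= \int[mu]_(w in `]0%R, 1%R[) (bes (t * w) x l * bes (t * (1 - w)) 0 y)%:E)%E.
  by apply: integral_ge0 => w _; rewrite lee_fin mulr_ge0 ?bes_nneg.
move: I1; rewrite (_ : (\int[mu]_(w in _) _)%E = ((gauss t (x + l + y) / t)%:E +
   (l * x * y / 2)%:E * \int[mu]_(w in `]0%R, 1%R[) (bes (t * w) x l * bes (t * (1 - w)) 0 y)%:E)%E); last first.
  rewrite -I2 -ge0_integralZl//; last 2 first.
  - by move=> w _; rewrite lee_fin mulr_ge0 ?bes_nneg.
  - by rewrite lee_fin divr_ge0// !mulr_ge0 ?ltW.
  rewrite -ge0_integralD//.
  - by apply: eq_integral => w; rewrite inE/= in_itv/= => /H ->; rewrite EFinD EFinM.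
  - move=> w; rewrite /= in_itv/= => /andP[w0 w1].
    by rewrite lee_fin mulr_ge0 ?gauss_ge0// hit_ge0 ?mulr_gt0 ?subr_gt0// ltW.
  - apply/measurable_EFinP; apply: measurable_funTS; apply: measurable_funM.
      by apply: measurable_gauss => //; exact: measurable_funM.
    by apply: measurable_hit => //; apply: measurable_funM => //; exact: measurable_funB.
  - by move=> w _; rewrite mule_ge0// lee_fin; [apply: divr_ge0 => //; rewrite !mulr_ge0 ?(ltW l0) ?(ltW x0) ?(ltW y0)|rewrite mulr_ge0 ?bes_nneg].
  - by apply: emeasurable_funM.
(* Subtraction requires the integral to be finite; an infinite value would contradict the finite
   Gaussian on the other side. *)
move: I0; case: (\int[mu]_(w in _) _)%E => [r| |]//=.
- rewrite lee_fin => r0; rewrite -EFinM -EFinD => -[] E; congr (_%:E).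
  have : t * (gauss t (x + l + y) / t + l * x * y / 2 * r) = t * (gauss t (`|x - l| + y) / t) by rewrite E.
  rewrite mulrDr mulrCA divff ?gt_eqF// mulr1 [t * (_ / t)]mulrCA divff ?gt_eqF// mulr1 => <-.
  by ring.
- move=> _; rewrite gt0_muley; first by rewrite addey.
  by rewrite lte_fin divr_gt0// !mulr_gt0.
Qed.

Lemma killed_floor_le b b' t x y : 0 < t -> b <= b' -> killed b' t x y <= killed b t x y.
Proof.
move=> t0 bb; rewrite {1}/killed; case: ifPn => [/andP[h1 h2]|_]; last exact: killed_ge0.
rewrite /killed !(le_lt_trans bb)//= lerD2l lerN2 gauss_le//.
by rewrite !ger0_norm; lra.
Qed.

Lemma exit_kernel_ge0 l t x y : 0 <= l -> 0 < t -> 0 <= exit_kernel l t x y.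
Proof. by move=> l0 t0; rewrite subr_ge0 killed_floor_le. Qed.

Lemma measurable_exit_kernel l t : measurable_fun setT (fun u : R * R => exit_kernel l t u.1 u.2).
Proof. by apply: measurable_funB; exact: measurable_killed. Qed.

(** The counterpart of [hit_cell] at the last visit of [l]: a Bessel bridge arriving at [l], then an
    entrance from 0 for the height above [l]. *)
Lemma exit_cell l t x F G : 0 < l -> 0 < t -> 0 < x -> measurable_fun setT F -> (forall z, 0 <= F z)%E ->
  measurable_fun setT G -> (forall z, 0 <= G z)%E ->
  (forall z, (0 < z)%R -> F (z + l)%R = z%:E * G z)%E -> (forall z, z <= 0 -> F (z + l) = 0%E) ->
  (\int[mu]_z ((exit_kernel l t x z)%:E * F z) =
   x%:E * \int[mu]_(w in `]0%R, 1%R[) ((t * l / 2 * bes (t * w) x l)%:E * entrance (t * (1 - w)) G))%E.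
Proof.
move=> l0 t0 x0 mF F0' mG G0 FG F0.
pose h (u : R * R) : \bar R := ((x * (t * l / 2) * bes (t * u.2) x l)%:E * ((bes (t * (1 - u.2)) 0 u.1 * bessel3_ref u.1)%:E * G u.1))%E.
have mtw : measurable_fun setT (fun w : R => t * w) by exact: measurable_funM.
have mtw' : measurable_fun setT (fun w : R => t * (1 - w)).
  by apply: measurable_funM => //; exact: measurable_funB.
have mh : measurable_fun setT h.
  apply: emeasurable_funM.
    apply/measurable_EFinP; apply: measurable_funM => //; apply: measurable_bes => //.
    exact: (measurable_pair_snd mtw).
  apply: emeasurable_funM; last exact: (measurable_pair_fst mG).
  apply/measurable_EFinP; apply: measurable_funM; last exact: (measurable_pair_fst measurable_bessel3_ref).
  by apply: measurable_bes => //; exact: (measurable_pair_snd mtw').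
have tl0 : 0 <= t * l / 2 by rewrite divr_ge0// mulr_ge0 ?ltW.
have h0 u : (0 <= h u)%E.
  rewrite mule_ge0//; first by rewrite lee_fin mulr_ge0 ?bes_nneg// mulr_ge0// ltW.
  by rewrite mule_ge0// lee_fin mulr_ge0 ?bes_nneg ?bessel3_ref_ge0.
rewrite (ge0_integralD_shift l); last 2 first.
- apply: emeasurable_funM => //; apply/measurable_EFinP.
  exact: (measurable_section (f := fun u : R * R => exit_kernel l t u.1 u.2) x (measurable_exit_kernel _ _)).
- by move=> z; rewrite mule_ge0// lee_fin exit_kernel_ge0// ltW.
transitivity (\int[mu]_z \int[mu]_(w in `]0%R, 1%R[) h (z, w))%E.
  apply: eq_integral => z _; rewrite /h/=; have [z0|z0] := ltP 0 z; last first.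
    rewrite F0// mule0 /bessel3_ref [0 < z]ltNge z0/=.
    by apply/esym/integral0_eq => w _; rewrite mulr0 mul0e mule0.
  rewrite FG// exit_kernel_integral// [RHS](_ : _ =
     \int[mu]_(w in `]0%R, 1%R[) ((z * (t * l * x * z / 2))%:E * G z * (bes (t * w) x l * bes (t * (1 - w)) 0 z)%:E))%E; last first.
    apply: eq_integral => w _; rewrite /bessel3_ref z0 muleA -EFinM [RHS]muleAC -EFinM.
    by congr (_%:E * _)%E; field.
  rewrite ge0_integralZl//.
  - by rewrite [LHS]muleAC EFinM; congr (_ * _)%E; rewrite muleA [(_%:E * z%:E)%E]muleC.
  - apply/measurable_EFinP; apply: measurable_funTS; apply: measurable_funM; exact: measurable_bes.
  - by move=> w _; rewrite lee_fin mulr_ge0 ?bes_nneg.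
  - by rewrite mule_ge0// lee_fin mulr_ge0 ?divr_ge0// ?mulr_ge0 ?ltW.
rewrite (ge0_integral_exchange measurableT (measurable_itv _) mh h0) -ge0_integralZl//.
- apply: eq_integral => w _; rewrite /h/= muleA -EFinM [(x * (t * l / 2 * _))%R]mulrA /entrance -ge0_integralZl//.
  + exact: (measurable_section (f := fun u : R * R => ((bes (t * (1 - u.1)) 0 u.2 * bessel3_ref u.2)%:E * G u.2)%E) w (measurable_entrance_integrand mtw' mG)).
  + by move=> z _; rewrite mule_ge0// lee_fin mulr_ge0 ?bes_nneg ?bessel3_ref_ge0.
  + by rewrite lee_fin mulr_ge0 ?bes_nneg// mulr_ge0// ltW.
- apply: measurable_funTS; apply: emeasurable_funM.
    by apply/measurable_EFinP; apply: measurable_funM => //; exact: measurable_bes.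
  exact: (measurable_entrance mtw').
- by move=> w _; rewrite mule_ge0 ?entrance_ge0// lee_fin mulr_ge0 ?bes_nneg.
- by rewrite ?lee_fin ?(ltW x0).
Qed.

Lemma entrance_bmass t l y s c : (entrance t (fun x => bmass l y s x c) = bmass l y (s - t) 0 ((s, setT) :: c))%E.
Proof. by rewrite /bmass/= /end_time/= subKr. Qed.

Lemma end_time_shift_set b s c : end_time s (shift_set b c) = end_time s c.
Proof. by rewrite /end_time /unzip1 /shift_set -map_comp. Qed.

Lemma measurable_bmass_start l y s c : msets c -> measurable_fun setT (fun x => bmass l y s x c).
Proof.
move=> mc; apply: measurable_chain; first exact: good_bstep.
- by apply/measurable_EFinP; exact: measurable_bes.
- by move=> z; rewrite lee_fin bes_nneg.
Qed.

(** Above the floor [l] the heights relative to [l] form a chain killed at 0; its Doob transform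
    leaves the factors [x] and [a] of the two ends. *)
Lemma after_mass l s x a c : path <%R s (unzip1 c) -> end_time s c < 1 -> msets c -> 0 < x -> 0 < a ->
  chain (kstep l s (shift_set l c)) (fun y => (killed l (1 - end_time s c) y (a + l))%:E) (x + l) =
  (x%:E * (a%:E * bmass 1 a s x c))%E.
Proof.
move=> pc ec mc x0 a0; rewrite kstep_shift//; last 2 first.
- by apply/measurable_EFinP; exact: measurable_killed.
- by move=> z; rewrite lee_fin killed_nneg.
under eq_chain do rewrite killedD.
rewrite (@killed_chain _ _ _ _ (fun z => a%:E * (bes (1 - end_time s c) z a)%:E)%E)//.
- by rewrite chainZ//; [by rewrite lee_fin ltW|exact: good_bstep|apply/measurable_EFinP; exact: measurable_bes|move=> z; rewrite lee_fin bes_nneg].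
- by apply: emeasurable_funM => //; apply/measurable_EFinP; exact: measurable_bes.
- by move=> z; rewrite mule_ge0// lee_fin ?bes_nneg// ltW.
- by move=> z z0; rewrite killed_bes ?subr_gt0// -!EFinM mulrA.
Qed.

End cells.

(** * Mass of a cell in terms of Bessel bridges *)

Section cell_mass.
Context {R : realType}.
Notation mu := (@lebesgue_measure R).
Implicit Types (f g F G : R -> \bar R) (s t x y z b : R) (c : seq (R * set R)).

Lemma killed_term_chain_le0 b s c t x y : x <= b ->
  chain (kstep b s c) (fun z => (killed b t z y)%:E) x = 0%E.
Proof.
move=> xb; case: c => [|e c] /=; first by rewrite /killed [b < x]ltNge xb.
exact: (@killed_chain_le0 _ b s x e c).
Qed.

Lemma measurable_entrance_integrand t G : measurable_fun setT G ->
  measurable_fun setT (fun z => (bes t 0 z * bessel3_ref z)%:E * G z)%E.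
Proof.
move=> mG; apply: emeasurable_funM => //; apply/measurable_EFinP.
by apply: measurable_funM; [exact: measurable_bes|exact: measurable_bessel3_ref].
Qed.

Lemma entranceZ t (k : \bar R) G : (0 <= k)%E -> measurable_fun setT G -> (forall z, 0 <= G z)%E ->
  entrance t (fun z => k * G z)%E = (k * entrance t G)%E.
Proof.
move=> k0 mG G0; rewrite /entrance -ge0_integralZl//.
- by apply: eq_integral => z _; rewrite muleCA.
- exact: measurable_entrance_integrand.
- by move=> z _; rewrite mule_ge0// lee_fin mulr_ge0 ?bes_nneg ?bessel3_ref_ge0.
Qed.

Lemma entrance_integral t (D : set R) (F : R -> R -> \bar R) : measurable D ->
  measurable_fun setT (fun u : R * R => F u.1 u.2) -> (forall w z, 0 <= F w z)%E ->
  (entrance t (fun z => \int[mu]_(w in D) F w z) = \int[mu]_(w in D) entrance t (F w))%E.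
Proof.
move=> mD mF F0.
exact: (@chain_integral _ [:: ((fun x z => bes t x z * bessel3_ref z), setT)] D F 0 mD
  (And4 measurableT (measurable_bes_ref t) (fun x z => mulr_ge0 (bes_nneg _ _ _) (bessel3_ref_ge0 _)) I) mF F0).
Qed.

Lemma entrance_insert t l y s c : 0 < t -> path <%R s (unzip1 c) -> end_time s c < l -> msets c -> 0 <= y ->
  (entrance t (fun x => bmass l y s x c) = bmass l y (s - t) 0 c)%E.
Proof.
move=> t0 pc ec mc y0; rewrite entrance_bmass bmass_insert0//=.
by rewrite pc andbT gtrBl.
Qed.

Variables (l d u v a : R) (C2 C C1 : seq (R * set R)).
Hypotheses (l0 : 0 < l) (d0 : 0 < d) (a0 : 0 < a).
Hypotheses (m1 : msets C1) (m : msets C) (m2 : msets C2).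
Hypotheses (p1 : path <%R (v + d) (unzip1 C1)) (e1 : end_time (v + d) C1 < 1).
Hypotheses (p : path <%R (u + d) (unzip1 C)) (e : end_time (u + d) C < v).
Hypotheses (p2 : path <%R 0 (unzip1 C2)) (e2 : end_time 0 C2 < u).

(** The five stretches of a cell, from the last one back: above [l] up to time 1, last visit of [l]
    in [[v, v + d]], above 0 from [u + d] to [v], dip to 0 in [[u, u + d]], above 0 up to [u]. The
    shifted path goes from [a] to [a + l]. *)
Definition cells_end : R -> \bar R :=
  chain (kstep l (v + d) (shift_set l C1)) (fun y => (killed l (1 - end_time (v + d) C1) y (a + l))%:E).
Definition cells_exit y : \bar R := (\int[mu]_z ((exit_kernel l d y z)%:E * cells_end z))%E.
Definition cells_mid : R -> \bar R := chain (kstep 0 (u + d) (C ++ [:: (v, setT)])) cells_exit.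
Definition cells_hit y : \bar R := (\int[mu]_z ((hit_kernel d y z)%:E * cells_mid z))%E.
Definition cells_mass : \bar R := chain (kstep 0 0 (C2 ++ [:: (u, setT)])) cells_hit a.

(** Masses between the exact times: [K3] from [a] down to 0 at [u + d * r], [K2] from there up to
    [l] at [v + d * q], and [K1], in heights above [l], from 0 at that time up to [a] at time 1. *)
Let K1 (q : R) := bmass 1 a (v + d * q) 0 C1.
Let K2 (r q : R) := bmass (v + d * q) l (u + d * r) 0 C.
Let K3 (r : R) := bmass (u + d * r) 0 0 a C2.
Let k : R := d * l / 2 * a.

Let mlin (b : R) : measurable_fun setT (fun q : R => b + d * q).
Proof. by apply: measurable_funD => //; exact: measurable_funM. Qed.

Let mlin1 (b : R) : measurable_fun setT (fun q : R * R => b + d * q.1).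
Proof. exact: (measurable_pair_fst (mlin b)). Qed.

Let mlin2 (b : R) : measurable_fun setT (fun q : R * R => b + d * q.2).
Proof. exact: (measurable_pair_snd (mlin b)). Qed.

Let mK1 : measurable_fun setT K1. Proof. exact: measurable_bmass. Qed.
Let mK2 : measurable_fun setT (fun q : R * R => K2 q.1 q.2).
Proof. by apply: measurable_bmass. Qed.
Let K10 q : (0 <= K1 q)%E. Proof. exact: bmass_ge0. Qed.
Let K20 r q : (0 <= K2 r q)%E. Proof. exact: bmass_ge0. Qed.
Let k0 : 0 <= k. Proof. by rewrite mulr_ge0 ?divr_ge0 ?mulr_ge0 ?(ltW d0) ?(ltW l0) ?(ltW a0). Qed.
Let kK q : (0 <= k%:E * K1 q)%E. Proof. by rewrite mule_ge0// lee_fin. Qed.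

Let S2 y : \bar R := (\int[mu]_(q in `]0%R, 1%R[) (k%:E * K1 q * (bes (d * q) y l)%:E))%E.

Let mS2f : measurable_fun setT (fun w : R * R => (k%:E * K1 w.1 * (bes (d * w.1) w.2 l)%:E)%E).
Proof.
apply: emeasurable_funM; first by apply: emeasurable_funM => //; exact: (measurable_pair_fst mK1).
apply/measurable_EFinP; apply: measurable_bes => //.
exact: measurable_funM.
Qed.

Let swap : measurable_fun setT (fun w : R * R => (w.2, w.1)).
Proof. exact: measurable_fun_pair. Qed.

Let mS2 : measurable_fun setT S2.
Proof.
apply: (measurable_setI_integral (h := fun w : R * R => (k%:E * K1 w.2 * (bes (d * w.2) w.1 l)%:E)%E)) => //.
- exact: (measurableT_comp mS2f swap).
- by move=> w; rewrite mule_ge0// lee_fin bes_nneg.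
Qed.

Let S20 y : (0 <= S2 y)%E.
Proof. by apply: integral_ge0 => q _; rewrite mule_ge0// lee_fin bes_nneg. Qed.

Let mend : measurable_fun setT cells_end.
Proof.
apply: measurable_chain; first by apply: good_kstep; exact: msets_shift_set.
- by apply/measurable_EFinP; exact: measurable_killed.
- by move=> z; rewrite lee_fin killed_nneg.
Qed.

Let end0 z : (0 <= cells_end z)%E.
Proof.
apply: chain_ge0; first by apply: good_kstep; exact: msets_shift_set.
by move=> y; rewrite lee_fin killed_nneg.
Qed.

Let exitE y : 0 < y -> cells_exit y = (y%:E * S2 y)%E.
Proof.
move=> y0; rewrite /cells_exit (@exit_cell _ l d y _ (fun z => a%:E * bmass 1 a (v + d) z C1)%E)//.
- congr (_ * _)%E; apply: eq_integral => q; rewrite inE/= in_itv/= => /andP[q0 q1].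
  rewrite entranceZ//; last 3 first.
  + by rewrite lee_fin ltW.
  + exact: measurable_bmass_start.
  + by move=> z; exact: bmass_ge0.
  rewrite entrance_insert ?mulr_gt0 ?subr_gt0 ?(ltW a0)//.
  rewrite (_ : v + d - d * (1 - q) = v + d * q); last by ring.
  by rewrite muleA -EFinM /k [RHS]muleAC -EFinM; congr (_%:E * _)%E; ring.
- by apply: emeasurable_funM => //; exact: measurable_bmass_start.
- by move=> z; rewrite mule_ge0 ?bmass_ge0// lee_fin ltW.
- by move=> z z0; rewrite /cells_end after_mass.
- by move=> z z0; rewrite /cells_end killed_term_chain_le0// gerDr.
Qed.

Let S3' z : \bar R := (\int[mu]_(q in `]0%R, 1%R[) (k%:E * K1 q * bmass (v + d * q) l (u + d) z (C ++ [:: (v, setT)])))%E.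

Let mC : msets (C ++ [:: (v, setT)]). Proof. by apply/msets_cat; split => //; split => //=; exact: measurableT. Qed.
Let pC s : path <%R s (unzip1 C) -> end_time s C < v -> path <%R s (unzip1 (C ++ [:: (v, setT)])).
Proof. by move=> h1 h2; rewrite /unzip1 map_cat cat_path h1/= h2. Qed.

Let midE z : 0 < z -> cells_mid z = (z%:E * S3' z)%E.
Proof.
move=> z0; rewrite /cells_mid (@killed_chain _ _ _ _ _ S2)//; last exact: pC.
congr (_ * _)%E; rewrite chain_integral//.
- apply: eq_integral => q _; rewrite chainZ//; last 3 first.
  + exact: good_bstep.
  + by apply/measurable_EFinP; exact: measurable_bes.
  + by move=> y; rewrite lee_fin bes_nneg.
  congr (_ * _)%E; rewrite /bmass; apply: eq_chain => y.
  by rewrite end_time_cat /end_time/= addrC addKr.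
- exact: good_bstep.
- by move=> q y; rewrite mule_ge0// lee_fin bes_nneg.
Qed.

Let mid0 z : z <= 0 -> cells_mid z = 0%E.
Proof.
move=> z0; rewrite /cells_mid; by case: (C) => [|e' C']; rewrite ?cat0s ?cat_cons; exact: killed_chain_le0.
Qed.

Let mbm (D : seq (R * set R)) : msets D -> measurable_fun setT (fun w : R * R => bmass (v + d * w.1) l (u + d) w.2 D).
Proof.
move=> mD; pose pc : seq (@pchain_step R R) := [seq ((fun=> e.1), e.2) | e <- bstep (u + d) D].
have cE q : inst q pc = bstep (u + d) D.
  by rewrite /inst /pc -map_comp -[RHS]map_id; apply: eq_map => -[].
have gpc : good_pchain pc.
  have := good_bstep (u + d) mD; rewrite /pc; elim: (bstep _ _) => [//|[k' A'] c' ih'] /= [mA' mk' k0' /ih' gc']; split => //.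
  have h : measurable_fun setT (fun u : (R * R) * R => (u.1.2, u.2)).
    by apply: measurable_fun_pair => //; exact: measurableT_comp.
  exact: (measurableT_comp mk' h).
pose f (q z : R) : \bar R := (bes (v + d * q - end_time (u + d) D) z l)%:E.
have mf : measurable_fun setT (fun w : R * R => f w.1 w.2).
  by apply/measurable_EFinP; apply: measurable_bes => //; exact: measurable_funB.
have f0 q z : (0 <= f q z)%E by rewrite lee_fin bes_nneg.
apply: eq_measurable_fun (measurable_pchain gpc mf f0) => w _.
by rewrite /bmass -(cE w.1).
Qed.

Let mS3f D : msets D -> measurable_fun setT (fun w : R * R => (k%:E * K1 w.1 * bmass (v + d * w.1) l (u + d) w.2 D)%E).
Proof.
move=> mD; apply: emeasurable_funM; last exact: mbm.
by apply: emeasurable_funM => //; exact: (measurable_pair_fst mK1).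
Qed.

Let mS3' : measurable_fun setT S3'.
Proof.
apply: (measurable_setI_integral (h := fun w : R * R => (k%:E * K1 w.2 * bmass (v + d * w.2) l (u + d) w.1 (C ++ [:: (v, setT)]))%E)) => //.
- exact: (measurableT_comp (mS3f mC) swap).
- by move=> w; rewrite mule_ge0// bmass_ge0.
Qed.

Let S3'0 z : (0 <= S3' z)%E.
Proof. by apply: integral_ge0 => q _; rewrite mule_ge0// bmass_ge0. Qed.

Let J (r : R) : \bar R := (\int[mu]_(q in `]0%R, 1%R[) (k%:E * K1 q * K2 r q))%E.

Let mJ : measurable_fun setT J.
Proof.
apply: (measurable_setI_integral (h := fun w : R * R => (k%:E * K1 w.2 * K2 w.1 w.2)%E)) => //.
- apply: emeasurable_funM => //; apply: emeasurable_funM => //; exact: (measurable_pair_snd mK1).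
- by move=> w; rewrite mule_ge0.
Qed.

Let J0 r : (0 <= J r)%E. Proof. by apply: integral_ge0 => q _; rewrite mule_ge0. Qed.

(** The entrance from 0 and the free position at [v] are both absorbed by Chapman-Kolmogorov, which
    leaves the bridge between the two exact times. *)
Let entS3 r : 0 < r < 1 -> entrance (d * (1 - r)) S3' = J r.
Proof.
move=> /andP[r0 r1]; rewrite entrance_integral//; last 2 first.
- exact: mS3f.
- by move=> q z; rewrite mule_ge0// bmass_ge0.
apply: eq_integral => q; rewrite inE/= in_itv/= => /andP[q0 q1].
rewrite entranceZ//; last 2 first.
- exact: measurable_bmass_start.
- by move=> z; exact: bmass_ge0.
have eC s : end_time s (C ++ [:: (v, setT)]) = v by rewrite end_time_cat.
congr (_ * _)%E; rewrite entrance_insert ?mulr_gt0 ?subr_gt0 ?(ltW l0)//; last 2 first.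
- exact: pC.
- by rewrite eC ltrDl mulr_gt0.
rewrite (_ : u + d - d * (1 - r) = u + d * r); last by ring.
have du : u + d * r < u + d by rewrite ltrD2l gtr_pMr.
have pr : path <%R (u + d * r) (unzip1 C).
  by case: (unzip1 C) p => [//|t' c'] /= /andP[h ->]; rewrite (lt_trans du h).
have er : end_time (u + d * r) C < v.
  by case: (C) e => [/=|//]; rewrite /end_time/=; apply: lt_trans.
rewrite (@bmass_insert _ _ _ _ _ v C [::]) ?cats0 ?eC//.
- exact: pC.
- by rewrite ltrDl mulr_gt0.
- exact: ltW.
Qed.

Let S4 x : \bar R := (\int[mu]_(r in `]0%R, 1%R[) ((d / 2)%:E * J r * (bes (d * r) x 0)%:E))%E.

Let dJ r : (0 <= (d / 2)%:E * J r)%E. Proof. by rewrite mule_ge0// lee_fin divr_ge0// ltW. Qed.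

Let hitE x : 0 < x -> cells_hit x = (x%:E * S4 x)%E.
Proof.
move=> x0; rewrite /cells_hit (@hit_cell _ d x _ S3')//.
congr (_ * _)%E; apply: eq_integral => r; rewrite inE/= in_itv/= => /entS3 ->.
by rewrite EFinM muleAC.
Qed.

Lemma cells_massE : cells_mass = (a%:E * \int[mu]_(r in `]0%R, 1%R[)
  ((d / 2)%:E * (\int[mu]_(q in `]0%R, 1%R[) (k%:E * K1 q * K2 r q)) * K3 r))%E.
Proof.
have mF : measurable_fun setT (fun w : R * R => ((d / 2)%:E * J w.1 * (bes (d * w.1) w.2 0)%:E)%E).
  apply: emeasurable_funM; first by apply: emeasurable_funM => //; exact: (measurable_pair_fst mJ).
  by apply/measurable_EFinP; apply: measurable_bes => //; exact: measurable_funM.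
have F0 r y : (0 <= (d / 2)%:E * J r * (bes (d * r) y 0)%:E)%E by rewrite mule_ge0// lee_fin bes_nneg.
have mC2 : msets (C2 ++ [:: (u, setT)]) by apply/msets_cat; split => //; split => //=; exact: measurableT.
have pC2 : path <%R 0 (unzip1 (C2 ++ [:: (u, setT)])).
  by rewrite /unzip1 map_cat cat_path p2/= andbT.
rewrite /cells_mass (@killed_chain _ _ _ _ _ S4)//; last 2 first.
- apply: (measurable_setI_integral (h := fun w : R * R => ((d / 2)%:E * J w.2 * (bes (d * w.2) w.1 0)%:E)%E)) => //.
  exact: (measurableT_comp mF swap).
- by move=> z; apply: integral_ge0 => r _.
congr (_ * _)%E; rewrite chain_integral//; last exact: good_bstep.
apply: eq_integral => r; rewrite inE/= in_itv/= => /andP[r0 r1].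
rewrite chainZ//; last 3 first.
- exact: good_bstep.
- by apply/measurable_EFinP; exact: measurable_bes.
- by move=> y; rewrite lee_fin bes_nneg.
have -> : K3 r = bmass (u + d * r) 0 0 a (C2 ++ [:: (u, setT)]).
  rewrite /K3 bmass_insert ?cats0 ?(ltW a0)//.
  by rewrite end_time_cat /end_time/= ltrDl mulr_gt0.
congr (_ * _)%E; rewrite /bmass; apply: eq_chain => y.
by rewrite end_time_cat /end_time/= addrC addKr.
Qed.

End cell_mass.

(** * Integration over the level of the start *)

Section cells_integral.
Context {R : realType}.
Notation mu := (@lebesgue_measure R).
Implicit Types (s t x y z b : R) (c : seq (R * set R)).

Lemma path_shift_time b s c : path <%R (s + b) (unzip1 (shift_time b c)) = path <%R s (unzip1 c).
Proof. by elim: c s => [//|[t A] c ih] s /=; rewrite ih ltrD2r. Qed.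

Lemma shift_timeD b b' c : shift_time b (shift_time b' c) = shift_time (b' + b) c.
Proof.
by rewrite /shift_time -map_comp; apply: eq_map => -[t A] /=; rewrite addrA.
Qed.

(** On the time circle the end of the shifted path, at height [a] above [l], and its start, at [a],
    are the same point: integrating over it is Chapman-Kolmogorov at time 1, and the two masses
    become one bridge from [s] to [l + 1]. *)
Lemma bmass_join l s y c1 c2 : path <%R s (unzip1 c1) -> end_time s c1 < 1 -> path <%R 0 (unzip1 c2) ->
  end_time 0 c2 < l -> msets c1 -> msets c2 -> 0 <= y ->
  (\int[mu]_a ((bessel3_ref a)%:E * (bmass 1 a s y c1 * bmass l 0 0 a c2)) =
   bmass (l + 1) 0 s y (c1 ++ shift_time 1 c2))%E.
Proof.
move=> p1 e1 p2 e2 m1 m2 y0.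
have ms2 : msets (shift_time 1 c2) by exact: msets_shift_time.
rewrite -(@bmass_insert _ _ _ _ _ 1)//; last 3 first.
- by rewrite /unzip1 map_cat cat_path p1/= e1/= -[X in path _ X]add0r path_shift_time.
- rewrite end_time_cat [end_time _ _](_ : _ = end_time (0 + 1) (shift_time 1 c2)) ?add0r//.
  by rewrite -{1}[1]add0r end_time_shift ltrD2r.
- by apply/msets_cat; split.
rewrite bmass_cat.
pose F a z := ((bessel3_ref a)%:E * bmass l 0 0 a c2 * (bes (1 - end_time s c1) z a)%:E)%E.
rewrite (@eq_chain _ _ _ (fun z => \int[mu]_(a in setT) F a z)%E); last first.
  move=> z; rewrite /bmass /=; apply: eq_integral => a _.
  rewrite -[chain _ _ _]/(bmass (l + 1) 0 1 a (shift_time 1 c2)).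
  rewrite (_ : bmass (l + 1) 0 1 a _ = bmass l 0 0 a c2); last first.
    by rewrite -[RHS](bmass_shift_time 1) add0r.
  by rewrite /F EFinM (mule.[ACl (2*3)*1])%AC.
have mb : measurable_fun setT (fun a => bmass l 0 0 a c2) by exact: measurable_bmass_start.
have mr : measurable_fun setT (fun a => (bessel3_ref a)%:E * bmass l 0 0 a c2)%E.
  by apply: emeasurable_funM => //; apply/measurable_EFinP; exact: measurable_bessel3_ref.
have r0 a : (0 <= (bessel3_ref a)%:E * bmass l 0 0 a c2)%E.
  by rewrite mule_ge0 ?bmass_ge0// lee_fin bessel3_ref_ge0.
rewrite chain_integral//; last 3 first.
- exact: good_bstep.
- apply: emeasurable_funM; first exact: (measurable_pair_fst mr).
  by apply/measurable_EFinP; exact: measurable_bes.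
- by move=> a z; rewrite mule_ge0// lee_fin bes_nneg.
apply: eq_integral => a _; rewrite chainZ//.
- by rewrite -/(bmass 1 a s y c1) -muleA [(bmass l _ _ _ _ * _)%E]muleC.
- exact: good_bstep.
- by apply/measurable_EFinP; exact: measurable_bes.
- by move=> z; rewrite lee_fin bes_nneg.
Qed.

Variables (l d u z0 : R) (c2 c c1 : seq (R * set R)).
Hypotheses (l0 : 0 < l) (d0 : 0 < d).
Hypotheses (m1 : msets c1) (m : msets c) (m2 : msets c2).
Hypotheses (p : path <%R d (unzip1 c)) (e : end_time d c < z0).
Hypotheses (p1 : path <%R d (unzip1 c1)) (e1 : end_time d c1 < 1 - (u + z0)).
Hypotheses (p2 : path <%R (1 - (u + z0)) (unzip1 c2)) (e2 : end_time (1 - (u + z0)) c2 < 1 - z0).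

(** Times in [c] count from [u], those in [c1] and [c2] from [v]. The times of [c2] lie beyond the
    end of the bridge and are read from its start on, whence the shift by [v - 1]. *)
Let v := u + z0.
Let C := shift_time u c.
Let C1 := shift_time v c1.
Let C2 := shift_time (v - 1) c2.

Let mC : msets C. Proof. exact: msets_shift_time. Qed.
Let mC1 : msets C1. Proof. exact: msets_shift_time. Qed.
Let mC2 : msets C2. Proof. exact: msets_shift_time. Qed.

Let pC : path <%R (u + d) (unzip1 C). Proof. by rewrite addrC path_shift_time. Qed.
Let eC : end_time (u + d) C < v. Proof. by rewrite addrC end_time_shift [v]addrC ltrD2r. Qed.
Let pC1 : path <%R (v + d) (unzip1 C1). Proof. by rewrite addrC path_shift_time. Qed.
Let eC1 : end_time (v + d) C1 < 1.
Proof. by rewrite addrC end_time_shift -ltrBrDr. Qed.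
Let z2 : 0 = 1 - v + (v - 1). Proof. by ring. Qed.
Let pC2 : path <%R 0 (unzip1 C2). Proof. by rewrite z2 path_shift_time. Qed.
Let eC2 : end_time 0 C2 < u.
Proof. by rewrite z2 end_time_shift; move: e2; rewrite -/v /v; lra. Qed.

Lemma path_end_lt t t' y0 (D : seq (R * set R)) : t' <= t ->
  path <%R t (unzip1 D) -> end_time t D < y0 -> path <%R t' (unzip1 D) /\ end_time t' D < y0.
Proof.
move=> tt; case: D => [|e' D] /=; first by rewrite /end_time/= => _; split=> //; exact: le_lt_trans tt _.
by rewrite /end_time/= => /andP[h ->] h'; rewrite (le_lt_trans tt h).
Qed.

Let k : R := d ^+ 2 * l / 4.
Let k0 : 0 <= k. Proof. by rewrite divr_ge0// mulr_ge0 ?sqr_ge0// ltW. Qed.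
Let h (t : R * R * R) : \bar R := (k%:E * bmass (v + d * t.2) l (u + d * t.1.2) 0 C *
  ((bessel3_ref t.1.1)%:E * (bmass 1 t.1.1 (v + d * t.2) 0 C1 * bmass (u + d * t.1.2) 0 0 t.1.1 C2)))%E.

Let mlin d1 (T1 : measurableType d1) (g : T1 -> R) (b : R) : measurable_fun setT g ->
  measurable_fun setT (fun w => b + d * g w).
Proof. by move=> mg; apply: measurable_funD => //; exact: measurable_funM. Qed.

Let m11 : measurable_fun setT (fun t : R * R * R => t.1.1). Proof. exact: measurableT_comp. Qed.
Let m12 : measurable_fun setT (fun t : R * R * R => t.1.2). Proof. exact: measurableT_comp. Qed.
Let mh : measurable_fun setT h.
Proof.
apply: emeasurable_funM.
  by apply: emeasurable_funM => //; apply: measurable_bmass => //; exact: mlin.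
apply: emeasurable_funM.
  by apply/measurable_EFinP; exact: (measurableT_comp measurable_bessel3_ref m11).
apply: emeasurable_funM; apply: measurable_bmass_all => //; exact: mlin.
Qed.

Let h0 (t : R * R * R) : (0 <= h t)%E.
Proof. by rewrite !mule_ge0 ?bmass_ge0// ?lee_fin ?bessel3_ref_ge0. Qed.

Let m3 : measurable_fun setT (fun t : R * R => \int[mu]_(q in `]0%R, 1%R[) h (t, q))%E.
Proof. exact: measurable_setI_integral. Qed.

Let I0 (D : set R) (t : R * R) : (0 <= \int[mu]_(q in D) h (t, q))%E.
Proof. exact: integral_ge0. Qed.

Let cells_mass_h a : 0 < a -> cells_mass l d u v a C2 C C1 =
  (\int[mu]_(r in `]0%R, 1%R[) \int[mu]_(q in `]0%R, 1%R[) h (a, r, q))%E.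
Proof.
move=> a0.
rewrite cells_massE// -ge0_integralZl//; last 3 first.
- apply: measurable_funTS; apply: emeasurable_funM; last by apply: measurable_bmass => //; exact: mlin.
  apply: emeasurable_funM => //.
  apply: (measurable_setI_integral (h := fun w : R * R => ((d * l / 2 * a)%:E * bmass 1 a (v + d * w.2) 0 C1 * bmass (v + d * w.2) l (u + d * w.1) 0 C)%E)) => //.
    apply: emeasurable_funM; last by apply: measurable_bmass => //; exact: mlin.
    by apply: emeasurable_funM => //; apply: measurable_bmass => //; exact: mlin.
  by move=> w; rewrite !mule_ge0 ?bmass_ge0// lee_fin !mulr_ge0 ?(ltW d0) ?(ltW l0) ?(ltW a0) ?invr_ge0.
- move=> r _; rewrite !mule_ge0 ?bmass_ge0// ?lee_fin ?divr_ge0 ?(ltW d0)//.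
  apply: integral_ge0 => q _.
  by rewrite !mule_ge0 ?bmass_ge0// lee_fin !mulr_ge0 ?(ltW d0) ?(ltW l0) ?(ltW a0) ?invr_ge0.
- by rewrite lee_fin ltW.
apply: eq_integral => r _; rewrite muleA muleA -EFinM muleAC -ge0_integralZl//.
- apply: eq_integral => q _; rewrite /h/= /bessel3_ref a0.
  rewrite [LHS](mule.[AC (2*(2*1)) ((1*3)*(5*(4*2)))])%AC [RHS](mule.[AC (2*(1*2)) ((1*3)*(2*(4*5)))])%AC.
  by rewrite -!EFinM; congr (_%:E * _)%E; rewrite /k; field.
- apply: measurable_funTS; apply: emeasurable_funM; last by apply: measurable_bmass => //; exact: mlin.
  by apply: emeasurable_funM => //; apply: measurable_bmass => //; exact: mlin.
- move=> q _; rewrite !mule_ge0 ?bmass_ge0// lee_fin; apply: mulr_ge0; rewrite ?(ltW a0)//.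
  by rewrite divr_ge0// mulr_ge0// ltW.
- by rewrite mule_ge0 ?bmass_ge0// lee_fin mulr_ge0 ?(ltW a0)// divr_ge0// ltW.
Qed.

Lemma measurable_cells_mass : measurable_fun (`]0%R, +oo[ : set R) (fun a => cells_mass l d u v a C2 C C1).
Proof.
apply: (eq_measurable_fun (fun a => \int[mu]_(r in `]0%R, 1%R[) \int[mu]_(q in `]0%R, 1%R[) h (a, r, q))%E).
  by move=> a; rewrite inE/= in_itv/= andbT => /cells_mass_h.
apply: measurable_funTS.
exact: (measurable_setI_integral (h := fun t : R * R => (\int[mu]_(q in `]0%R, 1%R[) h (t, q))%E)).
Qed.

(** The factors [a] of the two ends make up the reference density, so [bmass_join] applies. The
    constant is [d / 2] from the dip times [d * l / 2] from the exit. *)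
Lemma cells_mass_integral :
  (\int[mu]_(a in `]0%R, +oo[) cells_mass l d u v a C2 C C1 =
   (d ^+ 2 * l / 4)%:E * \int[mu]_(r in `]0%R, 1%R[) \int[mu]_(q in `]0%R, 1%R[)
     (bmass (z0 + d * q) l (d * r) 0 c * bmass (1 - z0 + d * r) 0 (d * q) 0 (c1 ++ c2)))%E.
Proof.
have mbm : measurable_fun setT (fun w : R * R => bmass (z0 + d * w.2) l (d * w.1) 0 c *
    bmass (1 - z0 + d * w.1) 0 (d * w.2) 0 (c1 ++ c2))%E.
  by apply: emeasurable_funM; apply: measurable_bmass => //; [exact: mlin|exact: measurable_funM|
    apply/msets_cat|exact: mlin|exact: measurable_funM].
have mpr d1 (T1 : measurableType d1) (r : R) : measurable_fun setT (fun w : T1 => (r, w)).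
  exact: measurable_fun_pair.
have bm0 r q : (0 <= bmass (z0 + d * q) l (d * r) 0 c * bmass (1 - z0 + d * r) 0 (d * q) 0 (c1 ++ c2))%E.
  by rewrite mule_ge0// bmass_ge0//; apply/msets_cat.
transitivity (\int[mu]_(a in `]0%R, +oo[) \int[mu]_(r in `]0%R, 1%R[) \int[mu]_(q in `]0%R, 1%R[) h (a, r, q))%E.
  by apply: eq_integral => a; rewrite inE/= in_itv/= andbT => /cells_mass_h.
rewrite (ge0_integral_exchange (measurable_itv _) (measurable_itv _) m3)// -ge0_integralZl//; last 2 first.
- by apply: measurable_funTS; apply: (measurable_setI_integral (h := fun w : R * R => (bmass (z0 + d * w.2) l (d * w.1) 0 c *
    bmass (1 - z0 + d * w.1) 0 (d * w.2) 0 (c1 ++ c2))%E)) => //.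
- by move=> r _; apply: integral_ge0.
apply: eq_integral => r; rewrite inE/= in_itv/= => /andP[r0 r1].
have m4 : measurable_fun setT (fun t : R * R => h (t.1, r, t.2)).
  have hp : measurable_fun setT (fun t : R * R => (t.1, r, t.2)).
    by apply: measurable_fun_pair => //; exact: measurable_fun_pair.
  exact: (measurableT_comp mh hp).
rewrite (ge0_integral_exchange (measurable_itv _) (measurable_itv _) m4)// -ge0_integralZl//; last first.
  by apply: measurable_funTS; exact: (measurableT_comp mbm (mpr _ _ r)).
apply: eq_integral => q; rewrite inE/= in_itv/= => /andP[q0 q1].
rewrite /h/= ge0_integralZl//; last 3 first.
- apply: measurable_funTS; apply: emeasurable_funM.
    by apply/measurable_EFinP; exact: measurable_bessel3_ref.
  by apply: emeasurable_funM; apply: measurable_bmass_all.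
- by move=> a _; rewrite !mule_ge0 ?bmass_ge0// lee_fin bessel3_ref_ge0.
- by rewrite mule_ge0 ?bmass_ge0.
rewrite -muleA; congr (_ * (_ * _))%E.
  by rewrite -[RHS](bmass_shift_time u) /v; congr bmass; ring.
rewrite [LHS](_ : _ = \int[mu]_a ((bessel3_ref a)%:E * (bmass 1 a (v + d * q) 0 C1 * bmass (u + d * r) 0 0 a C2)))%E; last first.
  rewrite [LHS]integral_mkcond; apply: eq_integral => a _.
  rewrite /patch mem_setE in_itv/= andbT; case: ifPn => // a0.
  by rewrite /bessel3_ref (negbTE a0) mul0e.
have vd : v + d * q <= v + d by rewrite lerD2l ger_pMr// ltW.
have [pv ev] := path_end_lt vd pC1 eC1.
rewrite bmass_join//; last by apply: lt_trans eC2 _; rewrite ltrDl mulr_gt0.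
rewrite -[RHS](bmass_shift_time v) /C2 shift_timeD subrK /shift_time map_cat.
by congr bmass; rewrite /v; ring.
Qed.

End cells_integral.

(** * Floors of a cell and the kernels across its two short steps *)

Section cell_floors.
Context {R : realType}.
Notation mu := (@lebesgue_measure R).
Implicit Types (s t x y z b e : R) (c : seq (R * set R)) (f : R -> R).

Definition with_floor b c : seq (R * R * set R) := [seq (p.1, b, p.2) | p <- c].

Lemma ftimes_with_floor b c : ftimes (with_floor b c) = unzip1 c.
Proof. by rewrite /ftimes -map_comp. Qed.

Lemma fend_with_floor b s c : fend s (with_floor b c) = end_time s c.
Proof. by rewrite /fend ftimes_with_floor. Qed.

Lemma fend_cat s (c1 c2 : seq (R * R * set R)) : fend s (c1 ++ c2) = fend (fend s c1) c2.
Proof. by rewrite /fend /ftimes map_cat last_cat. Qed.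

Lemma fsets_with_floor b c : fsets (with_floor b c) <-> msets c.
Proof. by elim: c => [//|p c ih] /=; rewrite ih. Qed.

Lemma fsets_cat (c1 c2 : seq (R * R * set R)) : fsets c1 -> fsets c2 -> fsets (c1 ++ c2).
Proof. by elim: c1 => [//|p c ih] /= [? /ih h] /h. Qed.

Lemma fstep_with_floor s b c (c' : seq (R * R * set R)) :
  fstep (@killed R) s (with_floor b c ++ c') = kstep b s c ++ fstep (@killed R) (end_time s c) c'.
Proof. by elim: c s => [//|[t A] c ih] s /=; rewrite ih. Qed.

Fixpoint stays_prefix f s (c : seq (R * R * set R)) : Prop :=
  if c is (t, b1, A) :: c' then [/\ forall u, s <= u <= t -> b1 < f u, A (f t) & stays_prefix f t c']
  else True.

Lemma stays_cat f s b (c1 c2 : seq (R * R * set R)) : stays f s b (c1 ++ c2) <-> stays_prefix f s c1 /\ stays f (fend s c1) b c2.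
Proof.
elim: c1 s => [|[[t b1] A] c1 ih] s /=; first by tauto.
by split=> [[h1 h2 /ih[h3 h4]]|[[h1 h2 h3] h4]]; split => //; apply/ih.
Qed.

Lemma stays_prefix_with_floor f s b c : path <%R s (unzip1 c) -> c <> [::] ->
  stays_prefix f s (with_floor b c) ->
  (forall t, s <= t <= end_time s c -> b < f t) /\ forall p, List.In p c -> p.2 (f p.1).
Proof.
elim: c s => [//|[t A] c ih] s /= /andP[st pc] _ [h1 h2].
case: c ih pc => [|p c] ih pc h3.
  by split => [t' /h1//|q [<-//|]].
have [||h4 h5] := ih t _ _ h3 => //.
split=> [t' /andP[st' t'e]|q [<-//|/h5//]].
by have [tt|tt] := leP t' t; [apply: h1; rewrite st'|apply: h4; rewrite (ltW tt)].
Qed.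

Lemma stays_with_floor f s b c : path <%R s (unzip1 c) -> stays f s b (with_floor b c) ->
  (forall t, s <= t <= 1 -> b < f t) /\ forall p, List.In p c -> p.2 (f p.1).
Proof.
elim: c s => [|[t A] c ih] s /=; first by move=> _ h; split.
move=> /andP[st pc] [h1 h2 /(ih _ pc)[h3 h4]]; split=> [t' /andP[st' t'1]|q [<-//|/h4//]].
by have [tt|tt] := leP t' t; [apply: h1; rewrite st'|apply: h3; rewrite (ltW tt)].
Qed.

Definition translate a (c : seq (R * R * set R)) : seq (R * R * set R) :=
  [seq (p.1.1, p.1.2 + a, [set y | p.2 (y - a)]) | p <- c].

Lemma ftimes_translate a (c : seq (R * R * set R)) : ftimes (translate a c) = ftimes c.
Proof. by rewrite /ftimes -map_comp. Qed.

Lemma fsets_translate a (c : seq (R * R * set R)) : fsets c -> fsets (translate a c).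
Proof.
elim: c => [//|[[t b] A] c ih] /= [mA /ih]; split => //.
have m : measurable_fun setT (fun y : R => y - a) by exact: measurable_funB.
by rewrite -[X in measurable X]setTI; exact: (m measurableT).
Qed.

Lemma stays_translate a f s b (c : seq (R * R * set R)) :
  stays (fun t => f t + a) s (b + a) (translate a c) <-> stays f s b c.
Proof.
elim: c s => [|[[t b1] A] c ih] s /=.
  by split=> h t /h; rewrite ltrD2r.
by rewrite addrK; split=> -[h1 h2 /ih h3]; split => // t' /h1; rewrite ltrD2r.
Qed.

Lemma fmass_translate a b y s x (c : seq (R * R * set R)) : fsets c ->
  fmass (@killed R) (b + a) (y + a) s (x + a) (translate a c) = fmass (@killed R) b y s x c.
Proof.
have kD b' t x' y' : killed (b' + a) t (x' + a) (y' + a) = killed b' t x' y'.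
  rewrite /killed !ltrD2r; congr (if _ then _ else _).
  by congr (gauss _ _ - gauss _ _); ring.
rewrite /fmass {1}/fend ftimes_translate -/(fend s c); move: (fend s c) => e.
elim: c s x => [|[[t b1] A] c ih] s x /=; first by rewrite kD.
move=> [mA mc]; have mA' : measurable [set y | A (y - a)].
  by have [] : fsets (translate a [:: (t, b1, A)]) by exact: fsets_translate.
have mc' := fsets_translate a mc.
have gk := good_fstep t (@good_killed R) mc'.
rewrite (ge0_integral_preimageD a)//.
- rewrite (_ : [set z | [set y | A (y - a)] (z + a)] = A); last first.
    by apply/seteqP; split=> z /=; rewrite addrK.
  by apply: eq_integral => z _; rewrite kD ih.
- apply: emeasurable_funM; first by apply/measurable_EFinP; exact: measurable_killed.
  apply: measurable_chain => //; first exact: measurable_kterm good_killed.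
  by move=> z; rewrite lee_fin killed_nneg.
- move=> z; rewrite mule_ge0 ?lee_fin ?killed_nneg// chain_ge0// => z'.
  by rewrite lee_fin killed_nneg.
Qed.

Variables (l d u v a : R) (C2 C C1 : seq (R * set R)).
Hypotheses (l0 : 0 < l) (d0 : 0 < d).
Hypotheses (m1 : msets C1) (m : msets C) (m2 : msets C2).
Hypotheses (p1 : path <%R (v + d) (unzip1 C1)) (e1 : end_time (v + d) C1 < 1).
Hypotheses (p : path <%R (u + d) (unzip1 C)) (e : end_time (u + d) C < v).
Hypotheses (p2 : path <%R 0 (unzip1 C2)) (e2 : end_time 0 C2 < u).

Definition cell_floors (f1 f2 : R) : seq (R * R * set R) :=
  with_floor 0 (C2 ++ [:: (u, setT)]) ++ (u + d, f1, setT) ::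
  with_floor 0 (C ++ [:: (v, setT)]) ++ (v + d, f2, setT) :: with_floor l (shift_set l C1).

Definition kernels_chain k1 k2 : seq (@chain_step R) :=
  kstep 0 0 (C2 ++ [:: (u, setT)]) ++ (k1, setT) :: kstep 0 (u + d) (C ++ [:: (v, setT)]) ++
  (k2, setT) :: kstep l (v + d) (shift_set l C1).

(** Only the kernels across [[u, u + d]] and [[v, v + d]] vary. The mass is additive in each, which
    makes differences of floor probabilities computable. *)
Definition two_mass k1 k2 : \bar R :=
  chain (kernels_chain k1 k2) (fun y => (killed l (1 - end_time (v + d) C1) y (a + l))%:E) a.

Let eC2 : end_time 0 (C2 ++ [:: (u, setT)]) = u. Proof. by rewrite end_time_cat. Qed.
Let eC : end_time (u + d) (C ++ [:: (v, setT)]) = v. Proof. by rewrite end_time_cat. Qed.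
Let mC2 : msets (C2 ++ [:: (u, setT)]).
Proof. by apply/msets_cat; split => //; split => //=; exact: measurableT. Qed.
Let mC : msets (C ++ [:: (v, setT)]).
Proof. by apply/msets_cat; split => //; split => //=; exact: measurableT. Qed.
Let mC1 : msets (shift_set l C1). Proof. exact: msets_shift_set. Qed.
Let pC2 : path <%R 0 (unzip1 (C2 ++ [:: (u, setT)])).
Proof. by rewrite /unzip1 map_cat cat_path p2/= e2. Qed.
Let pC : path <%R (u + d) (unzip1 (C ++ [:: (v, setT)])).
Proof. by rewrite /unzip1 map_cat cat_path p/= e. Qed.
Let unzip1_shift : unzip1 (shift_set l C1) = unzip1 C1.
Proof. by rewrite /unzip1 /shift_set -map_comp. Qed.
Let ud : u < u + d. Proof. by rewrite ltrDl. Qed.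
Let vd : v < v + d. Proof. by rewrite ltrDl. Qed.

Let fend_floors (f1 f2 : R) : fend 0 (cell_floors f1 f2) = end_time (v + d) C1.
Proof.
rewrite /cell_floors fend_cat [fend _ (_ :: _)](_ : _ = fend (u + d) (with_floor 0 (C ++ [:: (v, setT)]) ++ (v + d, f2, setT) :: with_floor l (shift_set l C1)))//.
rewrite fend_cat [LHS](_ : _ = fend (v + d) (with_floor l (shift_set l C1)))//.
by rewrite fend_with_floor end_time_shift_set.
Qed.

Lemma ftimes_ok_cell_floors (f1 f2 : R) : ftimes_ok 0 (cell_floors f1 f2).
Proof.
rewrite /ftimes_ok fend_floors e1 andbT /ftimes /cell_floors map_cat cat_path.
rewrite -!/(ftimes _) ftimes_with_floor pC2/= -/(end_time 0 _) eC2 ud/=.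
rewrite /ftimes map_cat cat_path -!/(ftimes _) ftimes_with_floor pC/= -/(end_time _ _) eC vd/=.
by rewrite -/(ftimes _) ftimes_with_floor unzip1_shift.
Qed.

Lemma fsets_cell_floors (f1 f2 : R) : fsets (cell_floors f1 f2).
Proof.
apply: fsets_cat; first exact/fsets_with_floor.
split=> /=; first exact: measurableT.
apply: fsets_cat; first exact/fsets_with_floor.
by split=> /=; [exact: measurableT|exact/fsets_with_floor].
Qed.

Lemma fmass_cell_floors (f1 f2 : R) :
  fmass (@killed R) l (a + l) 0 a (cell_floors f1 f2) = two_mass (killed f1 d) (killed f2 d).
Proof.
rewrite /fmass fend_floors /cell_floors fstep_with_floor eC2 /=.
rewrite fstep_with_floor eC /= [u + d]addrC addrK [v + d]addrC addrK [d + u]addrC [d + v]addrC.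
by rewrite -[with_floor l _]cats0 fstep_with_floor /= cats0.
Qed.

Definition good_kernel2 (k : R -> R -> R) :=
  measurable_fun setT (fun w : R * R => k w.1 w.2) /\ forall x z, 0 <= k x z.

Let term y : \bar R := (killed l (1 - end_time (v + d) C1) y (a + l))%:E.
Let mterm : measurable_fun setT term.
Proof. by apply/measurable_EFinP; exact: measurable_killed. Qed.
Let term0 y : (0 <= term y)%E. Proof. by rewrite lee_fin killed_nneg. Qed.
Let g3 := good_kstep l (v + d) mC1.
Let g2 := good_kstep 0 (u + d) mC.
Let g1 := good_kstep 0 0 mC2.

Lemma good_kernels_chain k1 k2 : good_kernel2 k1 -> good_kernel2 k2 -> good_chain (kernels_chain k1 k2).
Proof.
move=> [mk1 k10] [mk2 k20]; apply: good_chain_cat => //; split => //.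
exact: good_chain_cat.
Qed.

Lemma two_mass_ge0 k1 k2 : good_kernel2 k1 -> good_kernel2 k2 -> (0 <= two_mass k1 k2)%E.
Proof. by move=> *; apply: chain_ge0 => //; exact: good_kernels_chain. Qed.

Let tail2 k2 := (k2, setT) :: kstep l (v + d) (shift_set l C1).

Lemma two_massDr k1 k2 k2' : good_kernel2 k1 -> good_kernel2 k2 -> good_kernel2 k2' ->
  (two_mass k1 (fun x y => k2 x y + k2' x y)%R = two_mass k1 k2 + two_mass k1 k2')%E.
Proof.
move=> [mk1 k10] [mk2 k20] [mk2' k20'].
pose c := kstep 0 0 (C2 ++ [:: (u, setT)]) ++ (k1, setT) :: kstep 0 (u + d) (C ++ [:: (v, setT)]).
have E k : two_mass k1 k = chain c (chain (tail2 k) term) a.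
  by rewrite /c -chain_cat -catA.
have gc : good_chain c by exact: good_chain_cat.
rewrite !E -chainD//.
- by apply: eq_chain => x; rewrite /tail2 chain_kernelD.
- exact: measurable_chain.
- exact: measurable_chain.
- by move=> z; exact: chain_ge0.
- by move=> z; exact: chain_ge0.
Qed.

Lemma two_massDl k1 k1' k2 : good_kernel2 k1 -> good_kernel2 k1' -> good_kernel2 k2 ->
  (two_mass (fun x y => k1 x y + k1' x y)%R k2 = two_mass k1 k2 + two_mass k1' k2)%E.
Proof.
move=> [mk1 k10] [mk1' k10'] [mk2 k20].
pose c := kstep 0 0 (C2 ++ [:: (u, setT)]).
pose c' := kstep 0 (u + d) (C ++ [:: (v, setT)]) ++ tail2 k2.
have gc' : good_chain c' by exact: good_chain_cat.
have E k : two_mass k k2 = chain c (chain ((k, setT) :: c') term) a.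
  by rewrite /two_mass /kernels_chain chain_cat.
rewrite !E -chainD//.
- by apply: eq_chain => x; rewrite chain_kernelD.
- exact: measurable_chain.
- exact: measurable_chain.
- by move=> z; exact: chain_ge0.
- by move=> z; exact: chain_ge0.
Qed.

Lemma two_massZl (b : R) k1 k2 : 0 <= b -> good_kernel2 k1 -> good_kernel2 k2 ->
  (two_mass (fun x y => b * k1 x y)%R k2 = b%:E * two_mass k1 k2)%E.
Proof.
move=> b0 [mk1 k10] [mk2 k20].
pose c := kstep 0 0 (C2 ++ [:: (u, setT)]).
pose c' := kstep 0 (u + d) (C ++ [:: (v, setT)]) ++ tail2 k2.
have gc' : good_chain c' by exact: good_chain_cat.
have E k : two_mass k k2 = chain c (chain ((k, setT) :: c') term) a.
  by rewrite /two_mass /kernels_chain chain_cat.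
have mc' : measurable_fun setT (chain c' term) by exact: measurable_chain.
rewrite !E -chainZ//.
- apply: eq_chain => x /=; rewrite -ge0_integralZl//.
  + by apply: eq_integral => z _; rewrite EFinM muleA.
  + apply: emeasurable_funM => //; apply/measurable_EFinP.
    exact: (measurable_section (f := fun w : R * R => k1 w.1 w.2) x mk1).
  + by move=> z _; rewrite mule_ge0 ?lee_fin// chain_ge0.
- exact: measurable_chain.
- by move=> z; exact: chain_ge0.
Qed.

Lemma two_mass_cells : two_mass (hit_kernel d) (exit_kernel l d) = cells_mass l d u v a C2 C C1.
Proof. by rewrite /two_mass /kernels_chain chain_cat /= /cells_mass; apply: eq_chain => y; rewrite /cells_hit /=; apply: eq_integral => z _; rewrite chain_cat. Qed.

End cell_floors.

(** * Limits for shallow dips *)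

Section cell_limits.
Context {R : realType}.
Notation mu := (@lebesgue_measure R).
Implicit Types (s t x y z b e l d : R) (c : seq (R * set R)).

(** A derivative in the level, squeezed by the bounds [y / (1 + y) <= 1 - exp (- y) <= y]. *)
Lemma cvg_gauss_slope d x (e : nat -> R) : 0 < d -> 0 <= x -> (forall n, 0 < e n) ->
  e n @[n --> \oo] --> (0 : R) ->
  (e n)^-1 * (gauss d x - gauss d (x + 2 * e n)) @[n --> \oo] --> 2 * hit d x.
Proof.
move=> d0 x0 e0 ce; pose s n := 2 * (x + e n) / d.
have s0 n : 0 < s n by rewrite divr_gt0// mulr_gt0// ltr_wpDl.
have sE n : gauss d (x + 2 * e n) = gauss d x * expR (- (e n * s n)).
  rewrite !gaussE -[RHS]mulrA -expRD; congr (_ * expR _).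
  by rewrite /s; field; rewrite gt_eqF.
have cs : s n @[n --> \oo] --> 2 * x / d.
  apply: cvgM; last exact: cvg_cst.
  apply: cvgM; first exact: cvg_cst.
  by rewrite -[X in _ --> X]addr0; apply: cvgD => //; exact: cvg_cst.
have hE : 2 * hit d x = gauss d x * (2 * x / d) by rewrite /hit; field; rewrite gt_eqF.
apply: (@squeeze_cvgr _ _ _ _ (fun n => gauss d x * (s n / (1 + e n * s n))) (fun n => gauss d x * s n)).
- apply: nearW => n; have en := e0 n; have es : 0 < e n * s n by rewrite mulr_gt0.
  rewrite sE (_ : _^-1 * _ = gauss d x * ((1 - expR (- (e n * s n))) / e n)); last by ring.
  apply/andP; split; rewrite ler_wpM2l ?gauss_ge0//; last first.
    by rewrite ler_pdivrMr// [s n * e n]mulrC; have := expR_ge1Dx (- (e n * s n)); lra.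
  rewrite ler_pdivlMr// mulrAC ler_pdivrMr ?addr_gt0//.
  have h2 : (1 + e n * s n)^-1 * (1 + e n * s n) = 1 by rewrite mulVf// gt_eqF// addr_gt0.
  have h3 : (expR (e n * s n))^-1 * (1 + e n * s n) <= 1.
    by rewrite [leLHS]mulrC ler_pdivrMr ?expR_gt0// mul1r expR_ge1Dx.
  by rewrite expRN mulrBl mul1r [s n * e n]mulrC; lra.
- rewrite hE; apply: cvgM; first exact: cvg_cst.
  rewrite -[X in _ --> X]divr1; apply: cvgM => //; apply: cvgV; first exact: oner_neq0.
  rewrite -[X in _ --> X]addr0; apply: cvgD; first exact: cvg_cst.
  by rewrite -(mul0r (2 * x / d)); exact: cvgM.
- by rewrite hE; apply: cvgM => //; exact: cvg_cst.
Qed.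

(** At the floor the formula of images vanishes, so convergence from below includes starts and ends
    on the floor. *)
Lemma cvg_killed_below b d x y (e : nat -> R) : (forall n, 0 < e n) -> e n @[n --> \oo] --> (0 : R) ->
  killed (b - e n) d x y @[n --> \oo] --> killed b d x y.
Proof.
move=> e0 ce; have [/andP[bx b_y]|h] := boolP ((b <= x) && (b <= y)).
  have -> : killed b d x y = gauss d (y - x) - gauss d (y + x - 2 * b).
    rewrite /killed; case: ifPn => // /nandP[]; rewrite -leNgt => h; apply/esym.
      have -> : x = b by lra.
      by rewrite (_ : y + b - 2 * b = y - b) ?subrr//; ring.
    have -> : y = b by lra.
    by rewrite (_ : b + x - 2 * b = - (b - x)) ?gaussN ?subrr//; ring.
  rewrite (_ : (fun n => _) = fun n => gauss d (y - x) - gauss d (y + x - 2 * (b - e n))); last first.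
    by apply/funext => n; rewrite /killed ifT//; apply/andP; have := e0 n; split; lra.
  apply: cvgB; first exact: cvg_cst.
  rewrite gaussE; under eq_fun do rewrite gaussE.
  apply: cvgM; first exact: cvg_cst.
  apply: (cvgn_comp (@continuous_expR _ _)); apply: cvgN; apply: cvgM; last exact: cvg_cst.
  have h : y + x - 2 * (b - e n) @[n --> \oo] --> y + x - 2 * b.
    apply: cvgB; first exact: cvg_cst.
    apply: cvgM; first exact: cvg_cst.
    by rewrite -[X in _ --> X]subr0; apply: cvgB => //; exact: cvg_cst.
  exact: (cvgn_comp (@exprn_continuous _ 2 _) h).
have k0 b' : (b' < x) && (b' < y) = false -> killed b' d x y = 0 by rewrite /killed => ->.
have m0 : 0 < b - Num.min x y.
  by rewrite subr_gt0 gt_min; move: h; rewrite negb_and -!ltNge.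
have hb b' : Num.min x y < b' -> (b' < x) && (b' < y) = false.
  by rewrite gt_min => /orP[h'|h']; apply/negbTE; rewrite negb_and -!leNgt (ltW h') ?orbT.
rewrite k0; last by apply: hb; lra.
have h0 : (fun=> 0 : R) n @[n --> \oo] --> (0 : R) by exact: cvg_cst.
apply: cvg_trans h0; apply: near_eq_cvg.
by move: ce => /cvgr_lt/(_ _ m0); apply: filterS => n hn; rewrite k0//; apply: hb; lra.
Qed.

(** For nonnegative ends the two direct Gaussians cancel and only the image terms differ:
    [gauss d (x + y) - gauss d (x + y + 2 e)]. *)
Lemma cvg_hit_kernel d x y (e : nat -> R) : 0 < d -> (forall n, 0 < e n) ->
  e n @[n --> \oo] --> (0 : R) ->
  (e n)^-1 * (killed (- e n) d x y - killed 0 d x y) @[n --> \oo] --> hit_kernel d x y.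
Proof.
move=> d0 e0 ce; rewrite /hit_kernel; case: ifPn => [/andP[x0 y0]|h].
  rewrite (_ : (fun n => _) = fun n => (e n)^-1 * (gauss d (x + y) - gauss d (x + y + 2 * e n))).
    by apply: cvg_gauss_slope => //; rewrite addr_ge0.
  apply/funext => n; have en := e0 n; congr (_ * _).
  rewrite /killed ifT; last by apply/andP; split; lra.
  rewrite mulr0 subr0 [y + x]addrC mulrN opprK.
  case: ifPn => [_|/nandP[]]; first by ring.
    by rewrite -leNgt => h; rewrite (_ : x = 0) ?subr0 ?add0r ?subr0//; lra.
  by rewrite -leNgt => h; rewrite (_ : y = 0) ?sub0r ?gaussN ?subr0 ?addr0//; lra.
have m0 : 0 < - Num.min x y.
  by rewrite oppr_gt0 gt_min; move: h; rewrite negb_and -!ltNge.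
have h0 : (fun=> 0 : R) n @[n --> \oo] --> (0 : R) by exact: cvg_cst.
apply: cvg_trans h0; apply: near_eq_cvg.
have hb b' : Num.min x y < b' -> killed b' d x y = 0.
  by move=> h'; rewrite /killed ifF//; move: h'; rewrite gt_min => /orP[h'|h'];
    apply/negbTE; rewrite negb_and -!leNgt (ltW h') ?orbT.
by move: ce => /cvgr_lt/(_ _ m0); apply: filterS => n hn; rewrite !hb ?subrr ?mulr0//; lra.
Qed.

Lemma kernels_cvg_cat (c1 c2 : seq (@pchain_step R nat)) (c1' c2' : seq (@chain_step R)) :
  kernels_cvg c1 c1' -> kernels_cvg c2 c2' -> kernels_cvg (c1 ++ c2) (c1' ++ c2').
Proof. by elim: c1 c1' => [|[k A] c1 ih] [|[k' A'] c1']//= [? ? /ih h] /h. Qed.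

Definition const_chain (c : seq (@chain_step R)) : seq (@pchain_step R nat) :=
  [seq ((fun=> q.1), q.2) | q <- c].

Lemma kernels_cvg_const (c : seq (@chain_step R)) : kernels_cvg (const_chain c) c.
Proof. by elim: c => [//|[k A] c ih] /=; split=> // x z; exact: cvg_cst. Qed.

Lemma inst_const n (c : seq (@chain_step R)) : inst n (const_chain c) = c.
Proof. by rewrite /inst -map_comp -[RHS]map_id; apply: eq_map => -[]. Qed.

Lemma good_killed2 b t : good_kernel2 (@killed R b t).
Proof. by split; [exact: measurable_killed|move=> *; exact: killed_nneg]. Qed.

Lemma good_hit_kernel d : 0 < d -> good_kernel2 (@hit_kernel R d).
Proof. by move=> d0; split; [exact: measurable_hit_kernel|move=> *; exact: hit_kernel_ge0]. Qed.

Lemma good_exit_kernel l d : 0 <= l -> 0 < d -> good_kernel2 (@exit_kernel R l d).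
Proof. by move=> l0 d0; split; [exact: measurable_exit_kernel|move=> *; exact: exit_kernel_ge0]. Qed.

(** Density of the paths that stay above [- e] but not above 0. *)
Definition dip_kernel e d x y : R := killed (- e) d x y - killed 0 d x y.

Lemma good_dip_kernel e d : 0 <= e -> 0 < d -> good_kernel2 (dip_kernel e d).
Proof.
move=> e0 d0; split; first by apply: measurable_funB; exact: measurable_killed.
by move=> x y; rewrite subr_ge0 killed_floor_le// oppr_le0.
Qed.

Variables (l d u v : R) (C2 C C1 : seq (R * set R)).
Hypotheses (l0 : 0 < l) (d0 : 0 < d).
Hypotheses (m1 : msets C1) (m : msets C) (m2 : msets C2).
Hypotheses (p1 : path <%R (v + d) (unzip1 C1)) (e1 : end_time (v + d) C1 < 1).
Hypotheses (p : path <%R (u + d) (unzip1 C)) (e : end_time (u + d) C < v).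
Hypotheses (p2 : path <%R 0 (unzip1 C2)) (e2 : end_time 0 C2 < u).

(** The dip kernel is divided by the depth [w n]; the exit kernel needs no normalisation, since its
    level [l - w n] just tends to [l]. *)
Lemma two_mass_liminf a (w : nat -> R) : (forall n, 0 < w n <= l) -> w n @[n --> \oo] --> (0 : R) ->
  liminf_ge (cells_mass l d u v a C2 C C1)
    (fun n => two_mass l d u v a C2 C C1 (fun x y => (w n)^-1 * dip_kernel (w n) d x y) (exit_kernel (l - w n) d)).
Proof.
move=> w0 cw; rewrite -two_mass_cells.
have wp n : 0 < w n by have /andP[] := w0 n.
pose pc := const_chain (kstep 0 0 (C2 ++ [:: (u, setT)])) ++
  ((fun n x y => (w n)^-1 * dip_kernel (w n) d x y), setT) ::
  const_chain (kstep 0 (u + d) (C ++ [:: (v, setT)])) ++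
  ((fun n => exit_kernel (l - w n) d), setT) :: const_chain (kstep l (v + d) (shift_set l C1)).
have pcE n : inst n pc = kernels_chain l d u v C2 C C1 (fun x y => (w n)^-1 * dip_kernel (w n) d x y) (exit_kernel (l - w n) d).
  by rewrite /inst /pc map_cat/= map_cat/= -!/(inst n (const_chain _)) !inst_const.
rewrite (_ : (fun n => _) = fun n => chain (inst n pc)
    (fun y => (killed l (1 - end_time (v + d) C1) y (a + l))%:E) a); last first.
  by apply/funext => n; rewrite pcE.
have gd n : good_kernel2 (fun x y => (w n)^-1 * dip_kernel (w n) d x y).
  have [h1 h2] := good_dip_kernel (ltW (wp n)) d0.
  by split; [exact: measurable_funM|move=> x y; rewrite mulr_ge0 ?invr_ge0 ?(ltW (wp n))].
have ge n : good_kernel2 (exit_kernel (l - w n) d).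
  by apply: good_exit_kernel => //; rewrite subr_ge0; have /andP[] := w0 n.
apply: chain_liminf.
- by move=> n; rewrite pcE; exact: good_kernels_chain.
- by apply: good_kernels_chain => //; [exact: good_hit_kernel|apply: good_exit_kernel => //; exact: ltW].
- apply: kernels_cvg_cat; first exact: kernels_cvg_const.
  split => // [x z|]; first exact: cvg_hit_kernel.
  apply: kernels_cvg_cat; first exact: kernels_cvg_const.
  split => // [x z|]; last exact: kernels_cvg_const.
  by apply: cvgB; [exact: cvg_cst|exact: cvg_killed_below].
- by move=> n; apply/measurable_EFinP; exact: measurable_killed.
- by move=> n z; rewrite lee_fin killed_nneg.
- by apply/measurable_EFinP; exact: measurable_killed.
- by move=> z; rewrite lee_fin killed_nneg.
- by move=> z; apply: liminf_ge_cvg; exact: cvg_cst.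
Qed.

End cell_limits.

(** * Probability of a cell event *)

Section cell_event.
Context {R : realType} {d0 : measure_display} {T : measurableType d0} (P : probability T R).
Notation mu := (@lebesgue_measure R).
Variables (B : R -> T -> R) (l d u v : R) (C2 C C1 : seq (R * set R)).
Hypotheses (BB : brownian_bridge P 1 0 l B).
Hypotheses (cB : forall w, continuous (B ^~ w)) (mB : forall t, measurable_fun setT (B t)).
Hypotheses (l0 : 0 < l) (dp : 0 < d).
Hypotheses (m1 : msets C1) (m : msets C) (m2 : msets C2).
Hypotheses (p1 : path <%R (v + d) (unzip1 C1)) (e1 : end_time (v + d) C1 < 1).
Hypotheses (p : path <%R (u + d) (unzip1 C)) (e : end_time (u + d) C < v).
Hypotheses (p2 : path <%R 0 (unzip1 C2)) (e2 : end_time 0 C2 < u).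

Let M a := two_mass l d u v a C2 C C1.
Let p0 : R := (gauss 1 l)^-1.
Let p0_ge0 : (0 <= p0%:E)%E. Proof. by rewrite lee_fin invr_ge0 ltW// gauss_gt0. Qed.

Definition floor_event (a f1 f2 : R) : set T :=
  [set w | stays (fun t => B t w + a) 0 l (cell_floors l d u v C2 C C1 f1 f2)].

Lemma floor_event_prob (a f1 f2 : R) : P (floor_event a f1 f2) = (M a (killed f1 d) (killed f2 d) * p0%:E)%E.
Proof.
pose c := cell_floors l d u v C2 C C1 f1 f2.
have mc : fsets c by exact: fsets_cell_floors.
have -> : floor_event a f1 f2 = [set w | stays (B ^~ w) 0 (l - a) (translate (- a) c)].
  apply/seteqP; split=> w /=; have := stays_translate (- a) (fun t => B t w + a) 0 l c;
    by rewrite (_ : (fun t => B t w + a - a) = B ^~ w); [tauto|apply/funext => t; rewrite addrK].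
have oc : ftimes_ok 0 (translate (- a) c).
  by rewrite /ftimes_ok /fend ftimes_translate; exact: ftimes_ok_cell_floors.
rewrite (floor_prob BB)//; last exact: fsets_translate.
rewrite subr0; congr (_ * _)%E.
have := fmass_translate (- a) l (a + l) 0 a mc.
rewrite subrr addrAC subrr add0r => ->.
by rewrite fmass_cell_floors.
Qed.

(** The shift is made a coordinate, for joint measurability in the shift and the outcome. *)
Let X (t : R) (w : R * T) := B t w.2 + w.1.
Let mX t : measurable_fun setT (X t).
Proof. by apply: measurable_funD => //; exact: (measurable_pair_snd (mB t)). Qed.
Let cX w : continuous (X ^~ w).
Proof. by move=> t; apply: cvgD; [exact: cB|exact: cvg_cst]. Qed.

Lemma measurable_floor_event_pair (f1 f2 : R) : measurable [set w : R * T | floor_event w.1 f1 f2 w.2].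
Proof.
pose c := cell_floors l d u v C2 C C1 f1 f2.
have oc : ftimes_ok 0 c by exact: ftimes_ok_cell_floors.
have mc : fsets c by exact: fsets_cell_floors.
exact: (measurable_stays mX l cX oc mc).
Qed.

Lemma measurable_floor_event a (f1 f2 : R) : measurable (floor_event a f1 f2).
Proof.
have h : measurable_fun setT (fun w : T => (a, w)) by exact: measurable_fun_pair.
by have := h measurableT _ (measurable_floor_event_pair f1 f2); rewrite setTI.
Qed.

(* The path shifted up by [a] dips into ]- b, 0] during [u, u + d] and below [l - b] during
   [v, v + d]; it stays above 0 otherwise, and above [l] after [v + d]. *)
Definition cell_event (a b : R) : set T :=
  (floor_event a (- b) 0 `\` floor_event a (- b) (l - b)) `\`
  (floor_event a 0 0 `\` floor_event a 0 (l - b)).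

Lemma measurable_cell_event_pair b : measurable [set w : R * T | cell_event w.1 b w.2].
Proof.
by apply: measurableD; apply: measurableD; exact: measurable_floor_event_pair.
Qed.

Lemma measurable_cell_event a b : measurable (cell_event a b).
Proof. by apply: measurableD; apply: measurableD; exact: measurable_floor_event. Qed.

Lemma floor_event_le (a f1 f2 f2' : R) : f2' <= f2 -> floor_event a f1 f2 `<=` floor_event a f1 f2'.
Proof.
move=> ff w; rewrite /floor_event /cell_floors /= => /stays_cat[h1] /= [h2 h2' /stays_cat[h3 /= [h4 h4' h5]]].
apply/stays_cat; split => //=; split => //; apply/stays_cat; split => //=; split => //.
by move=> t /h4; apply: le_lt_trans.
Qed.

(** By additivity the mass of the dip and exit kernels is the mixed second difference of [two_mass]
    in the two floors, hence of the floor probabilities; this difference is at most the probability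
    of the event. *)
Lemma cell_event_ge a b : 0 < b <= l ->
  (M a (dip_kernel b d) (exit_kernel (l - b) d) * p0%:E <= P (cell_event a b))%E.
Proof.
move=> /andP[b0 bl]; have lb : 0 <= l - b by rewrite subr_ge0.
have g0 : good_kernel2 (@killed R 0 d) by exact: good_killed2.
have gl : good_kernel2 (@killed R (l - b) d) by exact: good_killed2.
have g1 := good_dip_kernel (ltW b0) dp.
have g2 := good_exit_kernel lb dp.
have E1 : killed (- b) d = (fun x y => killed 0 d x y + dip_kernel b d x y).
  by apply/funext => x; apply/funext => y; rewrite /dip_kernel addrC subrK.
have E2 : killed 0 d = (fun x y => killed (l - b) d x y + exit_kernel (l - b) d x y).
  by apply/funext => x; apply/funext => y; rewrite /exit_kernel addrC subrK.
set FA := floor_event a (- b) 0; set FB := floor_event a (- b) (l - b).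
set FC := floor_event a 0 0; set FD := floor_event a 0 (l - b).
have mA : measurable FA by exact: measurable_floor_event.
have mFB : measurable FB by exact: measurable_floor_event.
have mC : measurable FC by exact: measurable_floor_event.
have mD : measurable FD by exact: measurable_floor_event.
have DC : FD `<=` FC by exact: floor_event_le.
(* Subadditivity: [FA] is covered by [FB], by what [FC] has beyond [FD], and by the cell event. *)
have PE : (P FA + P FD <= P FB + P FC + P (cell_event a b))%E.
  have -> : (P FC = P FD + P (FC `\` FD))%E.
    rewrite -measureU//; last 2 first.
    - exact: measurableD.
    - by apply/seteqP; split=> w // -[? []].
    by congr (P _); rewrite setDUK.
  rewrite -[leRHS]addeA -[(P FD + _ + _)%E]addeA [leRHS]addeCA [leRHS]addeC leeD2r//.
  apply: (@le_trans _ _ (P (FB `|` ((FC `\` FD) `|` cell_event a b)))).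
    apply: le_measure; rewrite ?inE//.
      apply: measurableU => //; apply: measurableU; first exact: measurableD.
      exact: measurable_cell_event.
    move=> w Aw; have [?|nB] := pselect (FB w); first by left.
    by right; have [?|nC] := pselect ((FC `\` FD) w); [left|right].
  have mCD : measurable (FC `\` FD) by exact: measurableD.
  have mE := measurable_cell_event a b.
  apply: le_trans (measureU2 _ _ _) _ => //; first exact: measurableU.
  by rewrite leeD2l//; exact: measureU2.
have gsum (k k' : R -> R -> R) : good_kernel2 k -> good_kernel2 k' -> good_kernel2 (fun x y => k x y + k' x y).
  by move=> [mk k0] [mk' k0']; split; [exact: measurable_funD|move=> x y; rewrite addr_ge0].
have M0 k k' : good_kernel2 k -> good_kernel2 k' -> (0 <= M a k k')%E by move=> *; exact: two_mass_ge0.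
have fin k k' : (M a k k' * p0%:E \is a fin_num -> M a k k' \is a fin_num)%E.
  case: (M a k k') => //; rewrite ?gt0_mulye ?gt0_mulNye// lte_fin invr_gt0; exact: gauss_gt0.
have PA := floor_event_prob a (- b) 0; have PD := floor_event_prob a 0 (l - b).
have PB := floor_event_prob a (- b) (l - b); have PC := floor_event_prob a 0 0.
set kl := killed (l - b) d in gl E2 PD PB *.
set q2 := exit_kernel (l - b) d in g2 E2 *.
set q1 := dip_kernel b d in g1 E1 *.
have QB : M a (killed (- b) d) kl = (M a (killed 0 d) kl + M a q1 kl)%E.
  by rewrite /M -two_massDl// -E1.
have QC : M a (killed 0 d) (killed 0 d) = (M a (killed 0 d) kl + M a (killed 0 d) q2)%E.
  by rewrite /M -two_massDr// -E2.
have QA : M a (killed (- b) d) (killed 0 d) =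
    (M a (killed 0 d) kl + M a (killed 0 d) q2 + (M a q1 kl + M a q1 q2))%E.
  by rewrite /M -!two_massDr// -two_massDl// -?E2 -?E1.
(* A probability is finite, so the four masses it is made of are finite and the inequality becomes
   linear over the reals. *)
have fA : M a (killed (- b) d) (killed 0 d) \is a fin_num by apply: fin; rewrite -PA fin_num_measure.
move: PE; rewrite -/FA in PA; rewrite PA PB PC PD QA QB QC.
move: fA; rewrite QA !fin_numD => /andP[/andP[f1 f2] /andP[f3 f4]].
have : P (cell_event a b) \is a fin_num by rewrite fin_num_measure//; exact: measurable_cell_event.
move: f1 f2 f3 f4; case: (P (cell_event a b)) => [pe| |]//.
case: (M a _ kl) => [x1| |]//; case: (M a _ q2) => [x2| |]//.
case: (M a q1 kl) => [x3| |]//; case: (M a q1 q2) => [x4| |]//.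
move=> _ _ _ _ _ h.
have : (x1 + x2 + (x3 + x4)) * p0 + x1 * p0 <= (x1 + x3) * p0 + (x1 + x2) * p0 + pe.
  by rewrite -lee_fin !EFinD !EFinM !EFinD.
by rewrite !mulrDl -EFinM lee_fin; lra.
Qed.

(** [mn] stands for the depth of the minimum. For a given path the shifts [a] that realise the cell
    event lie within [w n] below [mn], so by Tonelli the integral over [a] of the cell probabilities
    is at most [w n * P E]. Dividing by [w n] and applying Fatou gives the limit mass on the
    left. *)
Lemma cell_prob (E : set T) (mn : T -> R) (b0 : R) : measurable E -> 0 < b0 <= l ->
  measurable_fun (`]0%R, +oo[ : set R) (fun a => cells_mass l d u v a C2 C C1) ->
  (forall a b w, 0 < a -> 0 < b <= b0 -> cell_event a b w -> E w /\ a <= mn w < a + b) ->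
  (p0%:E * \int[mu]_(a in `]0%R, +oo[) cells_mass l d u v a C2 C C1 <= P E)%E.
Proof.
move=> mE /andP[b00 b0l] mM HE.
pose w (n : nat) : R := b0 * n.+1%:R^-1.
have w0 n : 0 < w n by rewrite mulr_gt0// invr_gt0.
have wb n : w n <= b0 by rewrite ger_pMr// invf_le1// ler1n.
have cw : w n @[n --> \oo] --> (0 : R).
  rewrite -(mulr0 b0); apply: cvgM; first exact: cvg_cst.
  exact: cvg_harmonic.
pose U n : set (R * T) := [set q | 0 < q.1 /\ cell_event q.1 (w n) q.2].
have mU n : measurable (U n).
  rewrite (_ : U n = (fun q : R * T => q.1) @^-1` `]0%R, +oo[ `&` [set q | cell_event q.1 (w n) q.2]); last first.
    by apply/seteqP; split=> q /=; rewrite in_itv/= andbT.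
  apply: measurableI; last exact: measurable_cell_event_pair.
  have h : measurable_fun setT (fun q : R * T => q.1) by exact: measurable_fst.
  by rewrite -[X in measurable X]setTI; exact: h.
have mf n : measurable_fun setT (fun a => P (xsection (U n) a)) by exact: measurable_fun_xsection.
have xU n a : 0 < a -> xsection (U n) a = cell_event a (w n).
  move=> a0; apply/seteqP; split=> q; rewrite xsectionE /=; first by case.
  by split.
have M0 a : (0 <= cells_mass l d u v a C2 C C1)%E.
  rewrite -two_mass_cells; apply: two_mass_ge0 => //; first exact: good_hit_kernel.
  by apply: good_exit_kernel => //; exact: ltW.
have := @fatou_liminf_ge _ _ _ mu (`]0%R, +oo[ : set R) (fun n a => ((w n)^-1%:E * P (xsection (U n) a))%E)
  (fun a => p0%:E * cells_mass l d u v a C2 C C1)%E.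
rewrite ge0_integralZl// => H; apply: liminf_ge_le; first apply: H => //.
- by move=> n; apply: measurable_funTS; apply: emeasurable_funM => //; exact: mf.
- exact: emeasurable_funM.
- by move=> n a _; rewrite mule_ge0// lee_fin invr_ge0 ltW.
- by move=> a _; rewrite mule_ge0.
- move=> a; rewrite /= in_itv/= andbT => a0.
  have key : liminf_ge (p0%:E * cells_mass l d u v a C2 C C1)%E (fun n => p0%:E * M a (fun x y => ((w n)^-1 * dip_kernel (w n) d x y)%R) (exit_kernel (l - w n) d))%E.
    apply: (@liminf_geM _ p0 (fun=> p0)) => //.
    + exact: cvg_cst.
    + move=> n; apply: two_mass_ge0 => //.
        have [h1 h2] := good_dip_kernel (ltW (w0 n)) dp.
        by split; [exact: measurable_funM|move=> x y; rewrite mulr_ge0 ?invr_ge0 ?(ltW (w0 n))].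
      by apply: good_exit_kernel => //; rewrite subr_ge0 (le_trans (wb n)).
    + by apply: two_mass_liminf => // n; rewrite w0 (le_trans (wb n)).
  apply: (liminf_ge_near key); apply: nearW => n; have bn : 0 < w n <= l by rewrite w0 (le_trans (wb n)).
  have gd := good_dip_kernel (ltW (w0 n)) dp.
  have ge : good_kernel2 (exit_kernel (l - w n) d).
    by apply: good_exit_kernel => //; rewrite subr_ge0 (le_trans (wb n)).
  rewrite xU// /M two_massZl//; last by rewrite invr_ge0 ltW.
  rewrite muleCA; apply: lee_wpmul2l; first by rewrite lee_fin invr_ge0 ltW.
  by rewrite muleC; exact: cell_event_ge.
apply: nearW => n.
rewrite ge0_integralZl//; last 2 first.
- exact: (measurable_funTS (mf n)).
- by rewrite lee_fin invr_ge0 ltW.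
have h : (\int[mu]_(a in `]0%R, +oo[) P (xsection (U n) a) <= (w n)%:E * P E)%E.
  apply: (@le_trans _ _ (\int[mu]_a P (xsection (U n) a)))%E.
    by apply: ge0_subset_integral => //; exact: mf.
  have mI : measurable_fun setT (fun q => (\1_(U n) q : R)%:E).
    by apply/measurable_EFinP; exact: measurable_indic.
  have -> : (\int[mu]_a P (xsection (U n) a) = \int[P]_q mu (ysection (U n) q))%E.
    transitivity (\int[mu]_a \int[P]_q (\1_(U n) (a, q))%:E)%E.
      apply: eq_integral => a _; rewrite -[xsection _ _]setIT -integral_indic//; last exact: measurable_xsection.
      by apply: eq_integral => q _; rewrite !indicE mem_xsection.
    rewrite (@fubini_tonelli _ _ _ _ R mu P (fun q => (\1_(U n) q)%:E) mI)//.
    apply: eq_integral => q _; have mq := measurable_ysection q (mU n).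
    rewrite -[ysection _ _]setIT -(integral_indic mu measurableT mq).
    by apply: eq_integral => a _; rewrite !indicE mem_ysection.
  have PE : P E = (\int[P]_q (\1_E q)%:E)%E by rewrite integral_indic// setIT.
  rewrite PE -ge0_integralZl//; last 2 first.
  - by apply/measurable_EFinP; exact: measurable_indic.
  - by rewrite lee_fin ltW.
  apply: ge0_le_integral => //.
  - exact: (measurable_fun_ysection mu (mU n)).
  - by apply: emeasurable_funM => //; apply/measurable_EFinP; exact: measurable_indic.
  (* A path with some admissible shift belongs to [E]; for the others the section is empty. *)
  move=> q _; have [Uq|Uq] := eqVneq (ysection (U n) q) set0.
    by rewrite Uq measure0 mule_ge0// lee_fin ltW.
  have /set0P[a1] := Uq; rewrite ysectionE /= => -[a10 /(HE _ _ _ a10)[|Eq _]]; first by rewrite w0 wb.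
  rewrite indicE mem_set// mule1.
  (* From [a <= mn q < a + w n] the admissible shifts lie in an interval of length [w n]. *)
  apply: (@le_trans _ _ (mu (`[mn q - w n, mn q] : set R))).
    rewrite -ysectionE; have mq := measurable_ysection q (mU n).
    apply: le_measure; rewrite ?inE// => a; rewrite ysectionE /= => -[a0 /(HE _ _ _ a0)[|_ /andP[h1 h2]]]; first by rewrite w0 wb.
    by move: h1 h2 => /= h1 h2; rewrite in_itv/=; apply/andP; split; lra.
  rewrite lebesgue_measure_itv/= lte_fin ltrBlDr ltrDl w0 -EFinD lee_fin; lra.
apply: (@le_trans _ _ ((w n)^-1%:E * ((w n)%:E * P E)))%E.
  by apply: lee_wpmul2l => //; rewrite lee_fin invr_ge0 ltW.
by rewrite muleA -EFinM mulVf ?gt_eqF// mul1e.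
Qed.

End cell_event.

(** * Minimum and last hit of a path *)

Section paths.
Context {R : realType}.
Implicit Types (f : R -> R) (s t x a b u v d l : R).

(** By continuity the infimum of the minimisers is itself a minimiser, so every earlier time has a
    strictly larger value. *)
Lemma argmin_timeP f : continuous f ->
  [/\ 0 <= argmin_time f <= 1, forall s, 0 <= s <= 1 -> f (argmin_time f) <= f s &
      forall s, 0 <= s < argmin_time f -> f (argmin_time f) < f s].
Proof.
move=> cf; pose S := [set t | 0 <= t <= 1 /\ forall s, 0 <= s <= 1 -> f t <= f s].
have [c c01 cmin] : exists2 c, c \in `[0, 1]%R & forall t, t \in `[0, 1]%R -> f c <= f t.
  by apply: EVT_min => //; exact: continuous_subspaceT.
have Sc : S c by split; [move: c01; rewrite in_itv|move=> s s01; apply: cmin; rewrite in_itv].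
have hS : has_inf S by split; [exists c|exists 0 => t [/andP[]]].
have lS : lbound S (inf S) by apply: ge_inf; exists 0 => t [/andP[]].
have tau01 : 0 <= inf S <= 1.
  apply/andP; split; first by apply: lb_le_inf; [exists c|move=> t [/andP[]]].
  by apply: (le_trans (lS _ Sc)); case: Sc => /andP[].
have tauc : f (inf S) = f c.
  apply/eqP; rewrite eq_le (cmin (inf S)) ?in_itv// andbT leNgt; apply/negP => h.
  have : \forall t \near inf S, f c < f t.
    by apply: (cvgr_gt _ (cf (inf S))).
  move=> /nbhs_ballP[e /= e0 be].
  have [t St te] := inf_adherent e0 hS.
  have := be t; rewrite /ball/= => /(_ _).
  have -> : `|inf S - t| < e.
    by rewrite ler0_norm ?subr_le0 ?lS// opprB ltrBlDl.
  move=> /(_ isT); rewrite ltNge => /negP; apply.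
  by case: St => _ /(_ c); apply; move: c01; rewrite in_itv.
rewrite /argmin_time -/S; split => //.
  by move=> s s01; rewrite tauc; apply: cmin; rewrite in_itv.
move=> s /andP[s0 st]; rewrite ltNge; apply/negP => h.
have s1 : s <= 1 by rewrite (le_trans (ltW st))//; case/andP : tau01.
suff /lS : S s by rewrite leNgt st.
split; first by rewrite s0.
by move=> t t01; rewrite (le_trans h)// tauc; apply: cmin; rewrite in_itv.
Qed.

(* The path followed by its own copy, as in [B(t - 1) + B(1)] for [t >= 1]. *)
Definition unroll f t := f (Num.min t 1) + f (Num.max t 1 - 1).

Lemma unroll_le1 f t : f 0 = 0 -> t <= 1 -> unroll f t = f t.
Proof. by move=> f0 t1; rewrite /unroll min_l// max_r// subrr f0 addr0. Qed.

Lemma unroll_ge1 f t : 1 <= t -> unroll f t = f 1 + f (t - 1).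
Proof. by move=> t1; rewrite /unroll min_r// max_l. Qed.

Lemma continuous_unroll f : continuous f -> continuous (unroll f).
Proof.
move=> cf t; have cm : Num.min x 1 @[x --> t] --> Num.min t 1.
  have -> : (fun x => Num.min x 1) = (fun x => (x + 1 - `|x - 1|) / 2).
    by apply/funext => x; rewrite minr_absE.
  rewrite minr_absE; apply: cvgM; last exact: cvg_cst.
  apply: cvgB; first by apply: cvgD; [exact: cvg_id|exact: cvg_cst].
  by apply: cvg_norm; apply: cvgB; [exact: cvg_id|exact: cvg_cst].
have cM : (Num.max x 1 - 1) @[x --> t] --> Num.max t 1 - 1.
  apply: cvgB; last exact: cvg_cst.
  have -> : (fun x => Num.max x 1) = (fun x => (x + 1 + `|x - 1|) / 2).
    by apply/funext => x; rewrite maxr_absE.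
  rewrite maxr_absE; apply: cvgM; last exact: cvg_cst.
  apply: cvgD; first by apply: cvgD; [exact: cvg_id|exact: cvg_cst].
  by apply: cvg_norm; apply: cvgB; [exact: cvg_id|exact: cvg_cst].
apply: cvgD; first exact: (cvg_comp _ _ cm (cf _)).
exact: (cvg_comp _ _ cM (cf _)).
Qed.

(** Both branches of the transform are the unrolled path read from its minimum on. *)
Lemma vervaat_unroll f t : f 0 = 0 -> vervaat f t = unroll f (argmin_time f + t) - f (argmin_time f).
Proof.
move=> f0; rewrite /vervaat; case: ifPn => h.
  by rewrite unroll_le1//; lra.
by rewrite unroll_ge1; [ring|move: h; rewrite -ltNge; lra].
Qed.

Lemma continuous_vervaat f : continuous f -> f 0 = 0 -> continuous (vervaat f).
Proof.
move=> cf f0; rewrite (_ : vervaat f = fun t => unroll f (argmin_time f + t) - f (argmin_time f)); last first.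
  by apply/funext => t; rewrite vervaat_unroll.
have H : continuous (fun t => unroll f (argmin_time f + t)).
  move=> t; apply: (@continuous_comp _ _ _ (fun x => argmin_time f + x) (unroll f)).
    by apply: cvgD; [exact: cvg_cst|exact: cvg_id].
  exact: continuous_unroll.
by move=> t; apply: cvgB; [exact: H|exact: cvg_cst].
Qed.

(** Past [1 - argmin_time f] the transform runs over the path before its first minimum, strictly
    above the minimum: the end level is not hit there. *)
Lemma vervaat_gt_end f t : continuous f -> f 0 = 0 -> 1 - argmin_time f < t < 1 -> f 1 < vervaat f t.
Proof.
move=> cf f0 /andP[t1 t2]; have [_ _ h] := argmin_timeP cf.
rewrite vervaat_unroll// unroll_ge1; last by lra.
by have := h (argmin_time f + t - 1); rewrite (_ : 0 <= _ < _); [move=> /(_ isT); lra|apply/andP; split; lra].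
Qed.

Definition hits l f := [set t | 0 <= t < 1 /\ f t = l].

(** [0 <= x] covers the case without any hit, where the supremum is 0. *)
Lemma last_hit_le l f x : 0 <= x -> (forall t, hits l f t -> t <= x) -> last_hit l f <= x.
Proof.
move=> x0 hx; rewrite /last_hit -/(hits l f); have [->|/set0P h] := eqVneq (hits l f) set0; first by rewrite sup0.
exact: ge_sup.
Qed.

Lemma last_hit_ge l f t : hits l f t -> t <= last_hit l f.
Proof. by move=> h; apply: ub_le_sup => //; exists 1 => s [/andP[_ /ltW]]. Qed.

Section cell_path.
Variables (f : R -> R) (l a b u v d : R).
Hypotheses (cf : continuous f) (d0 : 0 < d) (u0 : 0 < u) (uv : u + d < v) (v1 : v + d < 1) (bl : 0 < b <= l).
Hypothesis G1 : forall t, 0 <= t <= u -> 0 < f t + a.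
Hypothesis G2 : forall t, u <= t <= u + d -> - b < f t + a.
Hypothesis G3 : exists2 t, u <= t <= u + d & f t + a <= 0.
Hypothesis G4 : forall t, u + d <= t <= v -> 0 < f t + a.
Hypothesis G5 : forall t, v <= t <= v + d -> 0 < f t + a.
Hypothesis G7 : forall t, v + d <= t <= 1 -> l < f t + a.

Lemma cell_path_min : u <= argmin_time f <= u + d /\ a <= - f (argmin_time f) < a + b.
Proof.
have [/andP[tau0 tau1] mi _] := argmin_timeP cf; set tau := argmin_time f in tau0 tau1 mi *.
have [t1 /andP[t1u t1d] h1] := G3; move: bl => /andP[b0 bl'].
move: (uv) (v1) (u0) (d0) => uv' v1' u0' d0'.
have m0 : f tau + a <= 0.
  have t101 : 0 <= t1 <= 1 by apply/andP; split; lra.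
  by apply: le_trans h1; rewrite lerD2r mi.
have pos : ~ 0 < f tau + a by move=> h; move: m0; rewrite leNgt h.
have tauj : u <= tau <= u + d.
  apply/andP; split; rewrite leNgt; apply/negP => h.
    by apply: pos; apply: G1; rewrite tau0 (ltW h).
  apply: pos; have [h2|h2] := leP tau v; first by apply: G4; rewrite h2 (ltW h).
  have [h3|h3] := leP tau (v + d); first by apply: G5; rewrite h3 (ltW h2).
  have := G7 (t := tau); rewrite (ltW h3) tau1 => /(_ isT); apply: lt_trans.
  by rewrite (lt_le_trans b0).
split => //; have := G2 tauj => h.
by apply/andP; split; lra.
Qed.

Hypotheses (f0 : f 0 = 0) (f1 : f 1 = l).
Hypothesis G6 : exists2 t, v <= t <= v + d & f t + a <= l - b.

(** The level to be hit, [f tau + l], is only known up to [b]; the dip below [l - b] in [[v, v + d]]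
    goes under it whatever the exact minimum. *)
Lemma cell_path_hit : v <= argmin_time f + last_hit l (vervaat f) <= v + d.
Proof.
have [/andP[tu td] /andP[ma mb]] := cell_path_min.
have [t2 /andP[t2v t2d] h6] := G6; move: bl => /andP[b0 bl'].
move: (uv) (v1) (u0) (d0) => uv' v1' u0' d0'.
have [/andP[tau0 tau1] _ _] := argmin_timeP cf.
have VE t := vervaat_unroll t f0.
set tau := argmin_time f in tau0 tau1 VE tu td ma mb *.
have g7 : l < f (v + d) + a by apply: G7; rewrite lexx ltW.
(* Intermediate values: the dip is below [f tau + l], and at [v + d] the path is above it. *)
have [t3 t3v t3E] : exists2 t3, t2 <= t3 <= v + d & f t3 = f tau + l.
  have t2vd : t2 <= v + d by [].
  have := @IVT _ f t2 (v + d) (f tau + l) t2vd (continuous_subspaceT cf).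
  have e1 : f t2 <= f tau + l by lra.
  have e2 : f tau + l <= f (v + d) by lra.
  rewrite (min_l (le_trans e1 e2)) (max_r (le_trans e1 e2)) e1 e2 => /(_ isT)[t3 + E].
  by rewrite in_itv/= => h; exists t3.
move: t3v => /andP[t23 t3d].
apply/andP; split.
  have : hits l (vervaat f) (t3 - tau).
    split; first by apply/andP; split; lra.
    rewrite VE -/tau unroll_le1//; last by lra.
    by rewrite (_ : tau + (t3 - tau) = t3); [rewrite t3E; ring|ring].
  by move=> /last_hit_ge; rewrite -/tau; lra.
suff : last_hit l (vervaat f) <= v + d - tau by rewrite -lerBrDl.
apply: last_hit_le; first by lra.
move=> t [/andP[h0 h1] ht]; rewrite leNgt; apply/negP => h.
(* A hit later than [v + d] would be either before the end of the bridge, where the path is above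
   [l - a], or on the wrapped part, which lies above the end level. *)
have [h2|h2] := leP t (1 - tau); last first.
  have := vervaat_gt_end cf f0 (t := t); rewrite -/tau h2 h1 => /(_ isT).
  by rewrite ht f1 ltxx.
have h3 : tau + t <= 1 by lra.
move: ht; rewrite VE -/tau unroll_le1//.
have : l < f (tau + t) + a by apply: G7; rewrite h3 andbT; lra.
by move=> *; lra.
Qed.

End cell_path.

End paths.

(** * From cells to the minimum and the last hit *)

Section near_event.
Context {R : realType} {d0 : measure_display} {T : measurableType d0} (P : probability T R).
Notation mu := (@lebesgue_measure R).
Variables (B : R -> T -> R) (l : R).
Hypotheses (BB : brownian_bridge P 1 0 l B).
Hypotheses (cB : forall w, continuous (B ^~ w)) (mB : forall t, measurable_fun setT (B t)).
Hypothesis l0 : 0 < l.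

(* A box [(t, lo, hi)] constrains the position at time [t] to [[lo, hi]]. *)
Definition box_rect (c : seq (R * R * R)) : seq (R * set R) :=
  [seq (q.1.1, `[q.1.2, q.2]%classic) | q <- c].

(** Only the upper bounds get the slack [e]: the shift [a] is at most the true depth of the minimum
    and falls short of it by less than [e]. *)
Definition in_boxes (g : R -> R) (e : R) (c : seq (R * R * R)) : bool :=
  all (fun q => q.1.2 <= g q.1.1 <= q.2 + e) c.

Lemma in_boxesP g e c : in_boxes g e c <->
  forall q, List.In q c -> q.1.2 <= g q.1.1 <= q.2 + e.
Proof.
rewrite /in_boxes; elim: c => [|q c ih] /=; first by split.
split=> [/andP[h /ih hc] q' [<-//|/hc//]|h].
by apply/andP; split; [apply: h; left|apply/ih => q' hq; apply: h; right].
Qed.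

Lemma msets_box_rect c : msets (box_rect c).
Proof. by elim: c => [//|q c ih] /=; split => //; exact: measurable_itv. Qed.

Lemma box_rect_cat c1 c2 : box_rect (c1 ++ c2) = box_rect c1 ++ box_rect c2.
Proof. exact: map_cat. Qed.

Definition tau w := argmin_time (B ^~ w).
Definition hit_time w := last_hit l (vervaat (B ^~ w)).
Definition low w := B (tau w) w.
Definition rolled t w := unroll (B ^~ w) t.

(** Times are counted from the fixed corners [u] and [v], heights from the true minimum. *)
Definition near_event u v e c c' : set T := [set w | [/\ u <= tau w <= u + e,
  v <= tau w + hit_time w <= v + e, in_boxes (fun s => rolled (u + s) w - low w) e c &
  in_boxes (fun s => rolled (v + s) w - low w - l) e c']].

Lemma stays_cell_floors (f : R -> R) (d u v f1 f2 : R) (C2 C C1 : seq (R * set R)) :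
  stays f 0 l (cell_floors l d u v C2 C C1 f1 f2) <->
  [/\ stays_prefix f 0 (with_floor 0 (C2 ++ [:: (u, setT)])),
      forall t, u <= t <= u + d -> f1 < f t,
      stays_prefix f (u + d) (with_floor 0 (C ++ [:: (v, setT)])),
      forall t, v <= t <= v + d -> f2 < f t &
      stays f (v + d) l (with_floor l (shift_set l C1))].
Proof.
rewrite /cell_floors; split.
  move=> /stays_cat[h1]; rewrite fend_with_floor end_time_cat /= => -[h2 _ /stays_cat[h3]].
  by rewrite fend_with_floor end_time_cat /= => -[h4 _ h5].
move=> [h1 h2 h3 h4 h5]; apply/stays_cat; split => //.
rewrite fend_with_floor end_time_cat /=; split => //; apply/stays_cat; split => //.
by rewrite fend_with_floor end_time_cat.
Qed.

Section one_cell.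
Variables (d u z0 : R) (c c1 c2 : seq (R * R * R)).
Let v := u + z0.
Hypothesis dp : 0 < d.
Hypotheses (p : path <%R d (unzip1 (box_rect c))) (e : end_time d (box_rect c) < z0).
Hypotheses (p1 : path <%R d (unzip1 (box_rect c1))) (e1 : end_time d (box_rect c1) < 1 - v).
Hypotheses (p2 : path <%R (1 - v) (unzip1 (box_rect c2))) (e2 : end_time (1 - v) (box_rect c2) < 1 - z0).

Let C := shift_time u (box_rect c).
Let C1 := shift_time v (box_rect c1).
Let C2 := shift_time (v - 1) (box_rect c2).
Let pC : path <%R (u + d) (unzip1 C). Proof. by rewrite addrC path_shift_time. Qed.
Let eC : end_time (u + d) C < v. Proof. by rewrite addrC end_time_shift [v]addrC ltrD2r. Qed.
Let pC1 : path <%R (v + d) (unzip1 C1). Proof. by rewrite addrC path_shift_time. Qed.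
Let eC1 : end_time (v + d) C1 < 1. Proof. by rewrite addrC end_time_shift -ltrBrDr. Qed.
Let z2 : 0 = 1 - v + (v - 1). Proof. by ring. Qed.
Let pC2 : path <%R 0 (unzip1 C2). Proof. by rewrite z2 path_shift_time. Qed.
Let eC2 : end_time 0 C2 < u.
Proof. by rewrite z2 end_time_shift; move: e2; rewrite /v; lra. Qed.
Let mC : msets C. Proof. by apply: msets_shift_time; exact: msets_box_rect. Qed.
Let mC1 : msets C1. Proof. by apply: msets_shift_time; exact: msets_box_rect. Qed.
Let mC2 : msets C2. Proof. by apply: msets_shift_time; exact: msets_box_rect. Qed.

Let In_shift b q D : List.In q D -> List.In (q.1.1 + b, `[q.1.2, q.2]%classic) (shift_time b (box_rect D)).
Proof.
by move=> h; apply: (List.in_map (fun e => (e.1 + b, e.2)) _ _ (List.in_map (fun q : R * R * R => (q.1.1, `[q.1.2, q.2]%classic)) _ _ h)).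
Qed.

Lemma In_path_ge s (D : seq (R * set R)) q : path <%R s (unzip1 D) -> List.In q D -> s <= q.1.
Proof.
elim: D s => [//|[t A] D ih] s /= /andP[st pD] [<-/=|/(ih _ pD)]; first exact: ltW.
by apply: le_trans; exact: ltW.
Qed.

Lemma In_path_end s (D : seq (R * set R)) q : path <%R s (unzip1 D) -> List.In q D -> q.1 <= end_time s D.
Proof.
elim: D s => [//|[t A] D ih] s /= /andP[st pD] [<-/=|/(ih _ pD)//].
exact: path_end_time.
Qed.

(** The cell event locates the two times up to [d] and the minimum level up to [b]; replacing [a] by
    the true depth moves heights up by less than [b <= d], which the slack absorbs. Paths that do
    not end at [l] are set aside. *)
Lemma cell_event_near a b w : 0 < a -> 0 < b <= Num.min d l ->
  cell_event B l d u v C2 C C1 a b w ->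
  (near_event u v d c (c1 ++ c2) w \/ B 1 w <> l) /\ a <= - low w < a + b.
Proof.
move=> a0 /andP[b0]; rewrite le_min => /andP[bd bl].
have [_ _ B0 _ _] := BB.
move=> [[/stays_cell_floors[R1 j R2 k R3] nB] nCD].
pose f t := B t w.
(* Otherwise the path would also satisfy the floor [l - b] in the second short step, which the event
   excludes. *)
have G6 : exists2 t, v <= t <= v + d & f t + a <= l - b.
  apply: contrapT => h; apply: nB; apply/stays_cell_floors; split => // t tk.
  by rewrite ltNge; apply/negP => h'; apply: h; exists t.
(* Otherwise the path would satisfy the floor 0 in the first short step; with the dip [G6] it would
   lie in the second difference, which the event removes. *)
have G3 : exists2 t, u <= t <= u + d & f t + a <= 0.
  apply: contrapT => h; apply: nCD; split.
    apply/stays_cell_floors; split => // t tj.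
    by rewrite ltNge; apply/negP => h'; apply: h; exists t.
  by move=> /stays_cell_floors[_ _ _ h' _]; case: G6 => t /h'; rewrite ltNge => /negP.
have u0 : 0 < u by apply: le_lt_trans (path_end_time pC2) eC2.
have uv : u + d < v by apply: le_lt_trans (path_end_time pC) eC.
have v1 : v + d < 1 by apply: le_lt_trans (path_end_time pC1) eC1.
have pC2' : path <%R 0 (unzip1 (C2 ++ [:: (u, setT)])).
  by rewrite /unzip1 map_cat cat_path pC2/= andbT.
have pC' : path <%R (u + d) (unzip1 (C ++ [:: (v, setT)])).
  by rewrite /unzip1 map_cat cat_path pC/= andbT.
have [G1 I1] : (forall t, 0 <= t <= u -> 0 < f t + a) /\
    forall q, List.In q C2 -> q.2 (f q.1 + a).
  have [|h1 h2] := stays_prefix_with_floor pC2' _ R1; first by case: (C2).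
  split; first by rewrite end_time_cat in h1.
  by move=> q hq; apply: h2; apply/List.in_or_app; left.
have [G4 I2] : (forall t, u + d <= t <= v -> 0 < f t + a) /\
    forall q, List.In q C -> q.2 (f q.1 + a).
  have [|h1 h2] := stays_prefix_with_floor pC' _ R2; first by case: (C).
  split; first by rewrite end_time_cat in h1.
  by move=> q hq; apply: h2; apply/List.in_or_app; left.
have [G7 I3] : (forall t, v + d <= t <= 1 -> l < f t + a) /\
    forall q, List.In q C1 -> q.2 (f q.1 + a - l).
  have [|h1 h2] := stays_with_floor _ R3.
    by rewrite (_ : unzip1 (shift_set l C1) = unzip1 C1)// /unzip1 /shift_set -map_comp.
  split => // q hq.
  exact: (h2 _ (List.in_map (fun e => (e.1, [set y | e.2 (y - l)])) _ _ hq)).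
have cf : continuous f := @cB w.
have f0 : f 0 = 0 := B0 w.
have bl' : 0 < b <= l by rewrite b0.
have [tj mb] := cell_path_min cf dp u0 uv v1 bl' G1 j G3 G4 k G7.
split => //; have [f1|f1] := eqVneq (f 1) l; last by right; exact/eqP.
left; split => //.
- exact: (cell_path_hit cf dp u0 uv v1 bl' G1 j G3 G4 k G7 f0 f1 G6).
- apply/in_boxesP => q hq; have /= := I2 _ (In_shift u hq).
  rewrite in_itv/= => /andP[h1 h2]; rewrite /rolled unroll_le1//; last first.
    have h : q.1.1 + u <= end_time (u + d) C by exact: (In_path_end pC (In_shift u hq)).
    by move: eC; lra.
  move: h1 h2 mb; rewrite [q.1.1 + u]addrC /low /f /tau => h1 h2 /andP[h3 h4].
  by apply/andP; split; lra.
- apply/in_boxesP => q hq'; have [hq|hq] := List.in_app_or _ _ _ hq'.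
    have /= := I3 _ (In_shift v hq).
    rewrite in_itv/= => /andP[h1 h2]; rewrite /rolled unroll_le1//; last first.
      have h : q.1.1 + v <= end_time (v + d) C1 by exact: (In_path_end pC1 (In_shift v hq)).
      by move: eC1; lra.
    move: h1 h2 mb; rewrite [q.1.1 + v]addrC /low /f /tau => h1 h2 /andP[h3 h4].
    by apply/andP; split; lra.
  have /= := I1 _ (In_shift (v - 1) hq).
  rewrite in_itv/= => /andP[h1 h2].
  have h : 0 <= q.1.1 + (v - 1) by exact: (In_path_ge pC2 (In_shift (v - 1) hq)).
  rewrite /rolled unroll_ge1; last by lra.
  move: h1 h2 mb f1; rewrite [q.1.1 + _]addrC -addrA [-1 + _]addrC addrA /low /f /tau => h1 h2 /andP[h3 h4] f1.
  by rewrite f1; apply/andP; split; lra.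
Qed.

Lemma near_event_prob : measurable (near_event u v d c (c1 ++ c2)) ->
  (((gauss 1 l)^-1 * (d ^+ 2 * l / 4))%:E *
   \int[mu]_(r in `]0%R, 1%R[) \int[mu]_(q in `]0%R, 1%R[)
     (bmass (z0 + d * q) l (d * r) 0 (box_rect c) *
      bmass (1 - z0 + d * r) 0 (d * q) 0 (box_rect (c1 ++ c2)))
   <= P (near_event u v d c (c1 ++ c2)))%E.
Proof.
(* The bridge ends at [l] only almost surely, so a null set is added to the event. *)
move=> mE; pose N := [set w | B 1 w <> l].
have mN : measurable N.
  rewrite (_ : N = B 1 @^-1` [set~ l])//.
  by rewrite -[X in measurable X]setTI; apply: mB => //; apply: measurableC.
have N0 : P N = 0%E.
  have [_ _ _ B1 _] := BB.
  by case: B1 => A [mA A0 sA]; apply: (subset_measure0 mN mA) => // w Nw; exact: sA.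
have -> : P (near_event u v d c (c1 ++ c2)) = P (near_event u v d c (c1 ++ c2) `|` N).
  by rewrite measureU0.
have key := @cells_mass_integral R l d u z0 _ _ _ l0 dp (msets_box_rect c1) (msets_box_rect c)
  (msets_box_rect c2) p e p1 e1 p2 e2.
rewrite EFinM -muleA box_rect_cat -key.
apply: (@cell_prob _ _ _ P B l d u v C2 C C1 BB cB mB l0 dp mC1 mC mC2 pC1 eC1 pC eC pC2 eC2 _ (fun w => - low w) (Num.min d l)).
- exact: measurableU.
- by rewrite lt_min dp l0 ge_min lexx orbT.
- by apply: measurable_cells_mass => //; exact: msets_box_rect.
- by move=> a b w a0 b0 /(cell_event_near a0 b0)[].
Qed.

End one_cell.

End near_event.

(** * Measurability of path functionals *)

Section path_measurability.
Context {R : realType}.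
Implicit Types (f g : R -> R) (s t x a b : R).

Lemma measurable_fun_gt d (T : measurableType d) (f : T -> R) :
  (forall x, measurable [set w | x < f w]) -> measurable_fun setT f.
Proof.
move=> H; apply: (measurability _ (RGenOInfty.measurableE R)) => _ [_ [x ->] <-].
rewrite setTI (_ : _ @^-1` _ = [set w | x < f w])//.
by apply/seteqP; split=> w /=; rewrite in_itv/= andbT.
Qed.

Lemma measurable_le_fun d (T : measurableType d) (f g : T -> R) :
  measurable_fun setT f -> measurable_fun setT g -> measurable [set w | f w <= g w].
Proof.
move=> mf mg; have h : measurable_fun setT (fun w => f w <= g w) by exact: measurable_fun_ler.
by have := h measurableT [set true] I; rewrite setTI; congr measurable; apply/seteqP; split=> w /=.
Qed.

Lemma continuous_lt_rat g x c : continuous g -> g x < c -> exists r : rat, g (ratr r) < c.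
Proof.
move=> cg gx; have : \forall y \near x, g y < c by exact: (cvgr_lt _ (cg x)).
move=> /nbhs_ballP[e /= e0 be].
have ob : open (ball x e) by exact: ball_open.
have [|y [xy [r _ ry]]] := @dense_rat R (ball x e) _ ob.
  by exists x; exact: ballxx.
by exists r; rewrite ry; exact: be.
Qed.

Definition retract a b x := Num.max a (Num.min b x).

Lemma continuous_retract a b : continuous (retract a b).
Proof.
move=> t; have cm : Num.min b x @[x --> t] --> Num.min b t.
  have -> : (fun x => Num.min b x) = (fun x => (b + x - `|b - x|) / 2).
    by apply/funext => x; rewrite minr_absE.
  rewrite minr_absE; apply: cvgM; last exact: cvg_cst.
  apply: cvgB; first by apply: cvgD; [exact: cvg_cst|exact: cvg_id].
  by apply: cvg_norm; apply: cvgB; [exact: cvg_cst|exact: cvg_id].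
have -> : retract a b = (fun x => (a + Num.min b x + `|a - Num.min b x|) / 2).
  by apply/funext => x; rewrite /retract maxr_absE.
apply: cvgM; last exact: cvg_cst.
apply: cvgD; first by apply: cvgD; [exact: cvg_cst|exact: cm].
by apply: cvg_norm; apply: cvgB; [exact: cvg_cst|exact: cm].
Qed.

Lemma retract_id a b x : a <= x <= b -> retract a b x = x.
Proof. by move=> /andP[ax xb]; rewrite /retract min_r// max_r. Qed.

Lemma retract_itv a b x : a <= b -> a <= retract a b x <= b.
Proof. by move=> ab; rewrite /retract le_max lexx ge_max ab/= ge_min lexx. Qed.

Lemma continuous_comp_retract g a b : continuous g -> continuous (fun x => g (retract a b x)).
Proof.
by move=> cg x; apply: (@continuous_comp _ _ _ (retract a b) g); [exact: continuous_retract|exact: cg].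
Qed.

(** The first minimum lies after [x] exactly when the path on [[0, x]] stays above some value of the
    path on [[0, 1]] by a positive margin; by continuity rational times suffice. *)
Lemma argmin_time_gtP f x : continuous f -> 0 <= x <= 1 ->
  x < argmin_time f <-> exists k (s : rat), forall t : rat,
    f (retract 0 1 (ratr s)) + k.+1%:R^-1 <= f (retract 0 x (ratr t)).
Proof.
move=> cf /andP[x0 x1]; have [tau01 mi str] := argmin_timeP cf; split.
  move=> xt; have [c c0x cmin] : exists2 c, c \in `[0, x]%R & forall t, t \in `[0, x]%R -> f c <= f t.
    by apply: EVT_min => //; exact: continuous_subspaceT.
  move: c0x; rewrite in_itv/= => /andP[c0 cx].
  have gap : 0 < f c - f (argmin_time f).
    by rewrite subr_gt0; apply: str; rewrite c0 (le_lt_trans cx).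
  have g2 : 0 < (f c - f (argmin_time f)) / 2 by rewrite divr_gt0.
  have /cvgr_lt/(_ _ g2)[k _ /(_ k (leqnn k)) /= hk] := @cvg_harmonic R.
  have [|s hs] := @continuous_lt_rat (fun y => f (retract 0 1 y)) (argmin_time f)
    (f (argmin_time f) + (f c - f (argmin_time f)) / 2) (@continuous_comp_retract f 0 1 cf).
    by rewrite retract_id// ltrDl.
  exists k, s => t.
  have := cmin (retract 0 x (ratr t)); rewrite in_itv/= retract_itv// => /(_ isT).
  by move: hk hs; move: (k.+1%:R^-1) => y; lra.
move=> [k [s H]]; rewrite ltNge; apply/negP => tx.
have [|t] := @continuous_lt_rat (fun y => f (retract 0 x y)) (argmin_time f)
    (f (retract 0 1 (ratr s)) + k.+1%:R^-1) (@continuous_comp_retract f 0 x cf).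
  rewrite retract_id ?tx; last by case/andP : tau01 => ->.
  have := mi (retract 0 1 (ratr s)); rewrite retract_itv// => /(_ isT) h.
  by rewrite (le_lt_trans h)// ltrDl invr_gt0.
by rewrite ltNge H.
Qed.

Lemma last_hit_ge0 l f : 0 <= last_hit l f.
Proof.
have [h|/set0P[t ht]] := eqVneq (hits l f) set0; first by rewrite /last_hit -/(hits l f) h sup0.
by apply: le_trans (last_hit_ge ht); case: ht => /andP[].
Qed.

Lemma last_hit_le1 l f : last_hit l f <= 1.
Proof. by apply: last_hit_le => // t [/andP[_ /ltW]]. Qed.

(** A hit after [x] lies in a compact interval at distance [(1 - x) / (n + 2)] from both [x] and 1,
    on which [|f - l|] has infimum 0. The offset 2 keeps this interval non-empty for every [n]. *)
Lemma last_hit_gtP l f x : continuous f -> 0 <= x < 1 ->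
  x < last_hit l f <-> exists n, forall k, exists r : rat,
    `|f (retract (x + (1 - x) / n.+2%:R) (1 - (1 - x) / n.+2%:R) (ratr r)) - l| < k.+1%:R^-1.
Proof.
move=> cf /andP[x0 x1].
have cg : continuous (fun y => `|f y - l|).
  by move=> y; apply: cvg_norm; apply: cvgB; [exact: cf|exact: cvg_cst].
have dx : 0 < 1 - x by rewrite subr_gt0.
have n0 n : 0 < n.+2%:R^-1 :> R by rewrite invr_gt0.
have n2 n : n.+2%:R^-1 <= 2^-1 :> R by rewrite lef_pV2 ?posrE// ler_nat.
split.
  move=> xl; have [t [/andP[t0 t1] tl] xt] : exists2 t, hits l f t & x < t.
    apply: contrapT => h; move: xl; rewrite ltNge => /negP; apply.
    apply: last_hit_le => // t ht; rewrite leNgt; apply/negP => xt.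
    by apply: h; exists t.
  have m0 : 0 < Num.min (t - x) (1 - t) / (1 - x) by rewrite divr_gt0// lt_min !subr_gt0 xt.
  have /cvgr_lt/(_ _ m0)[n _ /(_ n.+1 (leqnSn n)) /=] := @cvg_harmonic R.
  rewrite ltr_pdivlMr// lt_min => /andP[h1 h2].
  exists n => k; apply: (@continuous_lt_rat (fun y => `|f (retract _ _ y) - l|) t).
    exact: (@continuous_comp_retract (fun y => `|f y - l|)).
  rewrite retract_id ?tl ?subrr ?normr0 ?invr_gt0//.
  by move: h1 h2; move: (n.+2%:R^-1) => y h1 h2; apply/andP; split; lra.
move=> [n H]; set a := x + _ in H; set b := 1 - _ in H.
have ab : a <= b.
  by rewrite /a /b; have := n2 n; have := n0 n; move: (n.+2%:R^-1) => y; nra.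
have [c cab cmin] : exists2 c, c \in `[a, b]%R & forall t, t \in `[a, b]%R -> `|f c - l| <= `|f t - l|.
  by apply: (@EVT_min _ (fun y => `|f y - l|)) => //; exact: continuous_subspaceT.
move: cab; rewrite in_itv/= => /andP[ac cb].
have ax : x < a by rewrite ltrDl mulr_gt0.
have b1 : b < 1 by rewrite gtrBl mulr_gt0.
have fc : f c = l.
  apply/eqP; rewrite -subr_eq0 -normr_eq0; apply/eqP/le_anti; rewrite normr_ge0 andbT leNgt.
  apply/negP => h; have /cvgr_lt/(_ _ h)[k _ /(_ k (leqnn k)) /= hk] := @cvg_harmonic R.
  have [r hr] := H k; have := cmin (retract a b (ratr r)); rewrite in_itv/= retract_itv// => /(_ isT).
  by rewrite leNgt (lt_trans hr).
apply: (lt_le_trans ax); apply: (le_trans ac); apply: last_hit_ge; split => //.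
by rewrite (le_lt_trans cb) ?andbT// (le_trans _ ac)// (le_trans x0)// ltW.
Qed.

Section process.
Context d (T : measurableType d) (B : R -> T -> R) (l : R).
Hypotheses (cB : forall w, continuous (B ^~ w)) (mB : forall t, measurable_fun setT (B t)).
Hypothesis B0 : forall w, B 0 w = 0.

(** Joint measurability: the time is rounded down to a multiple of [1 / (n + 1)], and continuity of
    the paths gives the limit. *)
Lemma measurable_process_pair : measurable_fun setT (fun q : R * T => B q.1 q.2).
Proof.
pose fl (n : nat) (t : R) : R := (Num.floor (t * n.+1%:R))%:~R / n.+1%:R.
apply: (@measurable_fun_cvg _ _ _ setT (fun n (q : R * T) => B (fl n q.1) q.2)); last first.
  move=> [t w] _ /=; have ct : fl n t @[n --> \oo] --> t.
    apply: (@squeeze_cvgr _ _ _ _ (fun n => t - n.+1%:R^-1) (fun=> t)).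
    - apply: nearW => n; have n0 : 0 < n.+1%:R :> R by [].
      rewrite /fl ler_pdivlMr// ler_pdivrMr// mulrBl mulVf ?gt_eqF// lerBlDr.
      by rewrite Num.Theory.floor_le// -intrD1 (ltW (Num.Theory.floorD1_gt _)).
    - rewrite -[X in _ --> X]subr0; apply: cvgB; first exact: cvg_cst.
      exact: cvg_harmonic.
    - exact: cvg_cst.
  exact: (cvgn_comp (@cB w t) ct).
move=> n _ A mA; rewrite setTI.
rewrite (_ : _ @^-1` _ = \bigcup_(k : int) ([set q : R * T | Num.floor (q.1 * n.+1%:R) = k] `&`
   [set q | A (B (k%:~R / n.+1%:R) q.2)])); last first.
  apply/seteqP; split=> q /=; first by move=> h; exists (Num.floor (q.1 * n.+1%:R)).
  by move=> [k _ [/= h1 h2]]; rewrite /fl h1.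
apply: countable_bigcupT_measurable => [|k]; first exact: countableP.
apply: measurableI.
  rewrite (_ : [set q | _] = (fun q : R * T => q.1 * n.+1%:R) @^-1` `[k%:~R, (k + 1)%:~R[); last first.
    apply/seteqP; split=> q /=; rewrite in_itv/=.
      by move=> <-; rewrite Num.Theory.floor_le// Num.Theory.floorD1_gt.
    by move=> h; apply/Num.Theory.floor_def.
  have h : measurable_fun setT (fun q : R * T => q.1 * n.+1%:R) by apply: measurable_funM.
  by rewrite -[X in measurable X]setTI; apply: h.
have h := measurable_pair_snd (T1 := measurableTypeR R) (mB (k%:~R / n.+1%:R)).
by have := h measurableT _ mA; rewrite setTI.
Qed.

Lemma measurable_process_at d' (W : measurableType d') (f : W -> R) (g : W -> T) :
  measurable_fun setT f -> measurable_fun setT g -> measurable_fun setT (fun w => B (f w) (g w)).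
Proof.
move=> mf mg; have h : measurable_fun setT (fun w => (f w, g w)) by exact: measurable_fun_pair.
exact: (measurableT_comp measurable_process_pair h).
Qed.

Lemma measurable_tau : measurable_fun setT (tau B).
Proof.
apply: measurable_fun_gt => x.
have t01 w : 0 <= tau B w <= 1 by have [] := argmin_timeP (@cB w).
have [x0|x0] := ltP x 0.
  rewrite (_ : [set w | _] = setT)//; apply/seteqP; split=> w //= _.
  by have /andP[h _] := t01 w; exact: lt_le_trans h.
have [x1|x1] := ltP 1 x.
  rewrite (_ : [set w | _] = set0)//; apply/seteqP; split=> w //= h.
  by have /andP[_] := t01 w; rewrite leNgt (lt_trans x1 h).
rewrite (_ : [set w | _] = \bigcup_k \bigcup_(s : rat) \bigcap_(t : rat)
   [set w | B (retract 0 1 (ratr s)) w + k.+1%:R^-1 <= B (retract 0 x (ratr t)) w]); last first.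
  have x01 : 0 <= x <= 1 by rewrite x0.
  apply/seteqP; split=> w /=.
    by move=> /(argmin_time_gtP (@cB w) x01)[k [s h]]; exists k => //; exists s => // t _; exact: h.
  by move=> [k _ [s _ h]]; apply/(argmin_time_gtP (@cB w) x01); exists k, s => t; exact: h.
apply: bigcup_measurable => k _; apply: bigcupT_measurable_rat => s.
rewrite -[X in measurable X]setCK setC_bigcap; apply: measurableC.
apply: bigcupT_measurable_rat => t; apply: measurableC.
by apply: measurable_le_fun => //; exact: measurable_funD.
Qed.

Lemma measurable_low : measurable_fun setT (low B).
Proof. by apply: measurable_process_at => //; exact: measurable_tau. Qed.

Lemma measurable_rolled_at d' (W : measurableType d') (f : W -> R) (g : W -> T) :
  measurable_fun setT f -> measurable_fun setT g -> measurable_fun setT (fun w => rolled B (f w) (g w)).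
Proof.
move=> mf mg; apply: measurable_funD; apply: measurable_process_at => //.
  exact: measurable_minr.
by apply: measurable_funB => //; exact: measurable_maxr.
Qed.

Lemma measurable_vervaat_at d' (W : measurableType d') (f : W -> R) (g : W -> T) :
  measurable_fun setT f -> measurable_fun setT g ->
  measurable_fun setT (fun w => vervaat (B ^~ (g w)) (f w)).
Proof.
move=> mf mg; rewrite (_ : (fun w => _) = (fun w => rolled B (tau B (g w) + f w) (g w) - low B (g w))); last first.
  by apply/funext => w; rewrite vervaat_unroll.
apply: measurable_funB; last exact: (measurableT_comp measurable_low).
apply: measurable_rolled_at => //; apply: measurable_funD => //.
exact: (measurableT_comp measurable_tau).
Qed.

Lemma measurable_hit_time : measurable_fun setT (hit_time B l).
Proof.
apply: measurable_fun_gt => x.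
have [x0|x0] := ltP x 0.
  rewrite (_ : [set w | _] = setT)//; apply/seteqP; split=> w //= _.
  by apply: lt_le_trans x0 _; exact: last_hit_ge0.
have [x1|x1] := leP 1 x.
  rewrite (_ : [set w | _] = set0)//; apply/seteqP; split=> w //= h.
  by have := last_hit_le1 l (vervaat (B ^~ w)); rewrite leNgt (le_lt_trans x1 h).
rewrite (_ : [set w | _] = \bigcup_n \bigcap_k \bigcup_(r : rat)
   [set w | `|vervaat (B ^~ w) (retract (x + (1 - x) / n.+2%:R) (1 - (1 - x) / n.+2%:R) (ratr r)) - l| < k.+1%:R^-1]); last first.
  have x01 : 0 <= x < 1 by rewrite x0.
  have cV w := continuous_vervaat (@cB w) (B0 w).
  apply/seteqP; split=> w /=.
    by move=> /(last_hit_gtP l (cV w) x01)[n h]; exists n => // k _; have [r hr] := h k; exists r.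
  by move=> [n _ h]; apply/(last_hit_gtP l (cV w) x01); exists n => k; have [r _ hr] := h k I; exists r.
apply: bigcup_measurable => n _; apply: bigcap_measurableType => k _; apply: bigcupT_measurable_rat => r.
set t := retract _ _ _.
have mv : measurable_fun setT (fun w => `|vervaat (B ^~ w) t - l|).
  apply: measurableT_comp => //; apply: measurable_funB => //.
  by apply: (measurable_vervaat_at (f := fun=> t) (g := idfun)); [exact: measurable_cst|exact: measurable_id].
rewrite (_ : [set w | _] = (fun w => `|vervaat (B ^~ w) t - l|) @^-1` `]-oo, k.+1%:R^-1[); last first.
  by apply/seteqP; split=> w /=; rewrite in_itv.
by rewrite -[X in measurable X]setTI; apply: mv.
Qed.

Lemma measurable_near_event d' (W : measurableType d') (U V : W -> R) (g : W -> T) e c c' :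
  measurable_fun setT U -> measurable_fun setT V -> measurable_fun setT g ->
  measurable [set w | near_event B l (U w) (V w) e c c' (g w)].
Proof.
move=> mU mV mg.
have mt : measurable_fun setT (fun w => tau B (g w)) by exact: (measurableT_comp measurable_tau).
have mz : measurable_fun setT (fun w => hit_time B l (g w)) by exact: (measurableT_comp measurable_hit_time).
have ml : measurable_fun setT (fun w => low B (g w)) by exact: (measurableT_comp measurable_low).
have m2 (f1 f2 f3 : W -> R) : measurable_fun setT f1 -> measurable_fun setT f2 -> measurable_fun setT f3 ->
    measurable [set w | f1 w <= f2 w <= f3 w].
  move=> h1 h2 h3; rewrite (_ : [set w | _] = [set w | f1 w <= f2 w] `&` [set w | f2 w <= f3 w]).
    by apply: measurableI; exact: measurable_le_fun.
  by apply/seteqP; split=> w /= /andP.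
have mb (F : R -> W -> R) D : (forall s, measurable_fun setT (F s)) ->
    measurable [set w | in_boxes (F ^~ w) e D].
  move=> mF; rewrite /in_boxes; elim: D => [|q D ih] /=; first by rewrite (_ : [set w | _] = setT)//; apply/seteqP.
  rewrite (_ : [set w | _] = [set w | q.1.2 <= F q.1.1 w <= q.2 + e] `&` [set w | all (fun q => q.1.2 <= F q.1.1 w <= q.2 + e) D]).
    by apply: measurableI => //; exact: m2.
  by apply/seteqP; split=> w /= /andP.
rewrite (_ : [set w | _] = [set w | U w <= tau B (g w) <= U w + e] `&`
  [set w | V w <= tau B (g w) + hit_time B l (g w) <= V w + e] `&`
  [set w | in_boxes (fun s => rolled B (U w + s) (g w) - low B (g w)) e c] `&`
  [set w | in_boxes (fun s => rolled B (V w + s) (g w) - low B (g w) - l) e c']); last first.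
  by apply/seteqP; split=> w /=; [case|move=> [[[]]]].
apply: measurableI; [apply: measurableI; [apply: measurableI|]|].
- by apply: m2 => //; exact: measurable_funD.
- by apply: m2 => //; exact: measurable_funD.
- apply: (mb (fun s w => rolled B (U w + s) (g w) - low B (g w))) => s.
  by apply: measurable_funB => //; apply: measurable_rolled_at => //; exact: measurable_funD.
- apply: (mb (fun s w => rolled B (V w + s) (g w) - low B (g w) - l)) => s.
  apply: measurable_funB => //; apply: measurable_funB => //.
  by apply: measurable_rolled_at => //; exact: measurable_funD.
Qed.

End process.

End path_measurability.

(** * Lower bound on boxes *)

Section box_event.
Context {R : realType}.
Notation mu := (@lebesgue_measure R).

Lemma liminf_geMM (a b : \bar R) (u v : nat -> \bar R) : (0 <= a)%E -> (0 <= b)%E ->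
  (forall n, 0 <= u n)%E -> (forall n, 0 <= v n)%E ->
  liminf_ge a u -> liminf_ge b v -> liminf_ge (a * b)%E (fun n => u n * v n)%E.
Proof.
move=> a0 b0 u0 v0 ua vb r rab.
have [r0|r0] := ltP r 0.
  by apply: nearW => n; apply: (@lt_le_trans _ _ 0%E); rewrite ?lte_fin// mule_ge0.
have [x [x0 xa rx]] : exists x : R, [/\ 0 < x, (x%:E < a)%E & (r%:E < x%:E * b)%E].
  move: a b a0 b0 rab {ua vb} => [a| |] [b| |]//.
  - rewrite !lee_fin => a0 b0; rewrite -EFinM lte_fin => rab.
    have b0' : 0 < b.
      by rewrite lt_neqAle b0 andbT; apply/eqP => bE; move: rab; rewrite -bE mulr0 ltNge r0.
    have h : r / b < a by rewrite ltr_pdivrMr.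
    have h0 : 0 <= r / b by rewrite divr_ge0.
    exists ((r / b + a) / 2); split; [by lra|by rewrite lte_fin; lra|].
    by rewrite -EFinM lte_fin -ltr_pdivrMr//; lra.
  - rewrite lee_fin => a0 _ rab; have a0' : 0 < a.
      by rewrite lt_neqAle a0 andbT; apply/eqP => aE; move: rab; rewrite -aE mul0e lte_fin ltNge r0.
    exists (a / 2); split; [by rewrite divr_gt0|by rewrite lte_fin; lra|].
    by rewrite gt0_muley ?ltry// lte_fin divr_gt0.
  - rewrite lee_fin => _ b0 rab; have b0' : 0 < b.
      by rewrite lt_neqAle b0 andbT; apply/eqP => bE; move: rab; rewrite -bE mule0 lte_fin ltNge r0.
    exists (r / b + 1); split; [by rewrite ltr_wpDl// divr_ge0|by rewrite ltry|].
    by rewrite -EFinM lte_fin mulrDl divfK ?gt_eqF// mul1r ltrDl.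
  - by move=> _ _ _; exists 1; split => //; rewrite ?ltry// mul1e ltry.
have H : liminf_ge (x%:E * b)%E (fun n => x%:E * v n)%E.
  by apply: (@liminf_geM _ x (fun=> x)) => //; [exact: ltW|exact: cvg_cst|move=> n; exact: ltW].
move: (ua _ xa) (H _ rx); apply: filterS2 => n h1 h2.
by apply: (lt_le_trans h2); apply: lee_wpmul2r => //; exact: ltW.
Qed.

Lemma path_near0 y (D : seq (R * set R)) : path <%R 0 (unzip1 D) -> end_time 0 D < y ->
  exists2 x, 0 < x & forall e, 0 < e < x -> path <%R e (unzip1 D) /\ end_time e D < y.
Proof.
case: D => [|[t A] D] /=.
  by rewrite /end_time/= => _ y0; exists y => // e /andP[_].
move=> /andP[t0 pD] ey; exists t => // e /andP[_ et].
by rewrite et pD.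
Qed.

(** Applied at the time when the unrolled path passes the end of the bridge; a constraint exactly at
    that time would belong to neither part. *)
Lemma box_split x y (D : seq (R * R * R)) s : path <%R s (unzip1 (box_rect D)) -> s < x -> x < y ->
  end_time s (box_rect D) < y -> (forall q, List.In q D -> q.1.1 <> x) ->
  exists D1 D2, [/\ D = D1 ++ D2, path <%R s (unzip1 (box_rect D1)), end_time s (box_rect D1) < x,
    path <%R x (unzip1 (box_rect D2)) & end_time x (box_rect D2) < y].
Proof.
elim: D s => [|q D ih] s /=; first by move=> _ sx xy _ _; exists [::], [::]; split.
move=> /andP[sq pD] sx xy ey nx; have [qx|xq|qx] := ltgtP q.1.1 x.
- have [|D1 [D2 [-> p1 e1 p2 e2]]] := ih _ pD qx xy ey; first by move=> q' hq; apply: nx; right.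
  by exists (q :: D1), D2; split => //=; rewrite sq.
- by exists [::], (q :: D); split => //=; rewrite xq.
- by case: (nx q) => //; left.
Qed.

(** The reason for closed boxes: a continuous path outside a box stays outside its slight
    enlargement at all nearby times. *)
Lemma box_far (F : R -> R) x0 k lo hi : continuous F -> ~~ (lo <= F x0 - k <= hi) ->
  exists2 x, 0 < x & forall e y, 0 < e < x -> `|y - x0| <= e -> ~~ (lo <= F y - k <= hi + e).
Proof.
move=> cF; rewrite negb_and -!ltNge => /orP[h|h].
  have : \forall y \near x0, F y < lo + k by apply: (cvgr_lt _ (cF x0)); rewrite -ltrBlDr.
  move=> /nbhs_ballP[x /= xp bx]; exists x => // e y /andP[e0 ex] ye.
  have : F y < lo + k by apply: bx; rewrite /ball/= distrC (le_lt_trans ye).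
  by rewrite -ltrBlDr negb_and -!ltNge => ->.
have gap : 0 < (F x0 - k - hi) / 2 by rewrite divr_gt0// subr_gt0.
have : \forall y \near x0, F x0 - (F x0 - k - hi) / 2 < F y.
  by apply: (cvgr_gt _ (cF x0)); rewrite gtrBl.
move=> /nbhs_ballP[x /= xp bx]; exists (Num.min x ((F x0 - k - hi) / 2)); first by rewrite lt_min xp.
move=> e y /andP[e0]; rewrite lt_min => /andP[ex eg] ye.
have : F x0 - (F x0 - k - hi) / 2 < F y by apply: bx; rewrite /ball/= distrC (le_lt_trans ye).
by rewrite negb_and -!ltNge => hy; apply/orP; right; lra.
Qed.

Context {d0 : measure_display} {T : measurableType d0} (P : probability T R).
Variables (B : R -> T -> R) (l : R).
Hypotheses (BB : brownian_bridge P 1 0 l B).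
Hypotheses (cB : forall w, continuous (B ^~ w)) (mB : forall t, measurable_fun setT (B t)).
Hypothesis l0 : 0 < l.

Variables (b b' : R) (c c' : seq (R * R * R)).
Hypotheses (pc : path <%R 0 (unzip1 (box_rect c))) (ec : end_time 0 (box_rect c) < b).
Hypotheses (pc' : path <%R 0 (unzip1 (box_rect c'))) (ec' : end_time 0 (box_rect c') < 1 - b').

Let B0 w : B 0 w = 0. Proof. by have [_ _ ->] := BB. Qed.

Definition box_event : set T := [set w | [/\ b <= hit_time B l w <= b',
  in_boxes (fun s => vervaat (B ^~ w) s) 0 c &
  in_boxes (fun s => vervaat (B ^~ w) (hit_time B l w + s) - l) 0 c']].

Let en n : R := n.+1%:R^-1.
Let en0 n : 0 < en n. Proof. by rewrite invr_gt0. Qed.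
Let cen : en n @[n --> \oo] --> (0 : R). Proof. exact: cvg_harmonic. Qed.
Let en_small x : 0 < x -> \forall n \near \oo, 0 < en n < x.
Proof. by move=> x0; move: cen => /cvgr_lt/(_ _ x0); apply: filterS => n ->; rewrite en0. Qed.

(** Pairs of corners and outcomes whose near event holds at mesh [en n]; [z] is the time from the
    minimum to the last hit. *)
Let U n : set ((R * R) * T) :=
  [set q | b <= q.1.2 <= b' /\ near_event B l q.1.1 (q.1.1 + q.1.2) (en n) c c' q.2].

Let mU n : measurable (U n).
Proof.
have m1 : measurable_fun setT (fun q : (R * R) * T => q.1.1) by exact: measurableT_comp.
have m2 : measurable_fun setT (fun q : (R * R) * T => q.1.2) by exact: measurableT_comp.
have m3 : measurable_fun setT (fun q : (R * R) * T => q.2) by exact: measurable_snd.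
rewrite (_ : U n = [set q | b <= q.1.2] `&` [set q | q.1.2 <= b'] `&`
  [set q | near_event B l q.1.1 (q.1.1 + q.1.2) (en n) c c' q.2]); last first.
  by apply/seteqP; split=> q /=; [move=> [/andP[]]|move=> [[h1 h2] h3]; split => //; apply/andP].
apply: measurableI; first by apply: measurableI; exact: measurable_le_fun.
by apply: measurable_near_event => //; exact: measurable_funD.
Qed.

Let ind n (q : (R * R) * T) : \bar R := (\1_(U n) q)%:E.
Let mind n : measurable_fun setT (ind n).
Proof. by apply/measurable_EFinP; exact: measurable_indic. Qed.
Let ind0 n q : (0 <= ind n q)%E. Proof. by rewrite lee_fin. Qed.
Let indE n u z w : ind n (u, z, w) = if `[< U n (u, z, w) >] then 1%E else 0%E.
Proof. by rewrite /ind indicE; case: asboolP => hU; [rewrite mem_set|rewrite memNset]. Qed.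

Let slice n (q : R * T) : \bar R := (\int[mu]_z ind n (q.1, z, q.2))%E.
Let mslice n : measurable_fun setT (slice n).
Proof.
apply: (measurable_setI_integral (h := fun p : (R * T) * R => ind n (p.1.1, p.2, p.1.2))) => //.
have hp : measurable_fun setT (fun p : (R * T) * R => (p.1.1, p.2, p.1.2)).
  apply: measurable_fun_pair; last exact: measurableT_comp.
  by apply: measurable_fun_pair; [exact: measurableT_comp|exact: measurable_snd].
exact: (measurableT_comp (mind n) hp).
Qed.
Let slice0 n q : (0 <= slice n q)%E. Proof. by apply: integral_ge0 => z _. Qed.

Let area n w : \bar R := (\int[mu]_u slice n (u, w))%E.

Let area_ge0 n w : (0 <= area n w)%E. Proof. by apply: integral_ge0 => z _. Qed.
Let marea n : measurable_fun setT (area n).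
Proof.
apply: (measurable_setI_integral (h := fun p : T * R => slice n (p.2, p.1))) => //.
have hp : measurable_fun setT (fun p : T * R => (p.2, p.1)) by exact: measurable_fun_pair.
exact: (measurableT_comp (mslice n) hp).
Qed.

Let area_tonelli n :
  (\int[mu]_u \int[mu]_z P (xsection (U n) (u, z)) = \int[P]_w area n w)%E.
Proof.
transitivity (\int[mu]_u \int[P]_w slice n (u, w))%E; last first.
  exact: (@fubini_tonelli _ _ _ _ R mu P (slice n) (mslice n)).
apply: eq_integral => u _.
transitivity (\int[mu]_z \int[P]_w ind n (u, z, w))%E.
  apply: eq_integral => z _; have mx := measurable_xsection (u, z) (mU n).
  rewrite -[xsection _ _]setIT -(integral_indic P measurableT mx).
  by apply: eq_integral => w _; rewrite /ind !indicE mem_xsection.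
have hp : measurable_fun setT (fun p : R * T => (u, p.1, p.2)).
  by apply: measurable_fun_pair => //; exact: measurable_fun_pair.
exact: (@fubini_tonelli _ _ _ _ R mu P (fun p => ind n (u, p.1, p.2)) (measurableT_comp (mind n) hp)).
Qed.

(** For a given outcome [u] is within [en n] of the minimum, and then [u + z] is within [en n] of
    the last hit: two intervals of length [en n]. *)
Let area_le n w : (area n w <= ((en n) ^+ 2)%:E)%E.
Proof.
set e := en n; have e0 : 0 < e by exact: en0.
apply: (@le_trans _ _ (\int[mu]_u (e%:E * (\1_(`[tau B w - e, tau B w] : set R) u)%:E)))%E.
  apply: ge0_le_integral => //.
  - have hp : measurable_fun setT (fun u : R => (u, w)) by exact: measurable_fun_pair.
    exact: (measurableT_comp (mslice n) hp).
  - by apply: emeasurable_funM => //; apply/measurable_EFinP; exact: measurable_indic.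
  move=> u _; rewrite indicE; case: (boolP (u \in _)) => hu; last first.
    rewrite mule0 /slice integral0_eq// => z _; rewrite indE/=.
    case: asboolP => // -[_ [/= /andP[h1 h2] _ _ _]]; exfalso; move: hu; rewrite notin_setE; apply.
    by rewrite /= in_itv/=; apply/andP; split; rewrite /e; lra.
  pose I : set R := `[tau B w + hit_time B l w - e - u, tau B w + hit_time B l w - u]%classic.
  rewrite mule1; apply: (@le_trans _ _ (\int[mu]_z (\1_I z)%:E)%E).
    apply: ge0_le_integral => //.
    - have hp : measurable_fun setT (fun z : R => (u, z, w)).
        by apply: measurable_fun_pair => //; exact: measurable_fun_pair.
      exact: (measurableT_comp (mind n) hp).
    - by apply/measurable_EFinP; apply: measurable_indic; exact: measurable_itv.
    move=> z _; rewrite /= indE; case: asboolP => [|_]; last by rewrite lee_fin.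
    move=> -[_ [_ /= /andP[h1 h2] _ _]]; rewrite indicE mem_set//.
    by rewrite /I /= in_itv/=; apply/andP; split; rewrite /e; lra.
  have muI : mu I = e%:E.
    by rewrite /I lebesgue_measure_itv/= lte_fin ifT; [rewrite -EFinD; congr EFin; lra|lra].
  by rewrite (integral_indic mu measurableT (measurable_itv _)) setIT -/I -[X in (_ <= X)%E]muI.
rewrite ge0_integralZl//; last 2 first.
- by apply/measurable_EFinP; exact: measurable_indic.
- by rewrite lee_fin ltW.
pose J : set R := `[tau B w - e, tau B w]%classic.
have muJ : mu J = e%:E.
  by rewrite /J lebesgue_measure_itv/= lte_fin gtrBl e0 -EFinD opprB addrC subrK.
rewrite (integral_indic mu measurableT (measurable_itv _)) setIT [X in (_ * X <= _)%E](_ : _ = e%:E); last exact: muJ.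
by rewrite -EFinM expr2.
Qed.

(** The area in units of the squared mesh: at most 1 always, and eventually 0 off the box event. It
    approximates the indicator of the event from below. *)
Let ratio n w : \bar R := (((en n) ^- 2)%:E * area n w)%E.
Let ratio_ge0 n w : (0 <= ratio n w)%E.
Proof. by rewrite mule_ge0// lee_fin invr_ge0 exprn_ge0 ?ltW. Qed.
Let ratio_le1 n w : (ratio n w <= 1)%E.
Proof.
apply: (@le_trans _ _ (((en n) ^- 2)%:E * ((en n) ^+ 2)%:E))%E.
  by apply: lee_wpmul2l; [rewrite lee_fin invr_ge0 exprn_ge0 ?ltW|exact: area_le].
by rewrite -EFinM mulVf// expf_neq0// gt_eqF.
Qed.
Let mratio n : measurable_fun setT (ratio n).
Proof. by apply: emeasurable_funM => //; exact: marea. Qed.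

Let measurable_box_event : measurable box_event.
Proof.
have mht := measurable_hit_time l cB mB B0.
have mv (f : T -> R) : measurable_fun setT f -> measurable_fun setT (fun w => vervaat (B ^~ w) (f w)).
  by move=> mf; apply: (measurable_vervaat_at cB mB B0 (f := f) (g := idfun)) => //; exact: measurable_id.
have mb (F : R -> T -> R) D : (forall s, measurable_fun setT (F s)) ->
    measurable [set w | in_boxes (F ^~ w) 0 D].
  move=> mF; rewrite /in_boxes; elim: D => [|q D ih] /=; first by rewrite (_ : [set w | _] = setT)//; apply/seteqP.
  rewrite (_ : [set w | _] = [set w | q.1.2 <= F q.1.1 w] `&` [set w | F q.1.1 w <= q.2 + 0] `&` [set w | all (fun q => q.1.2 <= F q.1.1 w <= q.2 + 0) D]).
    by apply: measurableI => //; apply: measurableI; exact: measurable_le_fun.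
  by apply/seteqP; split=> w /=; [move=> /andP[/andP[]]|move=> [[? ?] ?]; apply/andP; split => //; apply/andP].
rewrite (_ : box_event = [set w | b <= hit_time B l w] `&` [set w | hit_time B l w <= b'] `&`
  [set w | in_boxes (fun s => vervaat (B ^~ w) s) 0 c] `&`
  [set w | in_boxes (fun s => vervaat (B ^~ w) (hit_time B l w + s) - l) 0 c']); last first.
  by apply/seteqP; split=> w /=; [move=> [/andP[]]|move=> [[[? ?] ?] ?]; split => //; apply/andP].
apply: measurableI; [apply: measurableI; [apply: measurableI|]|].
- exact: measurable_le_fun.
- exact: measurable_le_fun.
- by apply: (mb (fun s w => vervaat (B ^~ w) s)) => s; exact: mv.
- apply: (mb (fun s w => vervaat (B ^~ w) (hit_time B l w + s) - l)) => s.
  by apply: measurable_funB => //; apply: mv; exact: measurable_funD.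
Qed.

(** All conditions of the box event are closed; one that fails leaves a margin, which excludes every
    near event of smaller mesh, uniformly in the corners. *)
Let ratio_eventually0 w : ~ box_event w -> \forall n \near \oo, ratio n w = 0%E.
Proof.
move=> nE; suff [x x0 hx] : exists2 x, 0 < x & forall e u z, 0 < e < x -> b <= z <= b' ->
    ~ near_event B l u (u + z) e c c' w.
  move: (en_small x0); apply: filterS => n hn.
  rewrite /ratio /area integral0_eq ?mule0// => u _; apply: integral0_eq => z _.
  by rewrite /= indE; case: asboolP => // -[/(hx _ u _ hn)].
have cF : continuous (unroll (B ^~ w)) by exact: continuous_unroll.
have far (D : seq (R * R * R)) (x1 x0 : R) :
    ~~ in_boxes (fun s => unroll (B ^~ w) (x0 + s) - x1) 0 D ->
    exists2 x, 0 < x & forall e y, 0 < e < x -> `|y - x0| <= e ->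
      ~~ in_boxes (fun s => unroll (B ^~ w) (y + s) - x1) e D.
  rewrite /in_boxes; elim: D => [//|q D ih] /=; rewrite negb_and addr0 => /orP[h|/ih[x xp hx]].
    have [x xp hx] := box_far cF h; exists x => // e y he ye.
    by rewrite negb_and hx// opprD addrACA subrr addr0.
  by exists x => // e y he ye; rewrite negb_and hx// orbT.
have [h1|h1] := boolP (b <= hit_time B l w <= b'); last first.
  have [x xp hx] : exists2 x, 0 < x & hit_time B l w <= b - x \/ b' + x <= hit_time B l w.
    move: h1; rewrite negb_and -!ltNge => /orP[h|h].
      by exists (b - hit_time B l w); [rewrite subr_gt0|left; lra].
    by exists (hit_time B l w - b'); [rewrite subr_gt0|right; lra].
  exists x => // e u z /andP[e0 ex] /andP[bz zb] [/andP[h2 h3] /andP[h4 h5] _ _].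
  by case: hx; lra.
have VE s : vervaat (B ^~ w) s = unroll (B ^~ w) (tau B w + s) - low B w by exact: vervaat_unroll.
have [h2|h2] := boolP (in_boxes (fun s => unroll (B ^~ w) (tau B w + s) - low B w) 0 c); last first.
  have [x xp hx] := far _ _ _ h2; exists x => // e u z he _ [/andP[h3 h4] _ h5 _].
  have hn : `|u - tau B w| <= e by rewrite ler_norml; apply/andP; split; lra.
  by move/negP: (hx e u he hn); apply.
have [h3|h3] := boolP (in_boxes (fun s => unroll (B ^~ w) (tau B w + hit_time B l w + s) - (low B w + l)) 0 c'); last first.
  have [x xp hx] := far _ _ _ h3; exists x => // e u z he _ [_ /andP[h4 h5] _ h6].
  have hn : `|u + z - (tau B w + hit_time B l w)| <= e by rewrite ler_norml; apply/andP; split; lra.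
  move/negP: (hx e (u + z) he hn); apply.
  by move: h6; rewrite /in_boxes; congr is_true; apply: eq_all => q; rewrite opprD addrA.
exfalso; apply: nE; split => //.
  by move: h2; rewrite /in_boxes; congr is_true; apply: eq_all => q; rewrite VE.
by move: h3; rewrite /in_boxes; congr is_true; apply: eq_all => q; rewrite VE opprD !addrA.
Qed.

(** The cell constant [d ^+ 2 * l / 4] divided by the squared mesh and by the density [gauss 1 l] of
    the end point. *)
Let rate : R := (gauss 1 l)^-1 * l / 4.
Let rate_ge0 : 0 <= rate.
Proof. by rewrite divr_ge0// mulr_ge0 ?invr_ge0 ?(ltW (gauss_gt0 _ _)) ?ltW// gauss_gt0. Qed.

Definition box_density z : \bar R :=
  (bmass z l 0 0 (box_rect c) * bmass (1 - z) 0 0 0 (box_rect c'))%E.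

Let dens_ge0 z : (0 <= box_density z)%E.
Proof. by rewrite mule_ge0// bmass_ge0//; exact: msets_box_rect. Qed.

Let mdens : measurable_fun setT box_density.
Proof.
by apply: emeasurable_funM; apply: measurable_bmass => //; [exact: msets_box_rect|exact: msets_box_rect|exact: measurable_funB].
Qed.

(** Admissible corners: the last hit [u + z] comes before time 1, and no box sits at the time
    [1 - (u + z)], where the unrolled path wraps around. *)
Let S : set (R * R) := [set q | [/\ b <= q.2 <= b', 0 < q.1 < 1 - q.2 &
  forall p, List.In p c' -> p.1.1 <> 1 - (q.1 + q.2)]].

Let mass_near z e := (\int[mu]_(r in `]0%R, 1%R[) \int[mu]_(q in `]0%R, 1%R[)
     (bmass (z + e * q) l (e * r) 0 (box_rect c) *
      bmass (1 - z + e * r) 0 (e * q) 0 (box_rect c')))%E.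

Let cell_lower u z : S (u, z) -> \forall n \near \oo,
  (rate%:E * mass_near z (en n) <= ((en n) ^- 2)%:E * P (xsection (U n) (u, z)))%E.
Proof.
move=> [/= /andP[bz zb] /andP[u0 uz] nz].
have ez : end_time 0 (box_rect c) < z by exact: lt_le_trans ec bz.
have ez' : end_time 0 (box_rect c') < 1 - z by apply: (lt_le_trans ec'); rewrite lerD2l lerN2.
have xv : 0 < 1 - (u + z) by lra.
have vz : 1 - (u + z) < 1 - z by lra.
have [c1 [c2 [c'E p1 e1 p2 e2]]] := box_split pc' xv vz ez' nz.
have [x1 x10 h1] := path_near0 pc ez; have [x2 x20 h2] := path_near0 p1 e1.
have m0 : 0 < Num.min x1 x2 by rewrite lt_min x10.
move: (en_small m0); apply: filterS => n /andP[e0]; rewrite lt_min => /andP[ex1 ex2].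
have [|q1 q2] := h1 (en n); first by rewrite e0.
have [|q3 q4] := h2 (en n); first by rewrite e0.
rewrite (_ : xsection (U n) (u, z) = near_event B l u (u + z) (en n) c (c1 ++ c2)); last first.
  by rewrite -c'E xsectionE; apply/seteqP; split=> w /=; [case|move=> h; split => //; rewrite bz].
have mne : measurable (near_event B l u (u + z) (en n) c (c1 ++ c2)).
  by apply: (measurable_near_event l cB mB B0 (U := fun=> u) (V := fun=> u + z) (g := idfun)) => //; exact: measurable_id.
have := near_event_prob BB cB mB l0 e0 q1 q2 q3 q4 p2 e2 mne.
rewrite -c'E -/(mass_near z (en n)) => key.
apply: (@le_trans _ _ (((en n) ^- 2)%:E * (((gauss 1 l)^-1 * ((en n) ^+ 2 * l / 4))%:E * mass_near z (en n))))%E.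
  rewrite muleA -EFinM [X in (_ <= X%:E * _)%E](_ : _ = rate)//.
  by rewrite /rate; field; rewrite !gt_eqF ?gauss_gt0.
by apply: lee_wpmul2l => //; rewrite lee_fin invr_ge0 exprn_ge0 ?ltW.
Qed.

Let g (u z : R) : \bar R := (rate%:E * ((\1_S (u, z))%:E * box_density z))%E.

Let mS : measurable S.
Proof.
have m1 : measurable_fun setT (fun q : R * R => q.1) by exact: measurable_fst.
have m2 : measurable_fun setT (fun q : R * R => q.2) by exact: measurable_snd.
have mlt (f1 f2 : R * R -> R) : measurable_fun setT f1 -> measurable_fun setT f2 -> measurable [set q | f1 q < f2 q].
  move=> h1 h2; rewrite (_ : [set q | _] = ~` [set q | f2 q <= f1 q]).
    by apply: measurableC; exact: measurable_le_fun.
  by apply/seteqP; split=> q /=; rewrite ltNge => /negP.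
have mN (D : seq (R * R * R)) : measurable [set q : R * R | forall p, List.In p D -> p.1.1 <> 1 - (q.1 + q.2) :> R].
  elim: D => [|p D ih]; first by rewrite (_ : [set q | _] = setT)//; apply/seteqP; split=> // q _ p [].
  rewrite (_ : [set q | _] = ~` ([set q : R * R | p.1.1 <= 1 - (q.1 + q.2)] `&` [set q | 1 - (q.1 + q.2) <= p.1.1]) `&`
    [set q : R * R | forall p, List.In p D -> p.1.1 <> 1 - (q.1 + q.2)]); last first.
    apply/seteqP; split=> q /=.
      move=> H; split; last by move=> p' hp; apply: H; right.
      by move=> [h1 h2]; apply: (H p (or_introl erefl)); apply/le_anti; rewrite h1.
    by move=> [H1 H2] p' [<- E|/H2//]; apply: H1; rewrite E.
  have ms : measurable_fun setT (fun q : R * R => 1 - (q.1 + q.2)).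
    by apply: measurable_funB => //; exact: measurable_funD.
  apply: measurableI => //; apply: measurableC; apply: measurableI; exact: measurable_le_fun.
rewrite (_ : S = ([set q | b <= q.2] `&` [set q | q.2 <= b']) `&` ([set q | 0 < q.1] `&` [set q | q.1 < 1 - q.2]) `&`
  [set q : R * R | forall p, List.In p c' -> p.1.1 <> 1 - (q.1 + q.2)]); last first.
  by apply/seteqP; split=> q /=; [move=> [/andP[? ?] /andP[? ?] ?]|move=> [[[? ?] [? ?]] ?]; split => //; apply/andP].
have mB2 : measurable_fun setT (fun q : R * R => 1 - q.2) by exact: measurable_funB.
apply: measurableI => //; apply: measurableI; apply: measurableI.
- exact: measurable_le_fun.
- exact: measurable_le_fun.
- exact: mlt.
- exact: mlt.
Qed.

Let mg : measurable_fun setT (fun q : R * R => g q.1 q.2).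
Proof.
apply: emeasurable_funM => //; apply: emeasurable_funM; last exact: (measurable_pair_snd mdens).
rewrite (_ : (fun q => _) = fun q : R * R => (\1_S q)%:E); last by apply/funext => -[].
by apply/measurable_EFinP; exact: (measurable_indic mS).
Qed.

Let g0 u z : (0 <= g u z)%E.
Proof. by apply: mule_ge0; [|apply: mule_ge0]; rewrite ?lee_fin. Qed.

Let mpr n : measurable_fun setT (fun q : R * R => ((en n) ^- 2)%:E * P (xsection (U n) q))%E.
Proof. by apply: emeasurable_funM => //; exact: (measurable_fun_xsection P (mU n)). Qed.

Let pr0 n q : (0 <= ((en n) ^- 2)%:E * P (xsection (U n) q))%E.
Proof. by rewrite mule_ge0// lee_fin invr_ge0 exprn_ge0 ?ltW. Qed.

(** As the mesh tends to 0 the exact times inside the cell merge with its corners, and the average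
    over the unit square disappears. *)
Let mass_near_liminf z : b <= z <= b' -> liminf_ge (box_density z) (fun n => mass_near z (en n)).
Proof.
move=> /andP[bz zb].
have ez : end_time 0 (box_rect c) < z by exact: lt_le_trans ec bz.
have ez' : end_time 0 (box_rect c') < 1 - z by apply: (lt_le_trans ec'); rewrite lerD2l lerN2.
have mc := msets_box_rect c; have mc' := msets_box_rect c'.
pose F n (q : R * R) := (bmass (z + en n * q.2) l (en n * q.1) 0 (box_rect c) *
      bmass (1 - z + en n * q.1) 0 (en n * q.2) 0 (box_rect c'))%E.
have mF n : measurable_fun setT (F n).
  apply: emeasurable_funM; apply: measurable_bmass => //; first [exact: measurable_funM|
    by apply: measurable_funD => //; exact: measurable_funM].
have F0 n q : (0 <= F n q)%E by rewrite mule_ge0// bmass_ge0.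
have E1 (x : \bar R) : (0 <= x)%E -> (\int[mu]_(r in `]0%R, 1%R[) x = x)%E.
  move=> _; transitivity (x * mu (`]0%R, 1%R[ : set R))%E; first exact: integral_cst.
  by rewrite lebesgue_measure_itv/= lte_fin ltr01 sube0 mule1.
have lin (x r : R) : x + en n * r @[n --> \oo] --> x.
  rewrite -[X in _ --> X]addr0; apply: cvgD; first exact: cvg_cst.
  by rewrite -(mul0r r); apply: cvgM => //; exact: cvg_cst.
have lin0 (r : R) : en n * r @[n --> \oo] --> (0 : R).
  by rewrite -(mul0r r); apply: cvgM => //; exact: cvg_cst.
rewrite -[box_density z]E1// -[X in (\int[mu]_(r in _) X)%E]E1//.
apply: fatou_liminf_ge => //.
- by move=> n; apply: measurable_funTS; exact: (measurable_setI_integral (h := F n)).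
- by move=> n r _; apply: integral_ge0 => q _; exact: (F0 n (r, q)).
- by move=> r _; exact: integral_ge0.
- move=> r _; apply: fatou_liminf_ge => //.
  + by move=> n; apply: measurable_funTS; exact: (measurable_section (f := F n) r (mF n)).
  + by move=> n q _; exact: (F0 n (r, q)).
  + move=> q _; apply: liminf_geMM; try by [exact: bmass_ge0|move=> n; exact: bmass_ge0].
      by apply: bmass_liminf.
    by apply: bmass_liminf.
Qed.

Let g_liminf u z : liminf_ge (g u z) (fun n => ((en n) ^- 2)%:E * P (xsection (U n) (u, z)))%E.
Proof.
rewrite /g indicE; case: (boolP ((u, z) \in S)) => hS; last first.
  rewrite mul0e mule0 => r r0; apply: nearW => n; exact: lt_le_trans r0 _.
move: hS; rewrite inE => hS; rewrite mul1e.
apply: liminf_ge_near (cell_lower hS).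
apply: (@liminf_geM _ rate (fun=> rate)) => //; first exact: cvg_cst.
  move=> n; apply: integral_ge0 => r _; apply: integral_ge0 => q _.
  by rewrite mule_ge0// bmass_ge0//; exact: msets_box_rect.
by apply: mass_near_liminf; case: hS.
Qed.

Let ratio_liminf : liminf_ge (\int[mu]_u \int[mu]_z g u z)%E (fun n => \int[P]_w ratio n w)%E.
Proof.
have E n : (\int[P]_w ratio n w = \int[mu]_u \int[mu]_z (((en n) ^- 2)%:E * P (xsection (U n) (u, z))))%E.
  rewrite ge0_integralZl//; last by rewrite lee_fin invr_ge0 exprn_ge0 ?ltW.
  have mI : measurable_fun setT (fun u => \int[mu]_z P (xsection (U n) (u, z)))%E.
    apply: (measurable_setI_integral (h := fun q : R * R => P (xsection (U n) q))) => //.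
    exact: (measurable_fun_xsection P (mU n)).
  have I0 u : (0 <= \int[mu]_z P (xsection (U n) (u, z)))%E by exact: integral_ge0.
  have e0 : (0 <= ((en n) ^- 2)%:E)%E by rewrite lee_fin invr_ge0 exprn_ge0 ?ltW.
  rewrite -area_tonelli -ge0_integralZl//.
  apply: eq_integral => u _; rewrite ge0_integralZl//.
  exact: (measurable_section (f := fun q : R * R => P (xsection (U n) q)) u (measurable_fun_xsection P (mU n))).
rewrite (_ : (fun n => _) = fun n => \int[mu]_u \int[mu]_z (((en n) ^- 2)%:E * P (xsection (U n) (u, z))))%E; last first.
  by apply/funext => n.
apply: fatou_liminf_ge => //.
- by move=> n; exact: (measurable_setI_integral (h := fun q : R * R => ((en n) ^- 2)%:E * P (xsection (U n) q))%E).
- exact: (measurable_setI_integral (h := fun q : R * R => g q.1 q.2)).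
- by move=> n u _; exact: integral_ge0.
- by move=> u _; exact: integral_ge0.
- move=> u _; apply: fatou_liminf_ge => //.
  + by move=> n; exact: (measurable_section (f := fun q : R * R => ((en n) ^- 2)%:E * P (xsection (U n) q))%E u (mpr n)).
  + exact: (measurable_section (f := fun q : R * R => g q.1 q.2) u mg).
Qed.

Let ratio_compl n w : (0 <= 1 - ratio n w)%E.
Proof.
have := ratio_le1 n w; have := ratio_ge0 n w; case: (ratio n w) => [x| |]//.
by move=> _ h; rewrite sube_ge0.
Qed.

Let g_le : (\int[mu]_u \int[mu]_z g u z <= P box_event)%E.
Proof.
rewrite leNgt; apply/negP => /lte_dense_EFin[r /andP[r1 r2]].
have mE : measurable (~` box_event) by exact: measurableC.
(* Reverse Fatou for [ratio n], written as Fatou for [1 - ratio n]; the two integrals add up to 1,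
   which contradicts the two strict bounds. *)
have H : liminf_ge (\int[P]_w (\1_(~` box_event) w)%:E)%E (fun n => \int[P]_w (1 - ratio n w))%E.
  apply: fatou_liminf_ge => //.
  - by move=> n; apply: emeasurable_funB.
  - by apply/measurable_EFinP; exact: measurable_indic.
  - move=> w _; rewrite indicE; have [hw|hw] := pselect (box_event w).
      rewrite memNset /=; last by apply.
      by move=> x x0; apply: nearW => n; exact: lt_le_trans x0 _.
    rewrite mem_set//= => x x1; move: (ratio_eventually0 hw); apply: filterS => n ->.
    by rewrite sube0.
rewrite integral_indic// setIT in H.
have fE : P box_event \is a fin_num by rewrite fin_num_measure//; exact: measurable_box_event.
have h : ((1 - r)%:E < P (~` box_event))%E.
  rewrite probability_setC//; move: fE r1; case: (P box_event) => [x| |]// _ r1.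
  by move: r1; rewrite -EFinB !lte_fin; lra.
have [n [h1 h2]] : exists n, (r%:E < \int[P]_w ratio n w)%E /\ ((1 - r)%:E < \int[P]_w (1 - ratio n w))%E.
  have := filterI (ratio_liminf r2) (H _ h); move=> /(_ _)/filter_ex[n [? ?]]; by exists n.
have : (\int[P]_w ratio n w + \int[P]_w (1 - ratio n w) = 1)%E.
  rewrite -ge0_integralD//; last exact: emeasurable_funB.
  transitivity (1 * P setT)%E; last by rewrite mul1e; exact: probability_setT.
  rewrite -integral_cst//; apply: eq_integral => w _; rewrite /cst addeC subeK//.
  by rewrite ge0_fin_numE// (le_lt_trans (ratio_le1 n w))// ltry.
have := lteD h1 h2; rewrite -EFinD addrC subrK => h3 h4.
by move: h3; rewrite h4 ltxx.
Qed.

(** For fixed [z] the integrand does not depend on [u]; the factor [1 - z] is the length of the set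
    of admissible [u]. *)
Theorem box_event_ge :
  (\int[mu]_(z in `[b, b']) ((rate * (1 - z))%:E * box_density z) <= P box_event)%E.
Proof.
apply: le_trans g_le; rewrite (@fubini_tonelli _ _ _ _ R mu mu (fun q => g q.1 q.2) mg (fun q => g0 _ _)).
rewrite [leLHS]integral_mkcond; apply: ge0_le_integral => //.
- by move=> z _; apply: erestrict_ge0 => y /=; rewrite in_itv/= => /andP[_ yb]; rewrite mule_ge0// lee_fin mulr_ge0//; move: (ec') (path_end_time pc') => h1 h2; lra.
- apply/(measurable_restrictT _ (measurable_itv _))/measurable_funTS; apply: emeasurable_funM => //.
  by apply/measurable_EFinP; apply: measurable_funM => //; exact: measurable_funB.
- apply: (measurable_setI_integral (h := fun q : R * R => g q.2 q.1)) => //.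
  have hp : measurable_fun setT (fun q : R * R => (q.2, q.1)) by exact: measurable_fun_pair.
  exact: (measurableT_comp mg hp).
move=> z _; rewrite /patch mem_setE; case: ifPn => hz; last by apply: integral_ge0.
move: hz; rewrite in_itv/= => hz.
have mSz : measurable [set u | S (u, z)].
  have hp : measurable_fun setT (fun u : R => (u, z)) by exact: measurable_fun_pair.
  by have := hp measurableT _ mS; rewrite setTI.
have -> : (\int[mu]_u g u z = rate%:E * box_density z * mu [set u | S (u, z)])%E.
  rewrite -[X in mu X]setIT -(integral_indic mu measurableT mSz) -ge0_integralZl//.
  - apply: eq_integral => u _; rewrite /g -muleA; congr (_ * _)%E; rewrite muleC; congr (_ * (_)%:E)%E.
  - by apply/measurable_EFinP; exact: measurable_indic.
  - by rewrite mule_ge0.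
rewrite EFinM muleAC; apply: lee_wpmul2l; first by rewrite mule_ge0.
(* The corners [u] for which a box time falls on the end of the bridge are countably many, hence
   negligible. *)
have cnt D : countable [set u : R | exists2 p : R * R * R, List.In p D & p.1.1 = 1 - (u + z)].
  elim: D => [|p D ih].
    by rewrite (_ : [set u | _] = set0)//; apply/seteqP; split=> u // -[].
  apply: (@sub_countable _ _ _ ([set 1 - z - p.1.1] `|` [set u : R | exists2 p : R * R * R, List.In p D & p.1.1 = 1 - (u + z)])).
    apply: subset_card_le => u [q [<- E|hq E]]; last by right; exists q.
    by left => /=; lra.
  by rewrite -bigcup2E; apply: bigcup_countable => // -[|[|n]] _ /=; [exact: finite_set_countable|exact: ih|exact: countable0].
have mc : measurable [set u : R | exists2 p : R * R * R, List.In p c' & p.1.1 = 1 - (u + z)].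
  exact: countable_measurable.
apply: (@le_trans _ _ (mu (`]0%R, (1 - z)%R[ : set R))).
  by rewrite lebesgue_measure_itv/= lte_fin; case: ltP => h; rewrite ?sube0// lee_fin.
apply: (@le_trans _ _ (mu ([set u | S (u, z)] `|` [set u : R | exists2 p : R * R * R, List.In p c' & p.1.1 = 1 - (u + z)]))).
  apply: le_measure; rewrite ?inE//; first exact: measurableU.
  move=> u; rewrite /= in_itv/= => hu.
  have [h'|h'] := pselect (exists2 p : R * R * R, List.In p c' & p.1.1 = 1 - (u + z)); first by right.
  by left; split => //= p hp E; apply: h'; exists p.
by apply: le_trans (measureU2 _ _ _) _ => //; rewrite [X in (_ + X)%E]countable_lebesgue_measure0// adde0.
Qed.

End box_event.

(** * Laws determined by coordinates *)

Section coordinates.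
Context {R : realType}.
Notation mu := (@lebesgue_measure R).
Implicit Types (F G : set R -> \bar R) (L pre suf : seq (set R)).

(** A measure given as a bare set function, constrained on measurable sets only; this is what a law
    becomes when all coordinates but one are fixed. [sigma_fun_measure] supplies a genuine
    measure. *)
Definition sigma_fun F : Prop := [/\ F set0 = 0%E, forall A, measurable A -> (0 <= F A)%E &
  forall A : (set R)^nat, (forall i, measurable (A i)) -> trivIset setT A ->
    F (\bigcup_i A i) = (\sum_(i <oo) F (A i))%E].

Section as_measure.
Variables (F : set R -> \bar R) (sF : sigma_fun F).

Let F' (A : set R) : \bar R := if pselect (measurable A) then F A else 0%E.

Let F'0 : F' set0 = 0%E.
Proof. by rewrite /F'; case: pselect => [?|?]//; case: sF. Qed.

Let F'_ge0 A : (0 <= F' A)%E.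
Proof. by rewrite /F'; case: pselect => [mA|?]//; case: sF => _ h _; exact: h. Qed.

Let F'_sigma : semi_sigma_additive F'.
Proof.
move=> A mA tA mUA; have F'E B : measurable B -> F' B = F B by rewrite /F'; case: pselect.
rewrite F'E//; have [_ _ ->//] := sF.
rewrite [X in X @ _ --> _](_ : _ = (fun n => \sum_(0 <= i < n) F (A i))%E); last first.
  by apply/funext => n; apply: eq_bigr => i _; exact: F'E.
apply: is_cvg_nneseries => i _ _; case: sF => _ h _; exact: h.
Qed.

Definition as_measure := F'.
HB.instance Definition _ := isMeasure.Build _ _ _ as_measure F'0 F'_ge0 F'_sigma.

Lemma sigma_fun_measure : exists m : {measure set R -> \bar R}, forall A, measurable A -> F A = m A.
Proof. by exists as_measure => A mA; rewrite /= /as_measure /F'; case: pselect. Qed.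

End as_measure.

Lemma sigma_fun_integral (D : set R) (a : R -> R) (F : R -> set R -> \bar R) : measurable D ->
  measurable_fun setT a -> (forall z, 0 <= a z) -> (forall z, sigma_fun (F z)) ->
  (forall A, measurable A -> measurable_fun setT (fun z => F z A)) ->
  sigma_fun (fun A => \int[mu]_(z in D) ((a z)%:E * F z A))%E.
Proof.
move=> mD ma a0 sF mF; have F0 z A : measurable A -> (0 <= F z A)%E by case: (sF z) => _ h _; exact: h.
split.
- by apply: integral0_eq => z _; case: (sF z) => ->; rewrite mule0.
- by move=> A mA; apply: integral_ge0 => z _; rewrite mule_ge0 ?lee_fin ?F0.
move=> A mA tA; rewrite -integral_nneseries//.
- apply: eq_integral => z _; case: (sF z) => _ _ ->//.
  by rewrite -nneseriesZl// => i _; exact: F0.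
- move=> n; apply: measurable_funTS; apply: emeasurable_funM; last exact: mF.
  exact/measurable_EFinP.
- by move=> n z _; rewrite mule_ge0 ?lee_fin ?F0.
Qed.

Lemma sigma_fun_set_integral (G : set R) (f : R -> \bar R) : measurable G -> measurable_fun setT f ->
  (forall z, 0 <= f z)%E -> sigma_fun (fun A => \int[mu]_(z in A `&` G) f z)%E.
Proof.
move=> mG mf f0; split.
- by rewrite set0I integral_set0.
- by move=> A mA; apply: integral_ge0.
move=> A mA tA; rewrite setI_bigcupl ge0_integral_bigcup//.
- by move=> i; exact: (measurableI _ _ (mA i) mG).
- exact: measurable_funTS.
- exact: trivIset_setIr.
Qed.

Lemma sigma_fun_chain (c1 c2 : seq (@chain_step R)) (k : R -> R -> R) f x :
  good_chain c1 -> good_chain c2 -> measurable_fun setT (fun u : R * R => k u.1 u.2) ->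
  (forall y z, 0 <= k y z) -> measurable_fun setT f -> (forall z, 0 <= f z)%E ->
  sigma_fun (fun A => chain (c1 ++ (k, A) :: c2) f x).
Proof.
move=> + gc2 mk k0 mf f0.
have mc2 : measurable_fun setT (chain c2 f) by exact: measurable_chain.
elim: c1 x => [|[k' D] c1 ih] x /=.
  move=> _; have := @sigma_fun_set_integral setT (fun z => (k x z)%:E * chain c2 f z)%E measurableT.
  rewrite (_ : (fun A => _) = (fun A => \int[mu]_(z in A) ((k x z)%:E * chain c2 f z))%E); last first.
    by apply/funext => A; rewrite setIT.
  apply.
    apply: emeasurable_funM => //; apply/measurable_EFinP.
    exact: (measurable_section (f := fun u : R * R => k u.1 u.2) x mk).
  by move=> z; rewrite mule_ge0 ?lee_fin// chain_ge0.
move=> [mD mk' k'0 gc1]; apply: (@sigma_fun_integral D (k' x) (fun z A => chain (c1 ++ (k, A) :: c2) f z)) => //.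
- exact: (measurable_section (f := fun u : R * R => k' u.1 u.2) x mk').
- by move=> z; exact: ih.
- move=> A mA; apply: measurable_chain => //.
  by apply: good_chain_cat => //; split.
Qed.

Lemma sigma_fun_bmass (K : \bar R) l y s x t c1 c2 : (0 <= K)%E -> msets c1 -> msets c2 ->
  sigma_fun (fun A => K * bmass l y s x (c1 ++ (t, A) :: c2))%E.
Proof.
move=> K0 m1 m2.
have mf b : measurable_fun setT (fun z => (bes b z y)%:E) by apply/measurable_EFinP; exact: measurable_bes.
have := @sigma_fun_chain (bstep s c1) (bstep t c2) (fun x z => bes (t - end_time s c1) x z * bessel3_ref z)
  (fun z => K * (bes (l - end_time t c2) z y)%:E)%E x (good_bstep s m1) (good_bstep t m2) (measurable_bes_ref _).
move=> /(_ _)/(_ _)/(_ _) H.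
have {}H : sigma_fun (fun A => chain (bstep s c1 ++ ((fun x z => bes (t - end_time s c1) x z * bessel3_ref z), A) :: bstep t c2)
    (fun z => K * (bes (l - end_time t c2) z y)%:E)%E x).
  apply: H; first by move=> *; rewrite mulr_ge0 ?bes_nneg ?bessel3_ref_ge0.
    exact: emeasurable_funM.
  by move=> z; rewrite mule_ge0// lee_fin bes_nneg.
have E A : measurable A -> (K * bmass l y s x (c1 ++ (t, A) :: c2))%E =
    chain (bstep s c1 ++ ((fun x z => bes (t - end_time s c1) x z * bessel3_ref z), A) :: bstep t c2)
    (fun z => K * (bes (l - end_time t c2) z y)%:E)%E x.
  move=> mA; rewrite /bmass bstep_cat end_time_cat/= chainZ//.
  - by apply: good_chain_cat; [exact: good_bstep|split; [|exact: measurable_bes_ref|move=> *; rewrite mulr_ge0 ?bes_nneg ?bessel3_ref_ge0|exact: good_bstep]].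
  - by move=> z; rewrite lee_fin bes_nneg.
case: H => h1 h2 h3; split.
- by rewrite E.
- by move=> A mA; rewrite E// h2.
- move=> A mA tA; rewrite E ?h3//; last exact: bigcup_measurable.
  by apply: eq_eseriesr => i _; rewrite E.
Qed.

Definition sets_in (C : set R -> Prop) L : Prop := List.Forall C L.

Lemma sets_in_cat C L1 L2 : sets_in C (L1 ++ L2) <-> sets_in C L1 /\ sets_in C L2.
Proof. exact: List.Forall_app. Qed.

(** Coordinates are treated from left to right: those on the left are already in [C'], those on the
    right still in [C]. *)
Lemma coordinate_upgrade (Q : seq (set R) -> Prop) (C C' : set R -> Prop) n :
  (forall pre suf, (size pre + size suf).+1 = n -> sets_in C' pre -> sets_in C suf ->
    (forall A, C A -> Q (pre ++ A :: suf)) -> forall A, C' A -> Q (pre ++ A :: suf)) ->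
  (forall L, size L = n -> sets_in C L -> Q L) -> forall L, size L = n -> sets_in C' L -> Q L.
Proof.
move=> step base.
suff H L pre : (size pre + size L)%N = n -> sets_in C' pre -> sets_in C' L ->
    (forall L', size L' = size L -> sets_in C L' -> Q (pre ++ L')) -> Q (pre ++ L).
  by move=> L sL C'L; apply: (H L [::]) => // L' sL' CL'; apply: base => //; rewrite sL'.
elim: L pre => [|A L ih] pre sz Cpre CL h; first by apply: h => //; exact: List.Forall_nil.
have [CA CL'] : C' A /\ sets_in C' L by inversion CL.
rewrite -cat_rcons; apply: ih => //.
- by rewrite size_rcons addSnnS.
- by rewrite -cats1; apply/sets_in_cat; split => //; apply: List.Forall_cons.
move=> L' sL' CLs; rewrite cat_rcons; apply: step => //.
  by rewrite sL' -addnS.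
by move=> A' CA'; apply: h; [rewrite /= sL'|exact: List.Forall_cons].
Qed.

Definition coordwise n (Q : seq (set R) -> \bar R) : Prop := forall pre suf,
  (size pre + size suf).+1 = n -> sets_in measurable pre -> sets_in measurable suf ->
  sigma_fun (fun A => Q (pre ++ A :: suf)).

Definition segment (A : set R) : Prop := exists a b, A = `[a, b]%classic.
(** These two kinds of rays are complements of each other and increasing unions of segments, so a
    bound on segments passes to a ray and to its complement at once. *)
Definition half_line (A : set R) : Prop :=
  [\/ A = setT, exists x, A = `[x, +oo[%classic | exists x, A = `]-oo, x[%classic].

Lemma segment_measurable A : segment A -> measurable A.
Proof. by move=> [a [b ->]]; exact: measurable_itv. Qed.

Lemma half_line_measurable A : half_line A -> measurable A.
Proof. by case=> [->|[x ->]|[x ->]]; [exact: measurableT|exact: measurable_itv|exact: measurable_itv]. Qed.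

Lemma half_line_segments A : half_line A ->
  exists F : (set R)^nat, [/\ nondecreasing_seq F, forall i, segment (F i) & \bigcup_i F i = A].
Proof.
have arch (y : R) : exists i : nat, y <= i%:R.
  by exists (Num.bound `|y|); rewrite ltW// (le_lt_trans (ler_norm _))// archi_boundP.
case=> [->|[x ->]|[x ->]].
- exists (fun i => `[- i%:R, i%:R]%classic); split.
  + move=> i j ij; apply/subsetPset => y /=; rewrite !in_itv/= => /andP[h1 h2].
    have h : i%:R <= j%:R :> R by rewrite ler_nat.
    by apply/andP; split; [apply: le_trans h1; rewrite lerN2|exact: le_trans h2 h].
  + by move=> i; exists (- i%:R), i%:R.
  + apply/seteqP; split=> // y _; have [i hi] := arch `|y|; exists i => //=.
    by rewrite in_itv/= -ler_norml.
- exists (fun i => `[x, x + i%:R]%classic); split.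
  + move=> i j ij; apply/subsetPset => y /=; rewrite !in_itv/= => /andP[-> h2].
    by apply: (le_trans h2); rewrite lerD2l ler_nat.
  + by move=> i; exists x, (x + i%:R).
  + apply/seteqP; split=> y /=; first by move=> [i _]; rewrite /= !in_itv/= andbT => /andP[].
    rewrite in_itv/= andbT => xy; have [i hi] := arch (y - x); exists i => //=.
    by rewrite in_itv/= xy -lerBlDl.
- exists (fun i => `[x - i%:R, x - i.+1%:R^-1]%classic); split.
  + move=> i j ij; apply/subsetPset => y /=; rewrite !in_itv/= => /andP[h1 h2].
    have h3 : i%:R <= j%:R :> R by rewrite ler_nat.
    have h4 : j.+1%:R^-1 <= i.+1%:R^-1 :> R by rewrite lef_pV2 ?posrE// ler_nat.
    apply/andP; split; first by apply: le_trans h1; rewrite lerD2l lerN2.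
    by apply: (le_trans h2); rewrite lerD2l lerN2.
  + by move=> i; exists (x - i%:R), (x - i.+1%:R^-1).
  + apply/seteqP; split=> y /=.
      move=> [i _]; rewrite /= !in_itv/= => /andP[_ h]; apply: le_lt_trans h _.
      by rewrite gtrBl invr_gt0.
    rewrite in_itv/= => yx; have xy : 0 < x - y by rewrite subr_gt0.
    have /cvgr_lt/(_ _ xy)[i _ hi] := @cvg_harmonic R.
    have [j hj] := arch (x - y); exists (maxn i j) => //=.
    have := hi (maxn i j) (leq_maxl _ _); rewrite /harmonic /= => h.
    have : j%:R <= (maxn i j)%:R :> R by rewrite ler_nat leq_maxr.
    move=> h'; rewrite in_itv/=; apply/andP; split.
      by rewrite lerBlDl -lerBlDr (le_trans hj).
    by rewrite lerBrDl -lerBrDr ltW.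
Qed.

Lemma half_lineC A : half_line A -> A = setT \/ half_line (~` A).
Proof.
case=> [->|[x ->]|[x ->]]; first by left.
  by right; constructor 3; exists x; rewrite setCitvr.
by right; constructor 2; exists x; rewrite setCitvl.
Qed.

Lemma measure_le_bigcup (m1 m2 : {measure set R -> \bar R}) (F : (set R)^nat) :
  nondecreasing_seq F -> (forall i, measurable (F i)) -> (forall i, (m1 (F i) <= m2 (F i))%E) ->
  (m1 (\bigcup_i F i) <= m2 (\bigcup_i F i))%E.
Proof.
move=> ndF mF F12; have mU : measurable (\bigcup_i F i) by exact: bigcup_measurable.
have c1 := nondecreasing_cvg_mu (mu := m1) mF mU ndF.
have c2 := nondecreasing_cvg_mu (mu := m2) mF mU ndF.
rewrite -(cvg_lim _ c1)// -(cvg_lim _ c2)//; apply: lee_lim.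
- by apply/cvg_ex; eexists; exact: c1.
- by apply/cvg_ex; eexists; exact: c2.
- by apply: nearW => i; exact: F12.
Qed.

(** One inequality on segments and the reverse inequality for the total masses. A ray and its
    complement both satisfy the inequality and their sums agree, so both are equalities; rays
    generate the measurable sets. *)
Theorem coordwise_unique n (Q1 Q2 : seq (set R) -> \bar R) : coordwise n Q1 -> coordwise n Q2 ->
  (forall L, size L = n -> sets_in measurable L -> Q1 L < +oo)%E ->
  (forall L, size L = n -> sets_in segment L -> Q2 L <= Q1 L)%E ->
  (Q1 (nseq n setT) <= Q2 (nseq n setT))%E ->
  forall L, size L = n -> sets_in measurable L -> Q1 L = Q2 L.
Proof.
move=> cQ1 cQ2 fin le12 tot.
have sub C C' L : (forall A, C A -> C' A) -> sets_in C L -> sets_in C' L.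
  by move=> CC; exact: List.Forall_impl.
have szE pre suf A : (size pre + size suf).+1 = n -> size (pre ++ A :: suf) = n.
  by move=> <-; rewrite size_cat/= addnS.
have mcat pre suf A : sets_in measurable pre -> sets_in measurable suf -> measurable A -> sets_in measurable (pre ++ A :: suf).
  by move=> h1 h2 mA; apply/sets_in_cat; split => //; exact: List.Forall_cons.
(* From segments to rays by monotone limits. *)
have step1 : forall L, size L = n -> sets_in half_line L -> (Q2 L <= Q1 L)%E.
  apply: (coordinate_upgrade (Q := fun L => (Q2 L <= Q1 L)%E)) le12 => pre suf sz Cp Cs h A.
  have mp : sets_in measurable pre by exact: sub half_line_measurable Cp.
  have ms : sets_in measurable suf by exact: sub segment_measurable Cs.
  have [m1 m1E] := sigma_fun_measure (cQ1 pre suf sz mp ms).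
  have [m2 m2E] := sigma_fun_measure (cQ2 pre suf sz mp ms).
  move=> hA; have mA := half_line_measurable hA; rewrite m1E// m2E//.
  have [F [ndF sF <-]] := half_line_segments hA.
  have mF i := segment_measurable (sF i).
  by apply: measure_le_bigcup => // i; rewrite -m1E// -m2E// h.
(* From equality of total masses to equality on rays, one coordinate at a time; finiteness of [Q1]
   permits the cancellation. *)
have step2 : forall L, size L = n -> sets_in half_line L -> Q1 L = Q2 L.
  apply: (coordinate_upgrade (Q := fun L => Q1 L = Q2 L) (C := fun A => A = setT)).
    move=> pre suf sz Cp Cs h A hA.
    have Csh : sets_in half_line suf by apply: sub Cs => B ->; constructor 1.
    have mp : sets_in measurable pre by exact: sub half_line_measurable Cp.
    have ms : sets_in measurable suf by exact: sub half_line_measurable Csh.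
    have [m1 m1E] := sigma_fun_measure (cQ1 pre suf sz mp ms).
    have [m2 m2E] := sigma_fun_measure (cQ2 pre suf sz mp ms).
    have [->|hC] := half_lineC hA; first exact: h.
    have mA := half_line_measurable hA; have mC := half_line_measurable hC.
    have le B : half_line B -> (m2 B <= m1 B)%E.
      move=> hB; have mB := half_line_measurable hB; rewrite -m1E// -m2E//; apply: step1; first exact: szE.
      by apply/sets_in_cat; split => //; exact: List.Forall_cons.
    have T12 : m1 setT = m2 setT by rewrite -m1E// -m2E//; exact: h.
    have finT : (m1 setT < +oo)%E by rewrite -m1E//; apply: fin; [exact: szE|exact: mcat].
    have split1 (m : {measure set R -> \bar R}) : (m setT = m A + m (~` A))%E.
      by rewrite -measureU// ?setUv// setICr.
    have f1 : m1 A \is a fin_num.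
      by rewrite ge0_fin_numE// (le_lt_trans _ finT)//; apply: le_measure; rewrite ?inE.
    have f2 : m1 (~` A) \is a fin_num.
      by rewrite ge0_fin_numE// (le_lt_trans _ finT)//; apply: le_measure; rewrite ?inE.
    rewrite m1E// m2E//; move: T12 (le _ hA) (le _ hC); rewrite !split1.
    move: f1 f2 (measure_ge0 m2 A) (measure_ge0 m2 (~` A)); case: (m1 A) => [x1| |]//; case: (m1 (~` A)) => [x2| |]// _ _.
    case: (m2 A) => [y1| |]//; case: (m2 (~` A)) => [y2| |]// _ _; rewrite -!EFinD !lee_fin => -[] E h1 h2.
    by congr EFin; lra.
  move=> L sL CL; have -> : L = nseq n setT.
    rewrite -sL; elim: L {sL} CL => [//|B L ih] CL.
    by rewrite /= -ih; [congr cons; inversion CL|inversion CL].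
  apply/le_anti; rewrite tot; apply: step1; first by rewrite size_nseq.
  by elim: (n) => [|k ih]; [exact: List.Forall_nil|apply: List.Forall_cons => //; constructor 1].
(* From rays to all measurable sets: closed upper rays are stable by intersection and exhaust the
   line. *)
apply: (coordinate_upgrade (Q := fun L => Q1 L = Q2 L)) step2 => pre suf sz mp Cs h A.
have ms : sets_in measurable suf by exact: sub half_line_measurable Cs.
have [m1 m1E] := sigma_fun_measure (cQ1 pre suf sz mp ms).
have [m2 m2E] := sigma_fun_measure (cQ2 pre suf sz mp ms).
move=> mA; rewrite m1E// m2E//.
apply: (measure_unique (@RGenCInfty.G R) (fun i => `[- i%:R, +oo[%classic) (RGenCInfty.measurableE R)) => //.
- move=> B C [x ->] [y ->]; exists (Num.max x y); apply/seteqP; split=> z /=;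
    rewrite !in_itv/= !andbT ge_max; first by move=> [-> ->].
  by move=> /andP[].
- by move=> i; exists (- i%:R).
- apply/seteqP; split=> // y _; exists (Num.bound `|y|) => //=.
  by rewrite in_itv/= andbT lerNl ltW// (le_lt_trans (ler_norm _))// normrN archi_boundP.
- move=> B [x ->]; rewrite -m1E// -m2E//; apply: h; constructor 2; by exists x.
- by move=> i; rewrite -m1E//; apply: fin; [exact: szE|exact: mcat].
Qed.

End coordinates.

(** * Density of the last hit *)

Section hit_density.
Context {R : realType}.
Notation mu := (@lebesgue_measure R).

Lemma bes00 (t : R) : 0 < t -> bes t 0 0 = 2 / t * gauss t 0.
Proof.
move=> t0; rewrite bes_sinhc gaussE mul0r mul0r sinhc0 mulr1 !expr0n/= addr0 oppr0 !mul0r oppr0 expR0 !mulr1.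
have -> : 2 / t = Num.sqrt ((2 / t) ^+ 2) by rewrite sqrtr_sqr ger0_norm// divr_ge0// ltW.
rewrite -sqrtrV ?mulr_ge0 ?pi_ge0 ?(ltW t0)// -sqrtrM ?sqr_ge0//; congr Num.sqrt.
by have p0 := @pi_gt0 R; move: (pi) p0 => p p0; field; rewrite !gt_eqF.
Qed.

(** Up to the normalisation by [gauss 1 l], a hitting density of [l] followed by a Gaussian return
    to 0: the integrand of a convolution at total time 1. *)
Lemma last_hit_density_hit (l z : R) : 0 < l -> 0 < z < 1 ->
  last_hit_density l z = (gauss 1 l)^-1 * (gauss (1 - z) 0 * hit z l).
Proof.
move=> l0 /andP[z0 z1]; have z1' : 0 < 1 - z by rewrite subr_gt0.
have p0 := @pi_gt0 R.
rewrite /last_hit_density /hit !gaussE expr0n/= mul0r oppr0 expR0 mulr1 mulr1.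
rewrite (_ : Num.sqrt (2 * pi * (1 - z) * z ^+ 3) =
   Num.sqrt (2 * pi * (1 - z)) * Num.sqrt (2 * pi * z) * z / Num.sqrt (2 * pi)); last first.
  transitivity (Num.sqrt (2 * pi * (1 - z)) * Num.sqrt (2 * pi * z) * Num.sqrt (z ^+ 2) * Num.sqrt (2 * pi)^-1).
    rewrite -!sqrtrM ?mulr_ge0 ?pi_ge0 ?sqr_ge0 ?(ltW z1') ?(ltW z0)//.
    by congr Num.sqrt; move: (pi) p0 => p p0; field; rewrite gt_eqF.
  by rewrite sqrtr_sqr ger0_norm ?(ltW z0)// sqrtrV// mulr_ge0 ?pi_ge0.
have -> : expR (- (l ^+ 2 * (1 - z) / (2 * z))) = expR (l ^+ 2 / 2) * expR (- (l ^+ 2 / (2 * z))).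
  by rewrite -expRD; congr expR; field; rewrite gt_eqF.
rewrite expRN [X in _ = (_ * X)^-1 * _]expRN.
have s1 : 0 < Num.sqrt (2 * pi * (1 - z)) by rewrite sqrtr_gt0 !mulr_gt0.
have s2 : 0 < Num.sqrt (2 * pi * z) by rewrite sqrtr_gt0 !mulr_gt0.
have s3 : 0 < Num.sqrt (2 * pi : R) by rewrite sqrtr_gt0 !mulr_gt0.
have e1 := expR_gt0 (l ^+ 2 / 2); have e2 := expR_gt0 (l ^+ 2 / (2 * z)).
move: (Num.sqrt _) s1 (Num.sqrt _) s2 (Num.sqrt _) s3 (expR _) e1 (expR _) e2 => x1 h1 x2 h2 x3 h3 y1 k1 y2 k2.
by field; rewrite !gt_eqF.
Qed.

(** The form found on boxes when there is no constraint: [hit z l] carries [l / 2] and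
    [gauss (1 - z) 0] carries [(1 - z) / 2]. *)
Lemma last_hit_density_bes (l z : R) : 0 < l -> 0 < z < 1 ->
  last_hit_density l z = (gauss 1 l)^-1 * l / 4 * (1 - z) * (bes z 0 l * bes (1 - z) 0 0).
Proof.
move=> l0 z01; rewrite last_hit_density_hit//; case/andP : z01 => z0 z1.
rewrite hit_bes// bes00 ?subr_gt0//.
have p0 : 0 < gauss 1 l by rewrite gauss_gt0.
by move: (gauss 1 l) p0 => p p0; field; rewrite !gt_eqF// subr_gt0.
Qed.

Lemma integral_last_hit_density (l : R) : 0 < l ->
  (\int[mu]_(z in `]0%R, 1%R[) (last_hit_density l z)%:E = 1)%E.
Proof.
move=> l0; have I := @gauss_hit_integral R 1 0 l ltr01 (lexx 0) l0.
have mg : measurable_fun setT (fun w : R => gauss (1 - w) 0 * hit w l).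
  by apply: measurable_funM; [apply: measurable_gauss|apply: measurable_hit]; rewrite //; exact: measurable_funB.
transitivity (((gauss 1 l)^-1)%:E * \int[mu]_(z in `]0%R, 1%R[) (gauss (1 - z) 0 * hit z l)%:E)%E.
  rewrite -ge0_integralZl//.
  - by apply: eq_integral => z; rewrite inE/= in_itv/= => z01; rewrite last_hit_density_hit.
  - by apply: measurable_funTS; apply/measurable_EFinP.
  - move=> z; rewrite /= in_itv/= => /andP[z0 _]; rewrite lee_fin mulr_ge0 ?gauss_ge0//.
    by rewrite hit_ge0// ltW.
  - by rewrite lee_fin invr_ge0 ltW// gauss_gt0.
rewrite (_ : (\int[mu]_(z in _) _)%E = (gauss 1 l)%:E).
  by rewrite -EFinM mulVf// gt_eqF// gauss_gt0.
rewrite (ge0_integral01_onem (f := fun z => (gauss (1 - z) 0 * hit z l)%:E)).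
- have <- : (gauss 1 (0 + l) / 1)%:E = (gauss 1 l)%:E by rewrite add0r divr1.
  by rewrite -I; apply: eq_integral => w _; rewrite !mul1r subKr.
- exact/measurable_EFinP.
- move=> w; rewrite lee_fin mulr_ge0 ?gauss_ge0//; have [w0|w0] := leP w 0.
    by rewrite /hit gauss_le0// mulr0.
  by rewrite hit_ge0// ltW.
Qed.

End hit_density.

(** * The two laws as measures in each coordinate *)

Section coordwise_laws.
Context {R : realType}.
Notation mu := (@lebesgue_measure R).
Implicit Types (L pre suf : seq (set R)).

Lemma eq_sigma_fun (F G : set R -> \bar R) : (forall A, measurable A -> F A = G A) -> sigma_fun G -> sigma_fun F.
Proof.
move=> FG [h1 h2 h3]; split.
- by rewrite FG.
- by move=> A mA; rewrite FG// h2.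
- move=> A mA tA; rewrite FG ?h3//; last exact: bigcup_measurable.
  by apply: eq_eseriesr => i _; rewrite FG.
Qed.

(** The multiple is the integral of a constant, which covers an infinite [K] as well. *)
Lemma sigma_funZ (K : \bar R) (F : set R -> \bar R) : (0 <= K)%E -> sigma_fun F ->
  sigma_fun (fun A => K * F A)%E.
Proof.
move=> K0 sF; have [m mE] := sigma_fun_measure sF.
have E A : measurable A -> (K * F A = \int[m]_(z in A) cst K z)%E.
  by move=> mA; rewrite integral_cst// mE.
apply: (eq_sigma_fun E); split.
- by rewrite integral_set0.
- by move=> A mA; exact: integral_ge0.
- move=> A mA tA; rewrite ge0_integral_bigcup//.
Qed.

Lemma sets_in_take (C : set R -> Prop) n L : sets_in C L -> sets_in C (take n L) /\ sets_in C (drop n L).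
Proof. by move=> CL; apply/sets_in_cat; rewrite cat_take_drop. Qed.

Lemma coordwise_mul m n (q1 q2 : seq (set R) -> \bar R) : coordwise m q1 -> coordwise n q2 ->
  (forall L, size L = m -> sets_in measurable L -> 0 <= q1 L)%E ->
  (forall L, size L = n -> sets_in measurable L -> 0 <= q2 L)%E ->
  coordwise (m + n) (fun L => q1 (take m L) * q2 (drop m L))%E.
Proof.
move=> h1 h2 q10 q20 pre suf sz mp ms; have [sm|sm] := ltnP (size pre) m.
  have [m1 m2] := sets_in_take (m - (size pre).+1) ms.
  have szt : size (take (m - (size pre).+1) suf) = (m - (size pre).+1)%N.
    by rewrite size_takel// leq_subLR addSn; move: sz; rewrite -ltnS => ->; rewrite ltnS leq_addr.
  apply: (@eq_sigma_fun _ (fun A => q2 (drop (m - (size pre).+1) suf) * q1 (pre ++ A :: take (m - (size pre).+1) suf))%E).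
    move=> A mA; rewrite take_cat drop_cat ltnNge (ltnW sm)/= muleC.
    by have -> : (m - size pre)%N = (m - (size pre).+1).+1 by rewrite subnSK.
  apply: sigma_funZ.
    by apply: q20 => //; rewrite size_drop; move: sz sm szt; rewrite size_take; lia.
  by apply: h1 => //; rewrite szt -addSn subnKC.
have [m1 m2] := sets_in_take m mp.
apply: (@eq_sigma_fun _ (fun A => q1 (take m pre) * q2 (drop m pre ++ A :: suf))%E).
  move=> A mA; rewrite take_cat drop_cat; case: ltnP => sm'; first by [].
  have -> : size pre = m by lia.
  by rewrite subnn take0 drop0 take_oversize ?drop_oversize ?cats0//; lia.
apply: sigma_funZ; first by apply: q10 => //; rewrite size_takel.
by apply: h2 => //; rewrite size_drop; lia.
Qed.

Lemma msets_zip (ts : seq R) L : sets_in measurable L -> msets (zip ts L).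
Proof. by elim: L ts => [|A L ih] [|t ts]//= mL; inversion mL; split => //; exact: ih. Qed.

Lemma coordwise_bmass l y s x (ts : seq R) :
  coordwise (size ts) (fun L => bmass l y s x (zip ts L)).
Proof.
move=> pre suf sz mp ms.
have [ts1 [t [ts2 [E s1]]]] : exists ts1 t ts2, ts = ts1 ++ t :: ts2 /\ size ts1 = size pre.
  exists (take (size pre) ts), (nth 0 ts (size pre)), (drop (size pre).+1 ts); split.
    by rewrite -drop_nth ?cat_take_drop// -sz ltnS leq_addr.
  by rewrite size_takel// -sz ltnW// ltnS leq_addr.
apply: (@eq_sigma_fun _ (fun A => 1 * bmass l y s x (zip ts1 pre ++ (t, A) :: zip ts2 suf))%E).
  by move=> A mA; rewrite E zip_cat// mul1e.
by apply: sigma_fun_bmass => //; exact: msets_zip.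
Qed.

Lemma coordwise_integral n (G : set R) (a : R -> R) (q : R -> seq (set R) -> \bar R) :
  measurable G -> measurable_fun setT a -> (forall z, 0 <= a z) ->
  (forall z, coordwise n (q z)) ->
  (forall L, size L = n -> sets_in measurable L -> measurable_fun setT (fun z => q z L)) ->
  (forall z L, size L = n -> sets_in measurable L -> 0 <= q z L)%E ->
  coordwise n.+1 (fun L => \int[mu]_(z in head set0 L `&` G) ((a z)%:E * q z (behead L)))%E.
Proof.
move=> mG ma a0 cq mq q0 [|O pre] suf /= [sz] mp ms.
  apply: sigma_fun_set_integral => //.
    by apply: emeasurable_funM; [exact/measurable_EFinP|exact: mq].
  by move=> z; rewrite mule_ge0 ?lee_fin ?q0.
have [mO mp'] : measurable O /\ sets_in measurable pre by inversion mp.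
apply: (@sigma_fun_integral _ (O `&` G) a (fun z A => q z (pre ++ A :: suf))) => //.
- exact: measurableI.
- by move=> z; apply: cq => //; rewrite -sz addSn.
- move=> A mA; apply: mq; first by rewrite size_cat/= addnS -sz addSn.
  by apply/sets_in_cat; split => //; exact: List.Forall_cons.
Qed.

Section probability.
Context {d0 : measure_display} {T : measurableType d0} (P : probability T R).
Implicit Types (Ys : seq (T -> R)).

Definition coords Ys L : set T := \big[setI/setT]_(p <- zip Ys L) (p.1 @^-1` p.2).

Definition measurable_list Ys : Prop := List.Forall (fun Y => measurable_fun setT Y) Ys.

Lemma measurable_coords Ys L : measurable_list Ys -> sets_in measurable L -> measurable (coords Ys L).
Proof.
rewrite /coords; elim: Ys L => [|Y Ys ih] [|A L] mY mL /=; rewrite ?big_nil ?big_cons//.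
inversion mY; inversion mL; subst.
by apply: measurableI; [rewrite -[X in measurable X]setTI; exact: H1|exact: ih].
Qed.

Lemma coordwise_prob (D : set T) Ys : measurable D -> measurable_list Ys ->
  coordwise (size Ys) (fun L => P (D `&` coords Ys L)).
Proof.
move=> mD mY pre suf sz mp ms.
have [Y1 [Y [Y2 [E s1]]]] : exists Y1 Y Y2, Ys = Y1 ++ Y :: Y2 /\ size Y1 = size pre.
  exists (take (size pre) Ys), (nth (cst 0) Ys (size pre)), (drop (size pre).+1 Ys); split.
    by rewrite -drop_nth ?cat_take_drop// -sz ltnS leq_addr.
  by rewrite size_takel// -sz ltnW// ltnS leq_addr.
have [mY1 mYY] : measurable_list Y1 /\ measurable_list (Y :: Y2) by apply/List.Forall_app; rewrite -[app _ _]/(Y1 ++ _) -E.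
have [mYm mY2] : measurable_fun setT Y /\ measurable_list Y2 by inversion mYY.
pose D' := D `&` coords Y1 pre `&` coords Y2 suf.
have mD' : measurable D'.
  by apply: measurableI; [apply: measurableI => //|]; exact: measurable_coords.
have mYA A : measurable A -> measurable (Y @^-1` A) by move=> mA; rewrite -[X in measurable X]setTI; exact: mYm.
apply: (@eq_sigma_fun _ (fun A => P (D' `&` Y @^-1` A))).
  move=> A mA; rewrite /coords E zip_cat// big_cat big_cons/=; congr (P _).
  by rewrite /D' /coords; apply/seteqP; split=> w /=; tauto.
split.
- by rewrite preimage_set0 setI0 measure0.
- by [].
- move=> A mA tA; rewrite preimage_bigcup setI_bigcupr measure_semi_bigcup//.
  + by move=> i; apply: measurableI => //; exact: mYA.
  + by move=> i j _ _ [w [[_ h1] [_ h2]]]; apply: (tA i j) => //; exists (Y w).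
  + by apply: bigcup_measurable => i _; apply: measurableI => //; exact: mYA.
Qed.

End probability.
End coordwise_laws.

(** * Joint law of the last hit and of the two pieces *)

Section joint_law.
Context {R : realType} {d0 : measure_display} {T : measurableType d0} (P : probability T R).
Notation mu := (@lebesgue_measure R).
Variables (B : R -> T -> R) (l : R).
Hypotheses (BB : brownian_bridge P 1 0 l B).
Hypotheses (cB : forall w, continuous (B ^~ w)) (mB : forall t, measurable_fun setT (B t)).
Hypothesis l0 : 0 < l.

Let B0 w : B 0 w = 0. Proof. by have [_ _ ->] := BB. Qed.

Let Z := hit_time B l.
Definition before t w : R := vervaat (B ^~ w) t.
Definition after t w : R := vervaat (B ^~ w) (Z w + t) - l.

Let mZ : measurable_fun setT Z. Proof. exact: measurable_hit_time. Qed.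

Lemma measurable_before t : measurable_fun setT (before t).
Proof.
by apply: (measurable_vervaat_at cB mB B0 (f := fun=> t) (g := idfun)); [exact: measurable_cst|exact: measurable_id].
Qed.

Lemma measurable_after t : measurable_fun setT (after t).
Proof.
apply: measurable_funB => //.
apply: (measurable_vervaat_at cB mB B0 (f := fun w => Z w + t) (g := idfun)); last exact: measurable_id.
exact: measurable_funD.
Qed.

Definition rate : R := (gauss 1 l)^-1 * l / 4.

Let rate_ge0 : 0 <= rate.
Proof. by rewrite divr_ge0// mulr_ge0 ?(ltW l0)// invr_ge0 ltW// gauss_gt0. Qed.

(** The maximum with 0 keeps the weight nonnegative on the whole line. *)
Definition joint_density c c' z : \bar R :=
  ((rate * Num.max 0 (1 - z))%:E * (bmass z l 0 0 c * bmass (1 - z) 0 0 0 c'))%E.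

Lemma coords_cylinder (X : R -> T -> R) c : coords [seq X t | t <- unzip1 c] (unzip2 c) = cylinder X c.
Proof.
rewrite /coords /cylinder; elim: c => [|p c ih] /=; first by rewrite !big_nil.
by rewrite !big_cons ih.
Qed.

Lemma box_cylinder (X : R -> T -> R) c w : in_boxes (X ^~ w) 0 c <-> cylinder X (box_rect c) w.
Proof.
rewrite /in_boxes /cylinder; elim: c => [|p c ih] /=; first by rewrite big_nil.
rewrite big_cons addr0; split=> [/andP[h1 /ih h2]|[h1 h2]]; first by split => //=; rewrite in_itv.
by apply/andP; split; [move: h1; rewrite /= in_itv|exact/ih].
Qed.

Lemma bmass_setT (x s y u : R) (ts : seq R) : path <%R s ts -> last s ts < x -> 0 <= y -> 0 <= u ->
  bmass x u s y (zip ts (nseq (size ts) setT)) = (bes (x - s) y u)%:E.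
Proof.
elim: ts s => [//|t ts ih] s /= /andP[st pt] h y0 u0.
have uz : unzip1 (zip ts (nseq (size ts) (@setT R))) = ts by rewrite unzip1_zip// size_nseq.
have ms : msets (zip ts (nseq (size ts) (@setT R))).
  by apply: msets_zip; elim: (size ts) => [|k ihk]; [exact: List.Forall_nil|exact: List.Forall_cons].
rewrite /= bmass_insert0//=; last 2 first.
- by rewrite uz st.
- by rewrite /end_time uz.
apply: ih => //; last first.
  by case: ts pt h {uz ms} => [|t' ts]//= _; exact: lt_trans.
by case: ts pt {h uz ms} => [//|t' ts] /= /andP[tt' ->]; rewrite (lt_trans st tt').
Qed.

Section times.
Variables ts ts' : seq R.
Hypotheses (pt : path <%R 0 ts) (pt' : path <%R 0 ts').

(** The range of [Z] in which every time of [ts] is before [Z] and every time of [ts'] is before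
    [1 - Z], so that all coordinates fall inside their piece. *)
Let lo := last 0 ts.
Let hi := 1 - last 0 ts'.
Let G : set R := `]lo, hi[%classic.
Let mG : measurable G. Proof. exact: measurable_itv. Qed.
Let m := size ts.
Let n := size ts'.
Let Ys := Z :: ([seq before t | t <- ts] ++ [seq after t | t <- ts']).

Let mYs : measurable_list Ys.
Proof.
apply: List.Forall_cons => //; apply/List.Forall_app; split.
  by elim: (ts) => [|t s ih] /=; [exact: List.Forall_nil|apply: List.Forall_cons => //; exact: measurable_before].
by elim: (ts') => [|t s ih] /=; [exact: List.Forall_nil|apply: List.Forall_cons => //; exact: measurable_after].
Qed.

Let sYs : size Ys = (m + n).+1. Proof. by rewrite /= size_cat !size_map. Qed.

Let D : set T := Z @^-1` G.
Let mD : measurable D. Proof. by rewrite -[D]setTI; exact: mZ. Qed.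

Let Q1 L : \bar R := P (D `&` coords Ys L).
Let a z : R := rate * Num.max 0 (1 - z).
Let q z L : \bar R := (bmass z l 0 0 (zip ts (take m L)) * bmass (1 - z) 0 0 0 (zip ts' (drop m L)))%E.
Let Q2 L : \bar R := (\int[mu]_(z in head set0 L `&` G) ((a z)%:E * q z (behead L)))%E.

Let a0 z : 0 <= a z. Proof. by rewrite mulr_ge0// le_max lexx. Qed.
Let ma : measurable_fun setT a.
Proof. by apply: measurable_funM => //; apply: measurable_maxr => //; exact: measurable_funB. Qed.

Let cQ1 : coordwise (m + n).+1 Q1.
Proof. by rewrite -sYs; exact: coordwise_prob. Qed.

Let mq L : sets_in measurable L -> measurable_fun setT (fun z => q z L).
Proof.
move=> mL; have [m1 m2] := sets_in_take m mL.
apply: emeasurable_funM; apply: measurable_bmass => //; try exact: msets_zip.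
exact: measurable_funB.
Qed.

Let q0 z L : sets_in measurable L -> (0 <= q z L)%E.
Proof. by move=> mL; have [m1 m2] := sets_in_take m mL; rewrite mule_ge0 ?bmass_ge0//; exact: msets_zip. Qed.

Let cQ2 : coordwise (m + n).+1 Q2.
Proof.
apply: coordwise_integral => //.
- move=> z; apply: (@coordwise_mul _ m n (fun L => bmass z l 0 0 (zip ts L)) (fun L => bmass (1 - z) 0 0 0 (zip ts' L))).
  + exact: coordwise_bmass.
  + exact: coordwise_bmass.
  + by move=> L _ mL; rewrite bmass_ge0//; exact: msets_zip.
  + by move=> L _ mL; rewrite bmass_ge0//; exact: msets_zip.
- by move=> L _; exact: mq.
- by move=> z L _; exact: q0.
Qed.

Let boxes (s : seq R) L : size L = size s -> sets_in segment L ->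
  exists c, box_rect c = zip s L.
Proof.
elim: s L => [|t s ih] [|A L]//=; first by exists [::].
move=> [sz] sL; inversion sL; subst; have [x [y ->]] := H1; have [c cE] := ih _ sz H2.
by exists ((t, x, y) :: c); rewrite /= cE.
Qed.

Let box_le b b' L1 L2 : lo < b -> b' < hi -> size L1 = m -> size L2 = n ->
  sets_in segment L1 -> sets_in segment L2 ->
  (Q2 (`[b, b']%classic :: L1 ++ L2) <= Q1 (`[b, b']%classic :: L1 ++ L2))%E.
Proof.
move=> hb hb' s1 s2 sL1 sL2.
have [c cE] := boxes s1 sL1; have [c' cE'] := boxes s2 sL2.
have u1 : unzip1 (box_rect c) = ts by rewrite cE unzip1_zip// s1.
have u2 : unzip1 (box_rect c') = ts' by rewrite cE' unzip1_zip// s2.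
have := @box_event_ge R _ T P B l BB cB mB l0 b b' c c'.
rewrite /end_time u1 u2 => /(_ pt hb pt') H.
have {}H : (\int[mu]_(z in `[b, b']) ((rate * (1 - z))%:E * box_density l c c' z) <= P (box_event B l b b' c c'))%E.
  by apply: H; move: hb'; rewrite /hi; lra.
have IG : `[b, b']%classic `&` G = `[b, b']%classic.
  apply/setIidl => z; rewrite /= !in_itv/= => /andP[h1 h2].
  by rewrite /G/= in_itv/= (lt_le_trans hb h1) (le_lt_trans h2 hb').
have -> : Q2 (`[b, b']%classic :: L1 ++ L2) = (\int[mu]_(z in `[b, b']) ((rate * (1 - z))%:E * box_density l c c' z))%E.
  rewrite /Q2 /= IG; apply: eq_integral => z; rewrite inE/= in_itv/= => /andP[h1 h2].
  rewrite /a max_r; last first.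
    have := @path_end_time _ 0 (box_rect c'); rewrite /end_time u2 => /(_ pt') h3.
    by move: hb'; rewrite /hi; lra.
  by rewrite /q take_size_cat// drop_size_cat// -cE -cE'.
apply: (le_trans H); rewrite (_ : box_event B l b b' c c' = D `&` coords Ys (`[b, b']%classic :: L1 ++ L2))//.
rewrite /coords /Ys/= zip_cat ?size_map// big_cons big_cat/= -!/(coords _ _).
rewrite -[in coords _ L1]u1 -[in coords _ L2]u2.
have -> : L1 = unzip2 (box_rect c) by rewrite cE unzip2_zip// s1.
have -> : L2 = unzip2 (box_rect c') by rewrite cE' unzip2_zip// s2.
rewrite !coords_cylinder; apply/seteqP; split=> w /=.
  move=> [h1 h2 h3]; split; last by split; [rewrite in_itv|split; [apply/(box_cylinder before)|apply/(box_cylinder after)]].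
  have : `[b, b']%classic (Z w) by rewrite /= in_itv.
  by rewrite -IG => -[].
move=> [_ [h1 [h2 h3]]]; split; first by move: h1; rewrite in_itv.
- exact/(box_cylinder before).
- exact/(box_cylinder after).
Qed.

Let segI x y x' y' : (`[x, y] `&` `[x', y'] : set R) = `[Num.max x x', Num.min y y']%classic.
Proof.
apply/seteqP; split=> z /=; rewrite !in_itv/= ge_max le_min.
  by move=> [/andP[-> ->] /andP[-> ->]].
by move=> /andP[/andP[-> ->] /andP[-> ->]].
Qed.

Let le_segments L : size L = (m + n).+1 -> sets_in segment L -> (Q2 L <= Q1 L)%E.
Proof.
case: L => [//|O L] /= [sz] sL; have [sO sL'] : segment O /\ sets_in segment L by inversion sL.
have [L1 [L2 [E [s1 s2]]]] : exists L1 L2, L = L1 ++ L2 /\ size L1 = m /\ size L2 = n.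
  exists (take m L), (drop m L); rewrite cat_take_drop size_drop size_takel ?sz ?leq_addr//.
  by rewrite addKn.
move: sL'; rewrite E => /sets_in_cat[sL1 sL2].
have mS L' : sets_in segment L' -> sets_in measurable L' by apply: List.Forall_impl; exact: segment_measurable.
have mL : sets_in measurable (L1 ++ L2) by apply/sets_in_cat; split; exact: mS.
have szL : (size (@nil (set R)) + size (L1 ++ L2)).+1 = (m + n).+1 by rewrite add0n size_cat s1 s2.
have [m1 m1E] := sigma_fun_measure (cQ1 szL (List.Forall_nil _) mL).
have [m2 m2E] := sigma_fun_measure (cQ2 szL (List.Forall_nil _) mL).
have [x [y xyE]] := sO.
(* Segments inside the open interval [G], to which [box_le] applies, exhaust the part of [O] in
   [G]. *)
pose F k : set R := O `&` `[lo + k.+1%:R^-1, hi - k.+1%:R^-1]%classic.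
have FE k : F k = `[Num.max x (lo + k.+1%:R^-1), Num.min y (hi - k.+1%:R^-1)]%classic by rewrite /F xyE segI.
have UF : \bigcup_k F k = O `&` G.
  rewrite -setI_bigcupr; congr (_ `&` _); apply/seteqP; split=> z /=.
    move=> [k _]; rewrite /= in_itv/= => /andP[h1 h2]; have : 0 < k.+1%:R^-1 :> R by [].
    by move: (k.+1%:R^-1) h1 h2 => e h1 h2 e0; rewrite /G/= in_itv/=; apply/andP; split; lra.
  rewrite /G/= in_itv/= => /andP[h1 h2].
  have : 0 < Num.min (z - lo) (hi - z) by rewrite lt_min !subr_gt0 h1.
  move=> e0; have /cvgr_lt/(_ _ e0)[k _ hk] := @cvg_harmonic R.
  have := hk k (leqnn _); rewrite /= /harmonic/= lt_min => /andP[h3 h4].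
  exists k => //=; rewrite in_itv/=.
  by move: (k.+1%:R^-1) h3 h4 => e h3 h4; apply/andP; split; lra.
have mO := segment_measurable sO.
have mF k : measurable (F k) by rewrite FE; exact: measurable_itv.
have le : (m2 (\bigcup_k F k) <= m1 (\bigcup_k F k))%E.
  apply: measure_le_bigcup => //.
    move=> i j ij; apply/subsetPset => z; rewrite /F /= !in_itv/= => -[zO /andP[h1 h2]]; split => //.
    have h4 : j.+1%:R^-1 <= i.+1%:R^-1 :> R by rewrite lef_pV2 ?posrE// ler_nat.
    by move: (j.+1%:R^-1) (i.+1%:R^-1) h1 h2 h4 => e e' h1 h2 h4; apply/andP; split; lra.
  move=> k; rewrite -m1E// -m2E//= FE.
  have k0 : 0 < k.+1%:R^-1 :> R by [].
  apply: box_le => //; first by rewrite lt_max ltrDl k0 orbT.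
  by rewrite gt_min gtrBl k0 orbT.
move: le; rewrite UF -m1E ?m2E -?m2E//; try exact: measurableI.
have -> : Q2 (O `&` G :: L1 ++ L2) = Q2 (O :: L1 ++ L2) by rewrite /Q2/= -setIA setIid.
move=> h; apply: (le_trans h); rewrite /=.
apply: le_measure; rewrite ?inE.
- apply: measurableI => //; apply: measurable_coords => //; apply: List.Forall_cons => //.
  exact: measurableI.
- by apply: measurableI => //; apply: measurable_coords => //; exact: List.Forall_cons.
- by move=> w; rewrite /coords /Ys /= !big_cons/= => -[? [[? ?] ?]].
Qed.

Let setTs k : sets_in measurable (nseq k (@setT R)).
Proof. by elim: k => [|k ih]; [exact: List.Forall_nil|exact: List.Forall_cons]. Qed.

Let total_Q2 : Q2 (nseq (m + n).+1 setT) = (\int[mu]_(z in G) (last_hit_density l z)%:E)%E.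
Proof.
rewrite /Q2/= setTI; apply: eq_integral => z; rewrite inE/= /G/= in_itv/= /lo /hi => /andP[h1 h2].
have e0 (s : seq R) : path <%R 0 s -> 0 <= last 0 s.
  have := @path_end_time _ 0 (zip s (nseq (size s) (@setT R))).
  by rewrite /end_time unzip1_zip ?size_nseq.
have e1 := e0 _ pt; have e2 := e0 _ pt'.
rewrite /q take_nseq ?leq_addr// drop_nseq addKn.
rewrite !bmass_setT ?subr_ge0 ?(ltW l0)//; last by lra.
rewrite last_hit_density_bes//; last by lra.
by rewrite !subr0 -!EFinM /a max_r//; lra.
Qed.

(** The assumption on the law of [Z] is the comparison of total masses that turns the lower bound on
    boxes into an equality. *)
Lemma joint_law_sets L : (P (Z @^-1` G) <= \int[mu]_(z in G) (last_hit_density l z)%:E)%E ->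
  size L = (m + n).+1 -> sets_in measurable L -> Q1 L = Q2 L.
Proof.
move=> lawZ; apply: coordwise_unique => //.
  move=> L' sz mL'; rewrite -ge0_fin_numE// fin_num_measure//; apply: measurableI => //.
  exact: measurable_coords.
rewrite total_Q2; apply: le_trans lawZ; apply: le_measure; rewrite ?inE//.
by apply: measurableI => //; apply: measurable_coords.
Qed.

Lemma joint_law_coords O L L' : (P (Z @^-1` G) <= \int[mu]_(z in G) (last_hit_density l z)%:E)%E ->
  measurable O -> sets_in measurable L -> sets_in measurable L' -> size L = m -> size L' = n ->
  (P (Z @^-1` (O `&` G) `&` (cylinder before (zip ts L) `&` cylinder after (zip ts' L'))) =
   \int[mu]_(z in O `&` G) joint_density (zip ts L) (zip ts' L') z)%E.
Proof.
move=> lawZ mO mL mL' sL sL'; transitivity (Q1 (O :: L ++ L')).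
  congr (P _); rewrite /coords /Ys /= zip_cat ?size_map// big_cons big_cat/= -!/(coords _ _).
  have E X (s : seq R) M : size M = size s -> coords [seq X t | t <- s] M = cylinder (X : R -> T -> R) (zip s M).
    by move=> h; rewrite -coords_cylinder unzip1_zip ?unzip2_zip ?h.
  rewrite !E// /D preimage_setI.
  by apply/seteqP; split=> w /=; tauto.
rewrite joint_law_sets//=; last 2 first.
- by rewrite size_cat sL sL'.
- by apply: List.Forall_cons => //; apply/sets_in_cat.
by apply: eq_integral => z _; rewrite /q take_size_cat// drop_size_cat.
Qed.

End times.

(** Without times [G] is []0, 1[], where the density has integral 1, so the comparison of total
    masses is trivial. The law obtained here then supplies that comparison for every other choice of
    times. *)
Lemma hit_time_law (A : set R) : measurable A ->
  (P (Z @^-1` (A `&` `]0%R, 1%R[)) = \int[mu]_(z in A `&` `]0%R, 1%R[) (last_hit_density l z)%:E)%E.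
Proof.
move=> mA; have := @joint_law_coords [::] [::] isT isT A [::] [::].
rewrite /= subr0 integral_last_hit_density// => /(_ (probability_le1 _ _)).
move=> /(_ _ mA (List.Forall_nil _) (List.Forall_nil _) erefl erefl).
rewrite /cylinder !big_nil !setIT => ->.
  apply: eq_integral => z; rewrite inE/= in_itv/= => -[_ /andP[h1 h2]].
  rewrite /joint_density /bmass/= /end_time/= !subr0 last_hit_density_bes ?h1// max_r ?EFinM//.
  by rewrite subr_ge0 ltW.
by rewrite -[X in measurable X]setTI; exact: mZ.
Qed.

(** The joint density is split into the density of [Z] and two normalised bridge probabilities;
    [bes z 0 l] and [bes (1 - z) 0 0] are the total masses of the two bridges. *)
Definition before_prob c z : \bar R := (bmass z l 0 0 c * ((bes z 0 l)^-1)%:E)%E.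
Definition after_prob c z : \bar R := (bmass (1 - z) 0 0 0 c * ((bes (1 - z) 0 0)^-1)%:E)%E.

Lemma before_prob_ge0 c z : msets c -> (0 <= before_prob c z)%E.
Proof. by move=> mc; rewrite mule_ge0 ?bmass_ge0// lee_fin invr_ge0 bes_nneg. Qed.

Lemma after_prob_ge0 c z : msets c -> (0 <= after_prob c z)%E.
Proof. by move=> mc; rewrite mule_ge0 ?bmass_ge0// lee_fin invr_ge0 bes_nneg. Qed.

Lemma measurable_before_prob c : msets c -> measurable_fun setT (before_prob c).
Proof.
move=> mc; apply: emeasurable_funM; first exact: measurable_bmass.
by apply/measurable_EFinP; apply: measurable_funV; exact: measurable_bes.
Qed.

Lemma measurable_after_prob c : msets c -> measurable_fun setT (after_prob c).
Proof.
have m1 : measurable_fun setT (fun z : R => 1 - z) by exact: measurable_funB.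
move=> mc; apply: emeasurable_funM; first exact: measurable_bmass.
by apply/measurable_EFinP; apply: measurable_funV; exact: measurable_bes.
Qed.

Theorem joint_law c c' (O : set R) : path <%R 0 (unzip1 c) -> path <%R 0 (unzip1 c') -> msets c -> msets c' ->
  measurable O ->
  let G := `]end_time 0 c, 1 - end_time 0 c'[%classic in
  (P (Z @^-1` (O `&` G) `&` (cylinder before c `&` cylinder after c')) =
   \int[mu]_(z in O `&` G) ((last_hit_density l z)%:E * (before_prob c z * after_prob c' z)))%E.
Proof.
move=> pc pc' mc mc' mO G.
have mG : measurable G by exact: measurable_itv.
have G01 : G = G `&` `]0%R, 1%R[%classic.
  apply/esym/setIidl => z; rewrite /G/= !in_itv/= => /andP[h1 h2].
  by move: (path_end_time pc) (path_end_time pc') => h3 h4; apply/andP; split; lra.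
have mS (e : seq (R * set R)) : msets e -> sets_in measurable (unzip2 e).
  by elim: e => [_|p e ih] /=; [exact: List.Forall_nil|move=> [h1 /ih h2]; exact: List.Forall_cons].
have := @joint_law_coords (unzip1 c) (unzip1 c') pc pc' O (unzip2 c) (unzip2 c').
rewrite !zip_unzip -/(end_time 0 c) -/(end_time 0 c') -/G => ->//; try exact: mS; try by rewrite !size_map.
  apply: eq_integral => z; rewrite inE => -[_]; rewrite G01 => -[_]; rewrite /= in_itv/= => /andP[h1 h2].
  have z1 : 0 < 1 - z by rewrite subr_gt0.
  rewrite /joint_density /before_prob /after_prob last_hit_density_bes ?h1// max_r; last exact: ltW.
  have b1 : 0 < bes z 0 l by rewrite bes_gt0// ltW.
  have b2 : 0 < bes (1 - z) 0 0 by rewrite bes_gt0.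
  rewrite -/rate; move: (bmass _ _ _ _ c) (bmass _ _ _ _ c') (bes z 0 l) b1 (bes (1 - z) 0 0) b2 => x y u u0 v v0.
  rewrite [RHS](mule.[AC (1*((1*1)*(1*1))) ((1*(3*5))*(2*4))])%AC.
  rewrite -!EFinM; congr (_%:E * _)%E; field; by rewrite !gt_eqF.
by rewrite G01 hit_time_law// -G01.
Qed.

End joint_law.

(** * Conditional laws given the last hit *)

Section layer_cake.
Context {R : realType}.
Notation mu := (@lebesgue_measure R).

Definition below (h : \bar R) : set R := [set r | (0 <= r)%R /\ (r%:E < h)%E].

Lemma layers (h : \bar R) : (0 <= h)%E -> (\int[mu]_r (\1_(below h) r)%:E = h)%E.
Proof.
rewrite /below; case: h => [c| |]//.
- rewrite lee_fin => c0.
  rewrite (_ : [set r : R | _] = `[0, c[%classic); last first.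
    by apply/seteqP; split=> r /=; rewrite in_itv/= lte_fin; [move=> [-> ->]|move=> /andP[]].
  rewrite (integral_indic mu measurableT (measurable_itv _)) setIT.
  transitivity (if (0%:E < c%:E)%E then (c%:E - 0%:E)%E else 0%E).
    exact: lebesgue_measure_itv.
  rewrite lte_fin; case: ltP => h; first by rewrite sube0.
  by congr EFin; apply/le_anti; rewrite c0 h.
- move=> _; rewrite (_ : [set r : R | _] = `[0, +oo[%classic); last first.
    by apply/seteqP; split=> r /=; rewrite in_itv/= andbT ?ltry; [move=> [-> _]|].
  rewrite (integral_indic mu measurableT (measurable_itv _)) setIT; etransitivity; first exact: lebesgue_measure_itv.
  by rewrite /= ltry.
Qed.

(** [h (X w)] is the length of the set of nonnegative levels below it; Tonelli reduces the integral
    to superlevel sets. *)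
Lemma layer_cake d (T : measurableType d) (m : {sigma_finite_measure set T -> \bar R}) (a : T -> \bar R)
    (X : T -> R) (h : R -> \bar R) : measurable_fun setT a -> measurable_fun setT X -> measurable_fun setT h ->
  (forall w, 0 <= a w)%E -> (forall z, 0 <= h z)%E ->
  (\int[m]_w (a w * h (X w)) =
   \int[mu]_(r in `[0%R, +oo[) \int[m]_(w in X @^-1` [set z | r%:E < h z]) a w)%E.
Proof.
move=> ma mX mh a0 h0.
pose S := [set q : T * R | below (h (X q.1)) q.2].
have mS : measurable S.
  have m1 : measurable_fun setT (fun q : T * R => q.2%:E) by apply/measurable_EFinP; exact: measurable_snd.
  have m2 : measurable_fun setT (fun q : T * R => h (X q.1)).
    by apply: (measurable_pair_fst (f := h \o X)); exact: measurableT_comp.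
  have -> : S = (setT `&` [set q : T * R | 0 <= q.2%:E]%E) `&` (setT `&` [set q | q.2%:E < h (X q.1)]%E).
    by rewrite !setTI; apply/seteqP; split=> q /=; rewrite /S/= /below/= lee_fin.
  by apply: measurableI; [apply: measurable_lee => //|apply: measurable_lte].
have mbelow y : measurable (below y).
  have -> : below y = (setT `&` [set r : R | 0 <= r%:E]%E) `&` (setT `&` [set r | r%:E < y]%E).
    by rewrite !setTI; apply/seteqP; split=> q /=; rewrite /below/= lee_fin.
  by apply: measurableI; [apply: measurable_lee => //|apply: measurable_lte].
pose f (q : T * R) : \bar R := (a q.1 * (\1_S q)%:E)%E.
have mf : measurable_fun setT f.
  apply: emeasurable_funM; first exact: (measurable_pair_fst ma).
  by apply/measurable_EFinP; exact: measurable_indic.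
have f0 q : (0 <= f q)%E by rewrite mule_ge0// lee_fin.
transitivity (\int[m]_w \int[mu]_r f (w, r))%E.
  apply: eq_integral => w _; rewrite -[in LHS](layers (h0 (X w))) /f/= -ge0_integralZl//.
  apply/measurable_EFinP; exact: (measurable_indic (mbelow _)).
rewrite (@fubini_tonelli _ _ _ _ R m mu f mf f0) [RHS]integral_mkcond.
apply: eq_integral => r _; rewrite /patch mem_setE in_itv/= andbT; case: ifPn => r0; last first.
  by apply: integral0_eq => w _; rewrite /f indicE memNset ?mule0// /S/= /below/= (negbTE r0) => -[].
rewrite [RHS]integral_mkcond; apply: eq_integral => w _; rewrite /patch /f indicE/=.
case: ifPn; first by rewrite inE /= => h1; rewrite mem_set ?mule1.
by rewrite notin_setE /= => h1; rewrite memNset ?mule0// => -[].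
Qed.

(** Two weighted measures with the same image on sets give the same integrals of functions. It
    serves both for changing variables to the law of [Z] and for integrating against conditional
    probabilities. *)
Lemma transfer_integral d1 d2 (T1 : measurableType d1) (T2 : measurableType d2)
    (m1 : {sigma_finite_measure set T1 -> \bar R}) (m2 : {sigma_finite_measure set T2 -> \bar R})
    (D1 : set T1) (D2 : set T2) (a1 : T1 -> \bar R) (a2 : T2 -> \bar R)
    (X1 : T1 -> R) (X2 : T2 -> R) (h : R -> \bar R) : measurable D1 -> measurable D2 ->
  measurable_fun D1 a1 -> measurable_fun D2 a2 -> measurable_fun setT X1 -> measurable_fun setT X2 ->
  (forall w, D1 w -> 0 <= a1 w)%E -> (forall w, D2 w -> 0 <= a2 w)%E ->
  (forall S, measurable S -> \int[m1]_(w in X1 @^-1` S `&` D1) a1 w = \int[m2]_(w in X2 @^-1` S `&` D2) a2 w)%E ->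
  measurable_fun setT h -> (forall z, 0 <= h z)%E ->
  (\int[m1]_(w in D1) (a1 w * h (X1 w)) = \int[m2]_(w in D2) (a2 w * h (X2 w)))%E.
Proof.
move=> mD1 mD2 ma1 ma2 mX1 mX2 a10 a20 E mh h0.
have side d (T : measurableType d) (m : {sigma_finite_measure set T -> \bar R}) (D : set T) (a : T -> \bar R)
    (X : T -> R) : measurable D -> measurable_fun D a -> measurable_fun setT X -> (forall w, D w -> 0 <= a w)%E ->
    (\int[m]_(w in D) (a w * h (X w)) =
     \int[mu]_(r in `[0%R, +oo[) \int[m]_(w in X @^-1` [set z | r%:E < h z] `&` D) a w)%E.
  move=> mD ma mX a0; transitivity (\int[m]_w ((a \_ D) w * h (X w)))%E.
    by rewrite integral_mkcond; apply: eq_integral => w _; rewrite /patch; case: ifP; rewrite ?mul0e.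
  have mr : measurable_fun setT (a \_ D) by exact/(measurable_restrictT _ mD).
  rewrite (layer_cake m mr mX mh (erestrict_ge0 a0) h0).
  by apply: eq_integral => r _; rewrite -integral_mkcondr.
rewrite !side//; apply: eq_integral => r _; apply: E.
by rewrite -[X in measurable X]setTI; apply: emeasurable_fun_o_infty.
Qed.

End layer_cake.

(** * Versions of conditional probabilities and conditional independence *)

Section conditional.
Context {R : realType} {d0 : measure_display} {T : measurableType d0} (P : probability T R).
Variables (Z : T -> R) (mZ : measurable_fun setT Z).
Implicit Types (E D : set T) (A : set R) (g h : R -> \bar R).

Let mZA A : measurable A -> measurable (Z @^-1` A).
Proof. by move=> mA; rewrite -[X in measurable X]setTI; exact: mZ. Qed.

Let mcomp D h : measurable_fun setT h -> measurable_fun D (fun w => h (Z w)).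
Proof. by move=> mh; apply: measurable_funTS; exact: (measurableT_comp mh mZ). Qed.

(** The defining property of a conditional probability, extended from sets to nonnegative functions
    of [Z]. *)
Lemma cond_prob_integral E g h A : cond_prob P Z E g -> (forall z, 0 <= g z)%E ->
  measurable_fun setT h -> (forall z, 0 <= h z)%E -> measurable A ->
  (\int[P]_(w in E `&` Z @^-1` A) h (Z w) = \int[P]_(w in Z @^-1` A) (g (Z w) * h (Z w)))%E.
Proof.
move=> [mE mg Eg] g0 mh h0 mA.
have mEA : measurable (E `&` Z @^-1` A) by apply: measurableI => //; exact: mZA.
have := @transfer_integral R _ _ T T P P (E `&` Z @^-1` A) (Z @^-1` A) (cst 1%E) (g \o Z) Z Z h.
rewrite /= => <-//.
- by apply: eq_integral => w _; rewrite mul1e.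
- exact: mZA.
- exact: mcomp.
- move=> S mS; rewrite -preimage_setI -Eg; last exact: measurableI.
  rewrite integral_cst; last by apply: measurableI => //; exact: mZA.
  by rewrite mul1e preimage_setI setICA.
Qed.

Lemma cond_prob_ae E g g' : cond_prob P Z E g -> measurable_fun setT g' ->
  (\forall w \ae P, g (Z w) = g' (Z w)) -> cond_prob P Z E g'.
Proof.
move=> [mE mg Eg] mg' gg'; split => // A mA; rewrite Eg//.
apply: ae_eq_integral => //; [exact: mZA|exact: mcomp|exact: mcomp|].
by apply: filterS gg' => w h _.
Qed.

(** An arbitrary version may be negative somewhere; the defining equation on that set forces the
    integral of its absolute value there to vanish. *)
Lemma cond_prob_ge0 E g : cond_prob P Z E g -> \forall w \ae P, (0 <= g (Z w))%E.
Proof.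
move=> [mE mg Eg]; pose N := [set z | g z < 0]%E.
have mN : measurable N by rewrite -[N]setTI; apply: emeasurable_fun_infty_o.
have I0 : (\int[P]_(w in Z @^-1` N) `|g (Z w)| = 0)%E.
  have -> : (\int[P]_(w in Z @^-1` N) `|g (Z w)| = \int[P]_(w in Z @^-1` N) (- g (Z w)))%E.
    by apply: eq_integral => w; rewrite inE => /ltW/lee0_abs.
  apply/le_anti/andP; split; last by apply: integral_ge0 => w /ltW; rewrite oppe_ge0.
  have <- : (- (\int[P]_(w in Z @^-1` N) g (Z w)) = \int[P]_(w in Z @^-1` N) (- g (Z w)))%E.
    have N0 w : (Z @^-1` N) w -> (0 <= - g (Z w))%E by move=> /ltW; rewrite oppe_ge0.
    rewrite -[RHS]oppeK; congr (oppe _); rewrite -(integral_ge0N P N0).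
    by apply: eq_integral => w _; rewrite oppeK.
  by rewrite oppe_le0 -Eg.
have /(ae_eq_integral_abs P (mZA mN) (@mcomp (Z @^-1` N) g mg)) H := I0.
apply: filterS H => w /= h; rewrite leNgt; apply/negP => hN.
by move: (hN); rewrite (h hN) ltxx.
Qed.

Lemma cond_prob_max0 E g : cond_prob P Z E g -> cond_prob P Z E (fun z => maxe 0%E (g z)).
Proof.
move=> Eg; have [mE mg _] := Eg; apply: (cond_prob_ae Eg); first exact: measurable_maxe.
by apply: filterS (cond_prob_ge0 Eg) => w h; rewrite max_r.
Qed.

(** Dynkin's argument for an identity between a probability and an integral; the assumption on [D]
    and [F] is the case of the whole space, used for complements. *)
Lemma pi_system_ext (C : set (set T)) (D F : set T) (f : T -> \bar R) : setI_closed C ->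
  C `<=` measurable -> measurable D -> measurable F -> measurable_fun setT f -> (forall w, 0 <= f w)%E ->
  (P D = \int[P]_(w in F) f w)%E ->
  (forall E, C E -> P (E `&` D) = \int[P]_(w in E `&` F) f w)%E ->
  forall E, <<s C >> E -> (P (E `&` D) = \int[P]_(w in E `&` F) f w)%E.
Proof.
move=> IC mC mD mF mf f0 tot base.
suff : <<s C >> `<=` [set E | measurable E /\ (P (E `&` D) = \int[P]_(w in E `&` F) f w)%E].
  by move=> H E /H[].
apply: lambda_system_subset; [by []| | |by []].
- apply/dynkin_lambda_system; split.
  + by split=> //; rewrite !setTI.
  + move=> E [mE EE]; split; first exact: measurableC.
    have mED : measurable (E `&` D) by exact: measurableI.
    have mCD : measurable (~` E `&` D) by apply: measurableI => //; exact: measurableC.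
    have e1 : (P D = P (E `&` D) + P (~` E `&` D))%E.
      rewrite -measureU//; first by rewrite -setIUl setUv setTI.
      by rewrite setIACA setICr set0I.
    have e2 : (\int[P]_(w in F) f w = \int[P]_(w in E `&` F) f w + \int[P]_(w in ~` E `&` F) f w)%E.
      rewrite -ge0_integral_setU//.
      * by rewrite -setIUl setUv setTI.
      * exact: measurableI.
      * by apply: measurableI => //; exact: measurableC.
      * exact: measurable_funTS.
      * by apply/disj_setPS => w [[? _] [? _]].
    have fE : P (E `&` D) \is a fin_num by rewrite fin_num_measure.
    move: tot; rewrite e1 e2 -EE => h.
    move: fE h; move: (P (E `&` D)) (P (~` E `&` D)) (integral _ (~` E `&` F) f) => x y z.
    by case: x => [x| |]// _; case: y => [y| |]; case: z => [z| |]//= -[] /addrI ->.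
  + move=> G tG HG; have mG i : measurable (G i) by have [] := HG i.
    split; first exact: bigcup_measurable.
    rewrite !setI_bigcupl measure_semi_bigcup; last 3 first.
    * by move=> i; exact: measurableI.
    * exact: trivIset_setIr.
    * by apply: bigcup_measurable => i _; exact: measurableI.
    rewrite ge0_integral_bigcup//.
    * by apply: eq_eseriesr => i _; have [_ e] := HG i; exact: e.
    * by move=> i; exact: measurableI.
    * exact: measurable_funTS.
    * exact: trivIset_setIr.
- by move=> E CE; split; [exact: mC|exact: base].
Qed.

(** The product rule for some pair of nonnegative versions; [cond_indep_eventsP] passes to any
    nonnegative version for the second event. *)
Definition cond_indep_events E E' : Prop := exists p p', [/\ forall z, (0 <= p z)%E, forall z, (0 <= p' z)%E,
  cond_prob P Z E p, cond_prob P Z E' p' & cond_prob P Z (E `&` E') (fun z => p z * p' z)%E].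

Let cond_prob_measurable E g : cond_prob P Z E g -> measurable_fun setT g.
Proof. by case. Qed.

Lemma cond_indep_eventsP E E' q' A : cond_indep_events E E' -> cond_prob P Z E' q' ->
  (forall z, 0 <= q' z)%E -> measurable A ->
  (P (E `&` E' `&` Z @^-1` A) = \int[P]_(w in E `&` Z @^-1` A) q' (Z w))%E.
Proof.
move=> [p [p' [p0 p'0 Ep Ep' [_ _ e]]]] Eq q0 mA; rewrite e//.
have mp := cond_prob_measurable Ep; have mq := cond_prob_measurable Eq.
rewrite (cond_prob_integral Ep)//.
under eq_integral do rewrite muleC; rewrite -(cond_prob_integral Ep')// (cond_prob_integral Eq)//.
by apply: eq_integral => w _; rewrite muleC.
Qed.

(** Two successive Dynkin extensions, one for each family. Arbitrary versions are first replaced by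
    their positive parts, which agree with them almost surely. *)
Lemma cond_independent_gen (C1 C2 : set (set T)) : setI_closed C1 -> setI_closed C2 ->
  (forall E E', C1 E -> C2 E' -> cond_indep_events E E') ->
  C1 `<=` measurable -> (forall E', C2 E' -> exists2 p, cond_prob P Z E' p & forall z, (0 <= p z)%E) ->
  cond_independent P Z <<s C1>> <<s C2>>.
Proof.
move=> I1 I2 C12 mC1 ver2 E1 E2 g1 g2 hE1 hE2 c1 c2.
pose h1 z := maxe 0%E (g1 z); pose h2 z := maxe 0%E (g2 z).
have ch1 : cond_prob P Z E1 h1 := cond_prob_max0 c1.
have ch2 : cond_prob P Z E2 h2 := cond_prob_max0 c2.
have h10 z : (0 <= h1 z)%E by rewrite le_max lexx.
have h20 z : (0 <= h2 z)%E by rewrite le_max lexx.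
have mh1 := cond_prob_measurable ch1; have mh2 := cond_prob_measurable ch2.
have mC2 : C2 `<=` measurable by move=> E /ver2[p []].
have [mE1 mg1 e1] := c1; have [mE2 mg2 e2] := c2; have [_ _ e1'] := ch1; have [_ _ e2'] := ch2.
(* The first event is extended from the generators while the second is still a generator. *)
have step1 E' A : C2 E' -> measurable A ->
    (P (E1 `&` E' `&` Z @^-1` A) = \int[P]_(w in E' `&` Z @^-1` A) h1 (Z w))%E.
  move=> CE' mA; have [q cq q0] := ver2 _ CE'; have [mE' mq Eq] := cq.
  rewrite (cond_prob_integral cq)//; under eq_integral do rewrite muleC.
  rewrite -(cond_prob_integral ch1)// -setIA.
  apply: (pi_system_ext I1 mC1 _ _ _ _ _ _ hE1) => //.
  - by apply: measurableI => //; exact: mZA.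
  - exact: mZA.
  - exact: mcomp.
  - exact: Eq.
  - by move=> E CE; rewrite setIA; apply: cond_indep_eventsP => //; exact: C12.
(* The second event is extended with the first one now arbitrary. *)
have step2 A : measurable A -> (P (E1 `&` E2 `&` Z @^-1` A) = \int[P]_(w in E2 `&` Z @^-1` A) h1 (Z w))%E.
  move=> mA; rewrite setIAC setIC.
  apply: (pi_system_ext I2 mC2 _ _ _ _ _ _ hE2) => //.
  - by apply: measurableI => //; exact: mZA.
  - exact: mZA.
  - exact: mcomp.
  - by rewrite -e1'.
  - by move=> E CE; rewrite -step1// setICA setIA.
have : cond_prob P Z (E1 `&` E2) (fun z => h1 z * h2 z)%E.
  split; [exact: measurableI|exact: emeasurable_funM|].
  move=> A mA; rewrite step2// (cond_prob_integral ch2)//.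
  by apply: eq_integral => w _; rewrite muleC.
move=> h; apply: (cond_prob_ae h); first exact: emeasurable_funM.
apply: filterS2 (cond_prob_ge0 c1) (cond_prob_ge0 c2) => w w1 w2.
by rewrite /h1 /h2 !max_r.
Qed.

Section almost_sure.
Variables (M : set T) (mM : measurable M) (PM : P M = 1%E).

Lemma prob_setIas E : measurable E -> P (E `&` M) = P E.
Proof.
move=> mE; have mCM := measurableC mM.
have PC : P (~` M) = 0%E by rewrite probability_setC// PM subee.
rewrite -[E in RHS](setIT) -(setUv M) setIUr measureU//; last 3 first.
- exact: measurableI.
- exact: measurableI.
- by rewrite setIACA setICr setI0.
rewrite [X in (_ + X)%E](_ : _ = 0%E) ?adde0//.
apply/le_anti; rewrite measure_ge0 andbT -PC; apply: le_measure; rewrite ?inE//.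
exact: measurableI.
Qed.

Lemma cond_prob_as E E' g : measurable E -> measurable E' -> E `&` M = E' `&` M ->
  cond_prob P Z E g -> cond_prob P Z E' g.
Proof.
move=> mE mE' EE [_ mg Eg]; split => // A mA; rewrite -Eg// -prob_setIas; last first.
  by apply: measurableI => //; exact: mZA.
rewrite -[RHS]prob_setIas; last by apply: measurableI => //; exact: mZA.
by rewrite setIAC -EE setIAC.
Qed.

(** The events whose trace on [M] is in the generated sigma-algebra form a sigma-algebra, so it is
    enough to check generators. *)
Lemma sigma_setI (C G : set (set T)) : <<s C>> M -> (forall E, G E -> <<s C>> (E `&` M)) ->
  forall E, <<s G>> E -> <<s C>> (E `&` M).
Proof.
move=> CM CG; have [s0 sC sU] := smallest_sigma_algebra setT C.
suff : <<s G>> `<=` [set E | <<s C>> (E `&` M)] by [].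
apply: smallest_sub => //; split.
- by rewrite /= set0I.
- move=> E /= h; rewrite setTD.
  have -> : ~` E `&` M = setT `\` ((setT `\` M) `|` (E `&` M)).
    by rewrite !setTD setCU setCK setCI setIUr setICr setU0 setIC.
  apply: (sC); rewrite -bigcup2E; apply: (sU) => -[|[|i]] //=; exact: sC.
- by move=> F hF; rewrite /= setI_bigcupl; exact: sU.
Qed.

End almost_sure.

Lemma cond_independent_as (M : set T) (F1 F2 C1 C2 : set (set T)) : measurable M -> P M = 1%E ->
  F1 `<=` measurable -> F2 `<=` measurable ->
  (forall E, F1 E -> C1 (E `&` M)) -> (forall E, F2 E -> C2 (E `&` M)) ->
  cond_independent P Z C1 C2 -> cond_independent P Z F1 F2.
Proof.
move=> mM PM mF1 mF2 h1 h2 CI E1 E2 g1 g2 f1 f2 c1 c2.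
have m1 := mF1 _ f1; have m2 := mF2 _ f2.
have mI E : measurable E -> measurable (E `&` M) by move=> ?; exact: measurableI.
have mI' : measurable (E1 `&` E2) by exact: measurableI.
apply: (cond_prob_as mM PM _ _ _ (CI _ _ _ _ (h1 _ f1) (h2 _ f2) _ _)).
- by apply: measurableI; exact: mI.
- by [].
- by apply/seteqP; split=> w /=; tauto.
- by apply: (cond_prob_as mM PM _ _ _ c1) => //; [exact: mI|rewrite -setIA setIid].
- by apply: (cond_prob_as mM PM _ _ _ c2) => //; [exact: mI|rewrite -setIA setIid].
Qed.

End conditional.

(** * The two pieces *)

Section vervaat_bridge.
Context {R : realType} {d0 : measure_display} {T : measurableType d0} (P : probability T R).
Notation mu := (@lebesgue_measure R).

(** The supremum of the hits is a limit of hits, so continuity gives the level there, even if the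
    supremum were 1. *)
Lemma last_hit_value (l : R) f : continuous f -> 0 < last_hit l f -> f (last_hit l f) = l.
Proof.
move=> cf z0; apply/eqP; rewrite -subr_eq0 -normr_eq0; apply/eqP/le_anti; rewrite normr_ge0 andbT.
have hs : has_sup (hits l f).
  by apply: contrapT => h; move: z0; rewrite /last_hit sup_out// ltxx.
apply/ler_addgt0Pr => e e0; rewrite add0r.
have /cvgrPdist_le/(_ _ e0) : f x @[x --> last_hit l f] --> f (last_hit l f) by exact: cf.
case=> r /= r0 hr; have [t ht tz] := sup_adherent r0 hs.
have [_ ftl] := ht; have := hr t; rewrite /= ftl; apply; rewrite /ball_/= ger0_norm; first by move: tz; rewrite -/(last_hit l f); lra.
by rewrite subr_ge0 last_hit_ge.
Qed.

Lemma vervaat0 (f : R -> R) : continuous f -> f 0 = 0 -> vervaat f 0 = 0.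
Proof.
move=> cf f0; have [t01 _] := argmin_timeP cf.
by rewrite vervaat_unroll// addr0 unroll_le1 ?subrr//; case/andP: t01.
Qed.

Lemma vervaat1 (f : R -> R) : continuous f -> f 0 = 0 -> vervaat f 1 = f 1.
Proof.
move=> cf f0; have [/andP[t0 t1] _] := argmin_timeP cf.
by rewrite vervaat_unroll// unroll_ge1 ?addrK ?lerDr//; ring.
Qed.

Lemma rectangle_msets (c : seq (R * set R)) : rectangle c -> msets c.
Proof.
move=> [_]; elim: c => [//|p c ih] /= h; split; first exact: (h 0%N).
by apply: ih => i; exact: (h i.+1).
Qed.

Lemma eq_cylinder (X Y : R -> T -> R) s c w : path <%R s (unzip1 c) ->
  (forall t, s <= t <= end_time s c -> X t w = Y t w) -> cylinder X c w <-> cylinder Y c w.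
Proof.
rewrite /cylinder; elim: c s => [|[t A] c ih] s /=; first by rewrite !big_nil.
move=> /andP[st pc] h; rewrite !big_cons /= h; last by rewrite (ltW st); exact: (path_end_time pc).
have h' u : t <= u <= end_time t c -> X u w = Y u w.
  by move=> /andP[tu ue]; apply: h; rewrite (le_trans (ltW st) tu).
by split=> -[h1 /(ih _ pc h') h2].
Qed.

Variables (B : R -> T -> R) (l : R).
Hypotheses (BB : brownian_bridge P 1 0 l B).
Hypotheses (cB : forall w, continuous (B ^~ w)) (mB : forall t, measurable_fun setT (B t)).
Hypothesis l0 : 0 < l.

Let B0 w : B 0 w = 0. Proof. by have [_ _ ->] := BB. Qed.

Let Z := hit_time B l.
Let mZ : measurable_fun setT Z. Proof. exact: measurable_hit_time. Qed.
Let mZA (A : set R) : measurable A -> measurable (Z @^-1` A).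
Proof. by move=> mA; rewrite -[X in measurable X]setTI; exact: mZ. Qed.

(** The almost sure event on which both pieces have positive length and the end level is reached. *)
Definition regular : set T := Z @^-1` `]0, 1[ `&` B 1 @^-1` [set l].

Lemma measurable_regular : measurable regular.
Proof.
apply: measurableI; first exact: mZA.
by rewrite -[X in measurable X]setTI; exact: mB.
Qed.

(** [Z] lies in []0, 1[] almost surely because its density has total mass 1 there. *)
Lemma prob_regular : P regular = 1%E.
Proof.
have m1 : measurable (B 1 @^-1` [set l]) by rewrite -[X in measurable X]setTI; exact: mB.
rewrite /regular prob_setIas//; last 2 first.
- have [_ _ _ [N [mN N0 hN]] _] := BB.
  have : P (~` (B 1 @^-1` [set l])) = 0%E.
    by apply: (subset_measure0 _ mN hN N0); exact: measurableC.
  by rewrite probability_setC// => h; move: h; rewrite -(fineK (fin_num_measure P _ m1)) -EFinB => -[h]; congr EFin; lra.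
- exact: mZA.
by rewrite -[X in Z @^-1` X]setTI (hit_time_law BB)// setTI integral_last_hit_density.
Qed.

Let M := regular.
Let mM := measurable_regular.
Let PM := prob_regular.

Lemma measurable_last_hit_density : measurable_fun setT (@last_hit_density R l).
Proof.
have mp n : measurable_fun setT (fun z : R => z ^+ n) by exact: exprn_measurable.
have m1 : measurable_fun setT (fun z : R => 1 - z) by exact: measurable_funB.
apply: measurable_funM.
  apply: measurable_funM => //; apply: measurable_funV; apply: (measurableT_comp measurable_sqrtr).
  by apply: measurable_funM => //; apply: measurable_funM.
apply: measurableT_comp => //; apply: measurableT_comp => //; apply: measurable_funM; first exact: measurable_funM.
by apply: measurable_funV; exact: measurable_funM.
Qed.

Lemma last_hit_density_ge0 z : 0 <= last_hit_density l z.
Proof. by rewrite mulr_ge0 ?expR_ge0// divr_ge0 ?sqrtr_ge0// ltW. Qed.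

Lemma hit_time_prob A : measurable A ->
  P (Z @^-1` A) = (\int[mu]_(z in A `&` `]0%R, 1%R[) (last_hit_density l z)%:E)%E.
Proof.
move=> mA; rewrite -(hit_time_law BB)// -(prob_setIas mM PM); last exact: mZA.
rewrite -[RHS](prob_setIas mM PM); last by apply: mZA; exact: measurableI.
by congr (P _); apply/seteqP; split=> w /=; [move=> [? [? ?]]|move=> [[? _] ?]].
Qed.

Lemma hit_time_integral A (h : R -> \bar R) : measurable A -> measurable_fun setT h -> (forall z, 0 <= h z)%E ->
  (\int[P]_(w in Z @^-1` A) h (Z w) = \int[mu]_(z in A `&` `]0%R, 1%R[) ((last_hit_density l z)%:E * h z))%E.
Proof.
move=> mA mh h0.
have mAI (S : set R) : measurable S -> measurable (S `&` `]0, 1[) by move=> mS; exact: measurableI.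
have := @transfer_integral R _ _ T _ P mu (Z @^-1` A) (A `&` `]0, 1[) (cst 1%E)
  (fun z => (last_hit_density l z)%:E) Z idfun h.
rewrite /= => <-//.
- by apply: eq_integral => w _; rewrite mul1e.
- exact: mZA.
- exact: mAI.
- by apply: measurable_funTS; apply/measurable_EFinP; exact: measurable_last_hit_density.
- exact: measurable_id.
- by move=> z _; rewrite lee_fin last_hit_density_ge0.
- move=> S mS; rewrite integral_cst; last by apply: measurableI; exact: mZA.
  transitivity (P (Z @^-1` (S `&` A))); first by rewrite mul1e.
  by rewrite hit_time_prob; [rewrite setIA|exact: measurableI].
Qed.

(** Generators for a stopped piece: positions at times inside its lifetime, together with a
    condition on [Z]. The latter is needed because the stopped path at time [t] also depends on
    whether its lifetime is over. *)
Definition before_event c (A : set R) : set T :=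
  M `&` (Z @^-1` (A `&` `]end_time 0 c, 1[) `&` cylinder (before B) c).
Definition after_event c (A : set R) : set T :=
  M `&` (Z @^-1` (A `&` `]0, 1 - end_time 0 c[) `&` cylinder (after B l) c).

Definition before_kernel c (A : set R) : R -> \bar R := before_prob l c \_ (A `&` `]end_time 0 c, 1[).
Definition after_kernel c (A : set R) : R -> \bar R := after_prob c \_ (A `&` `]0, 1 - end_time 0 c[).

Let measurable_cylinder (X : R -> T -> R) c : (forall t, measurable_fun setT (X t)) -> msets c ->
  measurable (cylinder X c).
Proof.
move=> mX; rewrite /cylinder; elim: c => [_|p c ih [mp /ih hc]]; first by rewrite big_nil.
rewrite big_cons; apply: measurableI => //.
by rewrite -[X in measurable X]setTI; exact: mX.
Qed.

Let mbefore := measurable_before BB cB mB.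
Let mafter := measurable_after BB cB mB.

Lemma measurable_before_event c A : msets c -> measurable A -> measurable (before_event c A).
Proof.
move=> mc mA; apply: measurableI; first exact: mM.
by apply: measurableI; [apply: mZA; exact: measurableI|exact: measurable_cylinder].
Qed.

Lemma measurable_after_event c A : msets c -> measurable A -> measurable (after_event c A).
Proof.
move=> mc mA; apply: measurableI; first exact: mM.
by apply: measurableI; [apply: mZA; exact: measurableI|exact: measurable_cylinder].
Qed.

Lemma before_kernel_ge0 c A z : msets c -> (0 <= before_kernel c A z)%E.
Proof. by move=> mc; apply: erestrict_ge0 => {}z _; exact: before_prob_ge0. Qed.

Lemma after_kernel_ge0 c A z : msets c -> (0 <= after_kernel c A z)%E.
Proof. by move=> mc; apply: erestrict_ge0 => {}z _; exact: after_prob_ge0. Qed.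

Lemma measurable_before_kernel c A : msets c -> measurable A -> measurable_fun setT (before_kernel c A).
Proof.
move=> mc mA; have mI : measurable (A `&` `]end_time 0 c, 1[) by exact: measurableI.
by apply/(measurable_restrictT _ mI)/measurable_funTS; exact: measurable_before_prob.
Qed.

Lemma measurable_after_kernel c A : msets c -> measurable A -> measurable_fun setT (after_kernel c A).
Proof.
move=> mc mA; have mI : measurable (A `&` `]0, 1 - end_time 0 c[) by exact: measurableI.
by apply/(measurable_restrictT _ mI)/measurable_funTS; exact: measurable_after_prob.
Qed.

(** The joint law is read as a conditional law: its integrand against the density of [Z] is a
    product, one factor for each piece. Laws of single pieces are the cases where the other list of
    times is empty. *)
Lemma joint_kernels c c' A A' : path <%R 0 (unzip1 c) -> path <%R 0 (unzip1 c') -> msets c -> msets c' ->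
  measurable A -> measurable A' ->
  cond_prob P Z (before_event c A `&` after_event c' A')
    (fun z => before_kernel c A z * after_kernel c' A' z)%E.
Proof.
move=> pc pc' mc mc' mA mA'; split.
- by apply: measurableI; [exact: measurable_before_event|exact: measurable_after_event].
- by apply: emeasurable_funM; [exact: measurable_before_kernel|exact: measurable_after_kernel].
move=> D mD; pose G : set R := `]end_time 0 c, 1 - end_time 0 c'[%classic.
have mDAA : measurable (D `&` A `&` A') by apply: measurableI => //; exact: measurableI.
have e0 := path_end_time pc; have e0' := path_end_time pc'.
(* All times fit into their lifetimes exactly when those of each piece do, so the indicator
   factorises. *)
have GE z : G z <-> (`]end_time 0 c, 1[%classic z /\ `]0, 1 - end_time 0 c'[%classic z).
  rewrite /G /= !in_itv/=; split=> [/andP[h1 h2]|[/andP[h1 h2] /andP[h3 h4]]]; last by rewrite h1.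
  by split; apply/andP; split; lra.
have mE : measurable (Z @^-1` (D `&` A `&` A' `&` G) `&` (cylinder (before B) c `&` cylinder (after B l) c')).
  apply: measurableI; first by apply: mZA; apply: measurableI => //; exact: measurable_itv.
  by apply: measurableI; exact: measurable_cylinder.
transitivity (P (Z @^-1` (D `&` A `&` A' `&` G) `&` (cylinder (before B) c `&` cylinder (after B l) c'))).
  rewrite -[RHS](prob_setIas mM PM mE); congr (P _).
  apply/seteqP; split=> w.
    by move=> [[[? [[? ?] ?]] [_ [[? ?] ?]]] ?]; split => //; split => //; split => //; apply/GE.
  by move=> [[[[[? ?] ?] /GE[? ?]] [? ?]] ?].
have mk : measurable_fun setT (fun z => before_kernel c A z * after_kernel c' A' z)%E.
  by apply: emeasurable_funM; [exact: measurable_before_kernel|exact: measurable_after_kernel].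
have k0 z : (0 <= before_kernel c A z * after_kernel c' A' z)%E.
  by rewrite mule_ge0 ?before_kernel_ge0 ?after_kernel_ge0.
rewrite (joint_law BB cB mB l0 pc pc' mc mc' mDAA) (hit_time_integral mD mk k0).
rewrite [LHS]integral_mkcond [RHS]integral_mkcond; apply: eq_integral => z _.
rewrite /patch /before_kernel /after_kernel /patch !in_setI.
case: (z \in D) => //=; case: (z \in A) => //=; last by case: ifP; rewrite ?mul0e ?mule0.
case: (z \in A') => //=; last by case: ifP; rewrite ?mule0.
have -> : (z \in (`]end_time 0 c, 1 - end_time 0 c'[%classic : set R)) =
    (z \in (`]end_time 0 c, 1[%classic : set R)) && (z \in (`]0, 1 - end_time 0 c'[%classic : set R)).
  by apply/idP/andP; rewrite !inE => /GE.
case: ifP => [/andP[h1 ->]|h].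
  rewrite h1 ifT//; move: h1; rewrite !inE/= !in_itv/= => /andP[h1 ->].
  by rewrite (le_lt_trans e0 h1).
case: ifP => // _; move: h; case: (z \in _) => //=; rewrite ?mul0e ?mule0//.
by move=> ->; rewrite !mule0.
Qed.

Let after_all : after_event [::] setT = M.
Proof.
rewrite /after_event /cylinder big_nil setIT setTI /end_time/= subr0.
by apply/setIidl => w [].
Qed.

Let before_all : before_event [::] setT = M.
Proof.
rewrite /before_event /cylinder big_nil setIT setTI /end_time/=.
by apply/setIidl => w [].
Qed.

Lemma before_event_law c A : path <%R 0 (unzip1 c) -> msets c -> measurable A ->
  cond_prob P Z (before_event c A) (before_kernel c A).
Proof.
move=> pc mc mA; have := joint_kernels pc (isT : path <%R 0 (unzip1 [::])) mc I mA measurableT.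
rewrite after_all (_ : before_event c A `&` M = before_event c A); last by apply/setIidl => w [].
move=> h; suff <- : (fun z => before_kernel c A z * after_kernel [::] setT z)%E = before_kernel c A by [].
apply/funext => z; rewrite /before_kernel /patch; case: ifP => {}h; rewrite ?mul0e//.
have e0 := path_end_time pc.
move: h; rewrite inE => -[_ /=]; rewrite in_itv/= => /andP[h1 h2].
rewrite /after_kernel /patch mem_set; last first.
  by split => //=; rewrite in_itv/= /end_time/= subr0 (le_lt_trans e0 h1).
rewrite /after_prob /bmass/= /end_time/= subr0 -EFinM mulfV ?mule1//.
by rewrite gt_eqF// bes_gt0// subr_gt0.
Qed.

Lemma after_event_law c A : path <%R 0 (unzip1 c) -> msets c -> measurable A ->
  cond_prob P Z (after_event c A) (after_kernel c A).
Proof.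
move=> pc mc mA; have := joint_kernels (isT : path <%R 0 (unzip1 [::])) pc I mc measurableT mA.
rewrite before_all (_ : M `&` after_event c A = after_event c A); last by apply/setIidr => w [].
move=> h; suff <- : (fun z => before_kernel [::] setT z * after_kernel c A z)%E = after_kernel c A by [].
apply/funext => z; rewrite /after_kernel /patch; case: ifP => {}h; rewrite ?mule0//.
have e0 := path_end_time pc.
move: h; rewrite inE => -[_ /=]; rewrite in_itv/= => /andP[h1 h2].
rewrite /before_kernel /patch mem_set; last first.
  by split => //=; rewrite in_itv/= /end_time/= h1; lra.
rewrite /before_prob /bmass/= /end_time/= subr0 -EFinM mulfV ?mul1e//.
by rewrite gt_eqF// bes_gt0// ltW.
Qed.

Lemma event_indep c c' A A' : path <%R 0 (unzip1 c) -> path <%R 0 (unzip1 c') -> msets c -> msets c' ->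
  measurable A -> measurable A' -> cond_indep_events P Z (before_event c A) (after_event c' A').
Proof.
move=> pc pc' mc mc' mA mA'; exists (before_kernel c A), (after_kernel c' A'); split.
- by move=> z; exact: before_kernel_ge0.
- by move=> z; exact: after_kernel_ge0.
- exact: before_event_law.
- exact: after_event_law.
- exact: joint_kernels.
Qed.

Let insert_time t (A : set R) s c : path <%R s (unzip1 c) -> s < t -> msets c -> measurable A ->
  exists c', [/\ path <%R s (unzip1 c'), msets c', end_time s c' = Num.max t (end_time s c) &
    forall X : R -> T -> R, cylinder X c' = X t @^-1` A `&` cylinder X c].
Proof.
elim: c s => [|[u D] c ih] s /=.
  move=> _ st _ mA; exists [:: (t, A)]; split => //=; rewrite ?st//.
    by rewrite /end_time/= max_l// ltW.
  by move=> X; rewrite /cylinder big_cons.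
move=> /andP[su pc] st [mD mc] mA; have eu := path_end_time pc.
have [tu|ut|tu] := ltgtP t u.
- exists ((t, A) :: (u, D) :: c); split; rewrite /= ?st ?tu//.
    by rewrite /end_time/= max_r// (le_trans (ltW tu)).
  by move=> X; rewrite /cylinder big_cons.
- have [c' [pc' mc' ec' cc']] := ih _ pc ut mc mA; exists ((u, D) :: c'); split; rewrite /= ?su//.
  by move=> X; move: (cc' X); rewrite /cylinder !big_cons => ->; rewrite setICA.
- exists ((u, D `&` A) :: c); split; rewrite /= ?su//.
    by split => //; exact: measurableI.
    by rewrite tu /end_time/= max_r.
  by move=> X; rewrite /cylinder !big_cons/= tu preimage_setI setIA; congr (_ `&` _); rewrite setIC.
Qed.

(** Cylinders over two lists of times are put over the merged list, which makes the generators
    stable by intersection; sets at a common time are intersected. *)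
Let merge_times c c' : path <%R 0 (unzip1 c) -> path <%R 0 (unzip1 c') -> msets c -> msets c' ->
  exists d, [/\ path <%R 0 (unzip1 d), msets d, end_time 0 d = Num.max (end_time 0 c) (end_time 0 c') &
    forall X : R -> T -> R, cylinder X d = cylinder X c `&` cylinder X c'].
Proof.
move=> pc pc' mc mc'; suff [d [pd md ed cd]] : exists d, [/\ path <%R 0 (unzip1 d), msets d,
    Num.max 0 (end_time 0 d) = Num.max (end_time 0 c) (end_time 0 c') &
    forall X : R -> T -> R, cylinder X d = cylinder X c `&` cylinder X c'].
  by exists d; split => //; rewrite -ed max_r// path_end_time.
suff gen s : 0 <= s -> path <%R s (unzip1 c) -> exists d, [/\ path <%R 0 (unzip1 d), msets d,
    Num.max s (end_time 0 d) = Num.max (end_time s c) (end_time 0 c') &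
    forall X : R -> T -> R, cylinder X d = cylinder X c `&` cylinder X c'] by exact: gen.
elim: c s mc {pc} => [|[t A] c ih] s /=.
  by move=> _ s0 _; exists c'; split => // X; rewrite /cylinder big_nil setTI.
move=> [mA mc] s0 /andP[st pc]; have t0 : 0 < t by exact: le_lt_trans st.
have [d [pd md ed cd]] := ih _ mc (ltW t0) pc.
have [d' [pd' md' ed' cd']] := insert_time pd t0 md mA.
exists d'; split => //.
  rewrite ed' ed max_r// le_max; apply/orP; left.
  by rewrite (le_trans (ltW st))// path_end_time.
by move=> X; rewrite cd' cd setIA; congr (_ `&` _); rewrite /cylinder big_cons.
Qed.

Definition before_events : set (set T) := [set E | exists c A,
  [/\ path <%R 0 (unzip1 c), msets c, measurable A & E = before_event c A]].
Definition after_events : set (set T) := [set E | exists c A,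
  [/\ path <%R 0 (unzip1 c), msets c, measurable A & E = after_event c A]].

Lemma before_events_setI : setI_closed before_events.
Proof.
move=> _ _ [c [A [pc mc mA ->]]] [c' [A' [pc' mc' mA' ->]]].
have [d [pd md ed cd]] := merge_times pc pc' mc mc'.
exists d, (A `&` A'); split => //; first exact: measurableI.
rewrite /before_event cd ed; apply/seteqP; split=> w /=; rewrite !in_itv/= gt_max.
  by move=> [[? [[? /andP[-> ->]] ?]] [_ [[? /andP[-> _]] ?]]].
by move=> [? [[[? ?] /andP[/andP[-> ->] ->]] [? ?]]].
Qed.

Lemma after_events_setI : setI_closed after_events.
Proof.
move=> _ _ [c [A [pc mc mA ->]]] [c' [A' [pc' mc' mA' ->]]].
have [d [pd md ed cd]] := merge_times pc pc' mc mc'.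
have maxE (z x y : R) : (z < 1 - Num.max x y) = (z < 1 - x) && (z < 1 - y).
  have e u : (z < 1 - u) = (u < 1 - z) by rewrite ltrBrDl -ltrBrDr.
  by rewrite !e gt_max.
exists d, (A `&` A'); split => //; first exact: measurableI.
rewrite /after_event cd ed; apply/seteqP; split=> w /=; rewrite !in_itv/= maxE.
  by move=> [[? [[? /andP[-> ->]] ?]] [_ [[? /andP[_ ->]] ?]]].
by move=> [? [[[? ?] /andP[-> /andP[-> ->]]] [? ?]]].
Qed.

Let V := before B.

Let cV w : continuous (V ^~ w). Proof. exact: continuous_vervaat. Qed.
Let V0 w : V 0 w = 0. Proof. exact: vervaat0. Qed.
Let V1 w : M w -> V 1 w = l.
Proof. by move=> [_ <-]; rewrite /V /before vervaat1. Qed.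
Let M01 w : M w -> 0 < Z w < 1.
Proof. by move=> [/= + _]; rewrite in_itv. Qed.
Let VZ w : M w -> V (Z w) w = l.
Proof. by move=> /M01/andP[Z0 _]; exact: (last_hit_value (@cV w)). Qed.

Let Xb := piece_before Z V.
Let Xa := piece_after Z V.

Let Xb_lt t w : t < Z w -> Xb t w = V t w.
Proof. by move=> tZ; rewrite /Xb /piece_before min_l// ltW. Qed.
Let Xb_ge t w : M w -> Z w <= t -> Xb t w = l.
Proof. by move=> Mw Zt; rewrite /Xb /piece_before min_r// VZ. Qed.
Let Xa_lt t w : t < 1 - Z w -> Xa t w = after B l t w + l.
Proof. by move=> tZ; rewrite /Xa /piece_after min_l ?subrK// -lerBrDl ltW. Qed.
Let Xa_ge t w : M w -> 1 - Z w <= t -> Xa t w = l.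
Proof. by move=> Mw Zt; rewrite /Xa /piece_after min_r ?V1// -lerBlDl. Qed.

Lemma measurable_piece_before t : measurable_fun setT (Xb t).
Proof.
apply: (measurable_vervaat_at cB mB B0 (f := fun w => Num.min t (Z w)) (g := idfun)); last exact: measurable_id.
exact: measurable_minr.
Qed.

Lemma measurable_piece_after t : measurable_fun setT (Xa t).
Proof.
apply: (measurable_vervaat_at cB mB B0 (f := fun w => Num.min (Z w + t) 1) (g := idfun)); last exact: measurable_id.
by apply: measurable_minr => //; exact: measurable_funD.
Qed.

Let gen_events (C : set (set T)) (X : R -> T -> R) :
  <<s C>> M -> (forall t A, 0 <= t -> measurable A -> <<s C>> (X t @^-1` A `&` M)) ->
  forall E, path_sigma X E -> <<s C>> (E `&` M).
Proof.
move=> CM h; apply: sigma_setI => // _ [t [A [t0 mA ->]]]; exact: h.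
Qed.

Let measurable_gen (X : R -> T -> R) : (forall t, measurable_fun setT (X t)) ->
  path_sigma X `<=` measurable.
Proof.
move=> mX; apply: smallest_sub; first exact: sigma_algebra_measurable.
by move=> _ [t [A [_ mA ->]]]; rewrite -[X in measurable X]setTI; exact: mX.
Qed.

Let sigmaU (C : set (set T)) E F : <<s C>> E -> <<s C>> F -> <<s C>> (E `|` F).
Proof.
have [s0 _ sU] := smallest_sigma_algebra setT C.
by move=> sE sF; rewrite -bigcup2E; apply: (sU) => -[|[|i]].
Qed.

Let sigma_if (C : set (set T)) (Q : Prop) E : <<s C>> E -> <<s C>> (E `&` [set _ | Q]).
Proof.
move=> sE; have [q|q] := pselect Q.
  by rewrite (_ : _ `&` _ = E)//; apply/seteqP; split=> w // [].
rewrite (_ : _ `&` _ = set0); first by have [] := smallest_sigma_algebra setT C.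
by apply/seteqP; split=> w // [].
Qed.

Let sigma_before c A : path <%R 0 (unzip1 c) -> msets c -> measurable A -> <<s before_events>> (before_event c A).
Proof. by move=> pc mc mA; apply: sub_sigma_algebra; exists c, A. Qed.

Let sigma_after c A : path <%R 0 (unzip1 c) -> msets c -> measurable A -> <<s after_events>> (after_event c A).
Proof. by move=> pc mc mA; apply: sub_sigma_algebra; exists c, A. Qed.

(** On [M] the value at a positive [t] is either that of the running path, when [t] is before [Z],
    or the constant [l]; both cases are generators, the second one kept or dropped according to
    whether [l] is in the set. *)
Lemma path_sigma_before E : path_sigma Xb E -> <<s before_events>> (E `&` M).
Proof.
have sM : <<s before_events>> M by rewrite -before_all; exact: sigma_before.
apply: gen_events => // t A; rewrite le_eqVlt => /predU1P[<-|t0] mA.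
  rewrite (_ : _ `&` M = M `&` [set _ | A 0]); first exact: sigma_if.
  have X0 w : M w -> Xb 0 w = 0 by move=> /M01/andP[z0 _]; rewrite Xb_lt.
  by apply/seteqP; split=> w [h1 h2]; split => //; [move: h1; rewrite /= X0|rewrite /= X0].
rewrite (_ : _ `&` M = before_event [:: (t, A)] setT `|` (before_event [::] `]-oo, t] `&` [set _ | A l])).
  apply: sigmaU; last by apply: sigma_if; exact: sigma_before.
  by apply: sigma_before => //=; rewrite t0.
rewrite /before_event /cylinder big_nil big_seq1 setIT /end_time/=.
apply/seteqP; split=> w /=.
  move=> [h Mw]; have /andP[z0 z1] := M01 Mw; have [tz|zt] := ltP t (Z w).
    by left; split => //; split; [split => //; rewrite in_itv/= tz|move: h; rewrite Xb_lt].
  by right; split; [split => //; split; rewrite !in_itv/= ?zt ?z0|move: h; rewrite Xb_ge].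
move=> [[Mw [[_ +] h]]|[[Mw [+ _]] h]]; rewrite in_itv/=.
  by move=> /andP[tz _]; rewrite Xb_lt.
by move=> zt; rewrite Xb_ge.
Qed.

(** As for the first piece, with heights measured from [l]: the sets are translated by [l], and the
    stopped value is [l] once [t] exceeds [1 - Z]. *)
Lemma path_sigma_after E : path_sigma Xa E -> <<s after_events>> (E `&` M).
Proof.
have sM : <<s after_events>> M by rewrite -after_all; exact: sigma_after.
apply: gen_events => // t A; rewrite le_eqVlt => /predU1P[<-|t0] mA.
  rewrite (_ : _ `&` M = M `&` [set _ | A l]); first exact: sigma_if.
  have X0 w : M w -> Xa 0 w = l.
    by move=> Mw; have /andP[_ z1] := M01 Mw; rewrite Xa_lt ?subr_gt0// /after addr0 subrK; exact: VZ.
  by apply/seteqP; split=> w [h1 h2]; split => //; [move: h1; rewrite /= X0|rewrite /= X0].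
pose Al := [set y | A (y + l)].
have mAl : measurable Al.
  have ml : measurable_fun setT (fun y : R => y + l) by exact: measurable_funD.
  by rewrite -[Al]setTI; exact: ml.
rewrite (_ : _ `&` M = after_event [:: (t, Al)] setT `|` (after_event [::] `[1 - t, +oo[ `&` [set _ | A l])).
  apply: sigmaU; last by apply: sigma_if; exact: sigma_after.
  by apply: sigma_after => //=; rewrite t0.
rewrite /after_event /cylinder big_nil big_seq1 setIT /end_time/=.
apply/seteqP; split=> w /=.
  move=> [h Mw]; have /andP[z0 z1] := M01 Mw; have [tz|zt] := ltP t (1 - Z w).
    left; split => //; split; last by move: h; rewrite Xa_lt.
    by split => //; rewrite in_itv/= z0; lra.
  right; split; last by move: h; rewrite Xa_ge.
  by split => //; split; rewrite !in_itv/= ?subr0 ?z0 ?z1//; lra.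
move=> [[Mw [[_ +] h]]|[[Mw [+ _]] h]]; rewrite in_itv/=.
  by move=> /andP[_ tz]; rewrite Xa_lt//; lra.
by move=> zt; rewrite Xa_ge//; lra.
Qed.

Theorem pieces_independent : cond_independent P Z (path_sigma Xb) (path_sigma Xa).
Proof.
apply: (cond_independent_as mZ mM PM (measurable_gen measurable_piece_before)
  (measurable_gen measurable_piece_after) path_sigma_before path_sigma_after).
apply: cond_independent_gen => //.
- exact: before_events_setI.
- exact: after_events_setI.
- by move=> _ _ [c [A [pc mc mA ->]]] [c' [A' [pc' mc' mA' ->]]]; exact: event_indep.
- by move=> _ [c [A [_ mc mA ->]]]; exact: measurable_before_event.
- move=> _ [c [A [pc mc mA ->]]]; exists (after_kernel c A); first exact: after_event_law.
  by move=> z; exact: after_kernel_ge0.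
Qed.

Let as_regular (Q : T -> Prop) : (forall w, M w -> Q w) -> \forall w \ae P, Q w.
Proof.
move=> MQ; exists (~` M); split; first exact: measurableC.
  by rewrite probability_setC// PM subee.
by move=> w /= nQ Mw; apply: nQ; exact: MQ.
Qed.

Let Zas : \forall w \ae P, 0 < Z w < 1.
Proof. exact: as_regular M01. Qed.

Let measurable_ray (x : R) : measurable [set z : R | x < z].
Proof. by rewrite -set_itvoy; exact: measurable_itv. Qed.

Let continuous_min_comp (f g : R -> R) : continuous f -> continuous g -> continuous (fun u => Num.min (f u) (g u)).
Proof. by move=> cf cg u; apply: continuous_min; [exact: cf|exact: cg]. Qed.

(** At times before [Z] the stopped path is the transform itself, so up to the null complement of
    [M] the event is a [before_event], whose kernel is the bridge probability. *)
Theorem piece_before_bridge : cond_bessel3_bridge P Z id 0 l Xb.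
Proof.
split.
- by move=> t _; exact: measurable_piece_before.
- move=> w; apply: continuous_subspaceT => u.
  apply: (@continuous_comp _ _ _ (fun u => Num.min u (Z w)) (V ^~ w)); last exact: cV.
  by apply: continuous_min_comp => v; [exact: cvg_id|exact: cvg_cst].
- by apply: as_regular => w /M01/andP[z0 _]; rewrite Xb_lt.
- by apply: as_regular => w Mw; rewrite Xb_ge.
move=> c rc; have mc := rectangle_msets rc; have [pc _] := rc.
have e0 : 0 <= last_time c := path_end_time pc.
have mE : measurable (cylinder Xb c `&` [set w | last_time c < Z w]).
  apply: measurableI; first exact: (measurable_cylinder measurable_piece_before mc).
  exact: (mZA (@measurable_ray _)).
have gE z : (if last_time c < z then bridge_prob bessel3_density bessel3_ref z 0 l c else 0%E) =
    (before_prob l c \_ `]last_time c, +oo[) z.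
  rewrite /patch mem_setE in_itv/= andbT; case: ifPn => // lt.
  by rewrite /bridge_prob /before_prob bridge_massE// besE// (le_lt_trans e0).
have cE w : last_time c < Z w -> cylinder Xb c w <-> cylinder (before B) c w.
  by move=> h; apply: (eq_cylinder pc) => t /andP[_ te]; rewrite Xb_lt// (le_lt_trans te).
apply: (cond_prob_ae mZ (g := before_kernel c setT)).
- apply: (cond_prob_as mZ mM PM _ mE _ (before_event_law pc mc measurableT)).
    exact: measurable_before_event.
  rewrite /before_event setTI; apply/seteqP; split=> w /=.
    move=> [[Mw [h1 h2]] _]; split => //; move: h1; rewrite in_itv/= => /andP[h1 _]; split => //.
    by apply/(cE w h1).
  move=> [[h2 h1] Mw]; have /andP[_ z1] := M01 Mw; split => //; split => //.
  split; first by rewrite /= in_itv/= h1.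
  by apply/(cE w h1).
- rewrite (funext gE); apply/(measurable_restrictT _ (measurable_itv _))/measurable_funTS.
  exact: measurable_before_prob.
(* The kernel carries the extra restriction [Z < 1], which holds almost surely. *)
- apply: filterS Zas => w /andP[z0 z1]; rewrite gE /before_kernel /patch setTI !mem_setE !in_itv/= z1 !andbT.
  by [].
Qed.

Theorem piece_after_bridge : cond_excursion_above P l Z (fun z => 1 - z) Xa.
Proof.
split.
- by move=> t _; apply: measurable_funB => //; exact: measurable_piece_after.
- move=> w; apply: continuous_subspaceT => u.
  have cX : continuous (Xa ^~ w).
    move=> v; apply: (@continuous_comp _ _ _ (fun u => Num.min (Z w + u) 1) (V ^~ w)); last exact: cV.
    apply: continuous_min_comp => x; last exact: cvg_cst.
    by apply: cvgD; [exact: cvg_cst|exact: cvg_id].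
  by apply: cvgB; [exact: cX|exact: cvg_cst].
- apply: as_regular => w Mw; have /andP[z0 z1] := M01 Mw.
  rewrite Xa_lt ?subr_gt0// addrK /after addr0; apply/eqP; rewrite subr_eq0; apply/eqP; exact: VZ.
- by apply: as_regular => w Mw; rewrite Xa_ge// subrr.
move=> c rc; have mc := rectangle_msets rc; have [pc _] := rc.
have e0 : 0 <= last_time c := path_end_time pc.
have ltE (z : R) : (z < 1 - last_time c) = (last_time c < 1 - z) by rewrite ltrBrDl -ltrBrDr.
have m1 : measurable [set z : R | last_time c < 1 - z].
  rewrite (_ : [set z | _] = `]-oo, 1 - last_time c[%classic); first exact: measurable_itv.
  by apply/seteqP; split=> z /=; rewrite in_itv/= ltE.
have mE : measurable (cylinder (fun u w => Xa u w - l) c `&` [set w | last_time c < 1 - Z w]).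
  apply: measurableI; last exact: (mZA m1).
  by apply: measurable_cylinder => // t; apply: measurable_funB => //; exact: measurable_piece_after.
have gE z : (if last_time c < 1 - z then bridge_prob bessel3_density bessel3_ref (1 - z) 0 0 c else 0%E) =
    (after_prob c \_ `]-oo, 1 - last_time c[) z.
  rewrite /patch mem_setE in_itv/= ltE; case: ifPn => // lt.
  by rewrite /bridge_prob /after_prob bridge_massE// besE// (le_lt_trans e0).
have cE w : last_time c < 1 - Z w -> cylinder (fun u w => Xa u w - l) c w <-> cylinder (after B l) c w.
  by move=> h; apply: (eq_cylinder pc) => t /andP[_ te]; rewrite Xa_lt ?addrK// (le_lt_trans te).
apply: (cond_prob_ae mZ (g := after_kernel c setT)).
- apply: (cond_prob_as mZ mM PM _ mE _ (after_event_law pc mc measurableT)).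
    exact: measurable_after_event.
  rewrite /after_event setTI; apply/seteqP; split=> w /=.
    move=> [[Mw [h1 h2]] _]; split => //; move: h1; rewrite in_itv/= ltE => /andP[_ h1]; split => //.
    by apply/(cE w h1).
  move=> [[h2 h1] Mw]; have /andP[z0 _] := M01 Mw; split => //; split => //.
  split; first by rewrite /= in_itv/= z0 ltE.
  by apply/(cE w h1).
- rewrite (funext gE); apply/(measurable_restrictT _ (measurable_itv _))/measurable_funTS.
  exact: measurable_after_prob.
- apply: filterS Zas => w /andP[z0 z1]; by rewrite gE /after_kernel /patch setTI !mem_setE !in_itv/= z0.
Qed.

End vervaat_bridge.

(** * Reduction to globally continuous paths *)

Section clamp.
Context {R : realType}.
Implicit Types f : R -> R.

(** The bridge is only controlled on [[0, 1]]. Freezing the path outside gives continuity everywhere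
    and measurability at all times, and the transform on [[0, 1]] is the same because it only reads
    the path there. *)
Definition clamp f : R -> R := fun t => f (retract 0 1 t).

Lemma clampE f t : 0 <= t <= 1 -> clamp f t = f t.
Proof. by move=> t01; rewrite /clamp retract_id. Qed.

(** The retraction takes values in [[0, 1]], where continuity within the interval is all that is
    needed. *)
Lemma continuous_clamp f : {within `[0, 1], continuous f} -> continuous (clamp f).
Proof.
move=> /subspace_continuousP cf x.
have r01 y : `[0, 1]%classic (retract 0 1 y : R) by rewrite /= in_itv/= retract_itv.
apply: (@cvg_comp _ _ _ (retract 0 1) f _ (within `[0, 1] (nbhs (retract 0 1 x)))); last exact: cf.
move=> U /= hU.
have H : nbhs x (retract 0 1 @^-1` (fun y => `[0, 1]%classic y -> U y)) by exact: (@continuous_retract R 0 1 x _ hU).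
by apply: filterS H => y /= h; exact: (h (r01 y)).
Qed.

Lemma argmin_time_clamp f : argmin_time (clamp f) = argmin_time f.
Proof.
congr inf; apply/seteqP; split=> t /= [t01 h]; split => // s s01.
  by rewrite -(clampE f t01) -(clampE f s01) h.
by rewrite !clampE// h.
Qed.

Lemma vervaat_clamp f t : {within `[0, 1], continuous f} -> 0 <= t <= 1 -> vervaat (clamp f) t = vervaat f t.
Proof.
move=> cf t01; have [] := argmin_timeP (continuous_clamp cf).
rewrite argmin_time_clamp => tau01 _; rewrite /vervaat argmin_time_clamp.
move: t01 tau01 => /andP[t0 t1] /andP[h0 h1].
rewrite (clampE f (t := argmin_time f)) ?h0// (clampE f (t := 1)) ?ler01 ?lexx//.
by case: ifP => h; rewrite clampE//; apply/andP; split; move: h; lra.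
Qed.

Lemma last_hit_clamp l f : {within `[0, 1], continuous f} ->
  last_hit l (vervaat (clamp f)) = last_hit l (vervaat f).
Proof.
move=> cf; congr sup; apply/seteqP; split=> t /= [/andP[t0 t1] <-].
  by rewrite vervaat_clamp ?t0 ?t1 ?(ltW t1).
by rewrite t0 t1 vervaat_clamp ?t0 ?(ltW t1).
Qed.

Context {d0 : measure_display} {T : measurableType d0} (P : probability T R).

Lemma clamp_bridge (l : R) (B : R -> T -> R) : brownian_bridge P 1 0 l B ->
  let B' t w := clamp (B ^~ w) t in
  [/\ brownian_bridge P 1 0 l B', forall w, continuous (B' ^~ w) & forall t, measurable_fun setT (B' t)].
Proof.
move=> [mB cB B0 B1 fdd] B'; have cB' w : continuous (B' ^~ w) by exact: (continuous_clamp (cB w)).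
have mB' t : measurable_fun setT (B' t) by exact: (mB _ (retract_itv t ler01)).
split => //; split => //.
- by move=> w; exact: continuous_subspaceT.
- by move=> w; rewrite /B' clampE// lexx ler01.
- by apply: filterS B1 => w <-; rewrite /B' clampE// lexx ler01.
move=> c rc lc; rewrite -fdd//; congr (P _); apply/seteqP; have [pc _] := rc.
have cE w : cylinder B' c w <-> cylinder B c w.
  apply: (eq_cylinder pc) => t /andP[t0 tc]; rewrite /B' clampE// t0/=.
  by rewrite (le_trans tc)// ltW.
by split=> w /cE.
Qed.

Lemma eq_path_sigma (X Y : R -> T -> R) : (forall t, 0 <= t -> X t = Y t) -> path_sigma X = path_sigma Y.
Proof.
move=> XY; rewrite /path_sigma; congr smallest; apply/seteqP; split=> _ [t [A [t0 mA ->]]]; exists t, A.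
  by rewrite XY.
by rewrite -XY.
Qed.

Lemma eq_cond_markov_bridge k h Z len x y (X Y : R -> T -> R) : (forall t, 0 <= t -> X t = Y t) ->
  (forall w, 0 <= len (Z w)) -> cond_markov_bridge P k h Z len x y X -> cond_markov_bridge P k h Z len x y Y.
Proof.
move=> XY len0 [mX cX X0 Xl fdd]; split.
- by move=> t t0; rewrite -XY//; exact: mX.
- move=> w; apply: subspace_eq_continuous (cX w) => t; rewrite inE/= in_itv/= => /andP[t0 _].
  exact: (congr1 (fun g => g w) (XY t t0)).
- by rewrite -XY.
- by apply: filterS Xl => w; rewrite XY.
move=> c rc; have [pc _] := rc; have -> : cylinder Y c = cylinder X c; last exact: fdd.
have cE w : cylinder X c w <-> cylinder Y c w by apply: (eq_cylinder pc) => t /andP[t0 _]; rewrite XY.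
by apply/seteqP; split=> w /cE.
Qed.

End clamp.

Theorem corollary1p4 (R : realType) (d : measure_display)
    (T : measurableType d) (P : probability T R) (lam : R) (B : R -> T -> R)
    (lam_gt0 : 0 < lam) (B_bridge : brownian_bridge P 1 0 lam B) :
  let V : R -> T -> R := fun t w => vervaat (B ^~ w) t in
  let Z : T -> R := fun w => last_hit lam (V ^~ w) in
  [/\ measurable_fun setT Z,
      forall A : set R, measurable A ->
        P (Z @^-1` A) =
        (\int[lebesgue_measure]_(t in A `&` `]0%R, 1%R[)
           (last_hit_density lam t)%:E)%E,
      cond_independent P Z (path_sigma (piece_before Z V))
                           (path_sigma (piece_after Z V)),
      cond_bessel3_bridge P Z id 0 lam (piece_before Z V) &
      cond_excursion_above P lam Z (fun z => 1 - z) (piece_after Z V)].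
Proof.
move=> V Z; have [BB cB mB] := clamp_bridge B_bridge.
set B' := (fun t w => clamp (B ^~ w) t) in BB cB mB.
have cB0 w : {within `[0, 1], continuous (B ^~ w)} by have [_ + _ _ _] := B_bridge.
have ZE : hit_time B' lam = Z by apply/funext => w; exact: last_hit_clamp.
have Z01 w : 0 <= Z w <= 1 by rewrite last_hit_ge0 last_hit_le1.
(* The two transforms agree on [[0, 1]] only; the stopped pieces read no other time, which transfers
   both pieces. *)
have VE t w : 0 <= t <= 1 -> before B' t w = V t w by exact: vervaat_clamp.
have bE t : 0 <= t -> piece_before Z (before B') t = piece_before Z V t.
  move=> t0; apply/funext => w; apply: VE; have /andP[z0 z1] := Z01 w.
  by rewrite le_min t0 z0 ge_min z1 orbT.
have aE t : 0 <= t -> piece_after Z (before B') t = piece_after Z V t.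
  move=> t0; apply/funext => w; apply: VE; have /andP[z0 z1] := Z01 w.
  by rewrite le_min ler01 addr_ge0//= ge_min lexx orbT.
have B'0 w : B' 0 w = 0 by have [_ _ ->] := BB.
split.
- by rewrite -ZE; exact: measurable_hit_time.
- by move=> A mA; rewrite -ZE; exact: (hit_time_prob BB cB mB lam_gt0).
- rewrite -(eq_path_sigma bE) -(eq_path_sigma aE) -ZE.
  exact: (pieces_independent BB cB mB lam_gt0).
- apply: (eq_cond_markov_bridge bE) => [w|]; first by case/andP: (Z01 w).
  by rewrite -ZE; exact: (piece_before_bridge BB cB mB lam_gt0).
- apply: (@eq_cond_markov_bridge _ _ _ _ _ _ _ _ _ _ (fun u w => piece_after Z (before B') u w - lam)) => [t t0|w|].
  + by apply/funext => w; rewrite aE.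
  + by case/andP: (Z01 w) => _; rewrite subr_ge0.
  by rewrite -ZE; exact: (piece_after_bridge BB cB mB lam_gt0).
Qed.
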